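(* Let $f(z,t)$ be a smooth one-parametric family of conformal mappings onto exteriors of two rectilinear slits as described in the context. Then $f(z,t)$ satisfies the PDE $$\frac{\dot f(z,t)}{f'(z,t)}=h(z,t),$$ where $$h(z,t)=\sum_{j=1}^4\gamma_j(t)\bigl[\zeta(z-z_j(t))-\zeta(z_0(t)-z_j(t))-\eta_1(t)(z-z_0(t))\bigr]-\dot z_0(t),$$ $$\gamma_k(t)=\frac{\dot A_k(t)}{D_k(t)},\qquad D_k(t)=c(t)e^{\gamma(t)z_k(t)}\,\frac{\prod_{j=1,\,j\ne k}^4\sigma(z_k(t)-z_j(t))}{\sigma^2(z_k(t)-z_0(t))\,\sigma^2(z_k(t)-\overline{z_0(t)})},\qquad 1\le k\le4.$$ The period $\omega_1(t)$ equals $1$, and the period $\omega_2(t)$ satisfies $$\dot\omega_2(t)=2\pi i\sum_{j=1}^4\gamma_j(t).$$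
   Context: A dot is differentiation with respect to the real parameter $t$ (ranging over an interval), a prime is differentiation with respect to $z$. Weierstrass functions: for each $t$, $\omega_1(t)\equiv1$ and $\omega_2(t)=2m(t)i$ with $m(t)>0$; $\sigma(z)=\sigma(z;1,\omega_2(t))$ and $\zeta(z)=\zeta(z;1,\omega_2(t))=\sigma'(z)/\sigma(z)$ are the Weierstrass functions of the lattice generated by the full periods $1,\omega_2(t)$, and $\eta_k(t)=2\zeta(\omega_k(t)/2)$, so $\zeta(z+\omega_k)=\zeta(z)+\eta_k$. The family: $G(t)$ is the exterior (in $\overline{\mathbb C}$) of two disjoint slits (segments), the first on the ray $\{\arg w=\theta\}$, the second on the ray $\{\arg w=\theta+\beta\}$, with $\theta$ and $0<\beta<2\pi$ independent of $t$ (one may take $\theta=0$). For each $t$, $$f(z,t)= c(t)\int_{0}^z e^{\gamma(t)\xi}\frac{\prod_{k=1}^4\sigma(\xi-z_k(t))}{\sigma^2(\xi-z_0(t))\,\sigma^2(\xi-\overline{z_0(t)})}\,d\xi+c_1(t),\qquad c(t)\neq0,$$ where $c,c_1,m$, $x_k$ and $y_0$ are smooth functions of $t$, $$z_1=x_1,\quad z_2=x_2,\quad z_3=x_3+im,\quad z_4=x_4-im,\quad z_0=iy_0,$$ with $x_k,y_0$ real, $x_1<x_2<x_1+1$, $x_3<x_4<x_3+1$, $0<y_0<m$, and $$\gamma=\frac{\beta}{\pi}\eta_1,\qquad \sum_{k=1}^4x_k=\frac\beta\pi,\qquad \gamma+\sum_{k=1}^4\zeta(z_0-z_k)-2\zeta(z_0-\overline{z}_0)=0.$$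 The function $f(\cdot,t)$ is $1$-periodic and maps the rectangle $\{0<\operatorname{Re}z<1,\ 0<\operatorname{Im}z<m(t)\}$ with identified vertical sides conformally onto $G(t)$, the side $\operatorname{Im}z=0$ corresponding to the first slit and $\operatorname{Im}z=m$ to the second; it is extended by reflection to a meromorphic function on $\mathbb C$ satisfying $f(z+1,t)=f(z,t)$, $f(z+\omega_2(t),t)=e^{2i\beta}f(z,t)$. The points $z_k$ are (modulo the lattice) the preimages of the endpoints of the slits, and $A_k(t):=f(z_k(t),t)$ for the extended function. Thus $A_1,A_2,A_3$ are endpoints of the slits, while for $z_4=(x_4+im)-\omega_2$ the value $A_4$ equals $e^{-2i\beta}$ times the corresponding endpoint. One has $D_k(t)=f''(z_k(t),t)\neq0$. *)

(* Defs.v *)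
From Stdlib Require Export Reals ZArith List.
From Coquelicot Require Export Coquelicot.
Export ListNotations.
Open Scope C_scope.

Definition Cexp (z : C) : C :=
  (exp (Re z) * cos (Im z), exp (Re z) * sin (Im z))%R.

Definition Cprod {A : Type} (F : A -> C) (l : list A) : C :=
  fold_right (fun a p => F a * p) 1 l.

Definition Csum {A : Type} (F : A -> C) (l : list A) : C :=
  fold_right (fun a s => F a + s) 0 l.

Definition Clim_seq (u : nat -> C) : C :=
  (real (Lim_seq (fun n => Re (u n))), real (Lim_seq (fun n => Im (u n)))).

Definition nonzero_indices (N : nat) : list (Z * Z) :=
  let r := map (fun n => (Z.of_nat n - Z.of_nat N)%Z) (seq 0 (2 * N + 1)) in
  filter (fun p => negb ((fst p =? 0)%Z && (snd p =? 0)%Z)) (list_prod r r).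

Definition lattice_point (w1 w2 : C) (p : Z * Z) : C :=
  IZR (fst p) * w1 + IZR (snd p) * w2.

Definition in_lattice (w1 w2 z : C) : Prop :=
  exists p : Z * Z, z = lattice_point w1 w2 p.

(* The Weierstrass product.  It converges absolutely, so the limit along
   growing squares of indices is its value.  w1, w2 are full periods. *)
Definition sigma (w1 w2 z : C) : C :=
  z * Clim_seq (fun N =>
    Cprod (fun p => let w := lattice_point w1 w2 p in
                    (1 - z / w) * Cexp (z / w + (z / w) ^ 2 / 2))
          (nonzero_indices N)).

Definition zeta (w1 w2 z : C) : C :=
  C_derive (sigma w1 w2) z / sigma w1 w2 z.

(* The parameter interval I may contain its endpoints, where derivatives are
   one-sided: they are taken along the filter of neighbourhoods within I. *)
Definition is_interval (I : R -> Prop) : Prop :=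
  (forall a b s : R, I a -> I b -> (a <= s <= b)%R -> I s) /\
  (exists a b : R, I a /\ I b /\ (a < b)%R).

Definition is_derive_within {V : NormedModule R_AbsRing}
    (I : R -> Prop) (g : R -> V) (t : R) (l : V) : Prop :=
  filterdiff g (within I (locally t)) (fun s : R => scal s l).

Definition ex_derive_within {V : NormedModule R_AbsRing}
    (I : R -> Prop) (g : R -> V) (t : R) : Prop :=
  exists l : V, is_derive_within I g t l.

Definition smooth_within {V : NormedModule R_AbsRing}
    (I : R -> Prop) (g : R -> V) : Prop :=
  exists d : nat -> R -> V,
    (forall t, I t -> d 0%nat t = g t) /\
    (forall n t, I t -> is_derive_within I (d n) t (d (S n) t)).

(* The derivative of a complex-valued function of the parameter; meaningful
   where the derivative exists. *)
Definition dot (I : R -> Prop) (g : R -> C) (t : R) : C :=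
  iota (T := C_R_CompleteNormedModule)
       (is_derive_within (V := C_R_NormedModule) I g t).

(* [line_integral F U a b v]: v is the integral of F along some piecewise C^1
   path in U from a to b.  Each C^1 arc is parametrized by [0,1] and is the
   restriction of a C^1 map p on R with derivative dp. *)
Inductive line_integral (F : C -> C) (U : C -> Prop) : C -> C -> C -> Prop :=
| line_integral_nil (a : C) : line_integral F U a a 0
| line_integral_arc (a b e : C) (p dp : R -> C) (u v : C) :
    (forall s, is_derive (K := R_AbsRing) (V := C_R_NormedModule) p s (dp s)) ->
    (forall s, continuous (T := R_UniformSpace) (U := C_UniformSpace) dp s) ->
    (forall s, (0 <= s <= 1)%R -> U (p s)) ->
    p 0%R = a -> p 1%R = b ->
    is_RInt (V := C_R_NormedModule) (fun s => F (p s) * dp s) 0 1 u ->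
    line_integral F U b e v ->
    line_integral F U a e (u + v).

Record slit_data := SlitData {
  dc : R -> C;            (* c(t) *)
  dc1 : R -> C;           (* c_1(t) *)
  dm : R -> R;            (* m(t) *)
  dx : nat -> R -> R;     (* x_k(t), used for 1 <= k <= 4 *)
  dy0 : R -> R            (* y_0(t) *)
}.

Definition omega1 (t : R) : C := 1.
Definition omega2 (P : slit_data) (t : R) : C := 2 * dm P t * Ci.

Definition sigma_t (P : slit_data) (t : R) : C -> C :=
  sigma (omega1 t) (omega2 P t).
Definition zeta_t (P : slit_data) (t : R) : C -> C :=
  zeta (omega1 t) (omega2 P t).
Definition lattice_t (P : slit_data) (t : R) : C -> Prop :=
  in_lattice (omega1 t) (omega2 P t).
Definition eta1 (P : slit_data) (t : R) : C := 2 * zeta_t P t (omega1 t / 2).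

Definition K4 : list nat := [1; 2; 3; 4]%nat.

Definition zpt (P : slit_data) (k : nat) (t : R) : C :=
  match k with
  | 3%nat => dx P k t + Ci * dm P t
  | 4%nat => dx P k t - Ci * dm P t
  | _ => dx P k t
  end.

Definition z0 (P : slit_data) (t : R) : C := Ci * dy0 P t.

Definition gam (beta : R) (P : slit_data) (t : R) : C := beta / PI * eta1 P t.

(* The derivative of f in z is c(t) times this. *)
Definition integrand (beta : R) (P : slit_data) (t : R) (xi : C) : C :=
  Cexp (gam beta P t * xi) * Cprod (fun k => sigma_t P t (xi - zpt P k t)) K4
  / (sigma_t P t (xi - z0 P t) ^ 2 * sigma_t P t (xi - Cconj (z0 P t)) ^ 2).

(* The poles of the extended function. *)
Definition is_pole (P : slit_data) (t : R) (z : C) : Prop :=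
  lattice_t P t (z - z0 P t) \/ lattice_t P t (z - Cconj (z0 P t)).

Definition ray_point (alpha r : R) : C := r * Cexp (Ci * alpha).

(* The segment of the ray arg w = alpha between the distances r and s from 0. *)
Definition slit (alpha r s : R) (w : C) : Prop :=
  exists q : R, (r <= q <= s)%R /\ w = ray_point alpha q.

Definition has_pole (g : C -> C) (p : C) : Prop :=
  filterlim (fun z => Cmod (g z)) (locally' (T := C_UniformSpace) p)
            (Rbar_locally p_infty).

Definition holomorphic_at (g : C -> C) (z : C) : Prop :=
  ex_derive (K := C_AbsRing) (V := C_NormedModule) g z.

(* One representative of each point of the open rectangle with identified
   vertical sides. *)
Definition cylinder (m : R) (z : C) : Prop :=
  (0 <= Re z < 1)%R /\ (0 < Im z < m)%R.

(* g maps Q conformally onto the complement of E in the Riemann sphere, the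
   point p of Q being sent to infinity. *)
Definition conformal_onto_exterior
    (g : C -> C) (p : C) (Q E : C -> Prop) : Prop :=
  Q p /\ has_pole g p /\
  (forall z, Q z -> z <> p -> holomorphic_at g z) /\
  (forall z z', Q z -> z <> p -> Q z' -> z' <> p -> g z = g z' -> z = z') /\
  (forall w, (exists z, Q z /\ z <> p /\ g z = w) <-> ~ E w).

Definition endpoints (A A' B B' : C) : Prop :=
  (A = B /\ A' = B') \/ (A = B' /\ A' = B).

(* The conditions at a fixed parameter t; f z t is unconstrained at the poles. *)
Record slit_map (theta beta : R) (P : slit_data) (f : C -> R -> C) (t : R) :
    Prop := {
  sm_c : dc P t <> 0;
  sm_m : (0 < dm P t)%R;
  sm_x12 : (dx P 1 t < dx P 2 t < dx P 1 t + 1)%R;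
  sm_x34 : (dx P 3 t < dx P 4 t < dx P 3 t + 1)%R;
  sm_y0 : (0 < dy0 P t < dm P t)%R;
  sm_sum : (dx P 1 t + dx P 2 t + dx P 3 t + dx P 4 t = beta / PI)%R;
  sm_residue :
    gam beta P t + Csum (fun k => zeta_t P t (z0 P t - zpt P k t)) K4
    - 2 * zeta_t P t (z0 P t - Cconj (z0 P t)) = 0;
  sm_integral : forall z v : C,
    line_integral (integrand beta P t) (fun u => ~ is_pole P t u) 0 z v ->
    f z t = dc P t * v + dc1 P t;
  sm_holo : forall z, ~ is_pole P t z -> holomorphic_at (fun u => f u t) z;
  sm_pole : forall z, is_pole P t z -> has_pole (fun u => f u t) z;
  sm_reflect0 : forall z, ~ is_pole P t z ->
    f (Cconj z) t = Cexp (2 * Ci * theta) * Cconj (f z t);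
  sm_reflect1 : forall z, ~ is_pole P t z ->
    f (Cconj z + omega2 P t) t
    = Cexp (2 * Ci * (theta + beta)) * Cconj (f z t);
  sm_period1 : forall z, ~ is_pole P t z -> f (z + 1) t = f z t;
  sm_period2 : forall z, ~ is_pole P t z ->
    f (z + omega2 P t) t = Cexp (2 * Ci * beta) * f z t;
  (* f (zpt P 4 t) t is Cexp (- 2 * Ci * beta) times an endpoint, because
     zpt P 4 is the boundary preimage shifted by - omega2.  Slits lie on closed
     rays; disjointness then excludes that both contain 0. *)
  sm_conformal : exists r1 s1 r2 s2 : R,
    let S1 := slit theta r1 s1 in
    let S2 := slit (theta + beta) r2 s2 in
    (0 <= r1 < s1)%R /\ (0 <= r2 < s2)%R /\
    (forall w, ~ (S1 w /\ S2 w)) /\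
    conformal_onto_exterior (fun z => f z t) (z0 P t) (cylinder (dm P t))
      (fun w => S1 w \/ S2 w) /\
    (forall w, (exists x : R, w = f (RtoC x) t) <-> S1 w) /\
    (forall w, (exists x : R, w = f (x + Ci * dm P t) t) <-> S2 w) /\
    endpoints (f (zpt P 1 t) t) (f (zpt P 2 t) t)
      (ray_point theta r1) (ray_point theta s1) /\
    endpoints (f (zpt P 3 t) t) (Cexp (2 * Ci * beta) * f (zpt P 4 t) t)
      (ray_point (theta + beta) r2) (ray_point (theta + beta) s2)
}.

Record slit_family (I : R -> Prop) (theta beta : R) (P : slit_data)
    (f : C -> R -> C) : Prop := {
  sf_interval : is_interval I;
  sf_beta : (0 < beta < 2 * PI)%R;
  sf_c : smooth_within (V := C_R_NormedModule) I (dc P);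
  sf_c1 : smooth_within (V := C_R_NormedModule) I (dc1 P);
  sf_m : smooth_within (V := R_NormedModule) I (dm P);
  sf_x : forall k, In k K4 -> smooth_within (V := R_NormedModule) I (dx P k);
  sf_y0 : smooth_within (V := R_NormedModule) I (dy0 P);
  sf_map : forall t, I t -> slit_map theta beta P f t
}.

(* A_k(t), D_k(t) and gamma_k(t). *)
Definition A_ (P : slit_data) (f : C -> R -> C) (k : nat) (t : R) : C :=
  f (zpt P k t) t.

Definition D_ (beta : R) (P : slit_data) (k : nat) (t : R) : C :=
  dc P t * Cexp (gam beta P t * zpt P k t)
  * Cprod (fun j => sigma_t P t (zpt P k t - zpt P j t))
      (filter (fun j => negb (Nat.eqb j k)) K4)
  / (sigma_t P t (zpt P k t - z0 P t) ^ 2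
     * sigma_t P t (zpt P k t - Cconj (z0 P t)) ^ 2).

Definition gamma_ (I : R -> Prop) (beta : R) (P : slit_data)
    (f : C -> R -> C) (k : nat) (t : R) : C :=
  dot I (A_ P f k) t / D_ beta P k t.

Definition h (I : R -> Prop) (beta : R) (P : slit_data)
    (f : C -> R -> C) (z : C) (t : R) : C :=
  Csum (fun j => gamma_ I beta P f j t *
          (zeta_t P t (z - zpt P j t) - zeta_t P t (z0 P t - zpt P j t)
           - eta1 P t * (z - z0 P t))) K4
  - dot I (z0 P) t.

(* Main.v *)
(* Write phi = f' (an explicit sigma quotient) and let fdot be the derivative of f in t.
   At a fixed t consider
     q(z) = fdot / phi - sum_j gamma_j (zeta(z - z_j) - eta_1 z).
   Differentiating the period relations of f shows that q has period 1 and that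
   q(z + omega_2) - q(z) = 2 pi i sum_j gamma_j - omega_2', by Legendre's relation.  The zero of
   phi at z_j is simple and fdot(z_j) = A_j', so the pole of fdot / phi at z_j is cancelled by the
   zeta term; at the double pole p of phi, fdot + p' phi is only O(1/(z - p)), so fdot / phi tends
   to - p'.  Hence q extends to an entire function whose derivative is elliptic, so q is affine,
   and constant by 1-periodicity.  This gives omega_2', and the value of the constant is read
   off at z_0.

   Complex analysis is built on strict differentiability (two moving points), which is stable
   under composition with several variables and makes the derivative continuous.  Cauchy's
   estimate for the first derivative then yields that a bounded pointwise limit of holomorphic
   functions is holomorphic, hence the smoothness of sigma in z and in the period, Riemann's
   theorem on removable singularities and Liouville's theorem. *)

Require Import Defs.
From Stdlib Require Import Lra Lia ClassicalEpsilon Permutation.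

Local Open Scope R_scope.
Local Open Scope C_scope.

(** Only [c], [c_1], [m], [x_k] and [y_0] are assumed smooth in [t]; the smoothness of [eta_1],
    [sigma] and [f] in [t] has to be proved, and this shapes the development. [sigma] is [z] times
    [kap], a function holomorphic in [z] and in the period with value 1 at the origin; composing it
    with the smooth parameters gives the integrand, and [f] is then differentiated under the
    integral along segments that avoid the poles, starting from [f(0,t) = c_1(t)]. Since [I] may
    contain its end points, time derivatives compare [s] with the fixed time [t] only, while the
    points of the plane move freely; this asymmetric notion is [sdt]. Contour integration is
    replaced by real integrals with a parameter: over circles of varying radius for Cauchy's
    estimate, over horizontal segments of varying height for Legendre's relation. At a pole the size
    of [fdot + p' phi] is not visible directly; its derivative is explicit of order 2, and
    integrating it radially gives the order 1. *)

Ltac Rmin_facts a b := pose proof (Rmin_l a b); pose proof (Rmin_r a b).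

(** * Inequalities for the complex modulus *)

Lemma Cmod_minus_sym (a b : C) : Cmod (a - b) = Cmod (b - a).
Proof. rewrite <- Cmod_opp. f_equal. ring. Qed.

Lemma Cmod_minus_le (a b : C) : Cmod (a - b) <= Cmod a + Cmod b.
Proof. unfold Cminus. rewrite <- (Cmod_opp b). apply Cmod_triangle. Qed.

Lemma Cmod_triangle_sub (a b c : C) : Cmod (a - c) <= Cmod (a - b) + Cmod (b - c).
Proof. replace (a - c) with ((a - b) + (b - c)) by ring. apply Cmod_triangle. Qed.

Lemma Cmod_add_le (a b : C) (x y : R) :
  Cmod a <= x -> Cmod b <= y -> Cmod (a + b) <= x + y.
Proof. intros. eapply Rle_trans; [apply Cmod_triangle | lra]. Qed.

Lemma Cmod_mult_le (a b : C) (x y : R) :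
  Cmod a <= x -> Cmod b <= y -> Cmod (a * b) <= x * y.
Proof.
  intros. rewrite Cmod_mult. apply Rmult_le_compat; auto using Cmod_ge_0.
Qed.

Lemma Cmod_le_add_sub (a b : C) : Cmod a <= Cmod b + Cmod (a - b).
Proof. replace a with (b + (a - b)) at 1 by ring. apply Cmod_triangle. Qed.

Lemma Cmod_near_ne_0 (a b : C) : Cmod (b - a) < Cmod a -> b <> 0.
Proof.
  intros H E. subst. replace (0 - a) with (- a) in H by ring.
  rewrite Cmod_opp in H. lra.
Qed.

Lemma Cmod_small_eq (a b : C) : (forall e, 0 < e -> Cmod (a - b) <= e) -> a = b.
Proof.
  intros H. destruct (Ceq_dec a b) as [|N]; auto. exfalso.
  assert (a - b <> 0) by (intro E; apply N; replace a with (a - b + b) by ring; rewrite E; ring).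
  apply Cmod_gt_0 in H0. specialize (H (Cmod (a - b) / 2)%R). lra.
Qed.

Lemma Cminus_ne_0 (a b : C) : a <> b -> a - b <> 0.
Proof. intros N E; apply N; replace a with (a - b + b) by ring; rewrite E; ring. Qed.

(** * Strict differentiability along a filter *)

Section StrictFilter.
Context {T : Type} (Fl : (T -> Prop) -> Prop) {FF : Filter Fl} (N : T -> R).

(** [u] and [v] are moving values with common limit [u0], [L] is the linear part of [u - v], and [N]
    measures the displacement. Three choices of the filter give the derivative in the parameter
    along [I], the strict derivative in [z] and the joint one ([within_diff_sd], [sdiff_sd],
    [sdt_sd]), so that the chain rule is proved only once. *)
Record sd (u v : T -> C) (u0 : C) (L : T -> C) : Prop := {
  sd_bound : exists K, 0 <= K /\ Fl (fun p => Cmod (L p) <= K * N p);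
  sd_est : forall e, 0 < e -> Fl (fun p => Cmod (u p - v p - L p) <= e * N p);
  sd_lim1 : forall e, 0 < e -> Fl (fun p => Cmod (u p - u0) < e);
  sd_lim2 : forall e, 0 < e -> Fl (fun p => Cmod (v p - u0) < e)
}.

Definition strict2 (F : C -> C -> C) (x0 y0 l1 l2 : C) : Prop :=
  forall e, 0 < e -> exists d, 0 < d /\ forall x x' y y',
    Cmod (x - x0) < d -> Cmod (x' - x0) < d ->
    Cmod (y - y0) < d -> Cmod (y' - y0) < d ->
    Cmod (F x y - F x' y' - (l1 * (x - x') + l2 * (y - y')))
      <= e * (Cmod (x - x') + Cmod (y - y')).

Lemma strict2_cont (F : C -> C -> C) (x0 y0 l1 l2 : C) :
  strict2 F x0 y0 l1 l2 ->
  forall e, 0 < e -> exists d, 0 < d /\ forall x y,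
    Cmod (x - x0) < d -> Cmod (y - y0) < d -> Cmod (F x y - F x0 y0) < e.
Proof.
  intros H e He. destruct (H 1%R ltac:(lra)) as (d & Hd & B).
  set (K := (1 + Cmod l1 + Cmod l2)%R).
  assert (0 < K) by (unfold K; pose proof (Cmod_ge_0 l1); pose proof (Cmod_ge_0 l2); lra).
  assert (Hq : 0 < e / (4 * K)) by (apply Rdiv_lt_0_compat; lra).
  exists (Rmin d (e / (4 * K))). split; [apply Rmin_glb_lt; auto|].
  intros x y Hx Hy.
  assert (Hz : forall a : C, Cmod (a - a) = 0%R)
    by (intros; replace (a - a) with (RtoC 0) by ring; apply Cmod_0).
  Rmin_facts d (e / (4 * K))%R.
  specialize (B x x0 y y0 ltac:(lra) ltac:(rewrite Hz; lra) ltac:(lra) ltac:(rewrite Hz; lra)).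
  pose proof (Cmod_le_add_sub (F x y - F x0 y0) (l1 * (x - x0) + l2 * (y - y0))) as T1.
  pose proof (Cmod_add_le (l1 * (x - x0)) (l2 * (y - y0)) (Cmod l1 * (e / (4 * K)))
     (Cmod l2 * (e / (4 * K)))) as T2.
  rewrite !Cmod_mult in T2.
  assert (T3 : forall l a : C, Cmod a < e / (4 * K) -> Cmod l * Cmod a <= Cmod l * (e / (4 * K))).
  { intros. apply Rmult_le_compat_l; [apply Cmod_ge_0 | lra]. }
  specialize (T2 (T3 l1 (x - x0) ltac:(lra)) (T3 l2 (y - y0) ltac:(lra))).
  assert ((1 + 1 + Cmod l1 + Cmod l2) * (e / (4 * K)) < e).
  { apply Rle_lt_trans with (2 * K * (e / (4 * K)))%R.
    - apply Rmult_le_compat_r; [lra| unfold K; pose proof (Cmod_ge_0 l1); pose proof (Cmod_ge_0 l2); lra].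
    - replace (2 * K * (e / (4 * K)))%R with (e / 2)%R by (field; lra). lra. }
  lra.
Qed.

Lemma sd_comp2 (F : C -> C -> C) (l1 l2 x0 y0 : C) (u v L u' v' L' : T -> C) :
  strict2 F x0 y0 l1 l2 -> sd u v x0 L -> sd u' v' y0 L' ->
  sd (fun p => F (u p) (u' p)) (fun p => F (v p) (v' p)) (F x0 y0)
     (fun p => l1 * L p + l2 * L' p).
Proof.
  intros HF H H'.
  destruct (sd_bound _ _ _ _ H) as (K & HK & BK).
  destruct (sd_bound _ _ _ _ H') as (K' & HK' & BK').
  set (M := (1 + Cmod l1 + Cmod l2)%R).
  assert (HM : 0 < M) by (unfold M; pose proof (Cmod_ge_0 l1); pose proof (Cmod_ge_0 l2); lra).
  split.
  - exists (Cmod l1 * K + Cmod l2 * K')%R. split.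
    { apply Rplus_le_le_0_compat; apply Rmult_le_pos; auto using Cmod_ge_0. }
    generalize (filter_and _ _ BK BK'). apply filter_imp. intros p [A B].
    rewrite Rmult_plus_distr_r. apply Cmod_add_le; rewrite Rmult_assoc;
      apply Cmod_mult_le; auto; lra.
  - intros e He.
    (* [e1] pays for replacing [F] by its linear part, the increments of the arguments being at most
       [(K + 1) N] and [(K' + 1) N]. [e2] below pays for replacing these increments by [L] and [L'];
       [e2 <= 1] is what gives the constants [K + 1] and [K' + 1]. *)
    set (e1 := (e / (2 * (K + K' + 2)))%R).
    assert (He1 : 0 < e1) by (apply Rdiv_lt_0_compat; lra).
    destruct (HF e1 He1) as (d & Hd & B).
    set (e2 := Rmin 1 (e / (2 * M))).
    assert (He2 : 0 < e2) by (apply Rmin_glb_lt; [lra | apply Rdiv_lt_0_compat; lra]).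
    assert (He2' : M * e2 <= e / 2).
    { apply Rle_trans with (M * (e / (2 * M)))%R.
      - apply Rmult_le_compat_l; [lra | apply Rmin_r].
      - right; field; lra. }
    assert (He2'' : e2 <= 1) by apply Rmin_l.
    generalize (filter_and _ _ (filter_and _ _ BK BK')
      (filter_and _ _ (filter_and _ _ (sd_est _ _ _ _ H e2 He2) (sd_est _ _ _ _ H' e2 He2))
      (filter_and _ _
        (filter_and _ _ (sd_lim1 _ _ _ _ H d Hd) (sd_lim2 _ _ _ _ H d Hd))
        (filter_and _ _ (sd_lim1 _ _ _ _ H' d Hd) (sd_lim2 _ _ _ _ H' d Hd))))).
    apply filter_imp. intros p [[A1 A2] [[A3 A4] [[A5 A6] [A7 A8]]]].
    specialize (B _ _ _ _ A5 A6 A7 A8).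
    (* [N] is an arbitrary real function; wherever the estimate of [sd] holds, it is forced to be
       nonnegative. *)
    assert (HN : 0 <= N p).
    { destruct (Rle_or_lt 0 (N p)); auto. exfalso.
      pose proof (Cmod_ge_0 (u p - v p - L p)).
      assert (e2 * N p < 0)%R by (apply Ropp_lt_cancel; rewrite Ropp_0, Ropp_mult_distr_r; apply Rmult_lt_0_compat; lra).
      lra. }
    assert (C1 : Cmod (u p - v p) <= (K + 1) * N p).
    { pose proof (Cmod_le_add_sub (u p - v p) (L p)).
      assert (e2 * N p <= 1 * N p) by (apply Rmult_le_compat_r; auto). lra. }
    assert (C2 : Cmod (u' p - v' p) <= (K' + 1) * N p).
    { pose proof (Cmod_le_add_sub (u' p - v' p) (L' p)).
      assert (e2 * N p <= 1 * N p) by (apply Rmult_le_compat_r; auto). lra. }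
    replace (F (u p) (u' p) - F (v p) (v' p) - (l1 * L p + l2 * L' p))
      with ((F (u p) (u' p) - F (v p) (v' p) - (l1 * (u p - v p) + l2 * (u' p - v' p)))
        + (l1 * (u p - v p - L p) + l2 * (u' p - v' p - L' p))) by ring.
    apply Rle_trans with (e / 2 * N p + e / 2 * N p)%R; [| lra].
    apply Cmod_add_le.
    + eapply Rle_trans; [apply B|].
      apply Rle_trans with (e1 * ((K + K' + 2) * N p))%R.
      * apply Rmult_le_compat_l; lra.
      * right; unfold e1; field; lra.
    + apply Rle_trans with (Cmod l1 * (e2 * N p) + Cmod l2 * (e2 * N p))%R.
      * apply Cmod_add_le; apply Cmod_mult_le; auto; lra.
      * replace (Cmod l1 * (e2 * N p) + Cmod l2 * (e2 * N p))%R
          with ((Cmod l1 + Cmod l2) * e2 * N p)%R by ring.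
        apply Rmult_le_compat_r; auto. unfold M in He2'.
        assert (0 <= e2) by lra. lra.
  - intros e He. destruct (strict2_cont _ _ _ _ _ HF e He) as (d & Hd & B).
    generalize (filter_and _ _ (sd_lim1 _ _ _ _ H d Hd) (sd_lim1 _ _ _ _ H' d Hd)).
    apply filter_imp. intros p [A1 A2]. auto.
  - intros e He. destruct (strict2_cont _ _ _ _ _ HF e He) as (d & Hd & B).
    generalize (filter_and _ _ (sd_lim2 _ _ _ _ H d Hd) (sd_lim2 _ _ _ _ H' d Hd)).
    apply filter_imp. intros p [A1 A2]. auto.
Qed.

Lemma sd_ext (u v u1 v1 : T -> C) (u0 u0' : C) (L L1 : T -> C) :
  (forall p, u p = u1 p) -> (forall p, v p = v1 p) -> u0 = u0' -> (forall p, L p = L1 p) ->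
  sd u v u0 L -> sd u1 v1 u0' L1.
Proof.
  intros Hu Hv <- HL [A B C1 D]. split.
  - destruct A as (K & HK & A). exists K; split; auto.
    revert A; apply filter_imp; intros p; now rewrite HL.
  - intros e He; generalize (B e He); apply filter_imp; intros p; now rewrite HL, Hu, Hv.
  - intros e He; generalize (C1 e He); apply filter_imp; intros p; now rewrite Hu.
  - intros e He; generalize (D e He); apply filter_imp; intros p; now rewrite Hv.
Qed.

End StrictFilter.

Lemma strict2_mult (x0 y0 : C) : strict2 Cmult x0 y0 y0 x0.
Proof.
  intros e He. exists e; split; auto. intros x x' y y' H1 H2 H3 H4.
  replace (x * y - x' * y' - (y0 * (x - x') + x0 * (y - y')))
    with ((y - y0) * (x - x') + (x' - x0) * (y - y')) by ring.
  rewrite Rmult_plus_distr_l.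
  apply Cmod_add_le; apply Cmod_mult_le; lra.
Qed.

Lemma strict2_plus (x0 y0 : C) : strict2 Cplus x0 y0 1 1.
Proof.
  intros e He. exists e; split; auto. intros x x' y y' H1 H2 H3 H4.
  replace (x + y - (x' + y') - (1 * (x - x') + 1 * (y - y'))) with (RtoC 0) by ring.
  rewrite Cmod_0. apply Rmult_le_pos; [lra|]. pose proof (Cmod_ge_0 (x - x')).
  pose proof (Cmod_ge_0 (y - y')). lra.
Qed.

Definition sdiff (F : C -> C) (z0 l : C) : Prop :=
  forall e, 0 < e -> exists d, 0 < d /\ forall z z',
    Cmod (z - z0) < d -> Cmod (z' - z0) < d ->
    Cmod (F z - F z' - l * (z - z')) <= e * Cmod (z - z').

(** A dummy second argument lets functions of one variable enter [sd_comp2]. *)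
Lemma strict2_fst (F : C -> C) (x0 l y0 : C) :
  sdiff F x0 l -> strict2 (fun x _ => F x) x0 y0 l 0.
Proof.
  intros H e He. destruct (H e He) as (d & Hd & B). exists d; split; auto.
  intros x x' y y' H1 H2 H3 H4. replace (l * (x - x') + 0 * (y - y')) with (l * (x - x')) by ring.
  eapply Rle_trans; [apply B; auto|]. apply Rmult_le_compat_l; [lra|].
  pose proof (Cmod_ge_0 (y - y')); lra.
Qed.

Lemma sdiff_inv (z0 : C) : z0 <> 0 -> sdiff Cinv z0 (- / (z0 * z0)).
Proof.
  intros Hz e He. assert (Hm := proj1 (Cmod_gt_0 _) Hz). set (m := Cmod z0) in *.
  (* [m / 2] keeps the points away from 0. The error factor is then at most
     [(5/2) m d / (m^4 / 4) = 10 d / m^3], whence the second bound. *)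
  set (d := Rmin (m / 2) (e * (m * m * m) / 10)).
  assert (Hd : 0 < d).
  { apply Rmin_glb_lt; [lra|]. apply Rdiv_lt_0_compat; [|lra].
    repeat apply Rmult_lt_0_compat; auto. }
  exists d; split; auto. intros z z' H1 H2.
  assert (D1 : d <= m / 2) by apply Rmin_l.
  assert (D2 : d <= e * (m * m * m) / 10) by apply Rmin_r.
  assert (forall w, Cmod (w - z0) < d -> m / 2 <= Cmod w /\ w <> 0) as Q.
  { intros w Hw. assert (m / 2 <= Cmod w).
    { pose proof (Cmod_le_add_sub z0 w). rewrite Cmod_minus_sym in Hw. fold m in H. lra. }
    split; auto. intros E; subst; rewrite Cmod_0 in H; lra. }
  destruct (Q z H1) as [M1 N1]. destruct (Q z' H2) as [M2 N2].
  replace (/ z - / z' - - / (z0 * z0) * (z - z'))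
    with ((z * (z' - z0) + z0 * (z - z0)) * / (z * z' * (z0 * z0)) * (z - z')) by (field; auto).
  rewrite Cmod_mult. apply Rmult_le_compat_r; [apply Cmod_ge_0|].
  rewrite Cmod_mult, Cmod_inv by (repeat apply Cmult_neq_0; auto).
  rewrite !Cmod_mult. fold m.
  assert (M3 : Cmod z <= m + d).
  { pose proof (Cmod_le_add_sub z z0). fold m in H. lra. }
  assert (Cmod (z * (z' - z0) + z0 * (z - z0)) <= 5/2 * m * d).
  { apply Rle_trans with ((m + d) * d + m * d)%R.
    - apply Cmod_add_le; apply Cmod_mult_le; fold m; lra.
    - assert (d * d <= m / 2 * d) by (apply Rmult_le_compat_r; lra). lra. }
  apply Rle_trans with (5 / 2 * m * d * / (m / 2 * (m / 2) * (m * m)))%R.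
  - apply Rmult_le_compat; auto using Cmod_ge_0.
    + left. apply Rinv_0_lt_compat. repeat apply Rmult_lt_0_compat; lra.
    + apply Rinv_le_contravar; [repeat apply Rmult_lt_0_compat; lra|].
      apply Rmult_le_compat_r; [apply Rmult_le_pos; lra|].
      apply Rmult_le_compat; lra.
  - replace (5 / 2 * m * d * / (m / 2 * (m / 2) * (m * m)))%R
      with (10 * d / (m * m * m))%R by (field; lra).
    apply Rle_div_l; [repeat apply Rmult_lt_0_compat; auto| lra].
Qed.

(** * Derivatives of curves and the mean value inequality *)

Lemma norm_C_R (z : C) : norm (V := C_R_NormedModule) z = Cmod z.
Proof.
  unfold norm; simpl. unfold prod_norm, Cmod. f_equal.
  unfold norm; simpl. unfold abs; simpl. rewrite !Rmult_1_r.
  now rewrite <- !Rabs_mult, !Rabs_pos_eq by apply Rle_0_sqr.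
Qed.

Lemma scal_C_R (r : R) (z : C) :
  scal (K := R_AbsRing) (V := C_R_NormedModule) r z = r * z.
Proof.
  unfold scal; simpl. unfold prod_scal, Cmult; simpl.
  unfold scal; simpl. unfold mult; simpl. f_equal; ring.
Qed.

Lemma minus_C_R (x y : C) : minus (G := C_R_NormedModule) x y = x - y.
Proof. reflexivity. Qed.

Lemma is_derive_within_eps (I : R -> Prop) (g : R -> C) (t : R) (l : C) :
  I t ->
  (is_derive_within (V := C_R_NormedModule) I g t l <->
   forall e, 0 < e -> exists d, 0 < d /\ forall s, I s -> Rabs (s - t) < d ->
     Cmod (g s - g t - l * RtoC (s - t)) <= e * Rabs (s - t)).
Proof.
  intros It. split.
  - intros [_ H] e He.
    assert (L : is_filter_lim (within I (locally t)) t).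
    { intros P [d HP]. exists d. intros y By _. now apply HP. }
    destruct (H t L (mkposreal e He)) as [d Hd].
    exists d; split; [apply cond_pos|]. intros s Is Hs.
    specialize (Hd s Hs Is). simpl in Hd.
    rewrite !minus_C_R, scal_C_R, norm_C_R in Hd. rewrite Cmult_comm.
    exact Hd.
  - intros H. split.
    + apply (is_linear_scal_l (V := C_R_NormedModule)).
    + intros x Hx.
      (* [filterdiff] speaks of every limit point of the filter. Each set of this filter contains
         [t], because [t] lies in [I], so a ball around another point cannot belong to it. *)
      assert (x = t).
      { destruct (Req_dec x t) as [|N]; auto. exfalso.
        assert (Hp : 0 < Rabs (x - t) / 2) by (assert (0 < Rabs (x - t)) by (apply Rabs_pos_lt; lra); lra).
        destruct (Hx (ball x (mkposreal _ Hp)) (locally_ball x (mkposreal _ Hp))) as [d Q]. specialize (Q t (ball_center _ _) It).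
        change (Rabs (t - x) < Rabs (x - t) / 2) in Q.
        rewrite Rabs_minus_sym in Q. lra. }
      subst x. intros e. destruct (H e (cond_pos e)) as (d & Hd & B).
      exists (mkposreal d Hd). intros s Bs Is.
      rewrite !minus_C_R, scal_C_R, norm_C_R.
      specialize (B s Is Bs). rewrite Cmult_comm in B. exact B.
Qed.

Lemma is_derive_within_R_eps (I : R -> Prop) (g : R -> R) (t l : R) :
  I t ->
  is_derive_within (V := R_NormedModule) I g t l ->
   forall e, 0 < e -> exists d, 0 < d /\ forall s, I s -> Rabs (s - t) < d ->
     Rabs (g s - g t - l * (s - t)) <= e * Rabs (s - t).
Proof.
  intros It. 
  - intros [_ H] e He.
    assert (L : is_filter_lim (within I (locally t)) t).
    { intros P [d HP]. exists d. intros y By _. now apply HP. }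
    destruct (H t L (mkposreal e He)) as [d Hd].
    exists d; split; [apply cond_pos|]. intros s Is Hs.
    specialize (Hd s Hs Is). rewrite (Rmult_comm l). exact Hd.
Qed.

Definition rdiff (g : R -> C) (t : R) (l : C) : Prop :=
  forall e, 0 < e -> exists d, 0 < d /\ forall s, Rabs (s - t) < d ->
     Cmod (g s - g t - l * RtoC (s - t)) <= e * Rabs (s - t).

Lemma rdiff_is_derive (g : R -> C) (t : R) (l : C) :
  rdiff g t l <-> is_derive (K := R_AbsRing) (V := C_R_NormedModule) g t l.
Proof.
  split.
  - intros H. split.
    + apply (is_linear_scal_l (V := C_R_NormedModule)).
    + intros x Hx. apply (is_filter_lim_locally_unique (V := R_NormedModule)) in Hx. subst x.
      intros e. destruct (H e (cond_pos e)) as (d & Hd & B).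
      exists (mkposreal d Hd). intros s Bs.
      rewrite !minus_C_R, scal_C_R, norm_C_R.
      specialize (B s Bs). rewrite Cmult_comm in B. exact B.
  - intros [_ H] e He.
    destruct (H t (fun P HP => HP) (mkposreal e He)) as [d Hd].
    exists d; split; [apply cond_pos|]. intros s Hs.
    specialize (Hd s Hs). simpl in Hd.
    rewrite !minus_C_R, scal_C_R, norm_C_R in Hd. rewrite Cmult_comm.
    exact Hd.
Qed.

(** Projecting a curve on a fixed direction [v] makes the real mean value theorem applicable to
    it. *)
Lemma rdiff_dot (g : R -> C) (t : R) (l v : C) :
  rdiff g t l -> is_derive (fun x => Re (Cconj v * g x)) t (Re (Cconj v * l)).
Proof.
  intros H. split; [apply (is_linear_scal_l (V := R_NormedModule))|].
  intros x Hx. apply (is_filter_lim_locally_unique (V := R_NormedModule)) in Hx. subst x.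
  intros e. 
  assert (He : 0 < e / (1 + Cmod v)).
  { apply Rdiv_lt_0_compat; [apply cond_pos | pose proof (Cmod_ge_0 v); lra]. }
  destruct (H _ He) as (d & Hd & B).
  exists (mkposreal d Hd). intros s Bs. specialize (B s Bs).
  change (Rabs (Re (Cconj v * g s) - Re (Cconj v * g t) - (s - t) * Re (Cconj v * l)) <= e * Rabs (s - t)).
  replace (Re (Cconj v * g s) - Re (Cconj v * g t) - (s - t) * Re (Cconj v * l))%R
    with (Re (Cconj v * (g s - g t - l * RtoC (s - t))))
    by (destruct (g s), (g t), l, v; simpl; ring).
  eapply Rle_trans; [apply re_le_Cmod|]. rewrite Cmod_mult, Cmod_conj.
  apply Rle_trans with (Cmod v * (e / (1 + Cmod v) * Rabs (s - t)))%R.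
  - apply Rmult_le_compat_l; auto using Cmod_ge_0.
  - rewrite <- Rmult_assoc. apply Rmult_le_compat_r; [apply Rabs_pos|].
    pose proof (Cmod_ge_0 v). pose proof (cond_pos e).
    replace (Cmod v * (e / (1 + Cmod v)))%R with (e * (Cmod v / (1 + Cmod v)))%R by (field; lra).
    rewrite <- (Rmult_1_r e) at 2. apply Rmult_le_compat_l; [lra|].
    apply Rle_div_l; lra.
Qed.

(* The real mean value theorem is applied to [Re (conj v * g)], v the increment of g. *)
Lemma mean_value_ineq (g dg : R -> C) (B dB : R -> R) (a b : R) :
  a <= b ->
  (forall x, a <= x <= b -> rdiff g x (dg x)) ->
  (forall x, a <= x <= b -> is_derive B x (dB x)) ->
  (forall x, a <= x <= b -> Cmod (dg x) <= dB x) ->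
  Cmod (g b - g a) <= B b - B a.
Proof.
  intros Hab Hg HB Hle. set (v := g b - g a).
  set (k := fun x => (Cmod v * B x - Re (Cconj v * g x))%R).
  set (dk := fun x => (Cmod v * dB x - Re (Cconj v * dg x))%R).
  assert (Hk : forall x, a <= x <= b -> is_derive k x (dk x)).
  { intros x Hx. apply (is_derive_minus (V := R_NormedModule)).
    - apply is_derive_scal. auto.
    - apply rdiff_dot; auto. }
  destruct (MVT_gen k a b dk) as (c & Hc & E).
  - intros x Hx. apply Hk. rewrite Rmin_left, Rmax_right in Hx by auto. lra.
  - intros x Hx. rewrite Rmin_left, Rmax_right in Hx by auto.
    apply continuity_pt_filterlim. apply (ex_derive_continuous k). exists (dk x). auto.
  - rewrite Rmin_left, Rmax_right in Hc by auto.
    assert (0 <= dk c).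
    { unfold dk. specialize (Hle c Hc).
      assert (Re (Cconj v * dg c) <= Cmod v * dB c); [| lra].
      eapply Rle_trans; [apply Rle_abs|]. eapply Rle_trans; [apply re_le_Cmod|].
      apply Cmod_mult_le; auto. rewrite Cmod_conj; lra. }
    assert (0 <= k b - k a) by (rewrite E; apply Rmult_le_pos; lra).
    unfold k in H0.
    assert (Re (Cconj v * g b) - Re (Cconj v * g a) = Cmod v * Cmod v)%R.
    { replace (Cmod v * Cmod v)%R with (Cmod v ^ 2)%R by ring. rewrite Cmod2_alt.
      unfold v. destruct (g a), (g b); simpl; ring. }
    (* The inequality obtained so far carries a factor [Cmod v]. When this vanishes, what remains to
       show is that [B] does not decrease, which a second use of the mean value theorem gives. *)
    destruct (Req_dec (Cmod v) 0) as [Z|Z].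
    + rewrite Z. 
      assert (B b - B a >= 0); [| lra].
      destruct (MVT_gen B a b dB) as (c' & Hc' & E').
      * intros x Hx. apply HB. rewrite Rmin_left, Rmax_right in Hx by auto. lra.
      * intros x Hx. rewrite Rmin_left, Rmax_right in Hx by auto.
        apply continuity_pt_filterlim. apply (ex_derive_continuous B). exists (dB x). auto.
      * rewrite Rmin_left, Rmax_right in Hc' by auto. rewrite E'. apply Rle_ge.
        apply Rmult_le_pos; [|lra].
        eapply Rle_trans; [apply Cmod_ge_0| apply Hle; lra].
    + pose proof (Cmod_ge_0 v). apply Rmult_le_reg_l with (Cmod v); lra.
Qed.

Definition cdiff (F : C -> C) (z l : C) : Prop :=
  forall e, 0 < e -> exists d, 0 < d /\ forall w, Cmod (w - z) < d ->
    Cmod (F w - F z - l * (w - z)) <= e * Cmod (w - z).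

Lemma Cmod_self (z : C) : Cmod (z - z) = 0%R.
Proof. replace (z - z) with (RtoC 0) by ring. apply Cmod_0. Qed.

Lemma sdiff_cdiff (F : C -> C) (z l : C) : sdiff F z l -> cdiff F z l.
Proof.
  intros H e He. destruct (H e He) as (d & Hd & B). exists d; split; auto.
  intros w Hw. apply B; auto. rewrite Cmod_self; auto.
Qed.

Lemma cdiff_is_derive (F : C -> C) (z l : C) :
  cdiff F z l <-> is_derive (K := C_AbsRing) (V := C_NormedModule) F z l.
Proof.
  split.
  - intros H. split.
    + apply (is_linear_scal_l (K := C_AbsRing) (V := C_NormedModule)).
    + intros x Hx.
      apply (is_filter_lim_locally_unique (K := C_AbsRing) (V := AbsRing_NormedModule C_AbsRing)) in Hx. subst x.
      intros e. destruct (H e (cond_pos e)) as (d & Hd & B).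
      exists (mkposreal d Hd). intros s Bs. specialize (B s Bs).
      change (Cmod (F s - F z - (s - z) * l) <= e * Cmod (s - z)).
      rewrite Cmult_comm in B. now rewrite (Cmult_comm (s - z)), Cmult_comm.
  - intros [_ H] e He.
    destruct (H z (fun P HP => HP) (mkposreal e He)) as [d Hd].
    exists d; split; [apply cond_pos|]. intros s Hs.
    specialize (Hd s Hs). rewrite (Cmult_comm l). exact Hd.
Qed.

Lemma cdiff_C_derive (F : C -> C) (z l : C) : cdiff F z l -> C_derive F z = l.
Proof.
  intros H. apply is_C_derive_unique.
  apply cdiff_is_derive in H. 
  apply H.
Qed.

(** Compactness of [[a,b]]: a property that holds near each point with some radius holds everywhere
    with a common one. The gauge required by [compactness_value_1d] is chosen by [epsilon], and the
    conclusion of that theorem is doubly negated, hence [NNPP]. *)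
Lemma interval_uniform (a b : R) (Q : R -> R -> Prop) :
  (forall x d d', Q x d -> 0 < d' <= d -> Q x d') ->
  (forall x0, a <= x0 <= b -> exists d, 0 < d /\
     forall x, a <= x <= b -> Rabs (x - x0) < d -> Q x d) ->
  exists d, 0 < d /\ forall x, a <= x <= b -> Q x d.
Proof.
  intros Hmono H.
  assert (H' : forall x0, exists d : posreal, a <= x0 <= b ->
     forall x, a <= x <= b -> Rabs (x - x0) < d -> Q x d).
  { intros x0. destruct (classic (a <= x0 <= b)) as [A|A].
    - destruct (H x0 A) as (d & Hd & B). exists (mkposreal d Hd). auto.
    - exists (mkposreal 1 Rlt_0_1). intros; contradiction. }
  destruct (compactness_value_1d a b (fun x0 => epsilon (inhabits (mkposreal 1 Rlt_0_1))
     (fun d : posreal => a <= x0 <= b ->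
     forall x, a <= x <= b -> Rabs (x - x0) < d -> Q x d))) as [d Hd].
  exists d; split; [apply cond_pos|]. intros x Hx.
  destruct (NNPP _ (Hd x Hx)) as (t & Ht & H1 & H2).
  pose proof (epsilon_spec (inhabits (mkposreal 1 Rlt_0_1)) _ (H' t) Ht x Hx H1) as E.
  eapply Hmono; [exact E|]. split; [apply cond_pos | exact H2].
Qed.

(** * Integrals of complex-valued functions on an interval *)

Definition rcont (g : R -> C) (x : R) : Prop :=
  forall e, 0 < e -> exists d, 0 < d /\ forall y, Rabs (y - x) < d -> Cmod (g y - g x) < e.

Lemma rcont_continuous (g : R -> C) (x : R) :
  rcont g x -> continuous (T := R_UniformSpace) (U := C_R_NormedModule) g x.
Proof.
  intros H. apply (filterlim_locally (F := locally x) (U := C_R_NormedModule) g (g x)).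
  intros e. destruct (H e (cond_pos e)) as (d & Hd & B).
  exists (mkposreal d Hd). intros y Hy. 
  apply (norm_compat1 (V := C_R_NormedModule)). rewrite norm_C_R. apply B. exact Hy.
Qed.

(** The integral is kept as a relation: an integral is evaluated by exhibiting two values for one
    integrand and applying [CI_unique]. *)
Definition CI (g : R -> C) (a b : R) (v : C) : Prop :=
  is_RInt (V := C_R_NormedModule) g a b v.

Lemma CI_ex (g : R -> C) (a b : R) : a <= b ->
  (forall x, a <= x <= b -> rcont g x) -> exists v, CI g a b v.
Proof.
  intros Hab H. apply (ex_RInt_continuous (V := C_R_CompleteNormedModule)).
  intros x Hx. rewrite Rmin_left, Rmax_right in Hx by auto.
  apply rcont_continuous. auto.
Qed.

Lemma CI_unique (g : R -> C) (a b : R) (v w : C) : CI g a b v -> CI g a b w -> v = w.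
Proof.
  intros H1 H2. apply (is_RInt_unique (V := C_R_CompleteNormedModule)) in H1.
  apply (is_RInt_unique (V := C_R_CompleteNormedModule)) in H2. congruence.
Qed.

Lemma CI_bound (g : R -> C) (a b K : R) (v : C) : a <= b ->
  (forall x, a <= x <= b -> Cmod (g x) <= K) -> CI g a b v -> Cmod v <= K * (b - a).
Proof.
  intros Hab HK Hv. rewrite <- norm_C_R.
  eapply (norm_RInt_le (V := C_R_NormedModule)); [exact Hab| |exact Hv|].
  - intros x Hx. rewrite norm_C_R. apply HK; exact Hx.
  - rewrite Rmult_comm. apply (is_RInt_const (V := R_NormedModule)).
Qed.

Lemma CI_plus (g k : R -> C) (a b : R) (v w : C) :
  CI g a b v -> CI k a b w -> CI (fun x => g x + k x) a b (v + w).
Proof. apply (is_RInt_plus (V := C_R_NormedModule)). Qed.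

Lemma CI_minus (g k : R -> C) (a b : R) (v w : C) :
  CI g a b v -> CI k a b w -> CI (fun x => g x - k x) a b (v - w).
Proof. apply (is_RInt_minus (V := C_R_NormedModule)). Qed.

(** The scalars of the underlying normed module are real, so a complex factor has to be distributed
    over the real and imaginary parts. *)
Lemma CI_scal (c : C) (g : R -> C) (a b : R) (v : C) :
  CI g a b v -> CI (fun x => c * g x) a b (c * v).
Proof.
  intros H.
  assert (H1 := is_RInt_fct_extend_fst (U := R_NormedModule) (V := R_NormedModule) g a b v H).
  assert (H2 := is_RInt_fct_extend_snd (U := R_NormedModule) (V := R_NormedModule) g a b v H).
  apply (is_RInt_fct_extend_pair (U := R_NormedModule) (V := R_NormedModule)); simpl.
  - apply (is_RInt_minus (V := R_NormedModule));
    apply (is_RInt_scal (V := R_NormedModule)); assumption.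
  - apply (is_RInt_plus (V := R_NormedModule));
    apply (is_RInt_scal (V := R_NormedModule)); assumption.
Qed.

Lemma CI_ext (g k : R -> C) (a b : R) (v : C) : a <= b ->
  (forall x, a <= x <= b -> g x = k x) -> CI g a b v -> CI k a b v.
Proof.
  intros Hab E. apply (is_RInt_ext (V := C_R_NormedModule)).
  intros x Hx. rewrite Rmin_left, Rmax_right in Hx by auto. apply E; lra.
Qed.

Lemma CI_derive (g dg : R -> C) (a b : R) : a <= b ->
  (forall x, a <= x <= b -> rdiff g x (dg x)) ->
  (forall x, a <= x <= b -> rcont dg x) -> CI dg a b (g b - g a).
Proof.
  intros Hab H1 H2.
  apply (is_RInt_derive (V := C_R_CompleteNormedModule) g dg a b);
    intros x Hx; rewrite Rmin_left, Rmax_right in Hx by auto.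
  - apply rdiff_is_derive. auto.
  - apply rcont_continuous. auto.
Qed.

Definition within_diff (I : R -> Prop) (g : R -> C) (t : R) (l : C) : Prop :=
  forall e, 0 < e -> exists d, 0 < d /\ forall s, I s -> Rabs (s - t) < d ->
     Cmod (g s - g t - l * RtoC (s - t)) <= e * Rabs (s - t).

(** Differentiation under the integral sign. The difference quotient is only required to converge
    uniformly near each [u0]; [interval_uniform] turns this into uniformity on the whole of
    [[a,b]]. *)
Lemma integral_within_diff (I : R -> Prop) (t a b : R) (g : R -> R -> C) (dg : R -> C)
    (J : R -> C) (dJ : C) :
  a <= b -> I t ->
  (forall e u0, 0 < e -> a <= u0 <= b -> exists d, 0 < d /\ forall u s,
     a <= u <= b -> Rabs (u - u0) < d -> I s -> Rabs (s - t) < d ->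
     Cmod (g s u - g t u - dg u * RtoC (s - t)) <= e * Rabs (s - t)) ->
  (exists d, 0 < d /\ forall s, I s -> Rabs (s - t) < d -> CI (g s) a b (J s)) ->
  CI dg a b dJ ->
  within_diff I J t dJ.
Proof.
  intros Hab It H [d0 [Hd0 HJ]] HdJ e He.
  (* The [+ 1] keeps the quotient defined when [a = b]. *)
  set (e1 := (e / (b - a + 1))%R).
  assert (He1 : 0 < e1) by (apply Rdiv_lt_0_compat; lra).
  destruct (interval_uniform a b (fun u d => forall s, I s -> Rabs (s - t) < d ->
     Cmod (g s u - g t u - dg u * RtoC (s - t)) <= e1 * Rabs (s - t))) as (d & Hd & B).
  - intros x d d' Q Hd' s Is Hs. apply Q; auto. lra.
  - intros u0 Hu0. destruct (H e1 u0 He1 Hu0) as (d & Hd & B). exists d; split; auto.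
  - exists (Rmin d d0). split; [apply Rmin_glb_lt; auto|]. intros s Is Hs.
    Rmin_facts d d0.
    assert (Q : CI (fun u => g s u - g t u - RtoC (s - t) * dg u) a b (J s - J t - RtoC (s - t) * dJ)).
    { apply CI_minus; [apply CI_minus|apply CI_scal; exact HdJ]; apply HJ; auto; [lra|].
      rewrite Rminus_diag, Rabs_R0; auto. }
    rewrite (Cmult_comm dJ).
    apply Rle_trans with (e1 * Rabs (s - t) * (b - a))%R.
    + eapply CI_bound; [exact Hab| |exact Q]. intros x Hx. cbv beta.
      rewrite (Cmult_comm (RtoC (s - t)) (dg x)). apply B; auto; lra.
    + unfold e1. 
      replace (e / (b - a + 1) * Rabs (s - t) * (b - a))%R
        with (e * Rabs (s - t) * ((b - a) / (b - a + 1)))%R by (field; lra).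
      rewrite <- (Rmult_1_r (e * Rabs (s - t))) at 2.
      apply Rmult_le_compat_l; [apply Rmult_le_pos; [lra | apply Rabs_pos]|].
      apply Rle_div_l; lra.
Qed.

Lemma within_diff_rdiff (g : R -> C) (t : R) (l : C) :
  within_diff (fun _ => True) g t l -> rdiff g t l.
Proof. intros H e He. destruct (H e He) as (d & Hd & B). exists d; split; auto. Qed.

Lemma cdiff_unique (F : C -> C) (z l l' : C) : cdiff F z l -> cdiff F z l' -> l = l'.
Proof. intros H H'. apply cdiff_C_derive in H. apply cdiff_C_derive in H'. congruence. Qed.

(** * The complex exponential *)

Lemma Cexp_add (a b : C) : Cexp (a + b) = Cexp a * Cexp b.
Proof.
  unfold Cexp. destruct a as [x y], b as [x' y']. unfold Cmult; simpl.
  rewrite exp_plus, cos_plus, sin_plus. f_equal; ring.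
Qed.

Lemma Cexp_0 : Cexp 0 = 1.
Proof. unfold Cexp; simpl. rewrite exp_0, cos_0, sin_0. unfold RtoC. f_equal; ring. Qed.

Lemma Cmod_Cexp (z : C) : Cmod (Cexp z) = exp (Re z).
Proof.
  unfold Cexp, Cmod; simpl.
  replace (exp (Re z) * cos (Im z) * (exp (Re z) * cos (Im z) * 1) +
    exp (Re z) * sin (Im z) * (exp (Re z) * sin (Im z) * 1))%R
    with (exp (Re z) * exp (Re z) * (Rsqr (sin (Im z)) + Rsqr (cos (Im z))))%R
    by (unfold Rsqr; ring).
  rewrite sin2_cos2, Rmult_1_r. apply sqrt_square. left; apply exp_pos.
Qed.

Lemma Cexp_ne_0 (z : C) : Cexp z <> 0.
Proof. apply Cmod_gt_0. rewrite Cmod_Cexp. apply exp_pos. Qed.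

Lemma real_derive_eps (k : R -> R) (x l : R) : is_derive k x l ->
  forall e, 0 < e -> exists d, 0 < d /\ forall y, Rabs (y - x) < d ->
    Rabs (k y - k x - l * (y - x)) <= e * Rabs (y - x).
Proof.
  intros [_ H] e He. destruct (H x (fun P HP => HP) (mkposreal e He)) as [d Hd].
  exists d; split; [apply cond_pos|]. intros y Hy. rewrite (Rmult_comm l).
  exact (Hd y Hy).
Qed.

Lemma Cmod_le_Re_Im (z : C) : Cmod z <= Rabs (Re z) + Rabs (Im z).
Proof.
  replace z with (RtoC (Re z) + Ci * RtoC (Im z)) at 1
    by (destruct z as [x y]; unfold Ci, RtoC, Cmult, Cplus; simpl; f_equal; ring).
  eapply Rle_trans; [apply Cmod_triangle|]. rewrite Cmod_mult, Cmod_Ci, !Cmod_R. lra.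
Qed.

Lemma Im_le_Cmod (z : C) : Rabs (Im z) <= Cmod z.
Proof. eapply Rle_trans; [apply Rmax_r | apply Rmax_Cmod]. Qed.

Lemma cdiff_Cexp_0 : cdiff Cexp 0 1.
Proof.
  intros e He.
  (* With [m = Cmod w < e1], the real part of the error costs [4 e1 m] and the imaginary part
     [3 e1 m + 2 m^2 <= 5 e1 m]: together 9. *)
  set (e1 := Rmin 1 (e / 9)). assert (He1 : 0 < e1) by (apply Rmin_glb_lt; lra).
  assert (A1 : e1 <= 1) by apply Rmin_l. assert (A2 : e1 <= e / 9) by apply Rmin_r.
  destruct (real_derive_eps exp 0 1) with (e := e1) as (d1 & Hd1 & B1); auto.
  { rewrite <- exp_0. apply is_derive_Reals, derivable_pt_lim_exp. }
  destruct (real_derive_eps sin 0 1) with (e := e1) as (d2 & Hd2 & B2); auto.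
  { rewrite <- cos_0. apply is_derive_Reals, derivable_pt_lim_sin. }
  destruct (real_derive_eps cos 0 0) with (e := e1) as (d3 & Hd3 & B3); auto.
  { replace (is_derive cos 0 0) with (is_derive cos 0 (- sin 0)%R)
      by (f_equal; rewrite sin_0; ring). apply is_derive_Reals, derivable_pt_lim_cos. }
  set (d := Rmin (Rmin d1 d2) (Rmin d3 e1)).
  assert (d <= d1 /\ d <= d2 /\ d <= d3 /\ d <= e1) as (D1 & D2 & D3 & D4).
  { unfold d. Rmin_facts (Rmin d1 d2)%R (Rmin d3 e1)%R.
    Rmin_facts d1 d2.
    Rmin_facts d3 e1. lra. }
  assert (Hd : 0 < d) by (apply Rmin_glb_lt; apply Rmin_glb_lt; assumption).
  exists d. split; [exact Hd|]. intros w Hw.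
  rewrite Cexp_0. replace (w - 0) with w in * by ring. rewrite Cmult_1_l.
  assert (Hx : Rabs (Re w) <= Cmod w) by apply re_le_Cmod.
  assert (Hy : Rabs (Im w) <= Cmod w) by apply Im_le_Cmod.
  set (x := Re w) in *. set (y := Im w) in *.
  specialize (B1 x ltac:(rewrite Rminus_0_r; lra)).
  specialize (B2 y ltac:(rewrite Rminus_0_r; lra)).
  specialize (B3 y ltac:(rewrite Rminus_0_r; lra)).
  rewrite exp_0 in B1. rewrite sin_0 in B2. rewrite cos_0 in B3.
  rewrite !Rminus_0_r in B1, B2, B3.
  rewrite Rmult_1_l, (Rminus_0_r y) in B2.
  replace (cos y - 1 - 0 * y)%R with (cos y - 1)%R in B3 by ring.
  set (p := exp x) in *. set (m := Cmod w) in *.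
  assert (Hm : 0 <= m) by apply Cmod_ge_0.
  assert (Q1 : Rabs (p - 1 - 1 * x) <= e1 * m)
    by (eapply Rle_trans; [apply B1| apply Rmult_le_compat_l; lra]).
  assert (Q2 : Rabs (sin y - y) <= e1 * m)
    by (eapply Rle_trans; [apply B2| apply Rmult_le_compat_l; lra]).
  assert (Q3 : Rabs (cos y - 1) <= e1 * m)
    by (eapply Rle_trans; [apply B3| apply Rmult_le_compat_l; lra]).
  assert (Q5 : e1 * m <= m) by (rewrite <- (Rmult_1_l m) at 2; apply Rmult_le_compat_r; auto).
  assert (Q4 : Rabs (p - 1) <= 2 * m).
  { replace (p - 1)%R with ((p - 1 - 1 * x) + x)%R by ring.
    eapply Rle_trans; [apply Rabs_triang|]. lra. }
  assert (Q6 : Rabs p <= 3).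
  { replace p with ((p - 1) + 1)%R by ring. eapply Rle_trans; [apply Rabs_triang|].
    rewrite (Rabs_pos_eq 1) by lra. lra. }
  replace (Cexp w - 1 - w) with
    ((p - 1 - 1 * x + p * (cos y - 1))%R, (p * (sin y - y) + y * (p - 1))%R)
    by (unfold Cexp; destruct w; unfold RtoC, Cminus, Cplus, Copp; simpl in *; unfold p, x, y; f_equal; ring).
  eapply Rle_trans; [apply Cmod_le_Re_Im|]. cbn [Re Im fst snd].
  assert (Rabs (p - 1 - 1 * x + p * (cos y - 1)) <= e1 * m + 3 * (e1 * m)).
  { eapply Rle_trans; [apply Rabs_triang|]. rewrite Rabs_mult.
    apply Rplus_le_compat; auto. apply Rmult_le_compat; auto using Rabs_pos. }
  assert (Rabs (p * (sin y - y) + y * (p - 1)) <= 3 * (e1 * m) + m * (2 * m)).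
  { eapply Rle_trans; [apply Rabs_triang|]. rewrite !Rabs_mult.
    apply Rplus_le_compat; apply Rmult_le_compat; auto using Rabs_pos. }
  assert (m * m <= e1 * m) by (apply Rmult_le_compat_r; lra).
  assert (e1 * m <= e / 9 * m) by (apply Rmult_le_compat_r; lra).
  assert (0 <= e * m) by (apply Rmult_le_pos; lra). 
  lra.
Qed.

Lemma linear_small (K e : R) : 0 <= K -> 0 < e -> exists d, 0 < d /\
  forall x, 0 <= x < d -> K * x < e.
Proof.
  intros HK He. exists (e / (K + 1))%R. split; [apply Rdiv_lt_0_compat; lra|].
  intros x [H1 H2]. apply Rle_lt_trans with (K * (e / (K + 1)))%R.
  - apply Rmult_le_compat_l; lra.
  - replace (K * (e / (K + 1)))%R with (e * (K / (K + 1)))%R by (field; lra).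
    rewrite <- (Rmult_1_r e) at 2. apply Rmult_lt_compat_l; auto.
    apply Rlt_div_l; lra.
Qed.

(** * Differentiation rules for functions of the parameter *)

Section WithinRules.
Variables (I : R -> Prop) (t : R).

Definition within_filter (P : R -> Prop) : Prop :=
  exists d, 0 < d /\ forall s, I s -> Rabs (s - t) < d -> P s.

Global Instance within_filter_filter : Filter within_filter.
Proof.
  split.
  - exists 1%R; split; [lra | auto].
  - intros P Q (d & Hd & HP) (d' & Hd' & HQ). exists (Rmin d d'). split; [apply Rmin_glb_lt; auto|].
    intros s Is Hs. Rmin_facts d d'.
    split; [apply HP | apply HQ]; auto; lra.
  - intros P Q HPQ (d & Hd & HP). exists d; split; auto.
Qed.

Lemma within_diff_cont (g : R -> C) (l : C) : within_diff I g t l ->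
  forall e, 0 < e -> exists d, 0 < d /\ forall s, I s -> Rabs (s - t) < d -> Cmod (g s - g t) < e.
Proof.
  intros H e He. destruct (H 1%R ltac:(lra)) as (d & Hd & B).
  destruct (linear_small (1 + Cmod l) e) as (d' & Hd' & B'); auto.
  { pose proof (Cmod_ge_0 l); lra. }
  exists (Rmin d d'). split; [apply Rmin_glb_lt; auto|].
  intros s Is Hs. Rmin_facts d d'.
  specialize (B s Is ltac:(lra)). specialize (B' (Rabs (s - t)) ltac:(split; [apply Rabs_pos | lra])).
  pose proof (Cmod_le_add_sub (g s - g t) (l * RtoC (s - t))) as Q.
  rewrite Cmod_mult, Cmod_R in Q. lra.
Qed.

Lemma within_diff_sd (g : R -> C) (l : C) :
  within_diff I g t l <->
  sd within_filter (fun s => Rabs (s - t)) g (fun _ => g t) (g t) (fun s => l * RtoC (s - t)).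
Proof.
  split.
  - intros H. split.
    + exists (Cmod l). split; [apply Cmod_ge_0|]. exists 1%R; split; [lra|]. intros s _ _.
      rewrite Cmod_mult, Cmod_R. lra.
    + exact H.
    + intros e He. apply (within_diff_cont g l H e He).
    + intros e He. exists 1%R; split; [lra|]. intros. rewrite Cmod_self; auto.
  - intros H. exact (sd_est _ _ _ _ _ _ H).
Qed.

Lemma within_diff_ext (g k : R -> C) (l l' : C) :
  (forall s, g s = k s) -> l = l' -> within_diff I g t l -> within_diff I k t l'.
Proof.
  intros E <- H e He. destruct (H e He) as (d & Hd & B). exists d; split; auto.
  intros s Is Hs. rewrite <- !E. auto.
Qed.

Lemma within_diff_comp2 (F : C -> C -> C) (g k : R -> C) (l1 l2 a b : C) :
  strict2 F (g t) (k t) l1 l2 -> within_diff I g t a -> within_diff I k t b ->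
  within_diff I (fun s => F (g s) (k s)) t (l1 * a + l2 * b).
Proof.
  intros HF Hg Hk. apply within_diff_sd in Hg. apply within_diff_sd in Hk.
  apply within_diff_sd.
  eapply sd_ext; [apply within_filter_filter | | | | | 
    apply (sd_comp2 _ _ F l1 l2 _ _ _ _ _ _ _ _ HF Hg Hk)]; try reflexivity.
  intros s; cbv beta; ring.
Qed.

Lemma within_diff_const (c : C) : within_diff I (fun _ => c) t 0.
Proof.
  intros e He. exists 1%R; split; [lra|]. intros s _ _.
  replace (c - c - 0 * RtoC (s - t)) with (RtoC 0) by ring. rewrite Cmod_0.
  apply Rmult_le_pos; [lra | apply Rabs_pos].
Qed.

Lemma within_diff_id : within_diff I (fun s => RtoC s) t 1.
Proof.
  intros e He. exists 1%R; split; [lra|]. intros s _ _.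
  replace (RtoC s - RtoC t - 1 * RtoC (s - t)) with (RtoC 0) by (rewrite RtoC_minus; ring).
  rewrite Cmod_0. apply Rmult_le_pos; [lra | apply Rabs_pos].
Qed.

Lemma within_diff_comp (F : C -> C) (g : R -> C) (l a : C) :
  sdiff F (g t) l -> within_diff I g t a -> within_diff I (fun s => F (g s)) t (l * a).
Proof.
  intros HF Hg.
  eapply within_diff_ext; [| |apply (within_diff_comp2 (fun x _ => F x) g (fun _ => 0) l 0 a 0);
    [apply strict2_fst; exact HF | exact Hg | apply within_diff_const]]; [reflexivity | ring].
Qed.

Lemma within_diff_plus (g k : R -> C) (a b : C) :
  within_diff I g t a -> within_diff I k t b -> within_diff I (fun s => g s + k s) t (a + b).
Proof.
  intros Hg Hk. eapply within_diff_ext;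
    [| |apply (within_diff_comp2 Cplus g k 1 1 a b (strict2_plus _ _) Hg Hk)]; [reflexivity | ring].
Qed.

Lemma within_diff_mult (g k : R -> C) (a b : C) :
  within_diff I g t a -> within_diff I k t b ->
  within_diff I (fun s => g s * k s) t (a * k t + g t * b).
Proof.
  intros Hg Hk. eapply within_diff_ext;
    [| |apply (within_diff_comp2 Cmult g k _ _ a b (strict2_mult _ _) Hg Hk)]; [reflexivity | ring].
Qed.

Lemma within_diff_scal (c : C) (g : R -> C) (a : C) :
  within_diff I g t a -> within_diff I (fun s => c * g s) t (c * a).
Proof.
  intros Hg. eapply within_diff_ext;
    [| |apply (within_diff_mult (fun _ => c) g 0 a (within_diff_const c) Hg)]; [reflexivity | ring].
Qed.

End WithinRules.

Lemma rdiff_within (g : R -> C) (t : R) (l : C) :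
  rdiff g t l <-> within_diff (fun _ => True) g t l.
Proof.
  split; [|apply within_diff_rdiff]. intros H e He. destruct (H e He) as (d & Hd & B).
  exists d; split; auto.
Qed.

Lemma rdiff_ext (g k : R -> C) (t : R) (l l' : C) :
  (forall s, g s = k s) -> l = l' -> rdiff g t l -> rdiff k t l'.
Proof. rewrite !rdiff_within. apply within_diff_ext. Qed.

Lemma rdiff_mult (g k : R -> C) (t : R) (a b : C) :
  rdiff g t a -> rdiff k t b -> rdiff (fun s => g s * k s) t (a * k t + g t * b).
Proof. rewrite !rdiff_within. apply within_diff_mult. Qed.

Lemma rdiff_plus (g k : R -> C) (t : R) (a b : C) :
  rdiff g t a -> rdiff k t b -> rdiff (fun s => g s + k s) t (a + b).
Proof. rewrite !rdiff_within. apply within_diff_plus. Qed.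

Lemma rdiff_const (c : C) (t : R) : rdiff (fun _ => c) t 0.
Proof. rewrite rdiff_within. apply within_diff_const. Qed.

Lemma rdiff_id (t : R) : rdiff (fun s => RtoC s) t 1.
Proof. rewrite rdiff_within. apply within_diff_id. Qed.

Lemma rdiff_scal (c : C) (g : R -> C) (t : R) (a : C) :
  rdiff g t a -> rdiff (fun s => c * g s) t (c * a).
Proof. rewrite !rdiff_within. apply within_diff_scal. Qed.

Lemma rdiff_comp (F : C -> C) (g : R -> C) (t : R) (l a : C) :
  sdiff F (g t) l -> rdiff g t a -> rdiff (fun s => F (g s)) t (l * a).
Proof. rewrite !rdiff_within. apply within_diff_comp. Qed.

Lemma rdiff_rcont (g : R -> C) (t : R) (l : C) : rdiff g t l -> rcont g t.
Proof.
  rewrite rdiff_within. intros H e He.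
  destruct (within_diff_cont _ _ _ _ H e He) as (d & Hd & B). exists d; split; auto.
Qed.

(** * Rules for the strict complex derivative *)

Definition pair_filter (z0 : C) (P : C * C -> Prop) : Prop :=
  exists d, 0 < d /\ forall z z', Cmod (z - z0) < d -> Cmod (z' - z0) < d -> P (z, z').

Global Instance pair_filter_filter (z0 : C) : Filter (pair_filter z0).
Proof.
  split.
  - exists 1%R; split; [lra | auto].
  - intros P Q (d & Hd & HP) (d' & Hd' & HQ). exists (Rmin d d'). split; [apply Rmin_glb_lt; auto|].
    intros z z' Hz Hz'. Rmin_facts d d'.
    split; [apply HP | apply HQ]; auto; lra.
  - intros P Q HPQ (d & Hd & HP). exists d; split; auto.
Qed.

Lemma cdiff_cont (F : C -> C) (z0 l : C) : cdiff F z0 l ->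
  forall e, 0 < e -> exists d, 0 < d /\ forall z, Cmod (z - z0) < d -> Cmod (F z - F z0) < e.
Proof.
  intros H e He. destruct (H 1%R ltac:(lra)) as (d & Hd & B).
  destruct (linear_small (1 + Cmod l) e) as (d' & Hd' & B'); auto.
  { pose proof (Cmod_ge_0 l); lra. }
  exists (Rmin d d'). split; [apply Rmin_glb_lt; auto|].
  intros s Hs. Rmin_facts d d'.
  specialize (B s ltac:(lra)). specialize (B' (Cmod (s - z0)) ltac:(split; [apply Cmod_ge_0 | lra])).
  pose proof (Cmod_le_add_sub (F s - F z0) (l * (s - z0))) as Q.
  rewrite Cmod_mult in Q. lra.
Qed.

Lemma sdiff_cont (F : C -> C) (z0 l : C) : sdiff F z0 l ->
  forall e, 0 < e -> exists d, 0 < d /\ forall z, Cmod (z - z0) < d -> Cmod (F z - F z0) < e.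
Proof. intros H. apply (cdiff_cont F z0 l). now apply sdiff_cdiff. Qed.

Lemma sdiff_sd (F : C -> C) (z0 l : C) :
  sdiff F z0 l <->
  sd (pair_filter z0) (fun p => Cmod (fst p - snd p)) (fun p => F (fst p)) (fun p => F (snd p)) (F z0)
    (fun p => l * (fst p - snd p)).
Proof.
  split.
  - intros H. split.
    + exists (Cmod l). split; [apply Cmod_ge_0|]. exists 1%R; split; [lra|]. intros z z' _ _.
      simpl. rewrite Cmod_mult. lra.
    + exact H.
    + intros e He. destruct (sdiff_cont F z0 l H e He) as (d & Hd & B).
      exists d; split; auto.
    + intros e He. destruct (sdiff_cont F z0 l H e He) as (d & Hd & B).
      exists d; split; auto.
  - intros H. exact (sd_est _ _ _ _ _ _ H).
Qed.

Lemma sdiff_ext_loc (F G : C -> C) (z0 l : C) (d : R) : 0 < d ->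
  (forall z, Cmod (z - z0) < d -> F z = G z) -> sdiff F z0 l -> sdiff G z0 l.
Proof.
  intros Hd E H e He. destruct (H e He) as (d' & Hd' & B).
  exists (Rmin d d'). split; [apply Rmin_glb_lt; auto|].
  intros z z' Hz Hz'. Rmin_facts d d'.
  rewrite <- !E by lra. apply B; lra.
Qed.

Lemma sdiff_ext (F G : C -> C) (z0 l l' : C) :
  (forall z, F z = G z) -> l = l' -> sdiff F z0 l -> sdiff G z0 l'.
Proof. intros E <-. apply (sdiff_ext_loc F G z0 l 1 ltac:(lra)). auto. Qed.

Lemma sdiff_comp2 (F : C -> C -> C) (g k : C -> C) (z0 l1 l2 a b : C) :
  strict2 F (g z0) (k z0) l1 l2 -> sdiff g z0 a -> sdiff k z0 b ->
  sdiff (fun z => F (g z) (k z)) z0 (l1 * a + l2 * b).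
Proof.
  intros HF Hg Hk. apply sdiff_sd in Hg. apply sdiff_sd in Hk.
  apply sdiff_sd.
  eapply sd_ext; [apply pair_filter_filter | | | | | 
    apply (sd_comp2 _ _ F l1 l2 _ _ _ _ _ _ _ _ HF Hg Hk)]; try reflexivity.
  intros s; cbv beta; ring.
Qed.

Lemma sdiff_const (c z0 : C) : sdiff (fun _ => c) z0 0.
Proof.
  intros e He. exists 1%R; split; [lra|]. intros z z' _ _.
  replace (c - c - 0 * (z - z')) with (RtoC 0) by ring. rewrite Cmod_0.
  apply Rmult_le_pos; [lra | apply Cmod_ge_0].
Qed.

Lemma sdiff_id (z0 : C) : sdiff (fun z => z) z0 1.
Proof.
  intros e He. exists 1%R; split; [lra|]. intros z z' _ _.
  replace (z - z' - 1 * (z - z')) with (RtoC 0) by ring. rewrite Cmod_0.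
  apply Rmult_le_pos; [lra | apply Cmod_ge_0].
Qed.

Lemma sdiff_plus (g k : C -> C) (z0 a b : C) :
  sdiff g z0 a -> sdiff k z0 b -> sdiff (fun s => g s + k s) z0 (a + b).
Proof.
  intros Hg Hk. eapply sdiff_ext;
    [| |apply (sdiff_comp2 Cplus g k z0 1 1 a b (strict2_plus _ _) Hg Hk)]; [reflexivity | ring].
Qed.

Lemma sdiff_mult (g k : C -> C) (z0 a b : C) :
  sdiff g z0 a -> sdiff k z0 b -> sdiff (fun s => g s * k s) z0 (a * k z0 + g z0 * b).
Proof.
  intros Hg Hk. eapply sdiff_ext;
    [| |apply (sdiff_comp2 Cmult g k z0 _ _ a b (strict2_mult _ _) Hg Hk)]; [reflexivity | ring].
Qed.

Lemma sdiff_scal (c : C) (g : C -> C) (z0 a : C) :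
  sdiff g z0 a -> sdiff (fun s => c * g s) z0 (c * a).
Proof.
  intros Hg. eapply sdiff_ext;
    [| |apply (sdiff_mult (fun _ => c) g z0 0 a (sdiff_const c z0) Hg)]; [reflexivity | ring].
Qed.

Lemma sdiff_minus (g k : C -> C) (z0 a b : C) :
  sdiff g z0 a -> sdiff k z0 b -> sdiff (fun s => g s - k s) z0 (a - b).
Proof.
  intros Hg Hk. eapply sdiff_ext;
    [| |apply (sdiff_plus g (fun z => - (1) * k z) z0 a (- (1) * b) Hg (sdiff_scal _ _ _ _ Hk))].
  - intros z; simpl. ring.
  - ring.
Qed.

Lemma sdiff_comp (F : C -> C) (g : C -> C) (z0 l a : C) :
  sdiff F (g z0) l -> sdiff g z0 a -> sdiff (fun s => F (g s)) z0 (l * a).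
Proof.
  intros HF Hg.
  eapply sdiff_ext; [| |apply (sdiff_comp2 (fun x _ => F x) g (fun _ => 0) z0 l 0 a 0);
    [apply strict2_fst; exact HF | exact Hg | apply sdiff_const]]; [reflexivity | ring].
Qed.

Lemma sdiff_translate (F : C -> C) (z0 w l : C) :
  sdiff F (z0 + w) l -> sdiff (fun z => F (z + w)) z0 l.
Proof.
  intros H. eapply sdiff_ext; [| |apply (sdiff_comp F (fun z => z + w) z0 l (1 + 0) H);
    apply sdiff_plus; [apply sdiff_id | apply sdiff_const]]; [reflexivity | ring].
Qed.

(** By the functional equation the increment between two moving points is
    [Cexp z' (Cexp (z - z') - 1)], so the derivative at 0 suffices, with the continuity of [Cexp] to
    replace the factor [Cexp z'] by [Cexp z0]. *)
Lemma sdiff_Cexp (z0 : C) : sdiff Cexp z0 (Cexp z0).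
Proof.
  assert (Hc := cdiff_cont _ _ _ cdiff_Cexp_0).
  intros e He. set (A := (1 + Cmod (Cexp z0))%R).
  assert (HA : 1 <= A) by (unfold A; pose proof (Cmod_ge_0 (Cexp z0)); lra).
  (* The two terms of the decomposition below cost [2 A e1] and [A e1], since [2 A] bounds [Cexp z']
     and [A] bounds [Cexp z0]. *)
  set (e1 := Rmin 1 (e / (3 * A))).
  assert (He1 : 0 < e1) by (apply Rmin_glb_lt; [lra | apply Rdiv_lt_0_compat; lra]).
  assert (E1 : e1 <= 1) by apply Rmin_l. assert (E2 : e1 * (3 * A) <= e).
  { apply Rle_div_r; [lra | apply Rmin_r]. }
  destruct (Hc e1 He1) as (d1 & Hd1 & B1).
  destruct (cdiff_Cexp_0 e1 He1) as (d2 & Hd2 & B2).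
  exists (Rmin d1 (d2 / 2)). split; [apply Rmin_glb_lt; lra|]. intros z z' Hz Hz'.
  Rmin_facts d1 (d2 / 2)%R.
  assert (Q1 : Cmod (Cexp (z' - z0) - 1) <= e1).
  { left. rewrite <- Cexp_0. apply B1. replace (z' - z0 - 0) with (z' - z0) by ring. lra. }
  assert (Q2 : Cmod (Cexp (z - z') - 1 - (z - z')) <= e1 * Cmod (z - z')).
  { specialize (B2 (z - z')). rewrite Cexp_0 in B2.
    replace (z - z' - 0) with (z - z') in B2 by ring. rewrite Cmult_1_l in B2. apply B2.
    pose proof (Cmod_triangle_sub z z0 z'). rewrite (Cmod_minus_sym z0) in H1. lra. }
  assert (E : Cexp z' = Cexp z0 * Cexp (z' - z0)) by (rewrite <- Cexp_add; f_equal; ring).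
  assert (E' : Cexp z = Cexp z' * Cexp (z - z')) by (rewrite <- Cexp_add; f_equal; ring).
  rewrite E'.
  replace (Cexp z' * Cexp (z - z') - Cexp z' - Cexp z0 * (z - z'))
    with (Cexp z' * (Cexp (z - z') - 1 - (z - z')) + Cexp z0 * (Cexp (z' - z0) - 1) * (z - z'))
    by (rewrite E; ring).
  set (m := Cmod (z - z')) in *. assert (0 <= m) by apply Cmod_ge_0.
  assert (Q3 : Cmod (Cexp z') <= A * 2).
  { rewrite E. apply Cmod_mult_le; [unfold A; lra|].
    replace (Cexp (z' - z0)) with (1 + (Cexp (z' - z0) - 1)) by ring.
    eapply Rle_trans; [apply Cmod_triangle|]. rewrite Cmod_1. lra. }
  apply Rle_trans with (A * 2 * (e1 * m) + A * e1 * m)%R.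
  - apply Cmod_add_le; [apply Cmod_mult_le; auto|].
    apply Cmod_mult_le; [apply Cmod_mult_le; auto; unfold A; lra | unfold m; lra].
  - replace (A * 2 * (e1 * m) + A * e1 * m)%R with (e1 * (3 * A) * m)%R by ring.
    apply Rmult_le_compat_r; auto.
Qed.

(** At [z] the slopes [l'] and [l] both describe the increment of [F] over the same small real step
    [r], one by definition and the other by strictness at [z0]; comparing them bounds [l' - l]. This
    is how a strict derivative is continuous. *)
Lemma strict_deriv_near (F : C -> C) (z0 l : C) : sdiff F z0 l ->
  forall e, 0 < e -> exists d, 0 < d /\ forall z l', Cmod (z - z0) < d -> cdiff F z l' ->
   Cmod (l' - l) <= e.
Proof.
  intros H e He. destruct (H (e / 2)%R ltac:(lra)) as (d & Hd & B).
  exists d; split; auto. intros z l' Hz Hl.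
  destruct (Hl (e / 2)%R ltac:(lra)) as (d' & Hd' & B').
  set (r := (Rmin d' (d - Cmod (z - z0)) / 2)%R).
  assert (Hm : 0 < Rmin d' (d - Cmod (z - z0))) by (apply Rmin_glb_lt; lra).
  Rmin_facts d' (d - Cmod (z - z0))%R.
  assert (Er : Cmod (z + RtoC r - z) = r).
  { replace (z + RtoC r - z) with (RtoC r) by ring. rewrite Cmod_R. apply Rabs_pos_eq. unfold r; lra. }
  assert (Hr : 0 < r) by (unfold r; lra).
  specialize (B (z + RtoC r) z). specialize (B' (z + RtoC r)).
  rewrite Er in B, B'.
  assert (Hzr : Cmod (z + RtoC r - z0) < d).
  { pose proof (Cmod_triangle_sub (z + RtoC r) z z0) as Q. rewrite Er in Q. unfold r in *; lra. }
  specialize (B Hzr Hz). specialize (B' ltac:(unfold r; lra)).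
  apply Rmult_le_reg_r with r; auto.
  rewrite <- Er at 1. rewrite <- Cmod_mult.
  replace ((l' - l) * (z + RtoC r - z)) with
    ((F (z + RtoC r) - F z - l * (z + RtoC r - z)) - (F (z + RtoC r) - F z - l' * (z + RtoC r - z))) by ring.
  eapply Rle_trans; [apply Cmod_minus_le|]. lra.
Qed.

Lemma seg_point_near (z0 a b : C) (d s : R) : 0 <= s <= 1 ->
  Cmod (a - z0) < d -> Cmod (b - z0) < d -> Cmod (a + RtoC s * (b - a) - z0) < d.
Proof.
  intros Hs Ha Hb.
  replace (a + RtoC s * (b - a) - z0) with (RtoC (1 - s) * (a - z0) + RtoC s * (b - z0))
    by (rewrite RtoC_minus; ring).
  eapply Rle_lt_trans; [apply Cmod_triangle|]. rewrite !Cmod_mult, !Cmod_R, !Rabs_pos_eq by lra.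
  destruct (Req_dec s 0) as [->|]; [lra|].
  assert ((1 - s) * Cmod (a - z0) <= (1 - s) * d) by (apply Rmult_le_compat_l; lra).
  assert (s * Cmod (b - z0) < s * d) by (apply Rmult_lt_compat_l; lra). lra.
Qed.

(** The ordinary derivative of [F] is enough here, because along a curve one of the two points stays
    fixed. Mean value estimates thus become available before strict differentiability is known. *)
Lemma rdiff_cdiff_comp (F : C -> C) (g : R -> C) (t : R) (l a : C) :
  cdiff F (g t) l -> rdiff g t a -> rdiff (fun s => F (g s)) t (l * a).
Proof.
  intros HF Hg e He. set (K := (1 + Cmod a + Cmod l)%R).
  assert (HK : 0 < K) by (unfold K; pose proof (Cmod_ge_0 a); pose proof (Cmod_ge_0 l); lra).
  destruct (HF (e / (2 * K))%R) as (d & Hd & B); [apply Rdiv_lt_0_compat; lra|].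
  destruct (rdiff_rcont _ _ _ Hg d Hd) as (d1 & Hd1 & B1).
  set (e2 := Rmin 1 (e / (2 * K))).
  assert (He2 : 0 < e2) by (apply Rmin_glb_lt; [lra| apply Rdiv_lt_0_compat; lra]).
  destruct (Hg e2 He2) as (d2 & Hd2 & B2).
  assert (E1 : e2 <= 1) by apply Rmin_l. assert (E2 : e2 <= e / (2 * K)) by apply Rmin_r.
  exists (Rmin d1 d2). split; [apply Rmin_glb_lt; auto|]. intros s Hs.
  Rmin_facts d1 d2.
  specialize (B1 s ltac:(lra)). specialize (B2 s ltac:(lra)). specialize (B _ B1).
  set (m := Rabs (s - t)) in *. assert (0 <= m) by apply Rabs_pos.
  assert (e2 * m <= 1 * m) by (apply Rmult_le_compat_r; auto).
  assert (Q : Cmod (g s - g t) <= (1 + Cmod a) * m).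
  { pose proof (Cmod_le_add_sub (g s - g t) (a * RtoC (s - t))) as T.
    rewrite Cmod_mult, Cmod_R in T. fold m in T. lra. }
  replace (F (g s) - F (g t) - l * a * RtoC (s - t))
    with ((F (g s) - F (g t) - l * (g s - g t)) + l * (g s - g t - a * RtoC (s - t))) by ring.
  apply Rle_trans with (e / (2 * K) * ((1 + Cmod a) * m) + Cmod l * (e / (2 * K) * m))%R.
  - apply Cmod_add_le.
    + eapply Rle_trans; [apply B|]. apply Rmult_le_compat_l; auto.
      left; apply Rdiv_lt_0_compat; lra.
    + apply Cmod_mult_le; [lra|]. eapply Rle_trans; [apply B2|].
      apply Rmult_le_compat_r; auto.
  - replace (e / (2 * K) * ((1 + Cmod a) * m) + Cmod l * (e / (2 * K) * m))%R
      with (e / (2 * K) * m * K)%R by (unfold K; ring).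
    replace (e / (2 * K) * m * K)%R with (e * m / 2)%R by (field; lra).
    assert (0 <= e * m) by (apply Rmult_le_pos; lra). lra.
Qed.

Lemma rdiff_segment (a b : C) (s : R) : rdiff (fun s => a + RtoC s * (b - a)) s (b - a).
Proof.
  eapply rdiff_ext; [| |apply (rdiff_plus (fun _ => a) (fun s => (b - a) * RtoC s) s 0 ((b - a) * 1))].
  - intros x; simpl; ring.
  - ring.
  - apply rdiff_const.
  - apply rdiff_scal, rdiff_id.
Qed.

Lemma segment_mean_value (F dF : C -> C) (a b : C) (K : R) :
  (forall s, 0 <= s <= 1 -> cdiff F (a + RtoC s * (b - a)) (dF (a + RtoC s * (b - a)))) ->
  (forall s, 0 <= s <= 1 -> Cmod (dF (a + RtoC s * (b - a))) <= K) ->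
  Cmod (F b - F a) <= K * Cmod (b - a).
Proof.
  intros H HK.
  assert (Q := mean_value_ineq (fun s => F (a + RtoC s * (b - a)))
    (fun s => dF (a + RtoC s * (b - a)) * (b - a)) (fun s => K * Cmod (b - a) * s)%R
    (fun _ => K * Cmod (b - a))%R 0 1 ltac:(lra)).
  simpl in Q.
  replace (a + 1 * (b - a)) with b in Q by ring.
  replace (a + 0 * (b - a)) with a in Q by ring.
  rewrite Rmult_1_r, Rmult_0_r, Rminus_0_r in Q. apply Q.
  - intros x Hx. apply (rdiff_cdiff_comp F (fun s => a + RtoC s * (b - a)) x); auto.
    apply rdiff_segment.
  - intros x Hx.
    assert (D := is_derive_scal (fun s => s) x (K * Cmod (b - a)) 1%R (is_derive_id (K := R_AbsRing) x)).
    rewrite Rmult_1_r in D. exact D.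
  - intros x Hx. apply Cmod_mult_le; [auto | lra].
Qed.

Lemma ball_mean_value (F dF : C -> C) (z0 : C) (d K : R) :
  (forall z, Cmod (z - z0) < d -> cdiff F z (dF z)) ->
  (forall z, Cmod (z - z0) < d -> Cmod (dF z) <= K) ->
  forall z z', Cmod (z - z0) < d -> Cmod (z' - z0) < d -> Cmod (F z - F z') <= K * Cmod (z - z').
Proof.
  intros H HK z z' Hz Hz'. apply (segment_mean_value F dF z' z K); intros s Hs.
  - apply H, seg_point_near; auto.
  - apply HK, seg_point_near; auto.
Qed.

Lemma cdiff_minus_linear (F : C -> C) (z l c : C) :
  cdiff F z l -> cdiff (fun w => F w - c * w) z (l - c).
Proof.
  intros H e He. destruct (H e He) as (d & Hd & B). exists d; split; auto.
  intros w Hw. replace (F w - c * w - (F z - c * z) - (l - c) * (w - z))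
    with (F w - F z - l * (w - z)) by ring. auto.
Qed.

(** The mean value inequality for [F w - dF z0 * w], whose derivative is small near [z0]; a converse
    to [strict_deriv_near]. *)
Lemma sdiff_of_C1 (F dF : C -> C) (z0 : C) (d : R) : 0 < d ->
  (forall z, Cmod (z - z0) < d -> cdiff F z (dF z)) ->
  (forall e, 0 < e -> exists d, 0 < d /\ forall z, Cmod (z - z0) < d -> Cmod (dF z - dF z0) <= e) ->
  sdiff F z0 (dF z0).
Proof.
  intros Hd H Hc e He. destruct (Hc e He) as (d' & Hd' & B).
  exists (Rmin d d'). split; [apply Rmin_glb_lt; auto|]. intros z z' Hz Hz'.
  Rmin_facts d d'.
  assert (Q := ball_mean_value (fun w => F w - dF z0 * w) (fun w => dF w - dF z0) z0 (Rmin d d') e).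
  replace (F z - F z' - dF z0 * (z - z')) with (F z - dF z0 * z - (F z' - dF z0 * z')) by ring.
  apply Q; auto; intros w Hw.
  - apply cdiff_minus_linear. apply H; lra.
  - apply B; lra.
Qed.

(** * Cauchy's estimate *)

Lemma rdiff_Cexp_linear (c : C) (x : R) :
  rdiff (fun u => Cexp (c * RtoC u)) x (c * Cexp (c * RtoC x)).
Proof.
  eapply rdiff_ext; [reflexivity | |
    apply (rdiff_comp Cexp (fun u => c * RtoC u) x (Cexp (c * RtoC x)) (c * 1));
    [apply sdiff_Cexp | apply rdiff_scal, rdiff_id]]. ring.
Qed.

Lemma Ci_sqr : Ci * Ci = - (1).
Proof. unfold Ci, Cmult, Copp, RtoC; simpl. f_equal; ring. Qed.

Lemma Cmod_expi (s u : R) : Cmod (Cexp (RtoC s * Ci * RtoC u)) = 1%R.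
Proof.
  rewrite Cmod_Cexp. replace (Re (RtoC s * Ci * RtoC u)) with 0%R; [apply exp_0|].
  unfold Ci, RtoC, Cmult; simpl; ring.
Qed.

Definition cis (u : R) : C := Cexp (Ci * RtoC u).
Definition cis' (u : R) : C := Cexp (- Ci * RtoC u).

Lemma Cmod_cis (u : R) : Cmod (cis u) = 1%R.
Proof.
  unfold cis. rewrite <- (Cmod_expi 1 u). do 2 f_equal. ring.
Qed.

Lemma Cmod_cis' (u : R) : Cmod (cis' u) = 1%R.
Proof.
  unfold cis'. rewrite <- (Cmod_expi (- (1)) u). do 2 f_equal. rewrite RtoC_opp. ring.
Qed.

Lemma cis_cis' (u : R) : cis u * cis' u = 1.
Proof. unfold cis, cis'. rewrite <- Cexp_add, <- Cexp_0. f_equal; ring. Qed.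

Lemma cis_val (u : R) : cis u = (cos u, sin u).
Proof.
  unfold cis, Cexp. replace (Re (Ci * RtoC u)) with 0%R by (unfold Ci, RtoC, Cmult; simpl; ring).
  replace (Im (Ci * RtoC u)) with u by (unfold Ci, RtoC, Cmult; simpl; ring).
  rewrite exp_0, !Rmult_1_l. reflexivity.
Qed.

Lemma cis_2PI : cis (2 * PI) = cis 0.
Proof. now rewrite !cis_val, cos_2PI, sin_2PI, cos_0, sin_0. Qed.

Lemma cis'_2PI : cis' (2 * PI) = cis' 0.
Proof.
  assert (E : forall u, cis' u = / cis u).
  { intros u. assert (cis u <> 0) by apply Cexp_ne_0.
    replace (/ cis u) with (cis u * cis' u * / cis u) by (rewrite cis_cis'; ring).
    field; auto. }
  now rewrite !E, cis_2PI.
Qed.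

Lemma rdiff_cis (x : R) : rdiff cis x (Ci * cis x).
Proof. apply rdiff_Cexp_linear. Qed.

Lemma rdiff_cis' (x : R) : rdiff cis' x (- Ci * cis' x).
Proof. apply rdiff_Cexp_linear. Qed.

Lemma rcont_mult (g k : R -> C) (x : R) : rcont g x -> rcont k x -> rcont (fun u => g u * k u) x.
Proof.
  intros Hg Hk e He.
  set (A := (1 + Cmod (g x) + Cmod (k x))%R).
  assert (HA : 1 <= A) by (unfold A; pose proof (Cmod_ge_0 (g x)); pose proof (Cmod_ge_0 (k x)); lra).
  set (e1 := Rmin 1 (e / (3 * A))).
  assert (He1 : 0 < e1) by (apply Rmin_glb_lt; [lra | apply Rdiv_lt_0_compat; lra]).
  assert (E1 : e1 <= 1) by apply Rmin_l. assert (E2 : e1 * (3 * A) <= e).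
  { apply Rle_div_r; [lra | apply Rmin_r]. }
  destruct (Hg e1 He1) as (d1 & Hd1 & B1). destruct (Hk e1 He1) as (d2 & Hd2 & B2).
  exists (Rmin d1 d2). split; [apply Rmin_glb_lt; auto|]. intros y Hy.
  Rmin_facts d1 d2.
  specialize (B1 y ltac:(lra)). specialize (B2 y ltac:(lra)).
  replace (g y * k y - g x * k x) with
    ((g y - g x) * (k y - k x) + (g y - g x) * k x + g x * (k y - k x)) by ring.
  apply Rle_lt_trans with (e1 * 1 + e1 * Cmod (k x) + Cmod (g x) * e1)%R.
  - apply Cmod_add_le; [apply Cmod_add_le|]; apply Cmod_mult_le; lra.
  - assert (e1 * A < e1 * (3 * A)) by (apply Rmult_lt_compat_l; lra). unfold A in *; lra.
Qed.

Lemma CI_cis' : CI cis' 0 (2 * PI) 0.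
Proof.
  pose proof PI_RGT_0.
  replace (RtoC 0) with (Ci * cis' (2 * PI) - Ci * cis' 0) by (rewrite cis'_2PI; ring).
  apply (CI_derive (fun u => Ci * cis' u) cis'); [lra| |].
  - intros x _. eapply rdiff_ext; [reflexivity| |apply rdiff_scal, rdiff_cis'].
    replace (Ci * (- Ci * cis' x)) with (- (Ci * Ci) * cis' x) by ring.
    rewrite Ci_sqr; ring.
  - intros x _. eapply rdiff_rcont. apply rdiff_cis'.
Qed.

Lemma sdiff_deriv_cont (F dF : C -> C) (z0 z1 : C) (R0 : R) :
  (forall z, Cmod (z - z0) < R0 -> sdiff F z (dF z)) -> Cmod (z1 - z0) < R0 ->
  forall e, 0 < e -> exists d, 0 < d /\ forall z, Cmod (z - z1) < d -> 
    Cmod (z - z0) < R0 /\ Cmod (dF z - dF z1) <= e.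
Proof.
  intros H H1 e He. destruct (strict_deriv_near F z1 (dF z1) (H _ H1) e He) as (d & Hd & B).
  exists (Rmin d (R0 - Cmod (z1 - z0))). split; [apply Rmin_glb_lt; lra|].
  intros z Hz. Rmin_facts d (R0 - Cmod (z1 - z0))%R.
  assert (Cmod (z - z0) < R0) by (pose proof (Cmod_triangle_sub z z1 z0); lra).
  split; auto. apply (B z); [lra|]. apply sdiff_cdiff. auto.
Qed.

Lemma circle_near (z0 : C) (r s u u0 : R) (d : R) : 0 < d -> 0 <= r ->
  exists d', 0 < d' /\ forall s u, Rabs (s - r) < d' -> Rabs (u - u0) < d' ->
    Cmod ((z0 + RtoC s * cis u) - (z0 + RtoC r * cis u0)) < d.
Proof.
  intros Hd Hr.
  destruct (linear_small (r + 1) d) as (q & Hq & B); [lra|auto|].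
  destruct (rdiff_rcont _ _ _ (rdiff_cis u0) q Hq) as (d1 & Hd1 & B1).
  exists (Rmin d1 (q/2)). split; [apply Rmin_glb_lt; lra|]. clear s u. intros s u Hs Hu.
  Rmin_facts d1 (q/2)%R.
  replace (z0 + RtoC s * cis u - (z0 + RtoC r * cis u0))
    with (RtoC (s - r) * cis u + RtoC r * (cis u - cis u0)) by (rewrite RtoC_minus; ring).
  specialize (B1 u ltac:(lra)).
  set (m := Rmax (Rabs (s - r)) (Cmod (cis u - cis u0))).
  assert (Hm : 0 <= m < q).
  { unfold m; split; [eapply Rle_trans; [apply Rabs_pos| apply Rmax_l] | apply Rmax_lub_lt; lra]. }
  specialize (B m Hm). eapply Rle_lt_trans; [|exact B].
  replace ((r + 1) * m)%R with (m * 1 + r * m)%R by ring.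
  apply Cmod_add_le; apply Cmod_mult_le.
  - rewrite Cmod_R; apply Rmax_l.
  - rewrite Cmod_cis; lra.
  - rewrite Cmod_R, Rabs_pos_eq; lra.
  - apply Rmax_r.
Qed.

(* With [P(s) = int F(z0 + s e^{iu}) e^{-iu} du] one has [s P'(s) = P(s)], so
   [P(s)/s] is constant, and it tends to [2 pi F'(z0)] at [0]. *)
Lemma cauchy_estimate (F dF : C -> C) (z0 : C) (R0 r M : R) :
  (forall z, Cmod (z - z0) < R0 -> sdiff F z (dF z)) -> 0 < r < R0 ->
  (forall z, Cmod (z - z0) = r -> Cmod (F z) <= M) -> Cmod (dF z0) <= M / r.
Proof.
  intros HF Hr HM. pose proof PI_RGT_0 as Hpi.
  assert (Hin : forall s u, 0 <= s < R0 -> Cmod (z0 + RtoC s * cis u - z0) = s).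
  { intros s u Hs. replace (z0 + RtoC s * cis u - z0) with (RtoC s * cis u) by ring.
    rewrite Cmod_mult, Cmod_cis, Cmod_R, Rabs_pos_eq by lra. ring. }
  assert (Hline : forall s u, rdiff (fun u => z0 + RtoC s * cis u) u (RtoC s * (Ci * cis u))).
  { intros s u. eapply rdiff_ext; [reflexivity| |apply (rdiff_plus (fun _ => z0) _ u 0); 
      [apply rdiff_const | apply rdiff_scal, rdiff_cis]]. ring. }
  assert (HcF : forall s u, 0 <= s < R0 -> rcont (fun u => F (z0 + RtoC s * cis u)) u).
  { intros s u Hs. eapply rdiff_rcont.
    apply (rdiff_comp F (fun u => z0 + RtoC s * cis u) u (dF (z0 + RtoC s * cis u))); [|apply Hline].
    apply HF. rewrite Hin; lra. }
  assert (HcdF : forall s u, 0 <= s < R0 -> rcont (fun u => dF (z0 + RtoC s * cis u)) u).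
  { intros s u Hs e He.
    destruct (sdiff_deriv_cont F dF z0 (z0 + RtoC s * cis u) R0 HF) with (e := (e/2)%R) as (d & Hd & B).
    - rewrite Hin; lra.
    - lra.
    - destruct (rdiff_rcont _ _ _ (Hline s u) d Hd) as (d' & Hd' & B').
      exists d'; split; auto. intros y Hy. destruct (B _ (B' y Hy)). lra. }
  set (P := (fun s => RInt (V := C_R_CompleteNormedModule)
    (fun u => F (z0 + RtoC s * cis u) * cis' u) 0 (2 * PI)) : R -> C).
  assert (HP : forall s, 0 <= s < R0 -> CI (fun u => F (z0 + RtoC s * cis u) * cis' u) 0 (2 * PI) (P s)).
  { intros s Hs. apply (RInt_correct (V := C_R_CompleteNormedModule)).
    apply CI_ex; [lra|]. intros x _. apply rcont_mult; [apply HcF; auto|].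
    eapply rdiff_rcont, rdiff_cis'. }
  assert (HdP : forall s, 0 < s < R0 -> rdiff P s (P s / RtoC s)).
  { intros s Hs.
    destruct (CI_ex (fun u => dF (z0 + RtoC s * cis u)) 0 (2 * PI)) as [V HV]; [lra| |].
    { intros x _. apply HcdF; lra. }
    (* Integrating the derivative in [u] of [F (z0 + s e^(iu)) e^(-iu)] over a full period gives 0,
       that is [i s V - i P(s) = 0]. *)
    assert (E : P s / RtoC s = V).
    { assert (Q : CI (fun u => RtoC s * Ci * dF (z0 + RtoC s * cis u) - Ci * (F (z0 + RtoC s * cis u) * cis' u))
        0 (2 * PI) (RtoC s * Ci * V - Ci * P s)).
      { apply CI_minus; apply CI_scal; auto. apply HP; lra. }
      assert (Q' : CI (fun u => RtoC s * Ci * dF (z0 + RtoC s * cis u) - Ci * (F (z0 + RtoC s * cis u) * cis' u))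
        0 (2 * PI) (F (z0 + RtoC s * cis (2 * PI)) * cis' (2 * PI) - F (z0 + RtoC s * cis 0) * cis' 0)).
      { apply (CI_derive (fun u => F (z0 + RtoC s * cis u) * cis' u)); [lra| |].
        - intros x _. eapply rdiff_ext; [reflexivity| |apply rdiff_mult].
          2: { apply (rdiff_comp F (fun u => z0 + RtoC s * cis u) x (dF (z0 + RtoC s * cis x))); [|apply Hline].
               apply HF. rewrite Hin; lra. }
          2: apply rdiff_cis'.
          replace (dF (z0 + RtoC s * cis x) * (RtoC s * (Ci * cis x)) * cis' x)
            with (dF (z0 + RtoC s * cis x) * RtoC s * Ci * (cis x * cis' x)) by ring.
          rewrite cis_cis'. ring.
        - intros x _ e He.
          assert (rcont (fun u => RtoC s * Ci * dF (z0 + RtoC s * cis u)) x) as C1.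
          { apply (rcont_mult (fun _ => RtoC s * Ci)); [eapply rdiff_rcont, rdiff_const | apply HcdF; lra]. }
          assert (rcont (fun u => Ci * (F (z0 + RtoC s * cis u) * cis' u)) x) as C2.
          { apply (rcont_mult (fun _ => Ci)); [eapply rdiff_rcont, rdiff_const |].
            apply rcont_mult; [apply HcF; lra | eapply rdiff_rcont, rdiff_cis']. }
          destruct (C1 (e/2)%R ltac:(lra)) as (d1 & Hd1 & B1).
          destruct (C2 (e/2)%R ltac:(lra)) as (d2 & Hd2 & B2).
          exists (Rmin d1 d2). split; [apply Rmin_glb_lt; auto|]. intros y Hy.
          Rmin_facts d1 d2.
          specialize (B1 y ltac:(lra)). specialize (B2 y ltac:(lra)).
          match goal with |- Cmod (?a - ?b - (?a' - ?b')) < _ =>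
            replace (a - b - (a' - b')) with ((a - a') - (b - b')) by ring end.
          eapply Rle_lt_trans; [apply Cmod_minus_le | lra]. }
      rewrite cis_2PI, cis'_2PI in Q'.
      assert (Z := CI_unique _ _ _ _ _ Q Q').
      assert (Hs0 : RtoC s <> 0) by (intros A; apply RtoC_inj in A; lra).
      assert (Z' : Ci * (RtoC s * V - P s) = 0).
      { transitivity (RtoC s * Ci * V - Ci * P s); [ring | rewrite Z; ring]. }
      assert (Z2 : RtoC s * V - P s = 0).
      { replace (RtoC s * V - P s) with (- Ci * (Ci * (RtoC s * V - P s))).
        - rewrite Z'; ring.
        - replace (- Ci * (Ci * (RtoC s * V - P s))) with (- (Ci * Ci) * (RtoC s * V - P s)) by ring.
          rewrite Ci_sqr; ring. }
      replace (P s) with (RtoC s * V - (RtoC s * V - P s)) by ring. rewrite Z2. field; auto. }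
    (* It remains to see that [V] is the derivative of [P]: under the integral sign, the factor
       [cis u] from the chain rule cancels [cis' u]. *)
    rewrite E. apply within_diff_rdiff.
    apply (integral_within_diff (fun _ => True) s 0 (2 * PI) (fun s u => F (z0 + RtoC s * cis u) * cis' u)
      (fun u => dF (z0 + RtoC s * cis u)) P V); [lra | auto | | |auto].
    - intros e u0 He Hu0.
      assert (Hin0 : Cmod (z0 + RtoC s * cis u0 - z0) < R0) by (rewrite Hin; lra).
      destruct (HF _ Hin0 (e/2)%R ltac:(lra)) as (d1 & Hd1 & B1).
      destruct (sdiff_deriv_cont F dF z0 _ R0 HF Hin0 (e/2)%R ltac:(lra)) as (d2 & Hd2 & B2).
      destruct (circle_near z0 s s u0 u0 (Rmin d1 d2)) as (d & Hd & B); [apply Rmin_glb_lt; auto | lra|].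
      Rmin_facts d1 d2.
      exists d; split; auto. intros u s' Hu Hu1 _ Hs'.
      assert (N1 := B s' u Hs' Hu1).
      assert (N2 := B s u ltac:(rewrite Rminus_diag, Rabs_R0; auto) Hu1).
      specialize (B1 (z0 + RtoC s' * cis u) (z0 + RtoC s * cis u) ltac:(lra) ltac:(lra)).
      destruct (B2 (z0 + RtoC s * cis u) ltac:(lra)) as [_ B2'].
      set (l0 := dF (z0 + RtoC s * cis u0)) in *. set (l1 := dF (z0 + RtoC s * cis u)) in *.
      replace (z0 + RtoC s' * cis u - (z0 + RtoC s * cis u)) with (RtoC (s' - s) * cis u) in B1
        by (rewrite RtoC_minus; ring).
      replace (F (z0 + RtoC s' * cis u) * cis' u - F (z0 + RtoC s * cis u) * cis' u - l1 * RtoC (s' - s))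
        with ((F (z0 + RtoC s' * cis u) - F (z0 + RtoC s * cis u) - l0 * (RtoC (s' - s) * cis u)) * cis' u
           - (l1 - l0) * RtoC (s' - s) + l0 * RtoC (s' - s) * (cis u * cis' u - 1)) by ring.
      rewrite cis_cis'. rewrite Cmod_mult, Cmod_cis, Cmod_R, Rmult_1_r in B1.
      replace (l0 * RtoC (s' - s) * (1 - 1)) with (RtoC 0) by ring. rewrite Cplus_0_r.
      eapply Rle_trans; [apply Cmod_minus_le|]. rewrite !Cmod_mult, Cmod_cis', Cmod_R, Rmult_1_r.
      assert (Cmod (l1 - l0) * Rabs (s' - s) <= e / 2 * Rabs (s' - s))
        by (apply Rmult_le_compat_r; [apply Rabs_pos | auto]).
      lra.
    - exists (Rmin s (R0 - s)). split; [apply Rmin_glb_lt; lra|]. intros s' _ Hs'. apply HP.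
      Rmin_facts s (R0 - s)%R. apply Rabs_def2 in Hs'. lra. }
  set (S := fun s => P s * / RtoC s).
  assert (HS : forall s, 0 < s < R0 -> rdiff S s 0).
  { intros s Hs. assert (Hs0 : RtoC s <> 0) by (intros A; apply RtoC_inj in A; lra).
    eapply rdiff_ext; [reflexivity| | apply (rdiff_mult P (fun s => / RtoC s));
     [apply HdP; auto | apply (rdiff_comp Cinv (fun s => RtoC s) s); [apply sdiff_inv; auto| apply rdiff_id]]].
    field; auto. }
  assert (HSr : forall s, 0 < s <= r -> S s = S r).
  { intros s Hs. symmetry. apply Cmod_small_eq. intros e He.
    apply Rle_trans with (0 - 0)%R; [|lra].
    apply (mean_value_ineq S (fun _ => 0) (fun _ => 0%R) (fun _ => 0%R)); [lra| | |].
    - intros x Hx. apply HS; lra.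
    - intros x _. apply (is_derive_const (K := R_AbsRing) (V := R_NormedModule)).
    - intros; rewrite Cmod_0; lra. }
  assert (Hlim : S r = 2 * PI * dF z0).
  { apply Cmod_small_eq. intros e He.
    set (e1 := (e / (2 * PI))%R). assert (He1 : 0 < e1) by (apply Rdiv_lt_0_compat; lra).
    destruct (sdiff_cdiff _ _ _ (HF z0 ltac:(rewrite Cmod_self; lra)) e1 He1) as (d & Hd & B).
    set (s := Rmin r (d / 2)). assert (Hs : 0 < s) by (apply Rmin_glb_lt; lra).
    assert (Hsr : s <= r) by apply Rmin_l. assert (Hsd : s <= d / 2) by apply Rmin_r.
    assert (Hs0 : RtoC s <> 0) by (intros A; apply RtoC_inj in A; lra).
    rewrite <- (HSr s) by lra.
    (* The first-order expansion of [F] at [z0]: its constant term disappears because [cis'] has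
       integral 0 over a period, and its linear term contributes [2 pi s dF z0]. *)
    assert (Q : CI (fun u => F (z0 + RtoC s * cis u) * cis' u - (F z0 * cis' u + dF z0 * RtoC s * 1))
       0 (2 * PI) (P s - (F z0 * 0 + dF z0 * RtoC s * RtoC (2 * PI)))).
    { apply CI_minus; [apply HP; lra|]. apply CI_plus; [apply CI_scal, CI_cis'|].
      apply CI_scal.
      assert (A := is_RInt_const (V := C_R_NormedModule) 0 (2 * PI) (RtoC 1)).
      rewrite scal_C_R in A. replace (RtoC (2 * PI)) with (RtoC (2 * PI - 0) * 1) by (rewrite Rminus_0_r; ring).
      exact A. }
    apply (CI_bound _ _ _ (e1 * s)%R) in Q; [|lra|].
    - replace (S s - 2 * PI * dF z0) with ((P s - (F z0 * 0 + dF z0 * RtoC s * RtoC (2 * PI))) * / RtoC s)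
        by (unfold S; rewrite RtoC_mult; field; auto).
      rewrite Cmod_mult, Cmod_inv, Cmod_R, Rabs_pos_eq by (auto; lra).
      apply (Rmult_le_compat_r (/ s)) in Q; [|left; apply Rinv_0_lt_compat; auto].
      eapply Rle_trans; [exact Q|]. right. unfold e1. field. split; lra.
    - intros u _.
      replace (F (z0 + RtoC s * cis u) * cis' u - (F z0 * cis' u + dF z0 * RtoC s * 1))
        with ((F (z0 + RtoC s * cis u) - F z0 - dF z0 * (z0 + RtoC s * cis u - z0)) * cis' u
          + dF z0 * RtoC s * (cis u * cis' u - 1)) by ring.
      rewrite cis_cis'. replace (dF z0 * RtoC s * (1 - 1)) with (RtoC 0) by ring. rewrite Cplus_0_r.
      rewrite Cmod_mult, Cmod_cis', Rmult_1_r.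
      assert (A := Hin s u ltac:(lra)).
      specialize (B (z0 + RtoC s * cis u) ltac:(lra)). rewrite A in B. exact B. }
  (* [2 pi dF z0 = P r / r], and the integrand of [P r] is bounded by [M] on an interval of length
     [2 pi]. *)
  assert (HPr := HP r ltac:(lra)).
  apply (CI_bound _ _ _ M) in HPr; [|lra|].
  - assert (Hr0 : RtoC r <> 0) by (intros A; apply RtoC_inj in A; lra).
    assert (E : P r = RtoC r * (2 * PI * dF z0)) by (rewrite <- Hlim; unfold S; field; auto).
    rewrite E in HPr. rewrite !Cmod_mult, !Cmod_R, !Rabs_pos_eq in HPr by lra.
    apply Rle_div_r; [lra|]. apply Rmult_le_reg_l with (2 * PI)%R; lra.
  - intros u _. rewrite Cmod_mult, Cmod_cis', Rmult_1_r. apply HM. apply Hin; lra.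
Qed.

(** * Holomorphic functions *)

Definition hol (F : C -> C) (z : C) : Prop := exists l, sdiff F z l.

Lemma hol_sdiff (F : C -> C) (z : C) : hol F z -> sdiff F z (C_derive F z).
Proof.
  intros [l H]. now rewrite (cdiff_C_derive F z l) by (apply sdiff_cdiff; auto).
Qed.

Lemma sdiff_C_derive (F : C -> C) (z l : C) : sdiff F z l -> C_derive F z = l.
Proof. intros H. apply cdiff_C_derive, sdiff_cdiff, H. Qed.

Lemma hol_mult (F G : C -> C) (z : C) : hol F z -> hol G z -> hol (fun w => F w * G w) z.
Proof. intros [a Ha] [b Hb]. eexists. apply sdiff_mult; eauto. Qed.
Lemma hol_plus (F G : C -> C) (z : C) : hol F z -> hol G z -> hol (fun w => F w + G w) z.
Proof. intros [a Ha] [b Hb]. eexists. apply sdiff_plus; eauto. Qed.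
Lemma hol_minus (F G : C -> C) (z : C) : hol F z -> hol G z -> hol (fun w => F w - G w) z.
Proof. intros [a Ha] [b Hb]. eexists. apply sdiff_minus; eauto. Qed.
Lemma hol_const (c z : C) : hol (fun _ => c) z.
Proof. eexists; apply sdiff_const. Qed.
Lemma hol_id (z : C) : hol (fun w => w) z.
Proof. eexists; apply sdiff_id. Qed.
Lemma hol_comp (F G : C -> C) (z : C) : hol F (G z) -> hol G z -> hol (fun w => F (G w)) z.
Proof. intros [a Ha] [b Hb]. eexists. apply sdiff_comp; eauto. Qed.
Lemma hol_inv (F : C -> C) (z : C) : hol F z -> F z <> 0 -> hol (fun w => / F w) z.
Proof.
  intros Ha H. apply (hol_comp Cinv F); auto. eexists; apply sdiff_inv; auto.
Qed.
Lemma hol_div (F G : C -> C) (z : C) : hol F z -> hol G z -> G z <> 0 -> hol (fun w => F w / G w) z.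
Proof. intros. apply hol_mult; auto. apply hol_inv; auto. Qed.
Lemma hol_translate (F : C -> C) (w z : C) : hol F (z + w) -> hol (fun u => F (u + w)) z.
Proof. intros [a Ha]. eexists. apply sdiff_translate; eauto. Qed.
Lemma hol_ext_loc (F G : C -> C) (z0 : C) (d : R) : 0 < d ->
  (forall z, Cmod (z - z0) < d -> F z = G z) -> hol F z0 -> hol G z0.
Proof. intros Hd E [l H]. exists l. eapply sdiff_ext_loc; eauto. Qed.
Lemma hol_cont (F : C -> C) (z0 : C) : hol F z0 ->
  forall e, 0 < e -> exists d, 0 < d /\ forall z, Cmod (z - z0) < d -> Cmod (F z - F z0) < e.
Proof. intros [l H]. eapply sdiff_cont; eauto. Qed.

(** Cauchy's estimate on the circle of radius [R / 4] about [z], which stays in the disc; hence the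
    factor 4. *)
Lemma deriv_bound (F : C -> C) (z0 z : C) (R M : R) : 0 < R ->
  (forall w, Cmod (w - z0) < R -> hol F w /\ Cmod (F w) <= M) -> Cmod (z - z0) <= R / 2 ->
  Cmod (C_derive F z) <= 4 * M / R.
Proof.
  intros HR H Hz.
  assert (In : forall w, Cmod (w - z) < R / 2 -> Cmod (w - z0) < R).
  { intros w Hw. pose proof (Cmod_triangle_sub w z z0). lra. }
  replace (4 * M / R)%R with (M / (R / 4))%R by (field; lra).
  apply (cauchy_estimate F (C_derive F) z (R / 2)); [|lra|].
  - intros w Hw. apply hol_sdiff, H, In, Hw.
  - intros w Hw. apply H, In. lra.
Qed.

(** A bound for the second derivative in disguise: Cauchy's estimate is applied to the increment
    [F (w + h) - F w], which is at most [4 M / R * Cmod h] by the mean value inequality. The radius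
    [R / 8] turns 4 into 32. *)
Lemma deriv_lipschitz (F : C -> C) (z0 z : C) (R M : R) : 0 < R ->
  (forall w, Cmod (w - z0) < R -> hol F w /\ Cmod (F w) <= M) -> Cmod (z - z0) < R / 4 ->
  Cmod (C_derive F z - C_derive F z0) <= 32 * M / (R * R) * Cmod (z - z0).
Proof.
  intros HR H Hz. set (h := z - z0).
  assert (Q : forall w, Cmod (w - z0) < R / 4 ->
    sdiff (fun w => F (w + h) - F w) w (C_derive F (w + h) - C_derive F w)).
  { intros w Hw. apply sdiff_minus; [apply sdiff_translate|]; apply hol_sdiff, H; [|lra].
    replace (w + h - z0) with ((w - z0) + h) by ring.
    eapply Rle_lt_trans; [apply Cmod_triangle|]. unfold h. lra. }
  replace (C_derive F z) with (C_derive F (z0 + h)) by (f_equal; unfold h; ring).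
  replace (32 * M / (R * R) * Cmod h)%R with ((4 * M / R * Cmod h) / (R / 8))%R by (field; lra).
  apply (cauchy_estimate (fun w => F (w + h) - F w) (fun w => C_derive F (w + h) - C_derive F w) z0 (R / 4));
    [exact Q | lra|].
  intros w Hw.
  replace h with (w + h - w) at 2 by ring.
  apply (ball_mean_value F (C_derive F) z0 (R / 2)).
  - intros u Hu. apply sdiff_cdiff, hol_sdiff, H. lra.
  - intros u Hu. apply (deriv_bound F z0 u R M); auto. lra.
  - replace (w + h - z0) with ((w - z0) + h) by ring.
    eapply Rle_lt_trans; [apply Cmod_triangle|]. unfold h. lra.
  - lra.
Qed.

(** The constant depends on [R] and [M] alone, so the estimate is the same for all holomorphic
    functions bounded by [M] on the disc. Passing to the limit and treating several variables both
    rest on this. *)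
Lemma strict_estimate (F : C -> C) (z0 z z' : C) (R M rho : R) : 0 < R -> rho <= R / 4 ->
  (forall w, Cmod (w - z0) < R -> hol F w /\ Cmod (F w) <= M) ->
  Cmod (z - z0) < rho -> Cmod (z' - z0) < rho ->
  Cmod (F z - F z' - C_derive F z0 * (z - z')) <= 32 * M / (R * R) * rho * Cmod (z - z').
Proof.
  intros HR Hrho H Hz Hz'.
  assert (HM : 0 <= M).
  { destruct (H z0) as [_ A]; [rewrite Cmod_self; auto|]. pose proof (Cmod_ge_0 (F z0)). lra. }
  replace (F z - F z' - C_derive F z0 * (z - z'))
    with (F z - C_derive F z0 * z - (F z' - C_derive F z0 * z')) by ring.
  apply (ball_mean_value (fun w => F w - C_derive F z0 * w) (fun w => C_derive F w - C_derive F z0) z0 rho); auto.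
  - intros w Hw. apply cdiff_minus_linear, sdiff_cdiff, hol_sdiff, H. lra.
  - intros w Hw. eapply Rle_trans; [apply (deriv_lipschitz F z0 w R M); auto; lra|].
    apply Rmult_le_compat_l; [|lra]. apply Rmult_le_pos; [lra|].
    left. apply Rinv_0_lt_compat, Rmult_lt_0_compat; auto.
Qed.

(** * Convergent sequences and limits of holomorphic functions *)

Definition Ccvg (u : nat -> C) (l : C) : Prop :=
  forall e, 0 < e -> exists N, forall n, (N <= n)%nat -> Cmod (u n - l) < e.

Lemma Ccvg_unique (u : nat -> C) (l l' : C) : Ccvg u l -> Ccvg u l' -> l = l'.
Proof.
  intros H H'. apply Cmod_small_eq. intros e He.
  destruct (H (e/2)%R ltac:(lra)) as [N HN]. destruct (H' (e/2)%R ltac:(lra)) as [N' HN'].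
  specialize (HN (max N N') ltac:(lia)). specialize (HN' (max N N') ltac:(lia)).
  pose proof (Cmod_triangle_sub l (u (max N N')) l'). rewrite Cmod_minus_sym in HN. lra.
Qed.

Lemma Ccvg_cauchy (u : nat -> C) :
  (forall e, 0 < e -> exists N, forall n m, (N <= n)%nat -> (N <= m)%nat -> Cmod (u n - u m) < e) ->
  exists l, Ccvg u l.
Proof.
  intros H.
  destruct (Rcomplete.R_complete (fun n => Re (u n))) as [a Ha].
  { intros e He. destruct (H e He) as [N HN]. exists N. intros n m Hn Hm.
    unfold Rdist. replace (Re (u n) - Re (u m))%R with (Re (u n - u m)) by reflexivity.
    eapply Rle_lt_trans; [apply re_le_Cmod|]. auto. }
  destruct (Rcomplete.R_complete (fun n => Im (u n))) as [b Hb].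
  { intros e He. destruct (H e He) as [N HN]. exists N. intros n m Hn Hm.
    unfold Rdist. replace (Im (u n) - Im (u m))%R with (Im (u n - u m)) by reflexivity.
    eapply Rle_lt_trans; [apply Im_le_Cmod|]. auto. }
  exists (a, b). intros e He.
  destruct (Ha (e/2)%R ltac:(lra)) as [N HN]. destruct (Hb (e/2)%R ltac:(lra)) as [N' HN'].
  exists (max N N'). intros n Hn. specialize (HN n ltac:(lia)). specialize (HN' n ltac:(lia)).
  unfold Rdist in *. eapply Rle_lt_trans; [apply Cmod_le_Re_Im|]. simpl. 
  unfold Re, Im in *. unfold Rminus in *. lra.
Qed.

Lemma Ccvg_bound (u : nat -> C) (l : C) (M : R) : Ccvg u l -> (forall n, Cmod (u n) <= M) -> Cmod l <= M.
Proof.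
  intros H HM. destruct (Rle_or_lt (Cmod l) M) as [|A]; auto.
  destruct (H (Cmod l - M)%R ltac:(lra)) as [N HN]. specialize (HN N (le_n _)). specialize (HM N).
  pose proof (Cmod_le_add_sub l (u N)). rewrite Cmod_minus_sym in HN. lra.
Qed.

Lemma Ccvg_minus (u v : nat -> C) (l m : C) : Ccvg u l -> Ccvg v m -> Ccvg (fun n => u n - v n) (l - m).
Proof.
  intros H H' e He. destruct (H (e/2)%R ltac:(lra)) as [N HN]. destruct (H' (e/2)%R ltac:(lra)) as [N' HN'].
  exists (max N N'). intros n Hn. specialize (HN n ltac:(lia)). specialize (HN' n ltac:(lia)).
  replace (u n - v n - (l - m)) with ((u n - l) - (v n - m)) by ring.
  eapply Rle_lt_trans; [apply Cmod_minus_le|lra].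
Qed.

Lemma Ccvg_scal (c : C) (u : nat -> C) (l : C) : Ccvg u l -> Ccvg (fun n => c * u n) (c * l).
Proof.
  intros H e He. destruct (H (e / (1 + Cmod c))%R) as [N HN].
  { apply Rdiv_lt_0_compat; auto. pose proof (Cmod_ge_0 c); lra. }
  exists N. intros n Hn. specialize (HN n Hn). pose proof (Cmod_ge_0 c).
  replace (c * u n - c * l) with (c * (u n - l)) by ring. rewrite Cmod_mult.
  apply Rlt_div_r in HN; [|lra].
  pose proof (Cmod_ge_0 (u n - l)). lra.
Qed.

Lemma Ccvg_const (c : C) : Ccvg (fun _ => c) c.
Proof. intros e He. exists O. intros. rewrite Cmod_self; auto. Qed.

(* The strict estimate is uniform along a bounded sequence, so pointwise convergence is enough. *)
Lemma hol_limit (Fn : nat -> C -> C) (F : C -> C) (z0 : C) (R M : R) : 0 < R ->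
  (forall n w, Cmod (w - z0) < R -> hol (Fn n) w /\ Cmod (Fn n w) <= M) ->
  (forall w, Cmod (w - z0) < R -> Ccvg (fun n => Fn n w) (F w)) ->
  exists l, Ccvg (fun n => C_derive (Fn n) z0) l /\ sdiff F z0 l.
Proof.
  intros HR H Hc.
  assert (HM : 0 <= M).
  { destruct (H O z0) as [_ A]; [rewrite Cmod_self; auto|]. pose proof (Cmod_ge_0 (Fn O z0)). lra. }
  set (K := (32 * M / (R * R))%R).
  assert (HK : 0 <= K).
  { apply Rmult_le_pos; [lra|]. left. apply Rinv_0_lt_compat, Rmult_lt_0_compat; auto. }
  assert (HE : forall n z z' rho, rho <= R / 4 -> Cmod (z - z0) < rho -> Cmod (z' - z0) < rho ->
    Cmod (Fn n z - Fn n z' - C_derive (Fn n) z0 * (z - z')) <= K * rho * Cmod (z - z')).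
  { intros. unfold K. apply (strict_estimate (Fn n) z0 z z' R M rho); auto. }
  assert (Z0 : forall r, 0 < r -> Cmod (z0 - z0) < r) by (intros; rewrite Cmod_self; auto).
  destruct (Ccvg_cauchy (fun n => C_derive (Fn n) z0)) as [l Hl].
  { intros e He. destruct (linear_small K (e / 4)) as (q & Hq & Bq); auto; [lra|].
    set (rho := Rmin (q / 2) (R / 4)). assert (Hr : 0 < rho) by (apply Rmin_glb_lt; lra).
    assert (R1 : rho <= q / 2) by apply Rmin_l. assert (R2 : rho <= R / 4) by apply Rmin_r.
    specialize (Bq rho ltac:(lra)).
    set (h := RtoC (rho / 2)). set (z := z0 + h).
    assert (Ez : z - z0 = h) by (unfold z; ring).
    assert (Hh : Cmod h = (rho / 2)%R) by (unfold h; rewrite Cmod_R, Rabs_pos_eq; lra).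
    assert (Hz : Cmod (z - z0) < rho) by (rewrite Ez, Hh; lra).
    (* The difference of two derivatives is read off from the increments over [h]: four values of
       [Fn], each within [e / 8 * Cmod h] of the limit, and two strict estimates of [e / 4 * Cmod h]
       each. *)
    destruct (Hc z ltac:(lra) (e / 8 * Cmod h)%R) as [N1 HN1]; [rewrite Hh; apply Rmult_lt_0_compat; lra|].
    destruct (Hc z0 ltac:(auto) (e / 8 * Cmod h)%R) as [N2 HN2]; [rewrite Hh; apply Rmult_lt_0_compat; lra|].
    exists (max N1 N2). intros n m Hn Hm.
    assert (A1 := HN1 n ltac:(lia)). assert (A2 := HN1 m ltac:(lia)).
    assert (A3 := HN2 n ltac:(lia)). assert (A4 := HN2 m ltac:(lia)).
    assert (B1 := HE n z z0 rho R2 Hz (Z0 _ Hr)). assert (B2 := HE m z z0 rho R2 Hz (Z0 _ Hr)).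
    rewrite Ez in B1, B2.
    apply Rmult_lt_reg_r with (Cmod h); [rewrite Hh; lra|].
    rewrite <- Cmod_mult.
    replace ((C_derive (Fn n) z0 - C_derive (Fn m) z0) * h) with
      (((Fn n z - F z) - (Fn m z - F z)) - ((Fn n z0 - F z0) - (Fn m z0 - F z0))
       - ((Fn n z - Fn n z0 - C_derive (Fn n) z0 * h) - (Fn m z - Fn m z0 - C_derive (Fn m) z0 * h))) by ring.
    assert (K * rho * Cmod h <= e / 4 * Cmod h) by (apply Rmult_le_compat_r; lra).
    eapply Rle_lt_trans; [apply Cmod_minus_le|].
    pose proof (Cmod_minus_le (Fn n z - F z - (Fn m z - F z)) (Fn n z0 - F z0 - (Fn m z0 - F z0))).
    pose proof (Cmod_minus_le (Fn n z - F z) (Fn m z - F z)).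
    pose proof (Cmod_minus_le (Fn n z0 - F z0) (Fn m z0 - F z0)).
    pose proof (Cmod_minus_le (Fn n z - Fn n z0 - C_derive (Fn n) z0 * h) (Fn m z - Fn m z0 - C_derive (Fn m) z0 * h)).
    lra. }
  exists l; split; auto. intros e He.
  destruct (linear_small K e) as (q & Hq & Bq); auto.
  set (rho := Rmin (q / 2) (R / 4)). assert (Hr : 0 < rho) by (apply Rmin_glb_lt; lra).
  assert (R1 : rho <= q / 2) by apply Rmin_l. assert (R2 : rho <= R / 4) by apply Rmin_r.
  specialize (Bq rho ltac:(lra)).
  exists rho; split; auto. intros z z' Hz Hz'.
  apply Rle_trans with (K * rho * Cmod (z - z'))%R; [|apply Rmult_le_compat_r; [apply Cmod_ge_0|lra]].
  apply (Ccvg_bound (fun n => Fn n z - Fn n z' - (z - z') * C_derive (Fn n) z0)).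
  - rewrite (Cmult_comm l). apply Ccvg_minus; [apply Ccvg_minus; apply Hc; lra | apply Ccvg_scal; auto].
  - intros n. rewrite (Cmult_comm (z - z') (C_derive _ _)). apply HE; auto.
Qed.

(** A null sequence of nonzero increments of modulus at most [d / 2]. Difference quotients along it
    exhibit a derivative as a pointwise limit of holomorphic functions. *)
Definition step (d : R) (n : nat) : C := RtoC (d / (INR n + 2)).

Lemma step_bound (d : R) (n : nat) : 0 < d -> 0 < Cmod (step d n) <= d / 2.
Proof.
  intros Hd. pose proof (pos_INR n). unfold step.
  assert (0 < d / (INR n + 2)) by (apply Rdiv_lt_0_compat; lra).
  rewrite Cmod_R, Rabs_pos_eq by lra. split; auto.
  apply Rmult_le_compat_l; [lra|]. apply Rinv_le_contravar; lra.
Qed.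

Lemma step_cvg (d : R) : 0 < d -> Ccvg (step d) 0.
Proof.
  intros Hd e He. exists (Z.to_nat (up (d / e))). intros n Hn.
  replace (step d n - 0) with (step d n) by ring. unfold step.
  pose proof (pos_INR n).
  rewrite Cmod_R, Rabs_pos_eq by (left; apply Rdiv_lt_0_compat; lra).
  apply Rlt_div_l; [lra|].
  destruct (archimed (d / e)) as [A _].
  assert (0 < d / e) by (apply Rdiv_lt_0_compat; lra).
  assert (IZR (up (d / e)) <= INR n).
  { rewrite INR_IZR_INZ. apply IZR_le. assert (0 < up (d/e))%Z by (apply lt_IZR; lra). lia. }
  assert (d / e < INR n + 2) by lra. apply Rlt_div_l in H2; lra.
Qed.

Lemma quotient_cvg (F : C -> C) (z l : C) (d : R) : 0 < d -> cdiff F z l ->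
  Ccvg (fun n => (F (z + step d n) - F z) / step d n) l.
Proof.
  intros Hd H e He. destruct (H (e / 2)%R ltac:(lra)) as (r & Hr & B).
  destruct (step_cvg d Hd r Hr) as [N HN]. exists N. intros n Hn.
  specialize (HN n Hn). destruct (step_bound d n Hd) as [S1 S2].
  assert (N0 : step d n <> 0) by (now apply Cmod_gt_0).
  specialize (B (z + step d n)). replace (z + step d n - z) with (step d n) in B by ring.
  replace (step d n - 0) with (step d n) in HN by ring. specialize (B HN).
  apply Rmult_lt_reg_r with (Cmod (step d n)); auto. rewrite <- Cmod_mult.
  replace (((F (z + step d n) - F z) / step d n - l) * step d n) with
    (F (z + step d n) - F z - l * step d n) by (field; auto).
  eapply Rle_lt_trans; [apply B|]. apply Rmult_lt_compat_r; lra.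
Qed.

(** The difference quotients of [F] are holomorphic and, by [deriv_bound] and the mean value
    inequality, uniformly bounded, so [hol_limit] applies to them. *)
Lemma hol_derive (F : C -> C) (z0 : C) (R : R) : 0 < R ->
  (forall w, Cmod (w - z0) < R -> hol F w) -> hol (C_derive F) z0.
Proof.
  intros HR H.
  destruct (hol_cont F z0 (H z0 ltac:(rewrite Cmod_self; auto)) 1 ltac:(lra)) as (d & Hd & B).
  set (r := Rmin R d). assert (Hr : 0 < r) by (apply Rmin_glb_lt; auto).
  assert (r <= R) by apply Rmin_l. assert (r <= d) by apply Rmin_r.
  set (M := (Cmod (F z0) + 1)%R).
  assert (HF : forall w, Cmod (w - z0) < r -> hol F w /\ Cmod (F w) <= M).
  { intros w Hw. split; [apply H; lra|]. specialize (B w ltac:(lra)).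
    pose proof (Cmod_le_add_sub (F w) (F z0)). unfold M; lra. }
  destruct (hol_limit (fun n z => (F (z + step (r / 4) n) - F z) / step (r / 4) n)
    (C_derive F) z0 (r / 4) (4 * M / r)) as (l & _ & Hl).
  - lra.
  - intros n w Hw. destruct (step_bound (r / 4) n ltac:(lra)) as [S1 S2].
    assert (N0 : step (r/4) n <> 0) by (now apply Cmod_gt_0).
    assert (W : Cmod (w + step (r / 4) n - z0) < r / 2).
    { replace (w + step (r / 4) n - z0) with ((w - z0) + step (r/4) n) by ring.
      eapply Rle_lt_trans; [apply Cmod_triangle|]. lra. }
    split.
    + apply hol_div; [|apply hol_const|auto]. apply hol_minus; [apply hol_translate|]; apply HF; lra.
    + rewrite Cmod_div by auto. apply Rle_div_l; auto.
      replace (step (r / 4) n) with (w + step (r/4) n - w) at 2 by ring.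
      apply (ball_mean_value F (C_derive F) z0 (r / 2)); [| |lra|lra].
      * intros u Hu. apply sdiff_cdiff, hol_sdiff, HF. lra.
      * intros u Hu. apply (deriv_bound F z0 u r M); auto. lra.
  - intros w Hw. apply quotient_cvg; [lra|]. apply sdiff_cdiff, hol_sdiff, H. lra.
  - exists l; auto.
Qed.

(** * Holomorphic functions of two variables *)

Definition hol2 (Phi : C -> C -> C) (z0 w0 : C) : Prop :=
  exists R M, 0 < R /\ forall z w, Cmod (z - z0) < R -> Cmod (w - w0) < R ->
    hol (fun z => Phi z w) z /\ hol (Phi z) w /\ Cmod (Phi z w) <= M.

Definition partial1 (Phi : C -> C -> C) (z w : C) : C := C_derive (fun z => Phi z w) z.
Definition partial2 (Phi : C -> C -> C) (z w : C) : C := C_derive (Phi z) w.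

Lemma hol2_flip (Phi : C -> C -> C) (z0 w0 : C) (R M : R) :
  (forall z w, Cmod (z - z0) < R -> Cmod (w - w0) < R ->
    hol (fun z => Phi z w) z /\ hol (Phi z) w /\ Cmod (Phi z w) <= M) ->
  forall w z, Cmod (w - w0) < R -> Cmod (z - z0) < R ->
    hol (fun w => Phi z w) w /\ hol (fun z => Phi z w) z /\ Cmod (Phi z w) <= M.
Proof. intros H w z Hw Hz. destruct (H z w Hz Hw) as (A & B & D). auto. Qed.

(** [deriv_bound] in the first variable, for [Phi z w - Phi z w0], which is small by the mean value
    inequality in the second. This yields 16; the weaker 32 matches the constant of
    [strict_estimate]. *)
Lemma partial1_lipschitz (Phi : C -> C -> C) (z0 w0 w : C) (R M : R) : 0 < R -> 0 <= M ->
  (forall z w, Cmod (z - z0) < R -> Cmod (w - w0) < R ->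
    hol (fun z => Phi z w) z /\ hol (Phi z) w /\ Cmod (Phi z w) <= M) ->
  Cmod (w - w0) < R / 2 ->
  Cmod (partial1 Phi z0 w - partial1 Phi z0 w0) <= 32 * M / (R * R) * Cmod (w - w0).
Proof.
  intros HR HM H Hw. unfold partial1.
  assert (Z0 : forall a r, 0 < r -> Cmod (a - a) < r) by (intros; rewrite Cmod_self; auto).
  assert (S : forall v, Cmod (v - w0) < R / 2 -> sdiff (fun z => Phi z v) z0 (C_derive (fun z => Phi z v) z0)).
  { intros v Hv. apply hol_sdiff, H; auto. lra. }
  rewrite <- (sdiff_C_derive (fun z => Phi z w - Phi z w0) z0 _
    (sdiff_minus _ _ z0 _ _ (S w Hw) (S w0 ltac:(apply Z0; lra)))).
  apply Rle_trans with (4 * (4 * M / R * Cmod (w - w0)) / R)%R.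
  - apply (deriv_bound (fun z => Phi z w - Phi z w0) z0 z0 R); auto; [|rewrite Cmod_self; lra].
    intros z Hz. split.
    + apply hol_minus; apply H; auto; lra.
    + apply (ball_mean_value (Phi z) (C_derive (Phi z)) w0 (R / 2)); [| |lra|apply Z0; lra].
      * intros v Hv. apply sdiff_cdiff, hol_sdiff, H; lra.
      * intros v Hv. apply (deriv_bound (Phi z) w0 v R); auto; [|lra].
        intros v' Hv'. split; apply H; auto.
  - assert (HRR : 0 < R * R) by (apply Rmult_lt_0_compat; auto).
    replace (4 * (4 * M / R * Cmod (w - w0)) / R)%R
      with (16 * (M / (R * R) * Cmod (w - w0)))%R by (field; lra).
    replace (32 * M / (R * R) * Cmod (w - w0))%R with (32 * (M / (R * R) * Cmod (w - w0)))%R by (field; lra).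
    apply Rmult_le_compat_r; [|lra]. apply Rmult_le_pos; [|apply Cmod_ge_0].
    apply Rmult_le_pos; auto. left. apply Rinv_0_lt_compat; auto.
Qed.

(** Separate holomorphy with a local bound gives joint differentiability: go from [(z,w)] to
    [(z',w)] and then to [(z',w')], use [strict_estimate] on each leg, and move the two partial
    derivatives to the base point by [partial1_lipschitz]. *)
Lemma hol2_strict2 (Phi : C -> C -> C) (z0 w0 : C) : hol2 Phi z0 w0 ->
  strict2 Phi z0 w0 (partial1 Phi z0 w0) (partial2 Phi z0 w0).
Proof.
  intros (R & M & HR & H) e He.
  assert (Z0 : forall a r, 0 < r -> Cmod (a - a) < r) by (intros; rewrite Cmod_self; auto).
  assert (HM : 0 <= M).
  { destruct (H z0 w0) as (_ & _ & A); auto. pose proof (Cmod_ge_0 (Phi z0 w0)). lra. }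
  set (K := (32 * M / (R * R))%R).
  assert (HK : 0 <= K).
  { apply Rmult_le_pos; [lra|]. left. apply Rinv_0_lt_compat, Rmult_lt_0_compat; auto. }
  assert (D1 : forall w, Cmod (w - w0) < R / 2 -> Cmod (partial1 Phi z0 w - partial1 Phi z0 w0) <= K * Cmod (w - w0)).
  { intros w Hw. apply partial1_lipschitz; auto. }
  assert (D2 : forall z, Cmod (z - z0) < R / 2 -> Cmod (partial2 Phi z w0 - partial2 Phi z0 w0) <= K * Cmod (z - z0)).
  { intros z Hz. apply (partial1_lipschitz (fun w z => Phi z w) w0 z0 z R M); auto. apply hol2_flip; auto. }
  destruct (linear_small (2 * K) e) as (q & Hq & Bq); auto; [lra|].
  set (rho := Rmin (q / 2) (R / 4)). assert (Hr : 0 < rho) by (apply Rmin_glb_lt; lra).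
  assert (R1 : rho <= q / 2) by apply Rmin_l. assert (R2 : rho <= R / 4) by apply Rmin_r.
  specialize (Bq rho ltac:(lra)).
  exists rho; split; auto. intros z z' w w' Hz Hz' Hw Hw'.
  assert (E1 : Cmod (Phi z w - Phi z' w - partial1 Phi z0 w * (z - z')) <= K * rho * Cmod (z - z')).
  { apply (strict_estimate (fun z => Phi z w) z0 z z' R M rho); auto.
    intros v Hv. split; apply H; auto; lra. }
  assert (E2 : Cmod (Phi z' w - Phi z' w' - partial2 Phi z' w0 * (w - w')) <= K * rho * Cmod (w - w')).
  { apply (strict_estimate (Phi z') w0 w w' R M rho); auto.
    intros v Hv. split; apply H; auto; lra. }
  specialize (D1 w ltac:(lra)). specialize (D2 z' ltac:(lra)).
  assert (D1' : Cmod (partial1 Phi z0 w - partial1 Phi z0 w0) <= K * rho)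
    by (eapply Rle_trans; [exact D1 | apply Rmult_le_compat_l; lra]).
  assert (D2' : Cmod (partial2 Phi z' w0 - partial2 Phi z0 w0) <= K * rho)
    by (eapply Rle_trans; [exact D2 | apply Rmult_le_compat_l; lra]).
  replace (Phi z w - Phi z' w' - (partial1 Phi z0 w0 * (z - z') + partial2 Phi z0 w0 * (w - w'))) with
    ((Phi z w - Phi z' w - partial1 Phi z0 w * (z - z')) + (partial1 Phi z0 w - partial1 Phi z0 w0) * (z - z')
     + ((Phi z' w - Phi z' w' - partial2 Phi z' w0 * (w - w')) + (partial2 Phi z' w0 - partial2 Phi z0 w0) * (w - w'))) by ring.
  apply Rle_trans with ((K * rho * Cmod (z - z') + K * rho * Cmod (z - z'))
     + (K * rho * Cmod (w - w') + K * rho * Cmod (w - w')))%R.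
  - apply Cmod_add_le; apply Cmod_add_le; auto; apply Cmod_mult_le; auto; lra.
  - replace ((K * rho * Cmod (z - z') + K * rho * Cmod (z - z'))
     + (K * rho * Cmod (w - w') + K * rho * Cmod (w - w')))%R
     with (2 * K * rho * (Cmod (z - z') + Cmod (w - w')))%R by ring.
    apply Rmult_le_compat_r; [|lra]. pose proof (Cmod_ge_0 (z - z')). pose proof (Cmod_ge_0 (w - w')). lra.
Qed.

(** Holomorphy in the second variable follows once more from [hol_limit], the partial derivative
    being a limit of difference quotients in the first variable. It serves to differentiate [eta_1]
    with respect to the period. *)
Lemma hol2_partial1 (Phi : C -> C -> C) (z0 w0 : C) : hol2 Phi z0 w0 -> hol2 (partial1 Phi) z0 w0.
Proof.
  intros (R & M & HR & H).
  exists (R / 4)%R, (4 * M / R)%R. split; [lra|]. intros z w Hz Hw.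
  assert (Hb : forall z, Cmod (z - z0) <= R / 2 -> forall w, Cmod (w - w0) < R -> Cmod (partial1 Phi z w) <= 4 * M / R).
  { intros z1 Hz1 w1 Hw1. apply (deriv_bound (fun z => Phi z w1) z0 z1 R M); auto.
    intros v Hv. split; apply H; auto. }
  split; [|split; [|apply Hb; lra]].
  - apply (hol_derive (fun z => Phi z w) z (R / 4)); [lra|]. intros v Hv.
    apply H; [|lra]. pose proof (Cmod_triangle_sub v z z0). lra.
  - destruct (hol_limit (fun n w => (Phi (z + step (R / 4) n) w - Phi z w) / step (R / 4) n)
      (fun w => partial1 Phi z w) w (R / 4) (4 * M / R)) as (l & _ & Hl); [lra| | |exists l; exact Hl].
    + intros n v Hv. destruct (step_bound (R / 4) n ltac:(lra)) as [S1 S2].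
      assert (N0 : step (R/4) n <> 0) by (now apply Cmod_gt_0).
      assert (W : Cmod (z + step (R / 4) n - z0) < R / 2).
      { replace (z + step (R / 4) n - z0) with ((z - z0) + step (R/4) n) by ring.
        eapply Rle_lt_trans; [apply Cmod_triangle|]. lra. }
      assert (V : Cmod (v - w0) < R) by (pose proof (Cmod_triangle_sub v w w0); lra).
      split.
      * apply hol_div; [|apply hol_const|auto]. apply hol_minus; apply H; lra.
      * rewrite Cmod_div by auto. apply Rle_div_l; auto.
        replace (step (R / 4) n) with (z + step (R/4) n - z) at 2 by ring.
        apply (ball_mean_value (fun z => Phi z v) (fun z => partial1 Phi z v) z0 (R / 2)); [| |lra|lra].
        -- intros u Hu. apply sdiff_cdiff, (hol_sdiff (fun z => Phi z v)), H; lra.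
        -- intros u Hu. apply Hb; lra.
    + intros v Hv. apply (quotient_cvg (fun z => Phi z v)); [lra|].
      apply sdiff_cdiff, (hol_sdiff (fun z => Phi z v)), H; [lra|].
      pose proof (Cmod_triangle_sub v w w0); lra.
Qed.

(** * Division by a zero, removable singularities and Liouville's theorem *)

Lemma divide_zero (k : C -> C) (a : C) (R : R) : 0 < R ->
  (forall z, Cmod (z - a) < R -> hol k z) -> k a = 0 ->
  exists G, (forall z, Cmod (z - a) < R -> hol G z) /\ (forall z, z <> a -> G z = k z / (z - a))
    /\ G a = C_derive k a.
Proof.
  intros HR H Ha.
  assert (Ha0 : Cmod (a - a) < R) by (rewrite Cmod_self; auto).
  set (c1 := C_derive k a).
  assert (Hd := hol_derive k a R HR H). destruct Hd as [c2 Hc2].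
  set (c3 := c2 * RtoC (1 / 2)).
  assert (Hc3 : c2 = c3 + c3).
  { unfold c3. replace (c2 * RtoC (1 / 2) + c2 * RtoC (1 / 2)) with (c2 * (RtoC (1 / 2) + RtoC (1 / 2))) by ring.
    rewrite <- RtoC_plus. replace (1 / 2 + 1 / 2)%R with 1%R by lra. ring. }
  (* The second-order Taylor polynomial at [a] is removed, [c3] being half the second derivative.
     Then [T] is [o((z - a)^2)] and its derivative [o(z - a)], so [S = T / (z - a)] is continuously
     differentiable across [a] with derivative 0 there. *)
  set (T := fun z => k z - (c1 + c3 * (z - a)) * (z - a)).
  set (S := fun z => T z / (z - a)).
  set (dS := fun z => (C_derive k z - c1 - c2 * (z - a) - S z) / (z - a)).
  (* The numerator [T a] is 0, so this holds whatever the inverse of 0 is. *)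
  assert (Sa : S a = 0).
  { unfold S, T. rewrite Ha. replace (a - a) with (RtoC 0) by ring. unfold Cdiv. ring. }
  assert (HT : forall z, Cmod (z - a) < R -> sdiff T z (C_derive k z - c1 - c2 * (z - a))).
  { intros z Hz. unfold T.
    eapply sdiff_ext; [reflexivity| |apply sdiff_minus; [apply hol_sdiff, H, Hz|
      apply sdiff_mult; [apply sdiff_plus; [apply sdiff_const | apply sdiff_scal]|]; 
      apply sdiff_minus; [apply sdiff_id | apply sdiff_const | apply sdiff_id | apply sdiff_const]]].
    rewrite Hc3. ring. }
  assert (HS : forall z, Cmod (z - a) < R -> z <> a -> sdiff S z (dS z)).
  { intros z Hz N. apply Cminus_ne_0 in N. unfold S, dS.
    eapply sdiff_ext; [reflexivity| |apply (sdiff_mult T (fun z => / (z - a)));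
      [apply HT; auto | apply (sdiff_comp Cinv (fun z => z - a)); [apply sdiff_inv; auto | 
        apply sdiff_minus; [apply sdiff_id | apply sdiff_const]]]].
    unfold S. field; auto. }
  assert (HSm : forall e, 0 < e -> exists d, 0 < d /\ forall z, Cmod (z - a) < d ->
     Cmod (C_derive k z - c1 - c2 * (z - a)) <= e * Cmod (z - a) /\ Cmod (S z) <= e * Cmod (z - a)).
  { intros e He. destruct (sdiff_cdiff _ _ _ Hc2 e He) as (d & Hd & B).
    exists (Rmin d R). split; [apply Rmin_glb_lt; auto|]. intros z Hz.
    Rmin_facts d R. split; [apply B; lra|].
    destruct (Ceq_dec z a) as [->|N].
    { rewrite Sa, Cmod_0. apply Rmult_le_pos; [lra | apply Cmod_ge_0]. }
    apply Cminus_ne_0 in N. unfold S. rewrite Cmod_div by auto.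
    apply Rle_div_l; [now apply Cmod_gt_0|].
    assert (T a = 0) as Ta by (unfold T; rewrite Ha; ring).
    replace (T z) with (T z - T a) by (rewrite Ta; ring).
    apply (segment_mean_value T (fun z => C_derive k z - c1 - c2 * (z - a)) a z).
    - intros s Hs. apply sdiff_cdiff, HT. apply seg_point_near; auto; lra.
    - intros s Hs.
      assert (Q : Cmod (a + RtoC s * (z - a) - a) <= Cmod (z - a)).
      { replace (a + RtoC s * (z - a) - a) with (RtoC s * (z - a)) by ring.
        rewrite Cmod_mult, Cmod_R, Rabs_pos_eq by lra.
        rewrite <- (Rmult_1_l (Cmod (z - a))) at 2. apply Rmult_le_compat_r; [apply Cmod_ge_0 | lra]. }
      eapply Rle_trans; [apply B; lra|]. apply Rmult_le_compat_l; lra. }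
  set (dS' := fun z => if Ceq_dec z a then RtoC 0 else dS z).
  assert (HSa : sdiff S a 0).
  { replace (RtoC 0) with (dS' a) by (unfold dS'; destruct (Ceq_dec a a); [auto | contradiction]).
    apply (sdiff_of_C1 S dS' a R HR).
    - intros z Hz. unfold dS'. destruct (Ceq_dec z a) as [->|N].
      + intros e He. destruct (HSm e He) as (d & Hd & B). exists d; split; auto.
        intros w Hw. rewrite Sa. replace (S w - 0 - 0 * (w - a)) with (S w) by ring. apply B; auto.
      + apply sdiff_cdiff, HS; auto.
    - intros e He. destruct (HSm (e / 2)%R ltac:(lra)) as (d & Hd & B). exists d; split; auto.
      intros z Hz. unfold dS'. destruct (Ceq_dec a a) as [_|]; [|contradiction].
      destruct (Ceq_dec z a) as [->|N].
      + rewrite Cmod_self; lra.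
      + apply Cminus_ne_0 in N. destruct (B z Hz) as [B1 B2].
        replace (dS z - 0) with (dS z) by ring. unfold dS. rewrite Cmod_div by auto.
        apply Rle_div_l; [now apply Cmod_gt_0|]. eapply Rle_trans; [apply Cmod_minus_le|]. lra. }
  exists (fun z => c1 + c3 * (z - a) + S z). split; [|split].
  - intros z Hz. apply hol_plus; [apply hol_plus; [apply hol_const|]|].
    + apply hol_mult; [apply hol_const | apply hol_minus; [apply hol_id | apply hol_const]].
    + destruct (Ceq_dec z a) as [->|N]; [exists 0; auto | exists (dS z); auto].
  - intros z N. apply Cminus_ne_0 in N. unfold S, T. field; auto.
  - rewrite Sa. ring.
Qed.

(** [k = (z - a)^2 F] is continuously differentiable across [a], with [k] and its derivative
    vanishing there, so [divide_zero] can be applied twice. The derivative of [F] near [a] is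
    controlled by Cauchy's estimate on the circle about [z] of half the distance to [a]. *)
Lemma removable_singularity (F : C -> C) (a : C) (R : R) : 0 < R ->
  (forall z, Cmod (z - a) < R -> z <> a -> hol F z) ->
  (forall e, 0 < e -> exists d, 0 < d /\ forall z, Cmod (z - a) < d -> z <> a ->
    Cmod ((z - a) * F z) <= e) ->
  exists G, (forall z, Cmod (z - a) < R -> hol G z) /\ (forall z, z <> a -> G z = F z).
Proof.
  intros HR H Hs.
  set (k := fun z => (z - a) * (z - a) * F z).
  set (dk := fun z => if Ceq_dec z a then RtoC 0 else ((z - a) + (z - a)) * F z + (z - a) * (z - a) * C_derive F z).
  assert (dka : dk a = 0) by (unfold dk; destruct (Ceq_dec a a); [auto | contradiction]).
  assert (ka : k a = 0) by (unfold k; ring).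
  assert (Hk : forall z, Cmod (z - a) < R -> z <> a -> sdiff k z (dk z)).
  { intros z Hz N. unfold dk. destruct (Ceq_dec z a) as [|_]; [contradiction|]. unfold k.
    eapply sdiff_ext; [reflexivity| |apply sdiff_mult; [apply sdiff_mult; apply sdiff_minus;
      [apply sdiff_id | apply sdiff_const | apply sdiff_id | apply sdiff_const] | apply hol_sdiff, H; auto]].
    cbv beta; ring. }
  assert (Hdk : forall e, 0 < e -> exists d, 0 < d /\ forall z, Cmod (z - a) < d -> z <> a -> Cmod (dk z) <= e).
  (* With [m = Cmod (z - a)], [F] is at most [e / 5 / m] on the circle of radius [m / 2] about [z],
     so the last term of [dk] is at most [2 e / 5]; the first one costs [e / 10] twice. *)
  { intros e He. destruct (Hs (e / 10)%R ltac:(lra)) as (d & Hd & B).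
    exists (Rmin (d / 2) (R / 2)). split; [apply Rmin_glb_lt; lra|]. intros z Hz N.
    Rmin_facts (d / 2)%R (R / 2)%R.
    unfold dk. destruct (Ceq_dec z a) as [|_]; [contradiction|].
    assert (N' := Cminus_ne_0 _ _ N). assert (Hm := proj1 (Cmod_gt_0 _) N').
    set (m := Cmod (z - a)) in *.
    assert (Q : Cmod (C_derive F z) <= (e / 5 / m) / (m / 2)).
    { apply (cauchy_estimate F (C_derive F) z m); [|lra|].
      - intros w Hw. apply hol_sdiff, H.
        + pose proof (Cmod_triangle_sub w z a). fold m in H2. lra.
        + intros ->. rewrite Cmod_minus_sym in Hw. fold m in Hw. lra.
      - intros w Hw.
        assert (W1 : m / 2 <= Cmod (w - a)).
        { pose proof (Cmod_triangle_sub z w a). rewrite (Cmod_minus_sym z w), Hw in H2. fold m in H2. lra. }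
        assert (W2 : w <> a) by (intros ->; rewrite Cmod_self in W1; lra).
        assert (W3 : Cmod (w - a) < d).
        { pose proof (Cmod_triangle_sub w z a). fold m in H2. lra. }
        specialize (B w W3 W2). rewrite Cmod_mult in B.
        apply Rle_div_r; [lra|].
        assert (Cmod (F w) * (m / 2) <= Cmod (F w) * Cmod (w - a)) by (apply Rmult_le_compat_l; [apply Cmod_ge_0|auto]).
        lra. }
    specialize (B z ltac:(fold m; lra) N).
    replace (((z - a) + (z - a)) * F z) with ((z - a) * F z + (z - a) * F z) by ring.
    apply Rle_trans with (e / 10 + e / 10 + m * m * (e / 5 / m / (m / 2)))%R.
    - apply Cmod_add_le; [apply Cmod_add_le; auto | apply Cmod_mult_le; auto].
      rewrite Cmod_mult. fold m. lra.
    - replace (m * m * (e / 5 / m / (m / 2)))%R with (2 * e / 5)%R by (field; lra). lra. }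
  assert (Hka : sdiff k a 0).
  { rewrite <- dka. apply (sdiff_of_C1 k dk a R HR).
    - intros z Hz. destruct (Ceq_dec z a) as [->|N]; [|apply sdiff_cdiff; auto].
      rewrite dka. intros e He. destruct (Hs e He) as (d & Hd & B). exists d; split; auto.
      intros w Hw. rewrite ka. replace (k w - 0 - 0 * (w - a)) with ((w - a) * F w * (w - a)) by (unfold k; ring).
      rewrite Cmod_mult. destruct (Ceq_dec w a) as [->|N].
      + rewrite Cmod_self. lra.
      + apply Rmult_le_compat_r; [apply Cmod_ge_0|]. auto.
    - intros e He. destruct (Hdk e He) as (d & Hd & B). exists d; split; auto. intros z Hz.
      rewrite dka. replace (dk z - 0) with (dk z) by ring.
      destruct (Ceq_dec z a) as [->|N]; auto. rewrite dka, Cmod_0; lra. }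
  destruct (divide_zero k a R HR) as (G1 & A1 & A2 & A3); auto.
  { intros z Hz. destruct (Ceq_dec z a) as [->|N]; [exists 0; auto | exists (dk z); auto]. }
  rewrite (sdiff_C_derive _ _ _ Hka) in A3.
  destruct (divide_zero G1 a R HR A1 A3) as (G & B1 & B2 & B3).
  exists G. split; auto. intros z N. rewrite B2, A2 by auto. apply Cminus_ne_0 in N.
  unfold k. field; auto.
Qed.

Lemma liouville (F : C -> C) (M : R) :
  (forall z, hol F z) -> (forall z, Cmod (F z) <= M) -> forall z z', F z = F z'.
Proof.
  intros H HM.
  assert (HM0 : 0 <= M) by (eapply Rle_trans; [apply Cmod_ge_0 | apply (HM 0)]).
  assert (D : forall z e, 0 < e -> Cmod (C_derive F z) <= e).
  { intros z e He. apply Rle_trans with (M / ((M + 1) / e))%R.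
    - apply (cauchy_estimate F (C_derive F) z ((M + 1) / e + 1)); auto.
      + intros; apply hol_sdiff; auto.
      + assert (0 < (M + 1) / e) by (apply Rdiv_lt_0_compat; lra). lra.
    - replace (M / ((M + 1) / e))%R with (e * (M / (M + 1)))%R by (field; lra).
      rewrite <- (Rmult_1_r e) at 2. apply Rmult_le_compat_l; [lra|]. apply Rle_div_l; lra. }
  intros z z'. apply Cmod_small_eq. intros e He.
  pose proof (Cmod_ge_0 (z - z')).
  apply Rle_trans with (e / (Cmod (z - z') + 1) * Cmod (z - z'))%R.
  - apply (segment_mean_value F (C_derive F) z' z); intros.
    + apply sdiff_cdiff, hol_sdiff; auto.
    + apply D. apply Rdiv_lt_0_compat; lra.
  - replace (e / (Cmod (z - z') + 1) * Cmod (z - z'))%R with (e * (Cmod (z - z') / (Cmod (z - z') + 1)))%R by (field; lra).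
    rewrite <- (Rmult_1_r e) at 2. apply Rmult_le_compat_l; [lra|]. apply Rle_div_l; lra.
Qed.

(** Compactness, one coordinate at a time. As [interval_uniform] carries a single positive number,
    [r] serves both as the radius of a neighbourhood and, through [/ r], as the bound on it. *)
Lemma rectangle_bounded (F : C -> C) (a b c d : R) :
  (forall z0, exists r M, 0 < r /\ forall z, Cmod (z - z0) < r -> Cmod (F z) <= M) -> exists M, forall x y, a <= x <= b -> c <= y <= d -> Cmod (F (x, y)) <= M.
Proof.
  intros H.
  assert (L : forall x0 y0, exists r, 0 < r /\ forall x y, Rabs (x - x0) < r -> Rabs (y - y0) < r ->
    Cmod (F (x, y)) <= / r).
  { intros x0 y0. destruct (H (x0, y0)) as (r & M & Hr & B).
    set (K := Rmax 1 M). assert (HK : 1 <= K) by apply Rmax_l. assert (HK' : M <= K) by apply Rmax_r.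
    exists (Rmin (r / 2) (/ K)). split; [apply Rmin_glb_lt; [lra | apply Rinv_0_lt_compat; lra]|].
    Rmin_facts (r / 2)%R (/ K)%R.
    intros x y Hx Hy. apply Rle_trans with K.
    - assert (Q : Cmod ((x, y) - (x0, y0)) < r).
      { eapply Rle_lt_trans; [apply Cmod_le_Re_Im|]. simpl. unfold Rminus in *. lra. }
      specialize (B _ Q). lra.
    - assert (HKi : 0 < / K) by (apply Rinv_0_lt_compat; lra).
      replace K with (/ / K)%R at 1 by apply Rinv_inv. apply Rinv_le_contravar; auto.
      apply Rmin_glb_lt; lra. }
  destruct (interval_uniform a b (fun x r => forall y, c <= y <= d -> Cmod (F (x, y)) <= / r)) as (r & Hr & B).
  - intros x r r' Q Hr' y Hy. eapply Rle_trans; [apply Q; auto|]. apply Rinv_le_contravar; lra.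
  - intros x0 _.
    destruct (interval_uniform c d (fun y r => forall x, Rabs (x - x0) < r -> Cmod (F (x, y)) <= / r)) as (r & Hr & B).
    + intros y r r' Q Hr' x Hx. eapply Rle_trans; [apply Q; lra|]. apply Rinv_le_contravar; lra.
    + intros y0 _. destruct (L x0 y0) as (r & Hr & B). exists r; split; [auto | intros; apply B; auto].
    + exists r; split; [auto|]. intros x _ Hx y Hy. apply B; auto.
  - exists (/ r)%R. auto.
Qed.

Lemma hol_locally_bounded (F : C -> C) (z0 : C) : hol F z0 ->
  exists r M, 0 < r /\ forall z, Cmod (z - z0) < r -> Cmod (F z) <= M.
Proof.
  intros H. destruct (hol_cont F z0 H 1 ltac:(lra)) as (r & Hr & B).
  exists r, (Cmod (F z0) + 1)%R. split; auto. intros z Hz. specialize (B z Hz).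
  pose proof (Cmod_le_add_sub (F z) (F z0)). lra.
Qed.

(** * The Weierstrass product *)

Definition Rsum {A : Type} (F : A -> R) (l : list A) : R :=
  fold_right (fun a s => F a + s)%R 0%R l.

Lemma Rsum_app {A : Type} (F : A -> R) (l l' : list A) : (Rsum F (l ++ l') = Rsum F l + Rsum F l')%R.
Proof. induction l as [|a l IH]; simpl; [ring | rewrite IH; ring]. Qed.

Lemma Rsum_perm {A : Type} (F : A -> R) (l l' : list A) : Permutation l l' -> Rsum F l = Rsum F l'.
Proof. induction 1; simpl; try congruence; lra. Qed.

Lemma Rsum_le {A : Type} (F G : A -> R) (l : list A) :
  (forall a, In a l -> F a <= G a) -> Rsum F l <= Rsum G l.
Proof.
  induction l as [|a l IH]; simpl; intros H; [lra|].
  apply Rplus_le_compat; [apply H; auto | apply IH; auto].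
Qed.

Lemma Rsum_nonneg {A : Type} (F : A -> R) (l : list A) :
  (forall a, In a l -> 0 <= F a) -> 0 <= Rsum F l.
Proof.
  induction l as [|a l IH]; simpl; intros H; [lra|].
  apply Rplus_le_le_0_compat; [apply H; auto | apply IH; auto].
Qed.

Lemma Rsum_scal {A : Type} (c : R) (F : A -> R) (l : list A) : (Rsum (fun a => c * F a) l = c * Rsum F l)%R.
Proof. induction l as [|a l IH]; simpl; [ring | rewrite IH; ring]. Qed.

Lemma Rsum_const_bound {A : Type} (F : A -> R) (K : R) (l : list A) :
  (forall a, In a l -> F a <= K) -> Rsum F l <= INR (length l) * K.
Proof.
  induction l as [|a l IH]; intros H; [simpl; lra|].
  change (length (a :: l)) with (S (length l)). rewrite S_INR. simpl Rsum.
  assert (F a <= K) by (apply H; simpl; auto).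
  assert (Rsum F l <= INR (length l) * K) by (apply IH; intros; apply H; simpl; auto). lra.
Qed.

Lemma Cprod_app {A : Type} (F : A -> C) (l l' : list A) : Cprod F (l ++ l') = Cprod F l * Cprod F l'.
Proof. induction l as [|a l IH]; simpl; [ring | rewrite IH; ring]. Qed.

Lemma Cprod_perm {A : Type} (F : A -> C) (l l' : list A) : Permutation l l' -> Cprod F l = Cprod F l'.
Proof.
  induction 1; simpl; try congruence; rewrite !Cmult_assoc; f_equal; ring.
Qed.

Lemma Csum_perm {A : Type} (F : A -> C) (l l' : list A) : Permutation l l' -> Csum F l = Csum F l'.
Proof.
  induction 1; simpl; try congruence; rewrite !Cplus_assoc; f_equal; ring.
Qed.

Lemma Cprod_ext {A : Type} (F G : A -> C) (l : list A) :
  (forall a, In a l -> F a = G a) -> Cprod F l = Cprod G l.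
Proof.
  induction l as [|a l IH]; simpl; intros H; auto. rewrite H, IH; auto.
Qed.

Lemma Csum_ext {A : Type} (F G : A -> C) (l : list A) :
  (forall a, In a l -> F a = G a) -> Csum F l = Csum G l.
Proof.
  induction l as [|a l IH]; simpl; intros H; auto. rewrite H, IH; auto.
Qed.

Lemma Cprod_ne_0 {A : Type} (F : A -> C) (l : list A) :
  (forall a, In a l -> F a <> 0) -> Cprod F l <> 0.
Proof.
  induction l as [|a l IH]; simpl; intros H.
  - intros E; apply RtoC_inj in E; lra.
  - apply Cmult_neq_0; auto.
Qed.

(** Both bounds rest on [1 + x <= exp x]. They are proved together because the induction step of the
    second uses the first. *)
Lemma Cprod_bound {A : Type} (F : A -> C) (l : list A) :
  Cmod (Cprod F l) <= exp (Rsum (fun a => Cmod (F a - 1)) l) /\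
  Cmod (Cprod F l - 1) <= exp (Rsum (fun a => Cmod (F a - 1)) l) - 1.
Proof.
  induction l as [|a l [IH1 IH2]]; simpl.
  - rewrite exp_0, Cmod_1. split; [lra|]. rewrite Cmod_self. lra.
  - rewrite exp_plus. set (x := Cmod (F a - 1)) in *. set (S := exp _) in *.
    assert (Hx := exp_ineq1_le x).
    assert (Hx0 : 0 <= x) by apply Cmod_ge_0.
    assert (HS : 0 < S) by apply exp_pos.
    assert ((1 + x) * S <= exp x * S) by (apply Rmult_le_compat_r; lra).
    split.
    + eapply Rle_trans; [|exact H]. apply Cmod_mult_le; auto.
      pose proof (Cmod_le_add_sub (F a) 1). rewrite Cmod_1 in H0. exact H0.
    + replace (F a * Cprod F l - 1) with ((F a - 1) * Cprod F l + (Cprod F l - 1)) by ring.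
      apply Rle_trans with (x * S + (S - 1))%R; [|lra].
      apply Cmod_add_le; auto. apply Cmod_mult_le; auto. unfold x; lra.
Qed.

(** Keeps the tails of the Weierstrass product away from 0, which is how its zeros are located. *)
Lemma Cprod_lower_bound {A : Type} (F : A -> C) (l : list A) :
  Rsum (fun a => Cmod (F a - 1)) l <= 1 -> 
  1 - Rsum (fun a => Cmod (F a - 1)) l <= Cmod (Cprod F l).
Proof.
  induction l as [|a l IH]; simpl; intros H; [rewrite Cmod_1; lra|].
  set (x := Cmod (F a - 1)) in *. set (S := Rsum _ l) in *.
  assert (Hx : 0 <= x) by apply Cmod_ge_0.
  assert (HS : 0 <= S) by (apply Rsum_nonneg; intros; apply Cmod_ge_0).
  specialize (IH ltac:(lra)). rewrite Cmod_mult.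
  assert (1 - x <= Cmod (F a)).
  { pose proof (Cmod_le_add_sub 1 (F a)). rewrite Cmod_1, Cmod_minus_sym in H0. fold x in H0. lra. }
  apply Rle_trans with ((1 - x) * (1 - S))%R.
  - assert (0 <= x * S) by (apply Rmult_le_pos; auto). lra.
  - apply Rmult_le_compat; lra.
Qed.

Definition zrank (p : Z * Z) : Z := Z.max (Z.abs (fst p)) (Z.abs (snd p)).
Definition zrange (N : nat) : list Z := map (fun n => (Z.of_nat n - Z.of_nat N)%Z) (seq 0 (2 * N + 1)).

Lemma in_zrange (N : nat) (a : Z) : In a (zrange N) <-> (Z.abs a <= Z.of_nat N)%Z.
Proof.
  unfold zrange. rewrite in_map_iff. split.
  - intros (n & <- & H). apply in_seq in H. lia.
  - intros H. exists (Z.to_nat (a + Z.of_nat N)). split; [lia|]. apply in_seq. lia.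
Qed.

Lemma NoDup_zrange (N : nat) : NoDup (zrange N).
Proof.
  unfold zrange. apply FinFun.Injective_map_NoDup; [|apply seq_NoDup].
  intros x y H. lia.
Qed.

Lemma length_zrange (N : nat) : length (zrange N) = (2 * N + 1)%nat.
Proof. unfold zrange. now rewrite length_map, length_seq. Qed.

Lemma NoDup_list_prod {A B : Type} (l : list A) (l' : list B) :
  NoDup l -> NoDup l' -> NoDup (list_prod l l').
Proof.
  intros H H'. induction H as [|a l Ha Hl IH]; simpl; [constructor|].
  apply NoDup_app; auto.
  - apply FinFun.Injective_map_NoDup; auto. intros x y E; now inversion E.
  - intros [x y] Hx Hy. apply in_map_iff in Hx. destruct Hx as (u & E & _). inversion E; subst.
    apply in_prod_iff in Hy. tauto.
Qed.

Lemma in_nonzero_indices (N : nat) (p : Z * Z) :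
  In p (nonzero_indices N) <-> (1 <= zrank p <= Z.of_nat N)%Z.
Proof.
  unfold nonzero_indices. fold (zrange N). rewrite filter_In. destruct p as [a b].
  rewrite in_prod_iff, !in_zrange. unfold zrank; simpl.
  destruct (Z.eqb_spec a 0), (Z.eqb_spec b 0); simpl; split; intros; try split; try lia; try tauto;
    destruct H; try discriminate; lia.
Qed.

Lemma NoDup_nonzero_indices (N : nat) : NoDup (nonzero_indices N).
Proof. apply NoDup_filter, NoDup_list_prod; apply NoDup_zrange. Qed.

Definition tail_indices (N M : nat) : list (Z * Z) :=
  filter (fun p => (Z.of_nat N <? zrank p)%Z) (nonzero_indices M).

Lemma in_tail_indices (N M : nat) (p : Z * Z) :
  In p (tail_indices N M) <-> (1 <= zrank p /\ Z.of_nat N < zrank p <= Z.of_nat M)%Z.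
Proof.
  unfold tail_indices. rewrite filter_In, in_nonzero_indices, Z.ltb_lt. lia.
Qed.

Lemma indices_split (N M : nat) : (N <= M)%nat ->
  Permutation (nonzero_indices M) (nonzero_indices N ++ tail_indices N M).
Proof.
  intros H. apply NoDup_Permutation.
  - apply NoDup_nonzero_indices.
  - apply NoDup_app.
    + apply NoDup_nonzero_indices.
    + apply NoDup_filter, NoDup_nonzero_indices.
    + intros p. rewrite in_nonzero_indices, in_tail_indices. lia.
  - intros p. rewrite in_app_iff, !in_nonzero_indices, in_tail_indices. lia.
Qed.

Definition inv_cube (p : Z * Z) : R := (/ (IZR (zrank p) * IZR (zrank p) * IZR (zrank p)))%R.

Lemma zrank_pos (p : Z * Z) : (1 <= zrank p)%Z -> 1 <= IZR (zrank p).
Proof. intros H. now apply IZR_le in H. Qed.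

(** With [n = N + 1], the boundary of the index square is covered by four sides of [2 n + 1]
    indices, so its sum is at most [12 n / n^3]. Since [n + 1 <= 2 n], this is below
    [24 (1/n - 1/(n+1))], a form that telescopes over the shells. *)
Lemma shell_bound (N : nat) : 
  Rsum inv_cube (tail_indices N (S N)) <= 24 * (/ (INR N + 1) - / (INR N + 2)).
Proof.
  assert (HL : (length (tail_indices N (S N)) <= 4 * (2 * (S N) + 1))%nat).
  { set (r := zrange (S N)). set (k := Z.of_nat (S N)).
    assert (E : length (map (fun n => (n, k)) r ++ map (fun n => (n, - k)%Z) r ++
      map (fun n => (k, n)) r ++ map (fun n => ((- k)%Z, n)) r) = (4 * (2 * (S N) + 1))%nat).
    { rewrite !length_app, !length_map. unfold r. rewrite length_zrange. lia. }
    rewrite <- E. apply NoDup_incl_length; [apply NoDup_filter, NoDup_nonzero_indices|].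
    intros [a b] H. apply in_tail_indices in H. unfold zrank in H; simpl fst in H; simpl snd in H.
    rewrite !in_app_iff, !in_map_iff. unfold r.
    assert (b = k \/ b = - k \/ a = k \/ a = - k)%Z as [-> | [-> | [-> | ->]]] by lia;
    [left; exists a | right; left; exists a | right; right; left; exists b | right; right; right; exists b];
    (split; [reflexivity | apply in_zrange; lia]). }
  pose proof (pos_INR N) as HN. set (n := (INR N + 1)%R). assert (Hn : 1 <= n) by (unfold n; lra).
  eapply Rle_trans; [apply (Rsum_const_bound _ (/ (n * n * n)))|].
  - intros p Hp. apply in_tail_indices in Hp. unfold inv_cube.
    assert (E : IZR (zrank p) = n).
    { unfold n. rewrite INR_IZR_INZ, <- plus_IZR. f_equal. lia. }
    rewrite E. lra.
  - assert (HL' : INR (length (tail_indices N (S N))) <= 4 * (2 * n + 1)).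
    { eapply Rle_trans; [apply le_INR, HL|]. rewrite mult_INR, plus_INR, mult_INR, (S_INR N).
      right. unfold n. simpl. ring. }
    apply Rle_trans with (12 * n * / (n * n * n))%R.
    + apply Rmult_le_compat_r; [left; apply Rinv_0_lt_compat; repeat apply Rmult_lt_0_compat; lra|].
      lra.
    + replace (INR N + 2)%R with (n + 1)%R by (unfold n; ring).
      replace (24 * (/ n - / (n + 1)))%R with (12 * n * / (n * n * n) * (2 * n / (n + 1)))%R by (field; lra).
      rewrite <- (Rmult_1_r (12 * n * / (n * n * n))) at 1.
      apply Rmult_le_compat_l.
      * apply Rmult_le_pos; [lra|]. left; apply Rinv_0_lt_compat; repeat apply Rmult_lt_0_compat; lra.
      * apply Rle_div_r; lra.
Qed.

Lemma tail_bound (N k : nat) : 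
  Rsum inv_cube (tail_indices N (N + k)) <= 24 * (/ (INR N + 1) - / (INR (N + k) + 1)).
Proof.
  induction k as [|k IH].
  - replace (N + 0)%nat with N by lia.
    assert (tail_indices N N = []) as ->.
    { destruct (tail_indices N N) as [|p l] eqn:E; auto.
      assert (In p (tail_indices N N)) by (rewrite E; simpl; auto). apply in_tail_indices in H. lia. }
    simpl. lra.
  - assert (P : Permutation (tail_indices N (N + S k)) (tail_indices N (N + k) ++ tail_indices (N + k) (N + S k))).
    { apply NoDup_Permutation.
      - apply NoDup_filter, NoDup_nonzero_indices.
      - apply NoDup_app; [apply NoDup_filter, NoDup_nonzero_indices | apply NoDup_filter, NoDup_nonzero_indices |].
        intros p. rewrite !in_tail_indices. lia.
      - intros p. rewrite in_app_iff, !in_tail_indices. lia. }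
    rewrite (Rsum_perm _ _ _ P), Rsum_app.
    pose proof (shell_bound (N + k)) as Q. replace (S (N + k)) with (N + S k)%nat in Q by lia.
    replace (INR (N + S k) + 1)%R with (INR (N + k) + 2)%R
      by (replace (N + S k)%nat with (S (N + k)) by lia; rewrite S_INR; ring).
    lra.
Qed.

Lemma tail_bound' (N M : nat) : (N <= M)%nat -> Rsum inv_cube (tail_indices N M) <= 24 / (INR N + 1).
Proof.
  intros H. replace M with (N + (M - N))%nat by lia.
  eapply Rle_trans; [apply tail_bound|].
  pose proof (pos_INR (N + (M - N))).
  assert (0 < / (INR (N + (M - N)) + 1)) by (apply Rinv_0_lt_compat; lra). unfold Rdiv. lra.
Qed.

Lemma indices_bound (N : nat) : Rsum inv_cube (nonzero_indices N) <= 24.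
Proof.
  assert (E : Permutation (nonzero_indices N) (tail_indices 0 N)).
  { apply NoDup_Permutation; [apply NoDup_nonzero_indices | apply NoDup_filter, NoDup_nonzero_indices|].
    intros p. rewrite in_nonzero_indices, in_tail_indices. lia. }
  rewrite (Rsum_perm _ _ _ E). eapply Rle_trans; [apply tail_bound'; lia|]. simpl. lra.
Qed.

(** One constant for all periods in a compact part of the upper half plane, so that the product
    converges locally uniformly in the period as well. *)
Lemma lattice_lower_bound (A B : R) : 0 < A -> exists d, 0 < d /\ forall tau p,
  A <= Im tau -> Cmod tau <= B -> d * IZR (zrank p) <= Cmod (lattice_point 1 tau p).
Proof.
  intros HA. set (B' := Rmax 1 B). assert (HB : 1 <= B') by apply Rmax_l.
  assert (HB2 : B <= B') by apply Rmax_r.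
  (* For [w = n + k tau] the imaginary part gives [Cmod w >= A |k|], whence [d <= A]. Next,
     [|n| <= Cmod w + |k| B'], and [d <= 1/2] and [2 d B' <= A] make each of the two terms,
     multiplied by [d], at most [Cmod w / 2]. *)
  set (d := Rmin A (Rmin (1 / 2) (A / (2 * B')))).
  assert (D1 : d <= A) by apply Rmin_l.
  assert (D2 : d <= 1 / 2) by (eapply Rle_trans; [apply Rmin_r | apply Rmin_l]).
  assert (D3 : d * (2 * B') <= A).
  { apply Rle_div_r; [lra|]. eapply Rle_trans; [apply Rmin_r | apply Rmin_r]. }
  assert (Hd : 0 < d).
  { apply Rmin_glb_lt; auto. apply Rmin_glb_lt; [lra | apply Rdiv_lt_0_compat; lra]. }
  exists d. split; auto. intros tau [n k] HIm Htau. unfold lattice_point, zrank; cbn [fst snd].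
  set (w := RtoC (IZR n) * 1 + RtoC (IZR k) * tau).
  assert (W1 : Rabs (IZR k) * A <= Cmod w).
  { eapply Rle_trans; [|apply Im_le_Cmod].
    replace (Im w) with (IZR k * Im tau)%R by (unfold w; destruct tau; simpl; ring).
    rewrite Rabs_mult. apply Rmult_le_compat_l; [apply Rabs_pos|]. rewrite Rabs_pos_eq; lra. }
  assert (W2 : Rabs (IZR n) <= Cmod w + Rabs (IZR k) * B').
  { rewrite <- (Cmod_R (IZR n)). replace (RtoC (IZR n)) with (w - RtoC (IZR k) * tau) by (unfold w; ring).
    eapply Rle_trans; [apply Cmod_minus_le|]. rewrite Cmod_mult, Cmod_R.
    apply Rplus_le_compat_l. apply Rmult_le_compat_l; [apply Rabs_pos | lra]. }
  pose proof (Rabs_pos (IZR k)). pose proof (Rabs_pos (IZR n)).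
  assert (G1 : d * Rabs (IZR k) <= Cmod w).
  { eapply Rle_trans; [|exact W1]. rewrite Rmult_comm. apply Rmult_le_compat_l; auto. }
  assert (G2 : d * Rabs (IZR n) <= Cmod w).
  { apply (Rmult_le_compat_l d) in W2; [|lra].
    assert (d * (Rabs (IZR k) * B') <= Cmod w / 2).
    { assert (Rabs (IZR k) * (d * (2 * B')) <= Rabs (IZR k) * A) by (apply Rmult_le_compat_l; auto). lra. }
    assert (d * Cmod w <= 1 / 2 * Cmod w) by (apply Rmult_le_compat_r; [apply Cmod_ge_0 | auto]). lra. }
  destruct (Z.max_spec (Z.abs n) (Z.abs k)) as [[_ ->] | [_ ->]]; rewrite abs_IZR; auto.
Qed.

(** Weierstrass's primary factor of genus 2. *)
Definition efac (u : C) : C := (1 - u) * Cexp (u + u ^ 2 / 2).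

Lemma RtoC_2_ne_0 : RtoC 2 <> 0.
Proof. intros E; apply RtoC_inj in E; lra. Qed.

Lemma C2_half (u : C) : u ^ 2 / 2 = RtoC (1 / 2) * (u * u).
Proof.
  assert (H2 := RtoC_2_ne_0). rewrite RtoC_div by lra. simpl. field; auto.
Qed.

Lemma half_half : RtoC (1 / 2) + RtoC (1 / 2) = 1.
Proof. rewrite <- RtoC_plus. f_equal; lra. Qed.

Lemma sdiff_efac (u : C) : sdiff efac u (- (u * u) * Cexp (u + u ^ 2 / 2)).
Proof.
  apply (sdiff_ext (fun u => (1 - u) * Cexp (u + RtoC (1 / 2) * (u * u))) _ _
   ((0 - 1) * Cexp (u + RtoC (1 / 2) * (u * u)) +
     (1 - u) * (Cexp (u + RtoC (1 / 2) * (u * u)) * (1 + RtoC (1/2) * (1 * u + u * 1))))).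
  - intros z. unfold efac. now rewrite C2_half.
  - rewrite C2_half.
    replace (1 + RtoC (1 / 2) * (1 * u + u * 1)) with (1 + (RtoC (1 / 2) + RtoC (1 / 2)) * u) by ring.
    rewrite half_half. ring.
  - apply (sdiff_mult (fun u => 1 - u) (fun u => Cexp (u + RtoC (1 / 2) * (u * u)))).
    + apply sdiff_minus; [apply sdiff_const | apply sdiff_id].
    + apply (sdiff_comp Cexp (fun u => u + RtoC (1 / 2) * (u * u))); [apply sdiff_Cexp|].
      apply (sdiff_plus (fun u => u)); [apply sdiff_id|]. apply sdiff_scal.
      apply (sdiff_mult (fun u => u) (fun u => u)); apply sdiff_id.
Qed.

(** The derivative of [efac] collapses to [- u^2 exp(u + u^2/2)]; integrating it from 0 produces the
    third power that makes the product over the lattice converge. *)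
Lemma efac_bound (u : C) (B : R) : Cmod u <= B ->
  Cmod (efac u - 1) <= exp (B + B * B) * (Cmod u * Cmod u * Cmod u).
Proof.
  intros HB. assert (Hu := Cmod_ge_0 u).
  assert (E : efac 0 = 1).
  { unfold efac. rewrite C2_half. replace (0 + RtoC (1 / 2) * (0 * 0)) with (RtoC 0) by ring. rewrite Cexp_0. ring. }
  rewrite <- E.
  replace (exp (B + B * B) * (Cmod u * Cmod u * Cmod u))%R
    with (Cmod u * Cmod u * exp (B + B * B) * Cmod (u - 0))%R
    by (replace (u - 0) with u by ring; ring).
  apply (segment_mean_value efac (fun u => - (u * u) * Cexp (u + u ^ 2 / 2)) 0 u).
  - intros s _. apply sdiff_cdiff, sdiff_efac.
  - intros s Hs. replace (0 + RtoC s * (u - 0)) with (RtoC s * u) by ring. set (v := RtoC s * u).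
    assert (Hv : Cmod v <= Cmod u).
    { unfold v. rewrite Cmod_mult, Cmod_R, Rabs_pos_eq by lra.
      rewrite <- (Rmult_1_l (Cmod u)) at 2. apply Rmult_le_compat_r; lra. }
    apply Cmod_mult_le.
    + rewrite Cmod_opp. apply Cmod_mult_le; auto.
    + rewrite Cmod_Cexp. 
      assert (Re (v + v ^ 2 / 2) <= B + B * B).
      { eapply Rle_trans; [apply Rle_abs|]. eapply Rle_trans; [apply re_le_Cmod|].
        rewrite C2_half. apply Cmod_add_le; [lra|]. rewrite Cmod_mult, Cmod_R, Rabs_pos_eq by lra.
        assert (Cmod (v * v) <= B * B) by (apply Cmod_mult_le; lra).
        pose proof (Cmod_ge_0 (v * v)). lra. }
      destruct H as [H|H]; [left; apply exp_increasing; auto | rewrite H; lra].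
Qed.

Definition kapN (N : nat) (z tau : C) : C :=
  Cprod (fun p => efac (z / lattice_point 1 tau p)) (nonzero_indices N).

(** [sigma] without its zero at the origin. It is nonzero at 0, so a zero of a [sigma] factor, or a
    pole of the integrand, can be split off as an explicit linear factor. *)
Definition kap (z tau : C) : C := Clim_seq (fun N => kapN N z tau).

Lemma sigma_kap (tau z : C) : sigma 1 tau z = z * kap z tau.
Proof. reflexivity. Qed.

Lemma Ccvg_Clim (u : nat -> C) (l : C) : Ccvg u l -> Clim_seq u = l.
Proof.
  intros H. unfold Clim_seq. 
  assert (A : is_lim_seq (fun n => Re (u n)) (Re l)).
  { apply is_lim_seq_spec. intros e. destruct (H e (cond_pos e)) as [N HN]. exists N. intros n Hn.
    eapply Rle_lt_trans; [apply (re_le_Cmod (u n - l))|]. apply HN; auto. }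
  assert (B : is_lim_seq (fun n => Im (u n)) (Im l)).
  { apply is_lim_seq_spec. intros e. destruct (H e (cond_pos e)) as [N HN]. exists N. intros n Hn.
    eapply Rle_lt_trans; [apply (Im_le_Cmod (u n - l))|]. apply HN; auto. }
  rewrite (is_lim_seq_unique _ _ A), (is_lim_seq_unique _ _ B). simpl. now destruct l.
Qed.

Lemma exp_minus_1 (x : R) : exp x - 1 <= x * exp x.
Proof.
  assert (A := exp_ineq1_le (- x)). rewrite exp_Ropp in A. pose proof (exp_pos x).
  apply (Rmult_le_compat_r (exp x)) in A; [|lra]. rewrite Rinv_l in A by lra. lra.
Qed.

Lemma factor_bound (A B Z : R) : 0 < A -> exists D, 0 <= D /\ forall tau z p,
  A <= Im tau -> Cmod tau <= B -> Cmod z <= Z -> (1 <= zrank p)%Z ->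
  lattice_point 1 tau p <> 0 /\
  Cmod (efac (z / lattice_point 1 tau p) - 1) <= D * inv_cube p.
Proof.
  intros HA. destruct (lattice_lower_bound A B HA) as (d & Hd & HL).
  set (Z' := Rmax 0 Z). assert (HZ : 0 <= Z') by apply Rmax_l. assert (HZ' : Z <= Z') by apply Rmax_r.
  set (b := (Z' / d)%R).
  assert (Hb : 0 <= b) by (apply Rmult_le_pos; auto; left; apply Rinv_0_lt_compat; auto).
  exists (exp (b + b * b) * (b * b * b))%R. split.
  { apply Rmult_le_pos; [left; apply exp_pos |]. apply Rmult_le_pos; [apply Rmult_le_pos|]; exact Hb. }
  intros tau z p H1 H2 H3 Hp. specialize (HL tau p H1 H2).
  apply zrank_pos in Hp. set (r := IZR (zrank p)) in *.
  assert (Hw : 0 < Cmod (lattice_point 1 tau p)).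
  { eapply Rlt_le_trans; [|exact HL]. apply Rmult_lt_0_compat; lra. }
  assert (Hw0 : lattice_point 1 tau p <> 0) by (now apply Cmod_gt_0).
  split; auto. set (w := lattice_point 1 tau p) in *.
  assert (Hu : Cmod (z / w) <= b / r).
  { rewrite Cmod_div by auto. unfold b. 
    replace (Z' / d / r)%R with (Z' * / (d * r))%R by (field; lra).
    apply Rmult_le_compat; [apply Cmod_ge_0 | left; apply Rinv_0_lt_compat; auto | lra |].
    apply Rinv_le_contravar; auto. apply Rmult_lt_0_compat; lra. }
  assert (Hbr : b / r <= b).
  { apply Rle_div_l; [lra|]. rewrite <- (Rmult_1_r b) at 1. apply Rmult_le_compat_l; auto. }
  eapply Rle_trans; [apply (efac_bound _ b); lra|].
  unfold inv_cube. fold r. rewrite (Rmult_assoc (exp _)). apply Rmult_le_compat_l; [left; apply exp_pos|].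
  replace (b * b * b * / (r * r * r))%R with (b / r * (b / r) * (b / r))%R by (field; lra).
  pose proof (Cmod_ge_0 (z / w)).
  apply Rmult_le_compat; auto; [apply Rmult_le_pos; auto|]. apply Rmult_le_compat; auto.
Qed.

(** Writing a later partial product as an earlier one times a factor [q] close to 1 serves twice:
    the upper bound on [q - 1] gives the Cauchy property, the lower bound on [q] gives a nonzero
    limit. *)
Lemma kapN_facts (A B Z : R) : 0 < A -> exists K, 0 <= K /\
  forall tau z, A <= Im tau -> Cmod tau <= B -> Cmod z <= Z ->
  (forall N, Cmod (kapN N z tau) <= K) /\
  (forall N M, (N <= M)%nat -> exists q, kapN M z tau = kapN N z tau * q /\
     Cmod (q - 1) <= K / (INR N + 1) /\ 1 - K / (INR N + 1) <= Cmod q).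
Proof.
  intros HA. destruct (factor_bound A B Z HA) as (D & HD & HF).
  (* The second summand bounds the partial products, and the first bounds [q - 1] through
     [exp x - 1 <= x exp x]. *)
  set (K := (24 * D * exp (24 * D) + exp (24 * D))%R).
  assert (He : 1 <= exp (24 * D)).
  { pose proof (exp_ineq1_le (24 * D)). lra. }
  assert (HK1 : 0 <= 24 * D * exp (24 * D)) by (apply Rmult_le_pos; lra).
  exists K. split; [unfold K; lra|]. intros tau z H1 H2 H3.
  assert (Hsum : forall l S, (forall p, In p l -> (1 <= zrank p)%Z) -> Rsum inv_cube l <= S ->
    Rsum (fun p => Cmod (efac (z / lattice_point 1 tau p) - 1)) l <= D * S).
  { intros l S Hl HS. eapply Rle_trans; [apply (Rsum_le _ (fun p => D * inv_cube p)%R)|].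
    - intros p Hp. apply HF; auto.
    - rewrite Rsum_scal. apply Rmult_le_compat_l; auto. }
  assert (Mexp : forall x y, x <= y -> exp x <= exp y).
  { intros x y [L|L]; [left; apply exp_increasing; auto | rewrite L; lra]. }
  split.
  - intros N. eapply Rle_trans; [apply Cprod_bound|].
    apply Rle_trans with (exp (24 * D)); [|unfold K; lra]. apply Mexp.
    rewrite (Rmult_comm 24). apply Hsum; [|apply indices_bound].
    intros p Hp. apply in_nonzero_indices in Hp. lia.
  - intros N M HNM. pose proof (pos_INR N).
    exists (Cprod (fun p => efac (z / lattice_point 1 tau p)) (tail_indices N M)).
    assert (HT : Rsum (fun p => Cmod (efac (z / lattice_point 1 tau p) - 1)) (tail_indices N M) <= D * (24 / (INR N + 1))).
    { apply Hsum; [|apply tail_bound'; auto]. intros p Hp. apply in_tail_indices in Hp. lia. }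
    assert (HT0 : 0 <= Rsum (fun p => Cmod (efac (z / lattice_point 1 tau p) - 1)) (tail_indices N M))
      by (apply Rsum_nonneg; intros; apply Cmod_ge_0).
    set (S := Rsum _ _) in *.
    assert (HS1 : S <= 24 * D / (INR N + 1)).
    { replace (24 * D / (INR N + 1))%R with (D * (24 / (INR N + 1)))%R by (field; lra). auto. }
    assert (HS2 : S <= 24 * D).
    { eapply Rle_trans; [apply HS1|]. apply Rle_div_l; [lra|]. 
      rewrite <- (Rmult_1_r (24 * D)) at 1. apply Rmult_le_compat_l; lra. }
    split; [|split].
    + unfold kapN. rewrite (Cprod_perm _ _ _ (indices_split N M HNM)), Cprod_app. reflexivity.
    + eapply Rle_trans; [apply Cprod_bound|]. fold S. eapply Rle_trans; [apply exp_minus_1|].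
      apply Rle_trans with (24 * D / (INR N + 1) * exp (24 * D))%R.
      * apply Rmult_le_compat; auto; left; apply exp_pos.
      * replace (24 * D / (INR N + 1) * exp (24 * D))%R with (24 * D * exp (24 * D) / (INR N + 1))%R by (field; lra).
        apply Rmult_le_compat_r; [left; apply Rinv_0_lt_compat; lra | unfold K; lra].
    + assert (HKS : S <= K / (INR N + 1)).
      { eapply Rle_trans; [apply HS1|]. apply Rmult_le_compat_r; [left; apply Rinv_0_lt_compat; lra|].
        unfold K. assert (24 * D * 1 <= 24 * D * exp (24 * D)) by (apply Rmult_le_compat_l; lra). lra. }
      destruct (Rle_or_lt S 1) as [L|L].
      * assert (Q := Cprod_lower_bound (fun p => efac (z / lattice_point 1 tau p)) (tail_indices N M) L).
        cbv beta in Q. fold S in Q. lra.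
      * pose proof (Cmod_ge_0 (Cprod (fun p => efac (z / lattice_point 1 tau p)) (tail_indices N M))). lra.
Qed.

Lemma INR_small (K e : R) : 0 <= K -> 0 < e -> exists N : nat, K / (INR N + 1) < e.
Proof.
  intros HK He. exists (Z.to_nat (up (K / e))).
  set (N := Z.to_nat (up (K / e))). pose proof (pos_INR N).
  apply Rlt_div_l; [lra|]. destruct (archimed (K / e)) as [A _].
  assert (0 <= K / e) by (apply Rmult_le_pos; auto; left; apply Rinv_0_lt_compat; auto).
  assert (IZR (up (K / e)) <= INR N).
  { rewrite INR_IZR_INZ. apply IZR_le. unfold N. assert (0 < up (K/e))%Z by (apply lt_IZR; lra). lia. }
  assert (K / e < INR N + 1) by lra. apply Rlt_div_l in H2; lra.
Qed.

Lemma kapN_cvg (z tau : C) : 0 < Im tau -> Ccvg (fun N => kapN N z tau) (kap z tau).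
Proof.
  intros Ht. destruct (kapN_facts (Im tau) (Cmod tau) (Cmod z) Ht) as (K & HK & HF).
  destruct (HF tau z (Rle_refl _) (Rle_refl _) (Rle_refl _)) as [F1 F2].
  destruct (Ccvg_cauchy (fun N => kapN N z tau)) as [l Hl].
  - intros e He. destruct (INR_small (K * K) (e / 2)) as [N HN]; [apply Rmult_le_pos; auto | lra|].
    exists N.
    assert (Q : forall n, (N <= n)%nat -> Cmod (kapN n z tau - kapN N z tau) < e / 2).
    { intros n Hn. destruct (F2 N n Hn) as (q & E & Q1 & _).
      replace (kapN n z tau - kapN N z tau) with (kapN N z tau * (q - 1)) by (rewrite E; ring).
      eapply Rle_lt_trans; [|exact HN]. replace (K * K / (INR N + 1))%R with (K * (K / (INR N + 1)))%R by (unfold Rdiv; ring).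
      apply Cmod_mult_le; auto. }
    intros n m Hn Hm. pose proof (Q n Hn). pose proof (Q m Hm).
    pose proof (Cmod_triangle_sub (kapN n z tau) (kapN N z tau) (kapN m z tau)).
    rewrite (Cmod_minus_sym (kapN N z tau)) in H1. lra.
  - unfold kap. rewrite (Ccvg_Clim _ _ Hl). exact Hl.
Qed.

Lemma upper_half_near (tau0 : C) : 0 < Im tau0 -> exists r A B, 0 < r /\ 0 < A /\
  forall tau, Cmod (tau - tau0) < r -> A <= Im tau /\ Cmod tau <= B.
Proof.
  intros H. exists (Im tau0 / 2)%R, (Im tau0 / 2)%R, (Cmod tau0 + Im tau0)%R.
  split; [lra|]. split; [lra|]. intros tau Ht. split.
  - pose proof (Im_le_Cmod (tau - tau0)) as Q.
    replace (Im (tau - tau0)) with (Im tau - Im tau0)%R in Q by reflexivity.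
    pose proof (Rle_abs (- (Im tau - Im tau0))) as Q2. rewrite Rabs_Ropp in Q2. lra.
  - pose proof (Cmod_le_add_sub tau tau0). lra.
Qed.

Lemma hol_Cprod {A : Type} (F : A -> C -> C) (l : list A) (z : C) :
  (forall a, In a l -> hol (F a) z) -> hol (fun z => Cprod (fun a => F a z) l) z.
Proof.
  induction l as [|a l IH]; simpl; intros H; [apply hol_const|].
  apply hol_mult; auto.
Qed.

Lemma lattice_point_ne_0 (tau : C) (p : Z * Z) : 0 < Im tau -> (1 <= zrank p)%Z -> lattice_point 1 tau p <> 0.
Proof.
  intros Ht Hp. destruct (factor_bound (Im tau) (Cmod tau) 0 Ht) as (D & _ & HF).
  apply (HF tau 0); auto; try lra. rewrite Cmod_0; lra.
Qed.

Lemma hol_efac (u : C) : hol efac u.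
Proof. eexists; apply sdiff_efac. Qed.

Lemma hol_kapN (N : nat) (z tau : C) : 0 < Im tau ->
  hol (fun z => kapN N z tau) z /\ hol (kapN N z) tau.
Proof.
  intros Ht. split; apply (hol_Cprod (fun p w => _)).
  - intros p Hp. apply in_nonzero_indices in Hp. apply (hol_comp efac); [apply hol_efac|].
    apply hol_mult; [apply hol_id | apply hol_const].
  - intros p Hp. apply in_nonzero_indices in Hp. apply (hol_comp efac); [apply hol_efac|].
    apply hol_div; [apply hol_const | |apply lattice_point_ne_0; auto; lia].
    apply hol_plus; [apply hol_const | apply hol_mult; [apply hol_const | apply hol_id]].
Qed.

(** [hol_limit] is used in each variable separately, the partial products being bounded uniformly in
    both. *)
Lemma kap_hol2 (z0 tau0 : C) : 0 < Im tau0 -> hol2 kap z0 tau0.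
Proof.
  intros Ht. destruct (upper_half_near tau0 Ht) as (r & A & B & Hr & HA & HAB).
  destruct (kapN_facts A B (Cmod z0 + 1)%R HA) as (K & HK & HF).
  assert (Hz : forall z, Cmod (z - z0) < 1 -> Cmod z <= Cmod z0 + 1).
  { intros z Hz. pose proof (Cmod_le_add_sub z z0). lra. }
  set (q := Rmin (r / 2) (1 / 2)). assert (Hq : 0 < q) by (apply Rmin_glb_lt; lra).
  assert (q <= r / 2) by apply Rmin_l. assert (q <= 1 / 2) by apply Rmin_r.
  exists q, K. split; auto. intros z tau H1 H2.
  split; [|split].
  - destruct (hol_limit (fun N z => kapN N z tau) (fun z => kap z tau) z (1/2) K) as (l & _ & Hl);
      [lra| | |exists l; exact Hl].
    + intros n w Hw. destruct (HAB tau ltac:(lra)) as [I1 I2]. split; [exact (proj1 (hol_kapN n w tau ltac:(lra)))|].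
      apply HF; auto. apply Hz. pose proof (Cmod_triangle_sub w z z0). lra.
    + intros w Hw. apply kapN_cvg. destruct (HAB tau ltac:(lra)); lra.
  - destruct (hol_limit (fun N w => kapN N z w) (kap z) tau (r / 2) K) as (l & _ & Hl);
      [lra| | |exists l; exact Hl].
    + intros n w Hw. 
      destruct (HAB w) as [I1 I2]. { pose proof (Cmod_triangle_sub w tau tau0). lra. }
      split; [exact (proj2 (hol_kapN n z w ltac:(lra)))|]. apply HF; auto. apply Hz. lra.
    + intros w Hw. apply kapN_cvg. 
      destruct (HAB w) as [I1 I2]. { pose proof (Cmod_triangle_sub w tau tau0). lra. } lra.
  - destruct (HAB tau ltac:(lra)) as [I1 I2].
    apply (Ccvg_bound (fun N => kapN N z tau)); [apply kapN_cvg; lra|]. intros n. apply HF; auto. apply Hz; lra.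
Qed.

Lemma kapN_deriv_cvg (z tau : C) : 0 < Im tau ->
  Ccvg (fun N => C_derive (fun z => kapN N z tau) z) (C_derive (fun z => kap z tau) z).
Proof.
  intros Ht. destruct (kapN_facts (Im tau) (Cmod tau) (Cmod z + 1)%R Ht) as (K & HK & HF).
  destruct (hol_limit (fun N z => kapN N z tau) (fun z => kap z tau) z 1 K) as (l & Hl & Hl').
  - lra.
  - intros n w Hw. split; [exact (proj1 (hol_kapN n w tau Ht))|]. apply HF; try lra.
    pose proof (Cmod_le_add_sub w z); lra.
  - intros w _. apply kapN_cvg; auto.
  - now rewrite (sdiff_C_derive _ _ _ Hl').
Qed.

(** From some [N] on, each partial product is at least half as large as the [N]-th one, and that one
    is nonzero because none of its factors vanishes. *)
Lemma kap_ne_0 (z tau : C) : 0 < Im tau ->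
  (forall p, (1 <= zrank p)%Z -> z <> lattice_point 1 tau p) -> kap z tau <> 0.
Proof.
  intros Ht Hz. destruct (kapN_facts (Im tau) (Cmod tau) (Cmod z) Ht) as (K & HK & HF).
  destruct (HF tau z (Rle_refl _) (Rle_refl _) (Rle_refl _)) as [F1 F2].
  destruct (INR_small K (1 / 2)) as [N HN]; auto; [lra|].
  assert (H0 : kapN N z tau <> 0).
  { apply Cprod_ne_0. intros p Hp. apply in_nonzero_indices in Hp.
    assert (W := lattice_point_ne_0 tau p Ht ltac:(lia)).
    apply Cmult_neq_0; [|apply Cexp_ne_0]. intros E. apply (Hz p ltac:(lia)).
    replace z with (lattice_point 1 tau p - lattice_point 1 tau p * (1 - z / lattice_point 1 tau p)) by (field; auto).
    rewrite E. ring. }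
  assert (Hm := proj1 (Cmod_gt_0 _) H0).
  intros E. destruct (kapN_cvg z tau Ht (Cmod (kapN N z tau) / 2)%R ltac:(lra)) as [M HM].
  specialize (HM (max N M) ltac:(lia)). rewrite E in HM.
  replace (kapN (Init.Nat.max N M) z tau - 0) with (kapN (Init.Nat.max N M) z tau) in HM by ring.
  destruct (F2 N (max N M) ltac:(lia)) as (q & Eq & _ & Q). rewrite Eq, Cmod_mult in HM.
  assert (Cmod (kapN N z tau) * (1 / 2) <= Cmod (kapN N z tau) * Cmod q) by (apply Rmult_le_compat_l; lra).
  lra.
Qed.

(** * The zeta function *)

Lemma Ccvg_ext (u v : nat -> C) (l : C) : (forall n, u n = v n) -> Ccvg u l -> Ccvg v l.
Proof. intros E H e He. destruct (H e He) as [N HN]. exists N. intros. rewrite <- E; auto. Qed.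

Lemma Ccvg_plus (u v : nat -> C) (l m : C) : Ccvg u l -> Ccvg v m -> Ccvg (fun n => u n + v n) (l + m).
Proof.
  intros H H' e He. destruct (H (e/2)%R ltac:(lra)) as [N HN]. destruct (H' (e/2)%R ltac:(lra)) as [N' HN'].
  exists (max N N'). intros n Hn. specialize (HN n ltac:(lia)). specialize (HN' n ltac:(lia)).
  replace (u n + v n - (l + m)) with ((u n - l) + (v n - m)) by ring.
  eapply Rle_lt_trans; [apply Cmod_triangle|lra].
Qed.

Lemma Ccvg_comp2 (F : C -> C -> C) (u v : nat -> C) (l m l1 l2 : C) :
  strict2 F l m l1 l2 -> Ccvg u l -> Ccvg v m -> Ccvg (fun n => F (u n) (v n)) (F l m).
Proof.
  intros HF H H' e He. destruct (strict2_cont F l m l1 l2 HF e He) as (d & Hd & B).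
  destruct (H d Hd) as [N HN]. destruct (H' d Hd) as [N' HN'].
  exists (max N N'). intros n Hn. apply B; [apply HN | apply HN']; lia.
Qed.

Lemma Ccvg_div (u v : nat -> C) (l m : C) : m <> 0 -> Ccvg u l -> Ccvg v m ->
  Ccvg (fun n => u n / v n) (l / m).
Proof.
  intros Hm H H'.
  assert (Hi : Ccvg (fun n => / v n) (/ m)).
  { apply (Ccvg_comp2 (fun x _ => / x) v v m m _ _ (strict2_fst Cinv m _ m (sdiff_inv m Hm)) H' H'). }
  apply (Ccvg_comp2 Cmult u (fun n => / v n) l (/ m) _ _ (strict2_mult _ _) H Hi).
Qed.

Section Lattice.
Variable tau : C.
Hypothesis tau_pos : 0 < Im tau.

Notation lat := (in_lattice 1 tau).

Lemma lat_opp (z : C) : lat z -> lat (- z).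
Proof.
  intros [[n k] ->]. exists ((- n)%Z, (- k)%Z). unfold lattice_point; simpl.
  rewrite !opp_IZR, !RtoC_opp. ring.
Qed.

Lemma lat_plus (z w : C) : lat z -> lat w -> lat (z + w).
Proof.
  intros [[n k] ->] [[n' k'] ->]. exists ((n + n')%Z, (k + k')%Z). unfold lattice_point; simpl.
  rewrite !plus_IZR, !RtoC_plus. ring.
Qed.

Lemma lat_minus (z w : C) : lat z -> lat w -> lat (z - w).
Proof. intros. apply lat_plus; auto using lat_opp. Qed.

Lemma lat_0 : lat 0.
Proof. exists (0%Z, 0%Z). unfold lattice_point; simpl. ring. Qed.

Lemma lat_1 : lat 1.
Proof. exists (1%Z, 0%Z). unfold lattice_point; simpl. ring. Qed.

Lemma lat_tau : lat tau.
Proof. exists (0%Z, 1%Z). unfold lattice_point; simpl. ring. Qed.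

Lemma not_lat_shift (z w : C) : lat w -> ~ lat z -> ~ lat (z + w).
Proof. intros Hw Hz H. apply Hz. replace z with (z + w - w) by ring. apply lat_minus; auto. Qed.

Lemma not_lat_opp (z : C) : ~ lat z -> ~ lat (- z).
Proof. intros Hz H. apply Hz. replace z with (- - z) by ring. now apply lat_opp. Qed.

Lemma not_lat_ne (z : C) : ~ lat z -> forall p, z <> lattice_point 1 tau p.
Proof. intros H p E. apply H. now exists p. Qed.

Lemma lat_0_or_large : exists d, 0 < d /\ forall z, lat z -> z = 0 \/ d <= Cmod z.
Proof.
  destruct (lattice_lower_bound (Im tau) (Cmod tau) tau_pos) as (d & Hd & H).
  exists d; split; auto. intros z [p ->].
  destruct (Z_le_gt_dec 1 (zrank p)) as [L|L].
  - right. specialize (H tau p (Rle_refl _) (Rle_refl _)). apply zrank_pos in L.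
    eapply Rle_trans; [|exact H]. rewrite <- (Rmult_1_r d) at 1. apply Rmult_le_compat_l; lra.
  - left. destruct p as [n k]. unfold zrank in L; simpl in L.
    assert (n = 0%Z) as -> by lia. assert (k = 0%Z) as -> by lia. unfold lattice_point; simpl. ring.
Qed.

Lemma lat_isolated (z0 : C) : exists r, 0 < r /\ forall z, Cmod (z - z0) < r -> z <> z0 -> ~ lat z.
Proof.
  destruct lat_0_or_large as (d & Hd & H).
  (* Lattice points are at least [d] apart, so at most one of them other than [z0] lies within
     [d / 2] of it; if there is one, its distance is taken as the radius. *)
  destruct (classic (exists w, lat w /\ w <> z0 /\ Cmod (w - z0) < d / 2)) as [(w & Lw & Nw & Bw)|Q].
  - exists (Cmod (w - z0)). split; [apply Cmod_gt_0, Cminus_ne_0, Nw|].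
    intros z Hz Nz Lz. destruct (H (z - w) (lat_minus _ _ Lz Lw)) as [E|E].
    + replace z with w in Hz by (replace z with (z - w + w) by ring; rewrite E; ring). lra.
    + pose proof (Cmod_triangle_sub z z0 w). rewrite (Cmod_minus_sym z0 w) in H0. lra.
  - exists (d / 2)%R. split; [lra|]. intros z Hz Nz Lz. apply Q. exists z; auto.
Qed.

(** The regular part of zeta at the origin: [zeta(z) = 1/z + ell(z)], see [zeta_ell]. *)
Definition ell (z : C) : C := partial1 kap z tau / kap z tau.

Lemma sdiff_kap (z : C) : sdiff (fun z => kap z tau) z (partial1 kap z tau).
Proof.
  destruct (kap_hol2 z tau tau_pos) as (R & M & HR & H).
  apply (hol_sdiff (fun z => kap z tau)).
  refine (proj1 (H z tau _ _)); rewrite Cmod_self; auto.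
Qed.

Lemma sdiff_sigma (z : C) : sdiff (sigma 1 tau) z (kap z tau + z * partial1 kap z tau).
Proof.
  eapply sdiff_ext; [| |apply (sdiff_mult (fun z => z) (fun z => kap z tau) z);
    [apply sdiff_id | apply sdiff_kap]]; [reflexivity|ring].
Qed.

Lemma kap_ne (z : C) : (z = 0 \/ ~ lat z) -> kap z tau <> 0.
Proof.
  intros H. apply kap_ne_0; auto. intros p Hp E. destruct H as [->|H].
  - apply (lattice_point_ne_0 tau p tau_pos Hp). auto.
  - apply H. now exists p.
Qed.

Lemma kap_0 : kap 0 tau = 1.
Proof.
  apply (Ccvg_unique (fun N => kapN N 0 tau)); [apply kapN_cvg; auto|].
  apply (Ccvg_ext (fun _ => 1)); [|apply Ccvg_const]. intros N. symmetry. unfold kapN.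
  rewrite (Cprod_ext _ (fun _ => 1)).
  - induction (nonzero_indices N) as [|a l IH]; simpl; [auto | rewrite IH; ring].
  - intros p _. unfold Cdiv at 1. rewrite Cmult_0_l. unfold efac. rewrite C2_half.
    replace (0 + RtoC (1 / 2) * (0 * 0)) with (RtoC 0) by ring. rewrite Cexp_0. ring.
Qed.

Lemma sigma_ne_0 (z : C) : ~ lat z -> sigma 1 tau z <> 0.
Proof.
  intros H. rewrite sigma_kap. apply Cmult_neq_0; [|apply kap_ne; auto].
  intros ->. apply H, lat_0.
Qed.

Lemma not_lat_ne_0 (z : C) : ~ lat z -> z <> 0.
Proof. intros H ->. apply H, lat_0. Qed.

Lemma zeta_ell (z : C) : ~ lat z -> zeta 1 tau z = / z + ell z.
Proof.
  intros H. unfold zeta, ell. rewrite (sdiff_C_derive _ _ _ (sdiff_sigma z)), sigma_kap.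
  assert (kap z tau <> 0) by (apply kap_ne; auto).
  assert (z <> 0) by (apply not_lat_ne_0; auto). field; auto.
Qed.

Lemma hol_sigma (z : C) : hol (sigma 1 tau) z.
Proof. eexists; apply sdiff_sigma. Qed.

Lemma hol_zeta (z : C) : ~ lat z -> hol (zeta 1 tau) z.
Proof.
  intros H. apply hol_div; [|apply hol_sigma|apply sigma_ne_0; auto].
  apply (hol_derive _ _ 1); [lra|]. intros; apply hol_sigma.
Qed.

Lemma hol_ell (z : C) : (z = 0 \/ ~ lat z) -> hol ell z.
Proof.
  intros H. apply hol_div; [|eexists; apply sdiff_kap | apply kap_ne; auto].
  apply (hol_derive (fun z => kap z tau) z 1); [lra|]. intros; eexists; apply sdiff_kap.
Qed.

Definition zterm (z : C) (p : Z * Z) : C :=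
  let w := lattice_point 1 tau p in / (z - w) + / w + z / (w * w).

Lemma sdiff_kapN (N : nat) (z : C) : ~ lat z ->
  sdiff (fun z => kapN N z tau) z (kapN N z tau * Csum (zterm z) (nonzero_indices N)).
Proof.
  intros Hz. unfold kapN.
  assert (Q : forall l, (forall p, In p l -> (1 <= zrank p)%Z) ->
   sdiff (fun z => Cprod (fun p => efac (z / lattice_point 1 tau p)) l) z
     (Cprod (fun p => efac (z / lattice_point 1 tau p)) l * Csum (zterm z) l)).
  { induction l as [|p l IH]; intros Hl; simpl.
    - eapply sdiff_ext; [reflexivity| |apply sdiff_const]. ring.
    - assert (W := lattice_point_ne_0 tau p tau_pos (Hl p ltac:(simpl; auto))).
      assert (V : z - lattice_point 1 tau p <> 0) by (apply Cminus_ne_0, not_lat_ne; auto).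
      eapply sdiff_ext; [reflexivity| |apply sdiff_mult;
        [|apply IH; intros; apply Hl; simpl; auto]].
      2: { apply (sdiff_comp efac (fun z => z / lattice_point 1 tau p)); [apply sdiff_efac|].
           apply sdiff_mult; [apply sdiff_id | apply sdiff_const]. }
      cbv beta. set (w := lattice_point 1 tau p) in *.
      set (X := Cprod _ _). set (Y := Csum _ _).
      unfold zterm. fold w. unfold efac. set (E := Cexp _). field. auto. }
  apply Q. intros p Hp. apply in_nonzero_indices in Hp. lia.
Qed.

(** The sum is the logarithmic derivative of [kapN]; numerator and denominator converge separately,
    by [kapN_deriv_cvg] and [kapN_cvg]. *)
Lemma ell_cvg (z : C) : ~ lat z -> Ccvg (fun N => Csum (zterm z) (nonzero_indices N)) (ell z).
Proof.
  intros Hz.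
  apply (Ccvg_ext (fun N => C_derive (fun z => kapN N z tau) z / kapN N z tau)).
  - intros N. rewrite (sdiff_C_derive _ _ _ (sdiff_kapN N z Hz)).
    assert (kapN N z tau <> 0).
    { apply Cprod_ne_0. intros p Hp. apply in_nonzero_indices in Hp.
      assert (W := lattice_point_ne_0 tau p tau_pos ltac:(lia)).
      assert (V : lattice_point 1 tau p - z <> 0) by (apply Cminus_ne_0, not_eq_sym, not_lat_ne; auto).
      apply Cmult_neq_0; [|apply Cexp_ne_0].
      replace (1 - z / lattice_point 1 tau p) with ((lattice_point 1 tau p - z) * / lattice_point 1 tau p) by (field; auto).
      apply Cmult_neq_0; auto. intros E. apply Cmod_gt_0 in W. 
      assert (lattice_point 1 tau p * / lattice_point 1 tau p = 1) by (field; now apply Cmod_gt_0).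
      rewrite E, Cmult_0_r in H. apply RtoC_inj in H. lra. }
    field; auto.
  - apply Ccvg_div; [apply kap_ne; auto | apply kapN_deriv_cvg; auto | apply kapN_cvg; auto].
Qed.

(** * Quasi-periodicity of zeta by sums over squares of indices *)

Lemma Csum_map {A B : Type} (g : A -> B) (F : B -> C) (l : list A) :
  Csum F (map g l) = Csum (fun a => F (g a)) l.
Proof. induction l as [|a l IH]; simpl; [auto | now rewrite IH]. Qed.

Lemma Csum_plus {A : Type} (F G : A -> C) (l : list A) :
  Csum (fun a => F a + G a) l = Csum F l + Csum G l.
Proof. induction l as [|a l IH]; simpl; [ring | rewrite IH; ring]. Qed.

Lemma Csum_minus {A : Type} (F G : A -> C) (l : list A) :
  Csum (fun a => F a - G a) l = Csum F l - Csum G l.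
Proof. induction l as [|a l IH]; simpl; [ring | rewrite IH; ring]. Qed.

Lemma Csum_scal {A : Type} (c : C) (F : A -> C) (l : list A) :
  Csum (fun a => c * F a) l = c * Csum F l.
Proof. induction l as [|a l IH]; simpl; [ring | rewrite IH; ring]. Qed.

Lemma Csum_bound {A : Type} (F : A -> C) (K : R) (l : list A) :
  (forall a, In a l -> Cmod (F a) <= K) -> Cmod (Csum F l) <= INR (length l) * K.
Proof.
  intros H. apply Rle_trans with (Rsum (fun a => Cmod (F a)) l).
  - clear H. induction l as [|a l IH]; simpl; [rewrite Cmod_0; lra|].
    apply Cmod_add_le; auto. lra.
  - apply Rsum_const_bound; auto.
Qed.

Lemma Csum_list_prod {A B : Type} (F : A * B -> C) (l : list A) (l' : list B) :
  Csum F (list_prod l l') = Csum (fun a => Csum (fun b => F (a, b)) l') l.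
Proof.
  induction l as [|a l IH]; simpl; auto.
  rewrite <- IH. rewrite <- (Csum_map (fun b => (a, b)) F l').
  generalize (map (fun b => (a, b)) l'). intros k. induction k as [|x k IHk]; simpl; [ring | rewrite IHk; ring].
Qed.

Lemma telescope (G : Z -> C) (N : nat) :
  Csum (fun a => G (a - 1)%Z - G a) (zrange N) = G (- Z.of_nat N - 1)%Z - G (Z.of_nat N).
Proof.
  unfold zrange. rewrite Csum_map.
  assert (Q : forall m s, Csum (fun n => G (Z.of_nat n - Z.of_nat N - 1)%Z - G (Z.of_nat n - Z.of_nat N)%Z) (seq s m)
    = G (Z.of_nat s - Z.of_nat N - 1)%Z - G (Z.of_nat (s + m) - Z.of_nat N - 1)%Z).
  { induction m as [|m IH]; intros s; simpl.
    - replace (s + 0)%nat with s by lia. ring.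
    - rewrite IH. replace (Z.of_nat (S s) - Z.of_nat N - 1)%Z with (Z.of_nat s - Z.of_nat N)%Z by lia.
      replace (S s + m)%nat with (s + S m)%nat by lia. ring. }
  rewrite Q. replace (Z.of_nat 0 - Z.of_nat N - 1)%Z with (- Z.of_nat N - 1)%Z by lia.
  replace (Z.of_nat (0 + (2 * N + 1)) - Z.of_nat N - 1)%Z with (Z.of_nat N) by lia. reflexivity.
Qed.

Definition square (N : nat) : list (Z * Z) := list_prod (zrange N) (zrange N).

Lemma square_split (N : nat) : Permutation (square N) ((0%Z, 0%Z) :: nonzero_indices N).
Proof.
  apply NoDup_Permutation.
  - apply NoDup_list_prod; apply NoDup_zrange.
  - constructor; [|apply NoDup_nonzero_indices]. rewrite in_nonzero_indices. unfold zrank; simpl. lia.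
  - intros [a b]. unfold square. rewrite in_prod_iff, !in_zrange. simpl. rewrite in_nonzero_indices.
    unfold zrank; simpl. split.
    + intros H. destruct (Z.eq_dec a 0), (Z.eq_dec b 0); subst; auto; right; lia.
    + intros [E|H]; [inversion E; lia | lia].
Qed.

Definition ginv (z : C) (p : Z * Z) : C := / (z - lattice_point 1 tau p).

(** The partial sums are split into a part on which a lattice translation acts by moving the indices
    and a part affine in [z], whose increment under a translation does not depend on [z]. *)
Lemma zeta_cvg (z : C) : ~ lat z -> Ccvg (fun N => Csum (ginv z) (square N) + 
  Csum (fun p => / lattice_point 1 tau p + z / (lattice_point 1 tau p * lattice_point 1 tau p)) (nonzero_indices N))
  (zeta 1 tau z).
Proof.
  intros Hz. rewrite zeta_ell by auto.
  apply (Ccvg_ext (fun N => / z + Csum (zterm z) (nonzero_indices N))).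
  - intros N. rewrite (Csum_perm _ _ _ (square_split N)). cbn [Csum fold_right].
    fold (@Csum (Z * Z) (ginv z) (nonzero_indices N)).
    replace (ginv z (0%Z, 0%Z)) with (/ z) by (unfold ginv, lattice_point; simpl; f_equal; ring).
    rewrite <- Cplus_assoc, <- Csum_plus. f_equal. apply Csum_ext. intros p _. unfold zterm, ginv. ring.
  - apply Ccvg_plus; [apply Ccvg_const | apply ell_cvg; auto].
Qed.

(** The index set is symmetric under [p -> - p], and the terms of the series change sign under
    [(z, w) -> (- z, - w)]. *)
Lemma ell_odd (z : C) : ~ lat z -> ell (- z) = - ell z.
Proof.
  intros Hz. apply (Ccvg_unique (fun N => Csum (zterm (- z)) (nonzero_indices N))).
  - apply ell_cvg, not_lat_opp; auto.
  - apply (Ccvg_ext (fun N => - (1) * Csum (zterm z) (nonzero_indices N))).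
    + intros N. set (ng := fun p : Z * Z => ((- fst p)%Z, (- snd p)%Z)).
      assert (P : Permutation (nonzero_indices N) (map ng (nonzero_indices N))).
      { apply NoDup_Permutation.
        - apply NoDup_nonzero_indices.
        - apply FinFun.Injective_map_NoDup; [|apply NoDup_nonzero_indices].
          intros [a b] [a' b'] E. inversion E. f_equal; lia.
        - intros [a b]. rewrite in_map_iff. split.
          + intros H. exists ((- a)%Z, (- b)%Z). split; [unfold ng; simpl; f_equal; lia|].
            apply in_nonzero_indices in H. apply in_nonzero_indices. unfold zrank in *; simpl in *; lia.
          + intros ([a' b'] & E & H). inversion E; subst.
            apply in_nonzero_indices in H. apply in_nonzero_indices. unfold zrank in *; simpl in *; lia. }
      rewrite (Csum_perm _ _ _ P), Csum_map, <- Csum_scal. apply Csum_ext. intros p Hp.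
      assert (E : lattice_point 1 tau (ng p) = - lattice_point 1 tau p).
      { unfold lattice_point, ng; simpl. rewrite !opp_IZR, !RtoC_opp. ring. }
      apply in_nonzero_indices in Hp.
      assert (W := lattice_point_ne_0 tau p tau_pos ltac:(lia)).
      unfold zterm. rewrite E. set (w := lattice_point 1 tau p) in *.
      assert (z + w <> 0).
      { intros A. apply Hz. exists (ng p). rewrite E. fold w. replace z with (z + w - w) by ring. rewrite A. ring. }
      assert (V : z - w <> 0) by (apply Cminus_ne_0, not_lat_ne; auto).
      field. repeat split; auto.
      * replace (- z - w) with (- (z + w)) by ring. intros A. apply H. 
        replace (z + w) with (- - (z + w)) by ring. rewrite A. ring.
      * replace (z - - w) with (z + w) by ring; auto.
    + replace (- ell z) with (- (1) * ell z) by ring. apply Ccvg_scal, ell_cvg; auto.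
Qed.

Lemma zeta_odd (z : C) : ~ lat z -> zeta 1 tau (- z) = - zeta 1 tau z.
Proof.
  intros Hz. rewrite !zeta_ell, ell_odd by auto using not_lat_opp.
  assert (z <> 0) by (apply not_lat_ne_0; auto). field; auto.
Qed.

(** A single term [1/(z - w)] has only first order in [1/w], too weak for the [2 N + 1] indices of a
    side of the square; the difference between two points [z], [z'] has second order. *)
Lemma ginv_diff_bound (z z' : C) : exists K, 0 <= K /\ exists N0, forall N p, (N0 <= N)%nat ->
  (Z.of_nat N <= zrank p)%Z -> Cmod (ginv z p - ginv z' p) <= K / ((INR N + 1) * (INR N + 1)).
Proof.
  destruct (lattice_lower_bound (Im tau) (Cmod tau) tau_pos) as (d & Hd & H).
  set (Z := (Cmod z + Cmod z')%R).
  assert (HZ : 0 <= Z) by (unfold Z; pose proof (Cmod_ge_0 z); pose proof (Cmod_ge_0 z'); lra).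
  exists (Cmod (z - z') * (16 / (d * d)))%R. split.
  { apply Rmult_le_pos; [apply Cmod_ge_0|]. apply Rmult_le_pos; [lra|]. left. apply Rinv_0_lt_compat, Rmult_lt_0_compat; auto. }
  destruct (INR_small (2 * Z / d) 1) as [N1 HN1]; [|lra|].
  { apply Rmult_le_pos; [lra|]. left. apply Rinv_0_lt_compat; auto. }
  (* The successor ensures [N >= 1], so that [N + 1 <= 2 N]. Then [z - w] and [z' - w] are both at
     least [d (N + 1) / 4], which is the origin of the 16. *)
  exists (S N1). intros N p HN Hp. specialize (H tau p (Rle_refl _) (Rle_refl _)).
  set (w := lattice_point 1 tau p) in *.
  apply IZR_le in Hp. rewrite <- INR_IZR_INZ in Hp.
  apply le_INR in HN. rewrite S_INR in HN.
  pose proof (pos_INR N1) as HN1p. apply Rlt_div_l in HN1; [|lra]. rewrite Rmult_1_l in HN1.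
  apply Rlt_div_l in HN1; [|lra].
  assert (B1 : d * INR N <= Cmod w) by (eapply Rle_trans; [|exact H]; apply Rmult_le_compat_l; lra).
  assert (B2 : 2 * Z <= d * INR N).
  { rewrite (Rmult_comm d). left. eapply Rlt_le_trans; [exact HN1|]. apply Rmult_le_compat_r; lra. }
  set (n := (INR N + 1)%R).
  assert (B3 : d * n / 4 <= d * INR N / 2).
  { unfold n. assert (d * 1 <= d * INR N) by (apply Rmult_le_compat_l; lra). lra. }
  assert (Hn : 0 < d * n / 4) by (unfold n; pose proof (pos_INR N); apply Rdiv_lt_0_compat; [apply Rmult_lt_0_compat|]; lra).
  assert (C1 : d * n / 4 <= Cmod (z - w)).
  { pose proof (Cmod_le_add_sub w z). rewrite Cmod_minus_sym in H0. unfold Z in *. pose proof (Cmod_ge_0 z'). lra. }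
  assert (C2 : d * n / 4 <= Cmod (z' - w)).
  { pose proof (Cmod_le_add_sub w z'). rewrite Cmod_minus_sym in H0. unfold Z in *. pose proof (Cmod_ge_0 z). lra. }
  assert (N1' : z - w <> 0) by (apply Cmod_gt_0; lra).
  assert (N2' : z' - w <> 0) by (apply Cmod_gt_0; lra).
  unfold ginv. fold w.
  replace (/ (z - w) - / (z' - w)) with ((z' - z) / ((z - w) * (z' - w))) by (field; auto).
  rewrite Cmod_div, Cmod_mult by (apply Cmult_neq_0; auto).
  rewrite (Cmod_minus_sym z').
  apply Rle_trans with (Cmod (z - z') * / (d * n / 4 * (d * n / 4)))%R.
  - apply Rmult_le_compat_l; [apply Cmod_ge_0|]. apply Rinv_le_contravar; [apply Rmult_lt_0_compat; auto|].
    apply Rmult_le_compat; lra.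
  - right. unfold n. field. pose proof (pos_INR N). split; lra.
Qed.

(** There are [2 N + 1] terms, each [O(1/N^2)]. *)
Lemma boundary_sum_cvg (e1 e2 : nat -> Z -> Z * Z) (z z' : C) :
  (forall N k, (Z.of_nat N <= zrank (e1 N k))%Z) -> (forall N k, (Z.of_nat N <= zrank (e2 N k))%Z) ->
  Ccvg (fun N => Csum (fun k => (ginv z (e1 N k) - ginv z (e2 N k)) - (ginv z' (e1 N k) - ginv z' (e2 N k))) (zrange N)) 0.
Proof.
  intros H1 H2. destruct (ginv_diff_bound z z') as (K & HK & N0 & H).
  intros e He. destruct (INR_small (4 * K) e) as [N1 HN1]; [lra|auto|].
  exists (max N0 N1). intros N HN.
  replace (Cmod (Csum (fun k => (ginv z (e1 N k) - ginv z (e2 N k)) - (ginv z' (e1 N k) - ginv z' (e2 N k))) (zrange N) - 0)) with (Cmod (Csum (fun k => (ginv z (e1 N k) - ginv z (e2 N k)) - (ginv z' (e1 N k) - ginv z' (e2 N k))) (zrange N))) by (f_equal; ring).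
  set (n := (INR N + 1)%R). assert (Hn : 1 <= n) by (unfold n; pose proof (pos_INR N); lra).
  eapply Rle_lt_trans; [apply (Csum_bound _ (2 * (K / (n * n))))|].
  - intros k _.
    replace (ginv z (e1 N k) - ginv z (e2 N k) - (ginv z' (e1 N k) - ginv z' (e2 N k)))
      with ((ginv z (e1 N k) - ginv z' (e1 N k)) - (ginv z (e2 N k) - ginv z' (e2 N k))) by ring.
    eapply Rle_trans; [apply Cmod_minus_le|].
    pose proof (H N (e1 N k) ltac:(lia) (H1 N k)). pose proof (H N (e2 N k) ltac:(lia) (H2 N k)).
    fold n in H0, H3. lra.
  - rewrite length_zrange, plus_INR, mult_INR. simpl INR.
    apply Rle_lt_trans with (4 * K / n)%R.
    + replace (4 * K / n)%R with (2 * n * (2 * (K / (n * n))))%R by (field; lra).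
      apply Rmult_le_compat_r.
      * apply Rmult_le_pos; [lra|]. apply Rmult_le_pos; auto. left; apply Rinv_0_lt_compat, Rmult_lt_0_compat; lra.
      * unfold n. lra.
    + eapply Rle_lt_trans; [|exact HN1]. apply Rmult_le_compat_l; [lra|].
      assert (INR N1 <= INR N) by (apply le_INR; lia). pose proof (pos_INR N1).
      apply Rinv_le_contravar; unfold n; lra.
Qed.

(** Translating by [w] changes the square sum only along its boundary, with indices [e1] entering
    and [e2] leaving. The boundary sums for [z] and [z'] differ by a null sequence, and the affine
    parts have equal increments. *)
Lemma zeta_increment_const (w : C) (e1 e2 : nat -> Z -> Z * Z) :
  lat w ->
  (forall N k, (Z.of_nat N <= zrank (e1 N k))%Z) -> (forall N k, (Z.of_nat N <= zrank (e2 N k))%Z) ->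
  (forall z N, Csum (fun p => ginv (z + w) p - ginv z p) (square N) =
     Csum (fun k => ginv z (e1 N k) - ginv z (e2 N k)) (zrange N)) ->
  forall z z', ~ lat z -> ~ lat z' ->
  zeta 1 tau (z + w) - zeta 1 tau z = zeta 1 tau (z' + w) - zeta 1 tau z'.
Proof.
  intros Lw H1 H2 HE z z' Hz Hz'.
  assert (Hzw := not_lat_shift z w Lw Hz). assert (Hzw' := not_lat_shift z' w Lw Hz').
  assert (A := Ccvg_minus _ _ _ _ (Ccvg_minus _ _ _ _ (zeta_cvg _ Hzw) (zeta_cvg _ Hz))
    (Ccvg_minus _ _ _ _ (zeta_cvg _ Hzw') (zeta_cvg _ Hz'))).
  assert (B : zeta 1 tau (z + w) - zeta 1 tau z - (zeta 1 tau (z' + w) - zeta 1 tau z') = 0).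
  { apply (Ccvg_unique _ _ _ A).
    apply (Ccvg_ext _ _ _) with (2 := boundary_sum_cvg e1 e2 z z' H1 H2). intros N. cbv beta.
    rewrite Csum_minus, <- !HE, !Csum_minus.
    set (c := fun z => Csum (fun p => / lattice_point 1 tau p + z / (lattice_point 1 tau p * lattice_point 1 tau p)) (nonzero_indices N)).
    assert (Q : forall z, c (z + w) - c z = w * Csum (fun p => / (lattice_point 1 tau p * lattice_point 1 tau p)) (nonzero_indices N)).
    { intros u. unfold c. rewrite <- Csum_minus, <- Csum_scal. apply Csum_ext. intros p _. unfold Cdiv. ring. }
    fold (c (z + w)) (c z) (c (z' + w)) (c z').
    replace (c (z + w)) with (c (z + w) - c z + c z) by ring. rewrite Q.
    replace (c (z' + w)) with (c (z' + w) - c z' + c z') by ring. rewrite Q. ring. }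
  replace (zeta 1 tau (z + w) - zeta 1 tau z) with
   (zeta 1 tau (z + w) - zeta 1 tau z - (zeta 1 tau (z' + w) - zeta 1 tau z') + (zeta 1 tau (z' + w) - zeta 1 tau z')) by ring.
  rewrite B. ring.
Qed.

Lemma zeta_increment_1 (z z' : C) : ~ lat z -> ~ lat z' ->
  zeta 1 tau (z + 1) - zeta 1 tau z = zeta 1 tau (z' + 1) - zeta 1 tau z'.
Proof.
  (* Replacing [z] by [z + 1] moves the first index [a] to [a - 1]: the column [- N - 1] enters the
     square and the column [N] leaves it. *)
  apply (zeta_increment_const 1 (fun N k => ((- Z.of_nat N - 1)%Z, k)) (fun N k => (Z.of_nat N, k))).
  - apply lat_1.
  - intros; unfold zrank; simpl; lia.
  - intros; unfold zrank; simpl; lia.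
  - clear z z'. intros z N. unfold square. rewrite Csum_list_prod, Csum_minus.
    rewrite <- (telescope (fun a => Csum (fun k => ginv z (a, k)) (zrange N))).
    apply Csum_ext. intros a _. rewrite <- Csum_minus. apply Csum_ext. intros k _.
    unfold ginv, lattice_point; simpl. rewrite minus_IZR, RtoC_minus. do 2 f_equal. ring.
Qed.

Lemma zeta_increment_tau (z z' : C) : ~ lat z -> ~ lat z' ->
  zeta 1 tau (z + tau) - zeta 1 tau z = zeta 1 tau (z' + tau) - zeta 1 tau z'.
Proof.
  apply (zeta_increment_const tau (fun N k => (k, (- Z.of_nat N - 1)%Z)) (fun N k => (k, Z.of_nat N))).
  - apply lat_tau.
  - intros; unfold zrank; simpl; lia.
  - intros; unfold zrank; simpl; lia.
  - clear z z'. intros z N. unfold square. rewrite Csum_list_prod.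
    apply Csum_ext. intros a _. rewrite <- (telescope (fun k => ginv z (a, k))).
    apply Csum_ext. intros k _.
    unfold ginv, lattice_point; simpl. rewrite minus_IZR, RtoC_minus. do 2 f_equal. ring.
Qed.

Definition eta (w : C) : C := 2 * zeta 1 tau (w / 2).

Lemma not_lat_half_1 : ~ lat (1 / 2).
Proof.
  intros [[n k] E]. unfold lattice_point in E; simpl in E.
  assert (Hi : Im (1 / 2) = Im (RtoC (IZR n) * 1 + RtoC (IZR k) * tau)) by (f_equal; auto).
  assert (Hr : Re (1 / 2) = Re (RtoC (IZR n) * 1 + RtoC (IZR k) * tau)) by (f_equal; auto).
  rewrite <- RtoC_div in Hi, Hr by lra. destruct tau as [a b]; simpl in Hi, Hr, tau_pos.
  assert (IZR k = 0)%R.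
  { assert (IZR k * b = 0)%R by lra. apply Rmult_integral in H. destruct H; [auto | lra]. }
  rewrite H in Hr. assert (2 * IZR n = 1)%R by lra.
  rewrite <- mult_IZR in H0. apply eq_IZR in H0. lia.
Qed.

Lemma not_lat_half_tau : ~ lat (tau / 2).
Proof.
  intros [[n k] E]. unfold lattice_point in E; simpl in E.
  assert (Hi : Im (tau / 2) = Im (RtoC (IZR n) * 1 + RtoC (IZR k) * tau)) by (f_equal; auto).
  replace (tau / 2) with (RtoC (1 / 2) * tau) in Hi by (rewrite RtoC_div by lra; field; apply RtoC_2_ne_0).
  destruct tau as [a b]; simpl in Hi, tau_pos.
  assert (b * (2 * IZR k - 1) = 0)%R by lra. apply Rmult_integral in H. destruct H; [lra|].
  assert (2 * IZR k = 1)%R by lra.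
  rewrite <- mult_IZR in H0. apply eq_IZR in H0. lia.
Qed.

Lemma half_sum (w : C) : - (w / 2) + w = w / 2.
Proof.
  replace w with ((RtoC (1 / 2) + RtoC (1 / 2)) * w) at 2 by (rewrite half_half; ring).
  assert (H2 := RtoC_2_ne_0). rewrite RtoC_div by lra. field; auto.
Qed.

Lemma double (z : C) : 2 * z = z + z.
Proof. replace (RtoC 2) with (1 + 1) by (rewrite <- RtoC_plus; f_equal; lra). ring. Qed.

(** The constant increment is evaluated at [- 1/2], where oddness makes it [2 zeta(1/2)]. *)
Lemma zeta_add_1 (z : C) : ~ lat z -> zeta 1 tau (z + 1) = zeta 1 tau z + eta 1.
Proof.
  intros Hz. assert (Hh := not_lat_half_1).
  assert (E := zeta_increment_1 z (- (1 / 2)) Hz (not_lat_opp _ Hh)).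
  rewrite half_sum, zeta_odd in E by auto. unfold eta. rewrite double.
  replace (zeta 1 tau (z + 1)) with (zeta 1 tau (z + 1) - zeta 1 tau z + zeta 1 tau z) by ring.
  rewrite E. ring.
Qed.

Lemma zeta_add_tau (z : C) : ~ lat z -> zeta 1 tau (z + tau) = zeta 1 tau z + eta tau.
Proof.
  intros Hz. assert (Hh := not_lat_half_tau).
  assert (E := zeta_increment_tau z (- (tau / 2)) Hz (not_lat_opp _ Hh)).
  rewrite half_sum, zeta_odd in E by auto. unfold eta. rewrite double.
  replace (zeta 1 tau (z + tau)) with (zeta 1 tau (z + tau) - zeta 1 tau z + zeta 1 tau z) by ring.
  rewrite E. ring.
Qed.

End Lattice.

Lemma sigma_lattice (tau z : C) : 0 < Im tau -> in_lattice 1 tau z -> sigma 1 tau z = 0.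
Proof.
  intros Ht [p ->]. rewrite sigma_kap.
  destruct (Z_le_gt_dec 1 (zrank p)) as [L|L].
  - assert (kap (lattice_point 1 tau p) tau = 0) as ->; [|ring].
    apply (Ccvg_unique (fun N => kapN N (lattice_point 1 tau p) tau)); [apply kapN_cvg; auto|].
    intros e He. exists (Z.to_nat (zrank p)). intros N HN.
    assert (kapN N (lattice_point 1 tau p) tau = 0) as ->; [|rewrite Cmod_self; auto].
    assert (W := lattice_point_ne_0 tau p Ht L).
    assert (Hin : In p (nonzero_indices N)) by (apply in_nonzero_indices; lia).
    unfold kapN. revert Hin. generalize (nonzero_indices N). intros l.
    induction l as [|q l IH]; simpl; intros Hin; [contradiction|]. destruct Hin as [->|Hin].
    + unfold efac. replace (1 - lattice_point 1 tau p / lattice_point 1 tau p) with (RtoC 0) by (field; auto). ring.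
    + rewrite IH by auto. ring.
  - destruct p as [n k]. unfold zrank in L; simpl in L.
    assert (n = 0%Z) as -> by lia. assert (k = 0%Z) as -> by lia.
    replace (lattice_point 1 tau (0%Z, 0%Z)) with (RtoC 0) by (unfold lattice_point; simpl; ring). ring.
Qed.

(** * The Legendre relation *)

Lemma rcont_hol_comp (F : C -> C) (g : R -> C) (x : R) : hol F (g x) -> rcont g x -> rcont (fun u => F (g u)) x.
Proof.
  intros HF Hg e He. destruct (hol_cont F _ HF e He) as (d & Hd & B).
  destruct (Hg d Hd) as (d' & Hd' & B'). exists d'; split; auto.
Qed.

Lemma CI_reflect (g : R -> C) (a : R) (v : C) : CI g (- a) a v -> CI (fun x => g (- x)%R) (- a) a v.
Proof.
  intros H. apply (is_RInt_swap (V := C_R_NormedModule)) in H.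
  assert (Q := is_RInt_comp_opp (V := C_R_NormedModule) g (- a) a (opp v)).
  rewrite Ropp_involutive in Q. specialize (Q H).
  apply (is_RInt_opp (V := C_R_NormedModule)) in Q.
  assert (E : forall c : C, opp (G := C_R_NormedModule) (opp (G := C_R_NormedModule) c) = c)
    by (intros; apply (opp_opp (G := C_R_NormedModule))).
  rewrite <- (E v).
  eapply (is_RInt_ext (V := C_R_NormedModule)); [|exact Q].
  intros x _. apply E.
Qed.

Lemma CI_const (c : C) (a b : R) : CI (fun _ => c) a b (RtoC (b - a) * c).
Proof. rewrite <- scal_C_R. apply (is_RInt_const (V := C_R_NormedModule)). Qed.

Lemma constant_of_rdiff_0 (g : R -> C) (a b : R) : a <= b ->
  (forall x, a <= x <= b -> rdiff g x 0) -> g b = g a.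
Proof.
  intros Hab H. apply Cmod_small_eq. intros e He.
  apply Rle_trans with (0 - 0)%R; [|lra].
  apply (mean_value_ineq g (fun _ => 0) (fun _ => 0%R) (fun _ => 0%R)); auto.
  - intros x _. apply (is_derive_const (K := R_AbsRing) (V := R_NormedModule)).
  - intros; rewrite Cmod_0; lra.
Qed.

(** Adding the reflected integrand leaves [- 2 i y / (x^2 + y^2)], whose primitive is an arctangent;
    this avoids a complex logarithm. *)
Lemma CI_inv_line (y : R) (v : C) : 0 < y ->
  CI (fun x => / (RtoC x + Ci * RtoC y)) (- (1 / 2)) (1 / 2) v ->
  v = - (2 * Ci * RtoC (atan (1 / 2 / y))).
Proof.
  intros Hy Hv.
  assert (N : forall x, RtoC x + Ci * RtoC y <> 0 /\ RtoC x - Ci * RtoC y <> 0).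
  { intros x. split; intros E; apply (f_equal Im) in E; unfold Ci, RtoC in E; simpl in E; lra. }
  assert (Hv' := CI_reflect _ _ _ Hv).
  assert (Hs := CI_plus _ _ _ _ _ _ Hv Hv').
  set (G := fun x => - (2 * Ci) * RtoC (atan (x / y))).
  assert (HG : CI (fun x => / (RtoC x + Ci * RtoC y) + / (RtoC (- x) + Ci * RtoC y)) (- (1 / 2)) (1 / 2)
    (G (1 / 2)%R - G (- (1 / 2))%R)).
  { apply CI_derive; [lra| |].
    - intros x _. eapply rdiff_ext; [reflexivity| |apply rdiff_scal].
      2: { intros e He.
        destruct (real_derive_eps (fun x => atan (x / y)) x (/ (1 + (x / y) ^ 2) * / y) ) with (e := e) as (d & Hd & B); auto.
        - apply is_derive_Reals.
          apply (derivable_pt_lim_comp (fun x => x / y)%R atan).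
          + replace (/ y)%R with (1 * / y)%R at 1 by ring.
            apply (derivable_pt_lim_ext (fun x => / y * x)%R); [intros; unfold Rdiv; ring|].
            replace (1 * / y)%R with (/ y * 1)%R by ring. apply derivable_pt_lim_scal, derivable_pt_lim_id.
          + apply derivable_pt_lim_atan.
        - exists d. split; auto. intros s Hs'. specialize (B s Hs').
          rewrite <- RtoC_minus, <- RtoC_mult, <- RtoC_minus, Cmod_R. exact B. }
      destruct (N x) as [N1 N2].
      assert (N3 : RtoC (- x) + Ci * RtoC y <> 0).
      { rewrite RtoC_opp. intros E. apply N2. replace (RtoC x - Ci * RtoC y) with (- (- RtoC x + Ci * RtoC y)) by ring.
        rewrite E. ring. }
      assert (E1 : / (RtoC x + Ci * RtoC y) + / (RtoC (- x) + Ci * RtoC y)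
        = - ((1 + 1) * Ci * RtoC y) / ((RtoC x + Ci * RtoC y) * (RtoC x - Ci * RtoC y))).
      { rewrite RtoC_opp in *. field. repeat split; auto. }
      rewrite E1.
      assert (E2 : (RtoC x + Ci * RtoC y) * (RtoC x - Ci * RtoC y) = RtoC (x * x + y * y)).
      { rewrite RtoC_plus, !RtoC_mult. transitivity (RtoC x * RtoC x - Ci * Ci * (RtoC y * RtoC y)); [ring | rewrite Ci_sqr; ring]. }
      rewrite E2.
      assert (E3 : (/ (1 + (x / y) ^ 2) * / y)%R = (y / (x * x + y * y))%R).
      { assert (0 < x * x + y * y) by (pose proof (Rle_0_sqr x); unfold Rsqr in *; assert (0 < y * y) by (apply Rmult_lt_0_compat; auto); lra).
        field. repeat split; lra. }
      rewrite E3, RtoC_div, double.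
      2: { pose proof (Rle_0_sqr x); unfold Rsqr in *; assert (0 < y * y) by (apply Rmult_lt_0_compat; auto); lra. }
      unfold Cdiv. ring.
    - intros x _ e He.
      assert (rcont (fun u => / (RtoC u + Ci * RtoC y) + / (RtoC (- u) + Ci * RtoC y)) x) as Q; [|apply Q; auto].
      destruct (N x) as [N1 N2].
      assert (N3 : - (1) * RtoC x + Ci * RtoC y <> 0).
      { intros E. apply N2. replace (RtoC x - Ci * RtoC y) with (- (- (1) * RtoC x + Ci * RtoC y)) by ring.
        rewrite E. ring. }
      eapply rdiff_rcont. eapply rdiff_ext; [| |apply rdiff_plus].
      3: { apply (rdiff_comp Cinv (fun u => RtoC u + Ci * RtoC y)); [apply sdiff_inv; auto|].
           apply rdiff_plus; [apply rdiff_id | apply rdiff_const]. }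
      3: { apply (rdiff_comp Cinv (fun u => - (1) * RtoC u + Ci * RtoC y)); [apply sdiff_inv; auto|].
           apply rdiff_plus; [apply rdiff_scal, rdiff_id | apply rdiff_const]. }
      + intros s. cbv beta. do 2 f_equal. rewrite RtoC_opp. ring.
      + reflexivity. }
  assert (E := CI_unique _ _ _ _ _ Hs HG). unfold G in E.
  replace (- (1 / 2) / y)%R with (- (1 / 2 / y))%R in E by (field; lra).
  rewrite atan_opp, RtoC_opp in E.
  assert (E' : 2 * (v + 2 * Ci * RtoC (atan (1 / 2 / y))) = 0).
  { rewrite double. replace (v + 2 * Ci * RtoC (atan (1 / 2 / y)) + (v + 2 * Ci * RtoC (atan (1 / 2 / y))))
     with (v + v + (2 * Ci * RtoC (atan (1 / 2 / y)) + 2 * Ci * RtoC (atan (1 / 2 / y)))) by ring.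
    rewrite E. ring. }
  assert (Z : v + 2 * Ci * RtoC (atan (1 / 2 / y)) = 0).
  { destruct (Ceq_dec (v + 2 * Ci * RtoC (atan (1 / 2 / y))) 0) as [|B]; auto.
    exfalso. apply (Cmult_neq_0 _ _ RtoC_2_ne_0 B E'). }
  replace v with (v + 2 * Ci * RtoC (atan (1 / 2 / y)) - 2 * Ci * RtoC (atan (1 / 2 / y))) by ring.
  rewrite Z. ring.
Qed.

Section Legendre.
Variable m : R.
Hypothesis m_pos : 0 < m.
Let tau : C := 2 * RtoC m * Ci.
Notation lat := (in_lattice 1 tau).

Lemma Im_tau : Im tau = (2 * m)%R.
Proof. unfold tau, Ci; simpl; ring. Qed.

Lemma tau_pos : 0 < Im tau.
Proof. rewrite Im_tau. lra. Qed.

Lemma lat_coords (z : C) : lat z -> exists n k : Z, Re z = IZR n /\ Im z = (IZR k * (2 * m))%R.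
Proof.
  intros [[n k] ->]. exists n, k. unfold lattice_point, tau, Ci; simpl. split; ring.
Qed.

Lemma not_lat_strip (z : C) : 0 < Im z < 2 * m -> ~ lat z.
Proof.
  intros H L. destruct (lat_coords z L) as (n & k & _ & E). rewrite E in H.
  assert (0 < k)%Z. { apply lt_IZR. apply Rmult_lt_reg_r with (2 * m)%R; lra. }
  assert (k < 1)%Z. { apply lt_IZR. apply Rmult_lt_reg_r with (2 * m)%R; lra. }
  lia.
Qed.

Lemma not_lat_col (z : C) : 0 < Rabs (Re z) < 1 -> ~ lat z.
Proof.
  intros H L. destruct (lat_coords z L) as (n & k & E & _). rewrite E, <- abs_IZR in H.
  destruct H as [H1 H2]. apply lt_IZR in H1. apply lt_IZR in H2. lia.
Qed.

Lemma line_Im (x y : R) : Im (RtoC x + Ci * RtoC y) = y.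
Proof. unfold Ci; simpl; ring. Qed.

Lemma rcont_line (y x : R) : rcont (fun x => RtoC x + Ci * RtoC y) x.
Proof. eapply rdiff_rcont, rdiff_plus; [apply rdiff_id | apply rdiff_const]. Qed.

Lemma zeta_line_integral (y : R) : 0 < y < 2 * m ->
  exists v, CI (fun x => zeta 1 tau (RtoC x + Ci * RtoC y)) (- (1 / 2)) (1 / 2) v.
Proof.
  intros Hy. apply CI_ex; [lra|]. intros x _.
  apply (rcont_hol_comp (zeta 1 tau) (fun x => RtoC x + Ci * RtoC y)); [|apply rcont_line].
  apply (hol_zeta tau tau_pos), not_lat_strip. rewrite line_Im; auto.
Qed.

(** On the line [Im z = m] reflection in the imaginary axis is [z -> - z + tau], so the integrand
    and its reflection add up to the constant [eta tau]. *)
Lemma zeta_middle_integral (v : C) :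
  CI (fun x => zeta 1 tau (RtoC x + Ci * RtoC m)) (- (1 / 2)) (1 / 2) v -> v + v = eta tau tau.
Proof.
  intros Hv. assert (Hv' := CI_reflect _ _ _ Hv).
  assert (Hs := CI_plus _ _ _ _ _ _ Hv Hv').
  apply (CI_unique _ _ _ _ _ Hs).
  apply (CI_ext (fun _ => eta tau tau)); [lra| |].
  - intros x _. cbv beta.
    assert (L : ~ lat (RtoC x + Ci * RtoC m)) by (apply not_lat_strip; rewrite line_Im; lra).
    replace (RtoC (- x) + Ci * RtoC m) with (- (RtoC x + Ci * RtoC m) + tau)
      by (unfold tau; rewrite RtoC_opp; replace (RtoC 2) with (1 + 1) by (rewrite <- RtoC_plus; f_equal; lra); ring).
    rewrite (zeta_add_tau tau tau_pos), (zeta_odd tau tau_pos) by auto using not_lat_opp. ring.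
  - assert (A := CI_const (eta tau tau) (- (1 / 2)) (1 / 2)).
    replace (RtoC (1 / 2 - - (1 / 2)) * eta tau tau) with (eta tau tau) in A; [exact A|].
    replace (1 / 2 - - (1 / 2))%R with 1%R by lra. ring.
Qed.

(** The derivative in [y] under the integral is [i] times the integral of [zeta'] along the segment,
    that is [i] times the increment of zeta over the period 1. *)
Lemma zeta_integral_slope (y : R) (v w : C) : 0 < y <= m ->
  CI (fun x => zeta 1 tau (RtoC x + Ci * RtoC y)) (- (1 / 2)) (1 / 2) v ->
  CI (fun x => zeta 1 tau (RtoC x + Ci * RtoC m)) (- (1 / 2)) (1 / 2) w ->
  w - v = Ci * eta tau 1 * RtoC (m - y).
Proof.
  intros Hy Hv Hw.
  set (J := (fun y => RInt (V := C_R_CompleteNormedModule)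
    (fun x => zeta 1 tau (RtoC x + Ci * RtoC y)) (- (1 / 2)) (1 / 2)) : R -> C).
  assert (HJ : forall y, 0 < y < 2 * m -> CI (fun x => zeta 1 tau (RtoC x + Ci * RtoC y)) (- (1 / 2)) (1 / 2) (J y)).
  { intros y1 Hy1. apply (RInt_correct (V := C_R_CompleteNormedModule)). apply zeta_line_integral; auto. }
  assert (HdJ : forall y, 0 < y < 2 * m -> rdiff J y (Ci * eta tau 1)).
  { intros y0 Hy0. apply within_diff_rdiff.
    assert (HL : forall x y, 0 < y < 2 * m -> hol (zeta 1 tau) (RtoC x + Ci * RtoC y)).
    { intros x y1 Hy1. apply (hol_zeta tau tau_pos), not_lat_strip. rewrite line_Im; auto. }
    assert (HN : forall z, 0 < Im z < 2 * m -> hol (C_derive (zeta 1 tau)) z).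
    { intros z Hz. destruct (classic (0 < Rmin (Im z) (2 * m - Im z))) as [P|P].
      - apply (hol_derive (zeta 1 tau) z _ P). intros w' Hw'.
        apply (hol_zeta tau tau_pos), not_lat_strip.
        pose proof (Im_le_Cmod (w' - z)) as Q. replace (Im (w' - z)) with (Im w' - Im z)%R in Q by reflexivity.
        Rmin_facts (Im z)%R (2 * m - Im z)%R.
        assert (Rabs (Im w' - Im z) < Rmin (Im z) (2 * m - Im z)) as Q' by lra.
        apply Rabs_def2 in Q'. lra.
      - exfalso. apply P. apply Rmin_glb_lt; lra. }
    assert (HdI : CI (fun x => Ci * C_derive (zeta 1 tau) (RtoC x + Ci * RtoC y0)) (- (1 / 2)) (1 / 2) (Ci * eta tau 1)).
    { apply CI_scal.
      assert (E : eta tau 1 = zeta 1 tau (RtoC (1 / 2) + Ci * RtoC y0) - zeta 1 tau (RtoC (- (1 / 2)) + Ci * RtoC y0)).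
      { replace (RtoC (1 / 2) + Ci * RtoC y0) with (RtoC (- (1 / 2)) + Ci * RtoC y0 + 1)
          by (rewrite RtoC_opp, <- half_half; ring).
        rewrite (zeta_add_1 tau tau_pos); [ring|]. apply not_lat_strip. rewrite line_Im; auto. }
      rewrite E. apply (CI_derive (fun x => zeta 1 tau (RtoC x + Ci * RtoC y0))); [lra| |].
      - intros x _. eapply rdiff_ext; [reflexivity| |apply (rdiff_comp (zeta 1 tau) (fun x => RtoC x + Ci * RtoC y0));
          [apply hol_sdiff, HL; auto | apply rdiff_plus; [apply rdiff_id | apply rdiff_const]]]. ring.
      - intros x _. apply (rcont_hol_comp (C_derive (zeta 1 tau)) (fun x => RtoC x + Ci * RtoC y0)); [|apply rcont_line].
        apply HN. rewrite line_Im; auto. }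
    apply (integral_within_diff (fun _ => True) y0 (- (1 / 2)) (1 / 2)
      (fun y x => zeta 1 tau (RtoC x + Ci * RtoC y)) (fun x => Ci * C_derive (zeta 1 tau) (RtoC x + Ci * RtoC y0)) J);
      [lra | auto | | |exact HdI].
    - intros e u0 He Hu0.
      destruct (hol_sdiff _ _ (HL u0 y0 Hy0) (e / 2)%R ltac:(lra)) as (d1 & Hd1 & B1).
      destruct (hol_cont _ (RtoC u0 + Ci * RtoC y0) (HN (RtoC u0 + Ci * RtoC y0) ltac:(rewrite line_Im; exact Hy0)) (e / 2)%R ltac:(lra)) as (d2 & Hd2 & B2).
      set (d := Rmin d1 d2). assert (Hd : 0 < d) by (apply Rmin_glb_lt; auto).
      assert (D1l : d <= d1) by apply Rmin_l. assert (D2l : d <= d2) by apply Rmin_r.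
      exists (d / 2)%R. split; [lra|]. intros u s Hu Hu1 _ Hs.
      assert (Hn : forall s', Rabs (s' - y0) < d / 2 -> Cmod (RtoC u + Ci * RtoC s' - (RtoC u0 + Ci * RtoC y0)) < d).
      { intros s' Hs'. replace (RtoC u + Ci * RtoC s' - (RtoC u0 + Ci * RtoC y0)) with (RtoC (u - u0) + Ci * RtoC (s' - y0))
          by (rewrite !RtoC_minus; ring).
        eapply Rle_lt_trans; [apply Cmod_triangle|]. rewrite Cmod_mult, Cmod_Ci, !Cmod_R. lra. }
      assert (A1 := Hn s Hs). assert (A2 := Hn y0 ltac:(rewrite Rminus_diag, Rabs_R0; lra)).
      specialize (B1 _ _ (Rlt_le_trans _ _ _ A1 D1l) (Rlt_le_trans _ _ _ A2 D1l)).
      specialize (B2 _ (Rlt_le_trans _ _ _ A2 D2l)).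
      replace (RtoC u + Ci * RtoC s - (RtoC u + Ci * RtoC y0)) with (Ci * RtoC (s - y0)) in B1 by (rewrite RtoC_minus; ring).
      rewrite Cmod_mult, Cmod_Ci, Cmod_R, Rmult_1_l in B1.
      set (D0 := C_derive (zeta 1 tau) (RtoC u0 + Ci * RtoC y0)) in *.
      set (D1 := C_derive (zeta 1 tau) (RtoC u + Ci * RtoC y0)) in *.
      match goal with |- Cmod ?a <= _ => replace a with
        (zeta 1 tau (RtoC u + Ci * RtoC s) - zeta 1 tau (RtoC u + Ci * RtoC y0) - D0 * (Ci * RtoC (s - y0))
          - (D1 - D0) * (Ci * RtoC (s - y0))) by ring end.
      eapply Rle_trans; [apply Cmod_minus_le|]. rewrite !Cmod_mult, Cmod_Ci, Cmod_R, Rmult_1_l.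
      assert (Cmod (D1 - D0) * Rabs (s - y0) <= e / 2 * Rabs (s - y0)) by (apply Rmult_le_compat_r; [apply Rabs_pos | lra]).
      lra.
    - exists (Rmin y0 (2 * m - y0)). split; [apply Rmin_glb_lt; lra|]. intros s _ Hs. apply HJ.
      Rmin_facts y0 (2 * m - y0)%R.
      apply Rabs_def2 in Hs. lra. }
  rewrite (CI_unique _ _ _ _ _ Hv (HJ y ltac:(lra))), (CI_unique _ _ _ _ _ Hw (HJ m ltac:(lra))).
  assert (E : J m + - (Ci * eta tau 1) * RtoC m = J y + - (Ci * eta tau 1) * RtoC y).
  { apply (constant_of_rdiff_0 (fun y => J y + - (Ci * eta tau 1) * RtoC y)); [lra|].
    intros x Hx. eapply rdiff_ext; [reflexivity| |apply rdiff_plus; [apply HdJ; lra | apply rdiff_scal, rdiff_id]]. ring. }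
  rewrite RtoC_minus.
  replace (J m) with (J m + - (Ci * eta tau 1) * RtoC m + (Ci * eta tau 1) * RtoC m) by ring. rewrite E. ring.
Qed.

(* Integrating zeta over [-1/2 + iy, 1/2 + iy]: the value at [y = m] follows from oddness, the
   slope in [y] is [i eta1], and the limit at [y = 0+] is the half residue [- i pi]. *)
Lemma legendre : eta tau 1 * tau - eta tau tau = 2 * PI * Ci.
Proof.
  destruct (zeta_line_integral m ltac:(lra)) as [w Hw]. assert (E2 := zeta_middle_integral w Hw).
  assert (Hell : forall x, - (1 / 2) <= x <= 1 / 2 -> hol (ell tau) (RtoC x)).
  { intros x Hx. apply (hol_ell tau tau_pos). destruct (Req_dec x 0) as [->|N]; [auto|right].
    apply not_lat_col. simpl. split; [apply Rabs_pos_lt; auto|]. apply Rle_lt_trans with (1 / 2)%R; [|lra].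
    apply Rabs_le; lra. }
  destruct (CI_ex (fun x => ell tau (RtoC x)) (- (1 / 2)) (1 / 2)) as [l0 Hl0]; [lra| |].
  { intros x Hx. apply (rcont_hol_comp (ell tau) (fun x => RtoC x)); [apply Hell; auto|].
    eapply rdiff_rcont, rdiff_id. }
  (* [ell] is odd. Its value at 0 is obtained by continuity, since [ell_odd] speaks of points off
     the lattice. *)
  assert (El0 : l0 = 0).
  { assert (Hs := CI_plus _ _ _ _ _ _ Hl0 (CI_reflect _ _ _ Hl0)).
    assert (E0 : ell tau 0 = 0).
    { apply Cmod_small_eq. intros e He.
      destruct (hol_cont _ _ (Hell 0%R ltac:(lra)) (e / 2)%R ltac:(lra)) as (d & Hd & B).
      set (x := Rmin (d / 2) (1 / 2)). assert (0 < x) by (apply Rmin_glb_lt; lra).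
      assert (x <= d / 2) by apply Rmin_l. assert (x <= 1 / 2) by apply Rmin_r.
      assert (L : ~ lat (RtoC x)) by (apply not_lat_col; simpl; rewrite Rabs_pos_eq; lra).
      assert (B1 := B (RtoC x) ltac:(replace (RtoC x - 0) with (RtoC x) by ring; rewrite Cmod_R, Rabs_pos_eq; lra)).
      assert (B2 := B (- RtoC x) ltac:(replace (- RtoC x - 0) with (- RtoC x) by ring; rewrite Cmod_opp, Cmod_R, Rabs_pos_eq; lra)).
      rewrite (ell_odd tau tau_pos _ L) in B2.
      replace (ell tau 0 - 0) with (ell tau 0) by ring.
      assert (Cmod (2 * ell tau 0) <= 2 * (e / 2)).
      { rewrite double. replace (ell tau 0 + ell tau 0) with (- ((ell tau (RtoC x) - ell tau 0) + (- ell tau (RtoC x) - ell tau 0))) by ring.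
        rewrite Cmod_opp. eapply Rle_trans; [apply Cmod_triangle|]. lra. }
      rewrite Cmod_mult, Cmod_R, Rabs_pos_eq in H2; lra. }
    assert (Z : l0 + l0 = 0).
    { apply (CI_unique _ _ _ _ _ Hs). apply (CI_ext (fun _ => 0)); [lra| |].
      - intros x Hx. cbv beta. rewrite RtoC_opp. destruct (Req_dec x 0) as [->|N].
        + replace (- 0) with (RtoC 0) by ring. rewrite E0. ring.
        + assert (L : ~ lat (RtoC x)).
          { apply not_lat_col; simpl. split; [apply Rabs_pos_lt; auto|]. apply Rle_lt_trans with (1 / 2)%R; [|lra].
            apply Rabs_le; lra. }
          rewrite (ell_odd tau tau_pos _ L). ring.
      - assert (A := CI_const 0 (- (1 / 2)) (1 / 2)). rewrite Cmult_0_r in A. exact A. }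
    rewrite <- double in Z. destruct (Ceq_dec l0 0) as [|B]; auto.
    exfalso. apply (Cmult_neq_0 _ _ RtoC_2_ne_0 B Z). }
  (* The limit [y -> 0+] of the slope formula, in which the integral at height [y] splits into that
     of [1/z], tending to [- i pi], and that of [ell], tending to [l0 = 0]. *)
  assert (Main : w + PI * Ci = Ci * eta tau 1 * m).
  { apply Cmod_small_eq. intros e He.
    destruct (interval_uniform (- (1 / 2)) (1 / 2) (fun x d => forall y, 0 < y < d ->
      Cmod (ell tau (RtoC x + Ci * RtoC y) - ell tau (RtoC x)) <= e / 4)) as (d1 & Hd1 & B1).
    { intros x d d' Q Hd' y Hy. apply Q. lra. }
    { intros x0 Hx0. destruct (hol_cont _ _ (Hell x0 Hx0) (e / 8)%R ltac:(lra)) as (d & Hd & B).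
      exists (d / 2)%R. split; [lra|]. intros x Hx Hxx y Hy.
      assert (A1 := B (RtoC x + Ci * RtoC y)). assert (A2 := B (RtoC x)).
      rewrite <- RtoC_minus, Cmod_R in A2. specialize (A2 ltac:(lra)).
      assert (Cmod (RtoC x + Ci * RtoC y - RtoC x0) < d).
      { replace (RtoC x + Ci * RtoC y - RtoC x0) with (RtoC (x - x0) + Ci * RtoC y) by (rewrite RtoC_minus; ring).
        eapply Rle_lt_trans; [apply Cmod_triangle|]. rewrite Cmod_mult, Cmod_Ci, !Cmod_R, (Rabs_pos_eq y); lra. }
      specialize (A1 H). pose proof (Cmod_triangle_sub (ell tau (RtoC x + Ci * RtoC y)) (ell tau (RtoC x0)) (ell tau (RtoC x))).
      rewrite (Cmod_minus_sym (ell tau (RtoC x0))) in H0. lra. }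
    destruct (linear_small (Cmod (eta tau 1)) (e / 4)) as (d2 & Hd2 & B2); [apply Cmod_ge_0 | lra|].
    destruct (rdiff_rcont (fun y => RtoC (atan y)) 0 1) with (e := (e / 8)%R) as (d3 & Hd3 & B3); [|lra|].
    { intros e' He'. destruct (real_derive_eps atan 0 1) with (e := e') as (d & Hd & B); auto.
      - apply is_derive_Reals. replace 1%R with (/ (1 + 0 ^ 2))%R by field. apply derivable_pt_lim_atan.
      - exists d; split; auto. intros s Hs. rewrite <- RtoC_minus, <- RtoC_mult, <- RtoC_minus, Cmod_R. apply B; auto. }
    (* In this order: [ell] at height [y] is close to its real values, [eta1 y] is small,
       [atan (2 y)] is small, and [y <= m] for the slope formula. The first three cost [e / 4]
       each. *)
    set (y := Rmin (Rmin (d1 / 2) (d2 / 2)) (Rmin (d3 / 4) m)).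
    assert (Hy : 0 < y) by (repeat apply Rmin_glb_lt; lra).
    assert (y <= d1 / 2 /\ y <= d2 / 2 /\ y <= d3 / 4 /\ y <= m) as (Y1 & Y2 & Y3 & Y4).
    { unfold y. Rmin_facts (Rmin (d1 / 2) (d2 / 2))%R (Rmin (d3 / 4) m)%R.
      Rmin_facts (d1 / 2)%R (d2 / 2)%R.
      Rmin_facts (d3 / 4)%R m. lra. }
    destruct (zeta_line_integral y ltac:(lra)) as [v Hv].
    assert (E1 := zeta_integral_slope y v w ltac:(lra) Hv Hw).
    assert (Ny : forall x, RtoC x + Ci * RtoC y <> 0).
    { intros x E. apply (f_equal Im) in E. rewrite line_Im in E. simpl in E. lra. }
    destruct (CI_ex (fun x => / (RtoC x + Ci * RtoC y)) (- (1 / 2)) (1 / 2)) as [p Hp]; [lra| |].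
    { intros x _. apply (rcont_hol_comp Cinv (fun x => RtoC x + Ci * RtoC y)); [|apply rcont_line].
      eexists; apply sdiff_inv; auto. }
    assert (Ep := CI_inv_line y p Hy Hp).
    assert (Hq : CI (fun x => zeta 1 tau (RtoC x + Ci * RtoC y) - / (RtoC x + Ci * RtoC y) - ell tau (RtoC x))
      (- (1 / 2)) (1 / 2) (v - p - l0)) by (apply CI_minus; [apply CI_minus|]; auto).
    apply (CI_bound _ _ _ (e / 4)%R) in Hq; [|lra|].
    2: { intros x Hx. rewrite (zeta_ell tau tau_pos) by (apply not_lat_strip; rewrite line_Im; lra).
         match goal with |- Cmod ?a <= _ => replace a with (ell tau (RtoC x + Ci * RtoC y) - ell tau (RtoC x)) by ring end.
         apply B1; lra. }
    rewrite El0 in Hq. replace (v - p - 0) with (v - p) in Hq by ring.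
    assert (Eat : atan (1 / 2 / y) = (PI / 2 - atan (2 * y))%R).
    { replace (1 / 2 / y)%R with (/ (2 * y))%R by (field; lra). rewrite atan_inv; [ring|lra]. }
    rewrite Eat in Ep. specialize (B3 (2 * y)%R).
    rewrite Rminus_0_r, Rabs_pos_eq in B3 by lra. specialize (B3 ltac:(lra)).
    rewrite atan_0 in B3. replace (RtoC (atan (2 * y)) - 0) with (RtoC (atan (2 * y))) in B3 by ring.
    specialize (B2 y ltac:(lra)).
    assert (Ep' : p = - (PI * Ci) + 2 * Ci * RtoC (atan (2 * y))).
    { rewrite Ep, RtoC_minus.
      replace (2 * Ci * (RtoC (PI / 2) - RtoC (atan (2 * y)))) with (2 * RtoC (PI / 2) * Ci - 2 * Ci * RtoC (atan (2 * y))) by ring.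
      rewrite <- RtoC_mult. replace (2 * (PI / 2))%R with PI by field. ring. }
    replace (w + PI * Ci - Ci * eta tau 1 * m) with
      ((v - p) + 2 * Ci * RtoC (atan (2 * y)) - Ci * eta tau 1 * RtoC y).
    2: { rewrite RtoC_minus in E1. replace w with (w - v + v) by ring. rewrite E1. rewrite Ep'. ring. }
    eapply Rle_trans; [apply Cmod_minus_le|]. 
    pose proof (Cmod_triangle (v - p) (2 * Ci * RtoC (atan (2 * y)))).
    rewrite !Cmod_mult, Cmod_Ci in *. rewrite (Cmod_R 2), (Rabs_pos_eq 2) in H by lra.
    rewrite (Cmod_R y), (Rabs_pos_eq y) by lra. lra. }
  (* Twice [Main], with [w + w = eta tau] and [2 i m = tau]. *)
  rewrite <- E2. unfold tau at 2.
  replace (eta tau 1 * (2 * RtoC m * Ci)) with (2 * (Ci * eta tau 1 * m)) by ring.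
  rewrite <- Main, double. replace (2 * PI * Ci) with (2 * (PI * Ci)) by ring. rewrite (double (PI * Ci)). ring.
Qed.

End Legendre.

(** * Families of functions depending on time *)

(** A weak form of [F' = G], which can be read off the integral formula for [f] before any
    differentiability of [f] is known. *)
Definition segment_primitive (F G : C -> C) (a b : C) : Prop :=
  CI (fun x => G (a + RtoC x * (b - a)) * (b - a)) 0 1 (F b - F a).

Lemma sdiff_of_primitive (F G : C -> C) (z0 : C) (r : R) : 0 < r ->
  (forall a b, Cmod (a - z0) < r -> Cmod (b - z0) < r -> segment_primitive F G a b) ->
  (forall e, 0 < e -> exists d, 0 < d /\ forall z, Cmod (z - z0) < d -> Cmod (G z - G z0) < e) ->
  sdiff F z0 (G z0).
Proof.
  intros Hr HP Hc e He. destruct (Hc e He) as (d & Hd & B).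
  exists (Rmin r d). split; [apply Rmin_glb_lt; auto|]. intros z z' Hz Hz'.
  Rmin_facts r d.
  assert (Q := HP z' z ltac:(lra) ltac:(lra)).
  assert (Q' := CI_minus _ _ _ _ _ _ Q (CI_const (G z0 * (z - z')) 0 1)).
  apply (CI_bound _ _ _ (e * Cmod (z - z'))) in Q'; [|lra|].
  - replace (F z - F z' - G z0 * (z - z')) with (F z - F z' - RtoC (1 - 0) * (G z0 * (z - z')))
      by (rewrite Rminus_0_r; ring).
    eapply Rle_trans; [exact Q'|]. lra.
  - intros x Hx. 
    replace (G (z' + RtoC x * (z - z')) * (z - z') - G z0 * (z - z'))
      with ((G (z' + RtoC x * (z - z')) - G z0) * (z - z')) by ring.
    apply Cmod_mult_le; [|lra]. left. apply B. apply seg_point_near; auto; lra.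
Qed.

Lemma rcont_segment (F : C -> C) (a b : C) (x : R) : hol F (a + RtoC x * (b - a)) ->
  rcont (fun x => F (a + RtoC x * (b - a)) * (b - a)) x.
Proof.
  intros H. apply (rcont_mult (fun x => F (a + RtoC x * (b - a))) (fun _ => b - a)).
  - apply (rcont_hol_comp F (fun x => a + RtoC x * (b - a))); auto.
    eapply rdiff_rcont, rdiff_segment.
  - eapply rdiff_rcont, rdiff_const.
Qed.

Section Time.
Variables (I : R -> Prop) (t : R).
Hypothesis It : I t.
Hypothesis t_accum : forall d, 0 < d -> exists s, I s /\ s <> t /\ Rabs (s - t) < d.

(** Two candidate slopes are compared along points of [I] accumulating at [t]; this also works at an
    end point of [I] and is what makes [dot] computable. *)
Lemma within_diff_unique (g : R -> C) (l l' : C) :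
  within_diff I g t l -> within_diff I g t l' -> l = l'.
Proof.
  intros H H'. apply Cmod_small_eq. intros e He.
  destruct (H (e / 2)%R ltac:(lra)) as (d & Hd & B). destruct (H' (e / 2)%R ltac:(lra)) as (d' & Hd' & B').
  destruct (t_accum (Rmin d d')) as (s & Is & Ns & Hs); [apply Rmin_glb_lt; auto|].
  Rmin_facts d d'.
  specialize (B s Is ltac:(lra)). specialize (B' s Is ltac:(lra)).
  assert (0 < Rabs (s - t)) by (apply Rabs_pos_lt; lra).
  apply Rmult_le_reg_r with (Rabs (s - t)); auto.
  rewrite <- (Cmod_R (s - t)) at 1. rewrite <- Cmod_mult.
  replace ((l - l') * RtoC (s - t)) with ((g s - g t - l' * RtoC (s - t)) - (g s - g t - l * RtoC (s - t))) by ring.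
  eapply Rle_trans; [apply Cmod_minus_le|]. lra.
Qed.

Lemma within_diff_ext_on (g k : R -> C) (l : C) :
  (forall s, I s -> g s = k s) -> within_diff I g t l -> within_diff I k t l.
Proof.
  intros E H e He. destruct (H e He) as (d & Hd & B). exists d; split; auto.
  intros s Is Hs. rewrite <- !E; auto.
Qed.

Lemma within_diff_ext_near (g k : R -> C) (l : C) (d : R) : 0 < d ->
  (forall s, I s -> Rabs (s - t) < d -> g s = k s) -> within_diff I g t l -> within_diff I k t l.
Proof.
  intros Hd E H e He. destruct (H e He) as (d' & Hd' & B). exists (Rmin d d').
  split; [apply Rmin_glb_lt; auto|].
  Rmin_facts d d'.
  intros s Is Hs. rewrite <- !E; auto; try lra; [apply B; auto; lra|].
  rewrite Rminus_diag, Rabs_R0; auto.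
Qed.

Lemma within_diff_dot (g : R -> C) (l : C) : within_diff I g t l -> dot I g t = l.
Proof.
  intros H. unfold dot.
  apply (iota_unique (V := C_R_CompleteNormedModule)).
  - intros y Hy. apply (within_diff_unique g); auto. exact (proj1 (is_derive_within_eps I g t y It) Hy).
  - exact (proj2 (is_derive_within_eps I g t l It) H).
Qed.

Lemma within_diff_is_derive (g : R -> C) (l : C) :
  within_diff I g t l <-> is_derive_within (V := C_R_NormedModule) I g t l.
Proof. symmetry. exact (is_derive_within_eps I g t l It). Qed.

(** One time is frozen at [t] while both points of the plane move. With [s = t] this is the strict
    derivative in [z], with [z = z'] fixed the time derivative, and with [z = p s] the derivative
    along a moving point. *)
Definition sdt (g : R -> C -> C) (z0 a b : C) : Prop :=
  forall e, 0 < e -> exists d, 0 < d /\ forall s z z', I s -> Rabs (s - t) < d ->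
    Cmod (z - z0) < d -> Cmod (z' - z0) < d ->
    Cmod (g s z - g t z' - (a * RtoC (s - t) + b * (z - z'))) <= e * (Rabs (s - t) + Cmod (z - z')).

Lemma Rabs_self : Rabs (t - t) = 0%R.
Proof. rewrite Rminus_diag. apply Rabs_R0. Qed.

Lemma sdt_within (g : R -> C -> C) (z0 a b : C) : sdt g z0 a b -> within_diff I (fun s => g s z0) t a.
Proof.
  intros H e He. destruct (H e He) as (d & Hd & B). exists d; split; auto. intros s Is Hs.
  specialize (B s z0 z0 Is Hs ltac:(rewrite Cmod_self; auto) ltac:(rewrite Cmod_self; auto)).
  rewrite Cmod_self, Rplus_0_r in B.
  replace (a * RtoC (s - t) + b * (z0 - z0)) with (a * RtoC (s - t)) in B by ring. exact B.
Qed.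

Lemma sdt_sdiff (g : R -> C -> C) (z0 a b : C) : sdt g z0 a b -> sdiff (g t) z0 b.
Proof.
  intros H e He. destruct (H e He) as (d & Hd & B). exists d; split; auto. intros z z' Hz Hz'.
  specialize (B t z z' It ltac:(rewrite Rabs_self; auto) Hz Hz').
  rewrite Rabs_self, Rplus_0_l in B.
  replace (a * RtoC (t - t) + b * (z - z')) with (b * (z - z')) in B by (rewrite Rminus_diag; ring). exact B.
Qed.

Lemma sdt_lipschitz (g : R -> C -> C) (z0 a b : C) : sdt g z0 a b -> exists K d, 0 <= K /\ 0 < d /\
  forall s z z', I s -> Rabs (s - t) < d -> Cmod (z - z0) < d -> Cmod (z' - z0) < d ->
    Cmod (g s z - g t z') <= K * (Rabs (s - t) + Cmod (z - z')).
Proof.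
  intros H. destruct (H 1%R ltac:(lra)) as (d & Hd & B).
  exists (1 + Cmod a + Cmod b)%R, d.
  pose proof (Cmod_ge_0 a). pose proof (Cmod_ge_0 b).
  split; [lra|]. split; auto. intros s z z' Is Hs Hz Hz'. specialize (B s z z' Is Hs Hz Hz').
  pose proof (Cmod_le_add_sub (g s z - g t z') (a * RtoC (s - t) + b * (z - z'))) as Q.
  pose proof (Cmod_triangle (a * RtoC (s - t)) (b * (z - z'))) as Q'.
  rewrite !Cmod_mult, Cmod_R in Q'. 
  pose proof (Rabs_pos (s - t)). pose proof (Cmod_ge_0 (z - z')).
  assert (0 <= Cmod a * Cmod (z - z')) by (apply Rmult_le_pos; auto).
  assert (0 <= Cmod b * Rabs (s - t)) by (apply Rmult_le_pos; auto). lra.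
Qed.

Lemma sdt_cont (g : R -> C -> C) (z0 a b : C) : sdt g z0 a b ->
  forall e, 0 < e -> exists d, 0 < d /\ forall s z, I s -> Rabs (s - t) < d -> Cmod (z - z0) < d ->
    Cmod (g s z - g t z0) < e.
Proof.
  intros H e He. destruct (sdt_lipschitz g z0 a b H) as (K & d & HK & Hd & B).
  destruct (linear_small K e HK He) as (q & Hq & Bq).
  exists (Rmin d (q / 2)). split; [apply Rmin_glb_lt; lra|]. intros s z Is Hs Hz.
  Rmin_facts d (q / 2)%R.
  pose proof (Rabs_pos (s - t)). pose proof (Cmod_ge_0 (z - z0)).
  eapply Rle_lt_trans; [apply B; auto; try lra; rewrite Cmod_self; auto|]. apply Bq. lra.
Qed.

Definition tz_filter (z0 : C) (P : R * (C * C) -> Prop) : Prop :=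
  exists d, 0 < d /\ forall s z z', I s -> Rabs (s - t) < d -> Cmod (z - z0) < d -> Cmod (z' - z0) < d ->
   P (s, (z, z')).

Global Instance tz_filter_filter (z0 : C) : Filter (tz_filter z0).
Proof.
  split.
  - exists 1%R; split; [lra | auto].
  - intros P Q (d & Hd & HP) (d' & Hd' & HQ). exists (Rmin d d'). split; [apply Rmin_glb_lt; auto|].
    intros s z z' Is Hs Hz Hz'. Rmin_facts d d'.
    split; [apply HP | apply HQ]; auto; lra.
  - intros P Q HPQ (d & Hd & HP). exists d; split; auto.
Qed.

Lemma sdt_sd (g : R -> C -> C) (z0 a b : C) :
  sdt g z0 a b <->
  sd (tz_filter z0) (fun p => Rabs (fst p - t) + Cmod (fst (snd p) - snd (snd p)))%R
    (fun p => g (fst p) (fst (snd p))) (fun p => g t (snd (snd p))) (g t z0)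
    (fun p => a * RtoC (fst p - t) + b * (fst (snd p) - snd (snd p))).
Proof.
  split.
  - intros H. split.
    + exists (Cmod a + Cmod b)%R. pose proof (Cmod_ge_0 a). pose proof (Cmod_ge_0 b). split; [lra|].
      exists 1%R; split; [lra|]. intros s z z' _ _ _ _. cbn [fst snd].
      eapply Rle_trans; [apply Cmod_triangle|]. rewrite !Cmod_mult, Cmod_R.
      pose proof (Rabs_pos (s - t)). pose proof (Cmod_ge_0 (z - z')).
      assert (0 <= Cmod a * Cmod (z - z')) by (apply Rmult_le_pos; auto).
      assert (0 <= Cmod b * Rabs (s - t)) by (apply Rmult_le_pos; auto). lra.
    + exact H.
    + intros e He. destruct (sdt_cont g z0 a b H e He) as (d & Hd & B). exists d; split; auto.
    + intros e He. destruct (sdt_cont g z0 a b H e He) as (d & Hd & B). exists d; split; auto.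
      intros s z z' _ _ _ Hz'. apply B; auto. rewrite Rabs_self; auto.
  - intros H. exact (sd_est _ _ _ _ _ _ H).
Qed.

Lemma sdt_comp2 (F : C -> C -> C) (g k : R -> C -> C) (z0 l1 l2 a b a' b' : C) :
  strict2 F (g t z0) (k t z0) l1 l2 -> sdt g z0 a b -> sdt k z0 a' b' ->
  sdt (fun s z => F (g s z) (k s z)) z0 (l1 * a + l2 * a') (l1 * b + l2 * b').
Proof.
  intros HF Hg Hk. apply sdt_sd in Hg. apply sdt_sd in Hk. apply sdt_sd.
  eapply sd_ext; [apply tz_filter_filter | | | | | 
    apply (sd_comp2 _ _ F l1 l2 _ _ _ _ _ _ _ _ HF Hg Hk)]; try reflexivity.
  intros s; cbv beta; ring.
Qed.

Definition C1t (g : R -> C -> C) (z0 : C) : Prop := exists a b, sdt g z0 a b.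

Lemma C1t_comp2 (F : C -> C -> C) (g k : R -> C -> C) (z0 l1 l2 : C) :
  strict2 F (g t z0) (k t z0) l1 l2 -> C1t g z0 -> C1t k z0 -> C1t (fun s z => F (g s z) (k s z)) z0.
Proof. intros HF (a & b & H) (a' & b' & H'). do 2 eexists. apply (sdt_comp2 F); eauto. Qed.

Lemma C1t_mult (g k : R -> C -> C) (z0 : C) : C1t g z0 -> C1t k z0 -> C1t (fun s z => g s z * k s z) z0.
Proof. intros. eapply (C1t_comp2 Cmult); eauto. apply strict2_mult. Qed.

Lemma C1t_plus (g k : R -> C -> C) (z0 : C) : C1t g z0 -> C1t k z0 -> C1t (fun s z => g s z + k s z) z0.
Proof. intros. eapply (C1t_comp2 Cplus); eauto. apply strict2_plus. Qed.

Lemma C1t_comp (F : C -> C) (g : R -> C -> C) (z0 : C) : hol F (g t z0) -> C1t g z0 -> C1t (fun s z => F (g s z)) z0.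
Proof.
  intros [l HF] Hg. apply (C1t_comp2 (fun x _ => F x) g g z0 l 0); auto. apply strict2_fst; auto.
Qed.

Lemma C1t_inv (g : R -> C -> C) (z0 : C) : g t z0 <> 0 -> C1t g z0 -> C1t (fun s z => / g s z) z0.
Proof. intros H. apply (C1t_comp Cinv). eexists; apply sdiff_inv; auto. Qed.

Lemma C1t_time (g : R -> C) (z0 l : C) : within_diff I g t l -> C1t (fun s _ => g s) z0.
Proof.
  intros H. exists l, 0. intros e He. destruct (H e He) as (d & Hd & B). exists d; split; auto.
  intros s z z' Is Hs _ _. replace (l * RtoC (s - t) + 0 * (z - z')) with (l * RtoC (s - t)) by ring.
  eapply Rle_trans; [apply B; auto|]. apply Rmult_le_compat_l; [lra|]. pose proof (Cmod_ge_0 (z - z')). lra.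
Qed.

Lemma C1t_space (F : C -> C) (z0 : C) : hol F z0 -> C1t (fun _ z => F z) z0.
Proof.
  intros [l H]. exists 0, l. intros e He. destruct (H e He) as (d & Hd & B). exists d; split; auto.
  intros s z z' Is Hs Hz Hz'. replace (0 * RtoC (s - t) + l * (z - z')) with (l * (z - z')) by ring.
  eapply Rle_trans; [apply B; auto|]. apply Rmult_le_compat_l; [lra|]. pose proof (Rabs_pos (s - t)). lra.
Qed.

Lemma C1t_id (z0 : C) : C1t (fun _ z => z) z0.
Proof. apply (C1t_space (fun z => z)), hol_id. Qed.

Lemma C1t_const (c z0 : C) : C1t (fun _ _ => c) z0.
Proof. apply (C1t_space (fun _ => c)), hol_const. Qed.

Lemma C1t_minus (g k : R -> C -> C) (z0 : C) : C1t g z0 -> C1t k z0 -> C1t (fun s z => g s z - k s z) z0.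
Proof.
  intros Hg Hk. destruct (C1t_plus g (fun s z => - (1) * k s z) z0 Hg (C1t_mult _ _ _ (C1t_const _ _) Hk)) as (a & b & H).
  exists a, b. intros e He. destruct (H e He) as (d & Hd & B). exists d; split; auto.
  intros s z z' Is Hs Hz Hz'. specialize (B s z z' Is Hs Hz Hz').
  replace (g s z - k s z) with (g s z + - (1) * k s z) by ring.
  replace (g t z' - k t z') with (g t z' + - (1) * k t z') by ring. exact B.
Qed.

Lemma sdt_ext (g k : R -> C -> C) (z0 a b : C) (d : R) : 0 < d ->
  (forall s z, I s -> Rabs (s - t) < d -> Cmod (z - z0) < d -> g s z = k s z) ->
  sdt g z0 a b -> sdt k z0 a b.
Proof.
  intros Hd E H e He. destruct (H e He) as (d' & Hd' & B).
  exists (Rmin d d'). split; [apply Rmin_glb_lt; auto|]. intros s z z' Is Hs Hz Hz'.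
  Rmin_facts d d'.
  rewrite <- (E s z), <- (E t z') by (auto; rewrite ?Rabs_self; lra). apply B; auto; lra.
Qed.

Lemma C1t_ext (g k : R -> C -> C) (z0 : C) :
  (forall s z, I s -> g s z = k s z) -> C1t g z0 -> C1t k z0.
Proof.
  intros E (a & b & H). exists a, b. eapply (sdt_ext g k z0 a b 1); auto; lra.
Qed.

(** The total derivative along a moving point [p]; it is applied to the critical points [z_k] and to
    [z + tau]. *)
Lemma sdt_chain (g : R -> C -> C) (p : R -> C) (a b p' : C) :
  sdt g (p t) a b -> within_diff I p t p' -> within_diff I (fun s => g s (p s)) t (a + b * p').
Proof.
  intros H Hp e He.
  set (K := (2 + Cmod p' + Cmod b)%R).
  assert (HK : 0 < K) by (unfold K; pose proof (Cmod_ge_0 p'); pose proof (Cmod_ge_0 b); lra).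
  set (e1 := (e / (2 * K))%R). assert (He1 : 0 < e1) by (apply Rdiv_lt_0_compat; lra).
  destruct (H e1 He1) as (d & Hd & B).
  set (e2 := Rmin 1 e1). assert (He2 : 0 < e2) by (apply Rmin_glb_lt; lra).
  assert (E1 : e2 <= 1) by apply Rmin_l. assert (E2 : e2 <= e1) by apply Rmin_r.
  destruct (Hp e2 He2) as (d1 & Hd1 & B1).
  destruct (within_diff_cont _ _ _ _ Hp d Hd) as (d2 & Hd2 & B2).
  exists (Rmin d (Rmin d1 d2)). split; [repeat apply Rmin_glb_lt; auto|]. intros s Is Hs.
  Rmin_facts d (Rmin d1 d2)%R.
  Rmin_facts d1 d2.
  specialize (B1 s Is ltac:(lra)). specialize (B2 s Is ltac:(lra)).
  specialize (B s (p s) (p t) Is ltac:(lra) B2 ltac:(rewrite Cmod_self; auto)).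
  set (m := Rabs (s - t)) in *. assert (0 <= m) by apply Rabs_pos.
  assert (e2 * m <= 1 * m) by (apply Rmult_le_compat_r; auto).
  assert (Q : Cmod (p s - p t) <= (1 + Cmod p') * m).
  { pose proof (Cmod_le_add_sub (p s - p t) (p' * RtoC (s - t))) as T.
    rewrite Cmod_mult, Cmod_R in T. fold m in T. lra. }
  replace (g s (p s) - g t (p t) - (a + b * p') * RtoC (s - t)) with
    ((g s (p s) - g t (p t) - (a * RtoC (s - t) + b * (p s - p t))) + b * (p s - p t - p' * RtoC (s - t))) by ring.
  apply Rle_trans with (e1 * (m + (1 + Cmod p') * m) + Cmod b * (e1 * m))%R.
  - apply Cmod_add_le.
    + eapply Rle_trans; [apply B|]. apply Rmult_le_compat_l; lra.
    + apply Cmod_mult_le; [lra|]. eapply Rle_trans; [apply B1|]. apply Rmult_le_compat_r; auto.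
  - replace (e1 * (m + (1 + Cmod p') * m) + Cmod b * (e1 * m))%R with (e1 * K * m)%R by (unfold K; ring).
    unfold e1. replace (e / (2 * K) * K * m)%R with (e * m / 2)%R by (field; lra).
    assert (0 <= e * m) by (apply Rmult_le_pos; lra). lra.
Qed.

Definition tder (g : R -> C -> C) (z : C) : C := dot I (fun s => g s z) t.

Lemma sdt_tder (g : R -> C -> C) (z0 a b : C) : sdt g z0 a b -> tder g z0 = a.
Proof. intros H. apply within_diff_dot. eapply sdt_within; eauto. Qed.

Lemma C1t_sdt (g : R -> C -> C) (z0 : C) : C1t g z0 -> sdt g z0 (tder g z0) (C_derive (g t) z0).
Proof.
  intros (a & b & H). rewrite (sdt_tder _ _ _ _ H), (sdiff_C_derive _ _ _ (sdt_sdiff _ _ _ _ H)). exact H.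
Qed.

Lemma C1t_hol (g : R -> C -> C) (z0 : C) : C1t g z0 -> hol (g t) z0.
Proof. intros (a & b & H). exists b. eapply sdt_sdiff; eauto. Qed.

(** Taking [z' = z] in [sdt] at [z0] already makes the time increment at all nearby [z] nearly
    linear, with slope [tder g z0]; this slope is then exchanged for [tder g z]. *)
Lemma tder_uniform (g : R -> C -> C) (z0 : C) : C1t g z0 ->
  forall e, 0 < e -> exists d, 0 < d /\ forall z, Cmod (z - z0) < d -> C1t g z ->
    Cmod (tder g z - tder g z0) <= e /\
    forall s, I s -> Rabs (s - t) < d -> 
     Cmod (g s z - g t z - tder g z * RtoC (s - t)) <= e * Rabs (s - t).
Proof.
  intros H e He. destruct (C1t_sdt g z0 H (e / 4)%R ltac:(lra)) as (d & Hd & B).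
  exists d; split; auto. intros z Hz Hgz.
  assert (Q : Cmod (tder g z - tder g z0) <= e / 2).
  { assert (W := sdt_within _ _ _ _ (C1t_sdt g z Hgz)).
    destruct (W (e / 4)%R ltac:(lra)) as (d' & Hd' & B').
    destruct (t_accum (Rmin d d')) as (s & Is & Ns & Hs); [apply Rmin_glb_lt; auto|].
    Rmin_facts d d'.
    specialize (B s z z Is ltac:(lra) Hz Hz). specialize (B' s Is ltac:(lra)).
    rewrite Cmod_self, Rplus_0_r in B.
    assert (0 < Rabs (s - t)) by (apply Rabs_pos_lt; lra).
    apply Rmult_le_reg_r with (Rabs (s - t)); auto.
    rewrite <- (Cmod_R (s - t)) at 1. rewrite <- Cmod_mult.
    replace ((tder g z - tder g z0) * RtoC (s - t)) with
      ((g s z - g t z - (tder g z0 * RtoC (s - t) + C_derive (g t) z0 * (z - z))) - (g s z - g t z - tder g z * RtoC (s - t))) by ring.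
    eapply Rle_trans; [apply Cmod_minus_le|]. lra. }
  split; [lra|]. intros s Is Hs.
  specialize (B s z z Is Hs Hz Hz). rewrite Cmod_self, Rplus_0_r in B.
  replace (g s z - g t z - tder g z * RtoC (s - t)) with
    ((g s z - g t z - (tder g z0 * RtoC (s - t) + C_derive (g t) z0 * (z - z))) - (tder g z - tder g z0) * RtoC (s - t)) by ring.
  eapply Rle_trans; [apply Cmod_minus_le|]. rewrite Cmod_mult, Cmod_R.
  assert (Cmod (tder g z - tder g z0) * Rabs (s - t) <= e / 2 * Rabs (s - t)) by (apply Rmult_le_compat_r; auto using Rabs_pos).
  pose proof (Rabs_pos (s - t)). assert (0 <= e * Rabs (s - t)) by (apply Rmult_le_pos; lra). lra.
Qed.

(** [tder_uniform] supplies the local uniformity that [integral_within_diff] asks for. *)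
Lemma segment_tder (g G : R -> C -> C) (a b : C) :
  (forall x, 0 <= x <= 1 -> exists r, 0 < r /\ forall z, Cmod (z - (a + RtoC x * (b - a))) < r -> C1t g z) ->
  (exists d, 0 < d /\ forall s, I s -> Rabs (s - t) < d -> segment_primitive (G s) (g s) a b) ->
  exists v, CI (fun x => tder g (a + RtoC x * (b - a)) * (b - a)) 0 1 v /\
   within_diff I (fun s => G s b - G s a) t v.
Proof.
  intros Hg HG. set (p := fun x => a + RtoC x * (b - a)).
  assert (Hp : forall x, rcont p x) by (intros x; eapply rdiff_rcont, rdiff_segment).
  destruct (CI_ex (fun x => tder g (p x) * (b - a)) 0 1) as [v Hv]; [lra| |].
  { intros x Hx. apply (rcont_mult (fun x => tder g (p x)) (fun _ => b - a)); [|eapply rdiff_rcont, rdiff_const].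
    intros e He. destruct (Hg x Hx) as (r & Hr & Br).
    destruct (tder_uniform g (p x) (Br (p x) ltac:(unfold p; rewrite Cmod_self; auto)) (e / 2)%R ltac:(lra)) as (d & Hd & B).
    destruct (Hp x (Rmin r d)) as (d' & Hd' & B'); [apply Rmin_glb_lt; auto|].
    Rmin_facts r d.
    exists d'; split; auto. intros y Hy. specialize (B' y Hy).
    destruct (B (p y) ltac:(lra)) as [Q _]; [apply Br; fold (p x); lra|]. lra. }
  exists v. split; auto.
  apply (integral_within_diff I t 0 1 (fun s x => g s (p x) * (b - a)) (fun x => tder g (p x) * (b - a))
    (fun s => G s b - G s a) v); [lra|auto| |exact HG|exact Hv].
  intros e u0 He Hu0. destruct (Hg u0 Hu0) as (r & Hr & Br).
  destruct (linear_small (Cmod (b - a)) e (Cmod_ge_0 _) He) as (q & Hq & Bq).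
  specialize (Bq (q / 2)%R ltac:(lra)).
  destruct (tder_uniform g (p u0) (Br (p u0) ltac:(unfold p; rewrite Cmod_self; auto)) (q / 2)%R ltac:(lra)) as (d & Hd & B).
  destruct (Hp u0 (Rmin r d)) as (d' & Hd' & B'); [apply Rmin_glb_lt; auto|].
  Rmin_facts r d.
  exists (Rmin d d'). split; [apply Rmin_glb_lt; auto|]. intros u s Hu Hu' Is Hs.
  Rmin_facts d d'.
  specialize (B' u ltac:(lra)).
  destruct (B (p u) ltac:(lra)) as [_ Q]; [apply Br; fold (p u0); lra|]. specialize (Q s Is ltac:(lra)).
  replace (g s (p u) * (b - a) - g t (p u) * (b - a) - tder g (p u) * (b - a) * RtoC (s - t))
    with ((g s (p u) - g t (p u) - tder g (p u) * RtoC (s - t)) * (b - a)) by ring.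
  rewrite Cmod_mult.
  apply Rle_trans with (q / 2 * Rabs (s - t) * Cmod (b - a))%R.
  - apply Rmult_le_compat_r; auto using Cmod_ge_0.
  - replace (q / 2 * Rabs (s - t) * Cmod (b - a))%R with (Cmod (b - a) * (q / 2) * Rabs (s - t))%R by ring.
    apply Rmult_le_compat_r; [apply Rabs_pos|lra].
Qed.

(** Differentiability in time at [z0] alone is enough: the increment of [G] from [z0] to [z] is an
    integral of [g], so its change between [t] and [s] is [O(|s - t| |z - z0|)], negligible near
    [z0]. *)
Lemma primitive_C1t (g G : R -> C -> C) (z0 : C) (r : R) : 0 < r ->
  (forall z, Cmod (z - z0) < r -> C1t g z) ->
  (exists d, 0 < d /\ forall s a b, I s -> Rabs (s - t) < d -> 
     Cmod (a - z0) < r -> Cmod (b - z0) < r -> segment_primitive (G s) (g s) a b) ->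
  (exists l, within_diff I (fun s => G s z0) t l) ->
  sdt G z0 (tder G z0) (g t z0).
Proof.
  intros Hr Hg (d0 & Hd0 & HG) [l Hl].
  assert (El : tder G z0 = l) by (apply within_diff_dot; auto). rewrite El.
  assert (Hg0 : C1t g z0) by (apply Hg; rewrite Cmod_self; auto).
  assert (HS : sdiff (G t) z0 (g t z0)).
  { apply (sdiff_of_primitive (G t) (g t) z0 r Hr).
    - intros a b Ha Hb. apply HG; auto. rewrite Rabs_self; auto.
    - apply hol_cont, C1t_hol; auto. }
  destruct Hg0 as (ga & gb & Hg0). destruct (sdt_lipschitz g z0 ga gb Hg0) as (K & dK & HK & HdK & BK).
  intros e He. destruct (HS (e / 3)%R ltac:(lra)) as (d1 & Hd1 & B1).
  destruct (Hl (e / 3)%R ltac:(lra)) as (d2 & Hd2 & B2).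
  destruct (linear_small K (e / 3)) as (q & Hq & Bq); [auto|lra|].
  set (d := Rmin (Rmin (Rmin d0 r) dK) (Rmin (Rmin d1 d2) (q / 2))).
  assert (Hd : 0 < d) by (repeat apply Rmin_glb_lt; lra).
  assert (d <= d0 /\ d <= r /\ d <= dK /\ d <= d1 /\ d <= d2 /\ d <= q / 2) as (D0 & D1 & D2 & D3 & D4 & D5).
  { unfold d. Rmin_facts (Rmin (Rmin d0 r) dK)%R (Rmin (Rmin d1 d2) (q / 2))%R.
    Rmin_facts (Rmin d0 r)%R dK.
    Rmin_facts d0 r. 
    Rmin_facts (Rmin d1 d2)%R (q / 2)%R.
    Rmin_facts d1 d2. lra. }
  exists d; split; auto. intros s z z' Is Hs Hz Hz'.
  specialize (B1 z z' ltac:(lra) ltac:(lra)). specialize (B2 s Is ltac:(lra)).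
  assert (Hz00 : Cmod (z0 - z0) < r) by (rewrite Cmod_self; auto).
  assert (Q1 := HG s z0 z Is ltac:(lra) Hz00 ltac:(lra)).
  assert (Q2 := HG t z0 z It ltac:(rewrite Rabs_self; auto) Hz00 ltac:(lra)).
  assert (Q := CI_minus _ _ _ _ _ _ Q1 Q2).
  apply (CI_bound _ _ _ (e / 3 * Rabs (s - t))%R) in Q; [|lra|].
  (* Three errors of size [e / 3]: the change in time of the increment from [z0], the time increment
     at [z0], and the space increment at time [t]. *)
  - replace (G s z - G t z' - (l * RtoC (s - t) + g t z0 * (z - z'))) with
      ((G s z - G s z0 - (G t z - G t z0)) + (G s z0 - G t z0 - l * RtoC (s - t)) 
        + (G t z - G t z' - g t z0 * (z - z'))) by ring.
    pose proof (Rabs_pos (s - t)). pose proof (Cmod_ge_0 (z - z')).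
    apply Rle_trans with (e / 3 * Rabs (s - t) * (1 - 0) + e / 3 * Rabs (s - t) + e / 3 * Cmod (z - z'))%R.
    + apply Cmod_add_le; auto. apply Cmod_add_le; auto.
    + assert (0 <= e * Rabs (s - t)) by (apply Rmult_le_pos; lra).
      assert (0 <= e * Cmod (z - z')) by (apply Rmult_le_pos; lra). lra.
  - intros x Hx. set (u := z0 + RtoC x * (z - z0)).
    assert (Hu : Cmod (u - z0) < d) by (apply seg_point_near; auto; rewrite Cmod_self; auto).
    replace (g s u * (z - z0) - g t u * (z - z0)) with ((g s u - g t u) * (z - z0)) by ring.
    specialize (BK s u u Is ltac:(lra) ltac:(lra) ltac:(lra)). rewrite Cmod_self, Rplus_0_r in BK.
    specialize (Bq (Cmod (z - z0)) ltac:(split; [apply Cmod_ge_0 | lra])).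
    rewrite Cmod_mult. pose proof (Rabs_pos (s - t)).
    apply Rle_trans with (K * Rabs (s - t) * Cmod (z - z0))%R.
    + apply Rmult_le_compat_r; auto using Cmod_ge_0.
    + replace (K * Rabs (s - t) * Cmod (z - z0))%R with (K * Cmod (z - z0) * Rabs (s - t))%R by ring.
      apply Rmult_le_compat_r; lra.
Qed.

End Time.

(** * The family of slit maps *)

Lemma interval_accum (I : R -> Prop) (t : R) : is_interval I -> I t ->
  forall d, 0 < d -> exists s, I s /\ s <> t /\ Rabs (s - t) < d.
Proof.
  intros [Hc (a & b & Ia & Ib & Hab)] It d Hd.
  destruct (Rlt_or_le t b) as [L|L].
  - exists (Rmin b (t + d / 2)). Rmin_facts b (t + d / 2)%R.
    assert (t < Rmin b (t + d / 2)) by (apply Rmin_glb_lt; lra).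
    split; [apply (Hc t b); auto; lra|]. split; [lra|]. rewrite Rabs_pos_eq; lra.
  - exists (Rmax a (t - d / 2)). pose proof (Rmax_l a (t - d / 2)). pose proof (Rmax_r a (t - d / 2)).
    assert (Rmax a (t - d / 2) < t) by (apply Rmax_lub_lt; lra).
    split; [apply (Hc a t); auto; lra|]. split; [lra|]. rewrite Rabs_left; lra.
Qed.

Lemma smooth_within_diff (I : R -> Prop) (g : R -> C) (t : R) : I t ->
  smooth_within (V := C_R_NormedModule) I g -> exists l, within_diff I g t l.
Proof.
  intros It (d & H0 & H). exists (d 1%nat t). apply (within_diff_ext_on I t It (d 0%nat)); [exact H0|].
  exact (proj1 (is_derive_within_eps I (d 0%nat) t (d 1%nat t) It) (H 0%nat t It)).
Qed.

Lemma smooth_within_diff_R (I : R -> Prop) (g : R -> R) (t : R) : I t ->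
  smooth_within (V := R_NormedModule) I g -> exists l : R, within_diff I (fun s => RtoC (g s)) t (RtoC l).
Proof.
  intros It (d & H0 & H). exists (d 1%nat t).
  apply (within_diff_ext_on I t It (fun s => RtoC (d 0%nat s))); [intros s Is; now rewrite H0|].
  intros e He.
  destruct (is_derive_within_R_eps I (d 0%nat) t (d 1%nat t) It (H 0%nat t It) e He) as (r & Hr & B).
  exists r; split; auto. intros s Is Hs. rewrite <- RtoC_minus, <- RtoC_mult, <- RtoC_minus, Cmod_R. auto.
Qed.

Lemma line_integral_app (F : C -> C) (U : C -> Prop) (a b e u v : C) :
  line_integral F U a b u -> line_integral F U b e v -> line_integral F U a e (u + v).
Proof.
  intros H1 H2. induction H1 as [a|a b1 e1 p dp u1 v1 Hp Hc HU Ha Hb Hi Hl IH].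
  - rewrite Cplus_0_l. exact H2.
  - rewrite <- Cplus_assoc. eapply line_integral_arc; eauto.
Qed.

Lemma line_integral_segment (F : C -> C) (U : C -> Prop) (a b u : C) :
  (forall x, 0 <= x <= 1 -> U (a + RtoC x * (b - a))) ->
  CI (fun x => F (a + RtoC x * (b - a)) * (b - a)) 0 1 u -> line_integral F U a b u.
Proof.
  intros HU Hu. replace u with (u + 0) by ring.
  apply (line_integral_arc F U a b b (fun x => a + RtoC x * (b - a)) (fun _ => b - a)); auto.
  - intros s. apply rdiff_is_derive, rdiff_segment.
  - intros s. apply continuous_const.
  - ring.
  - ring.
  - constructor.
Qed.

Section Family.
Variables (I : R -> Prop) (theta beta : R) (P : slit_data) (f : C -> R -> C).
Hypothesis Hf : slit_family I theta beta P f.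

Notation tau := (omega2 P).
Notation nonpole s z := (~ is_pole P s z).

Lemma Im_tau_pos (s : R) : I s -> 0 < Im (tau s).
Proof. intros Is. apply tau_pos. apply (sm_m _ _ _ _ _ (sf_map _ _ _ _ _ Hf s Is)). Qed.

(** Conjugation is not holomorphic, but [z0] is purely imaginary, so its conjugate is a smooth
    function of [t] through [y_0]. *)
Lemma conj_z0_eq (s : R) : Cconj (z0 P s) = - Ci * RtoC (dy0 P s).
Proof. unfold z0, Cconj, Ci, RtoC, Cmult, Copp; simpl. f_equal; ring. Qed.

Lemma sigma_t_kap (s : R) (z : C) : sigma_t P s z = z * kap z (tau s).
Proof. reflexivity. Qed.

Lemma sigma_t_ne_0 (s : R) (z : C) : I s -> ~ lattice_t P s z -> sigma_t P s z <> 0.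
Proof. intros Is. apply (sigma_ne_0 (tau s) (Im_tau_pos s Is)). Qed.

Definition phi (s : R) (z : C) : C := dc P s * integrand beta P s z.

(** * Smoothness of the integrand in the parameter *)

Section Coefficients.
Variable t : R.
Hypothesis It : I t.

Let t_accum := interval_accum I t (sf_interval _ _ _ _ _ Hf) It.
Let tp := Im_tau_pos t It.

Lemma tau_diff : exists l, within_diff I tau t l.
Proof.
  destruct (smooth_within_diff_R I (dm P) t It (sf_m _ _ _ _ _ Hf)) as [l Hl].
  exists (2 * Ci * RtoC l). eapply within_diff_ext; [| |apply (within_diff_scal I t (2 * Ci) _ _ Hl)]; [|reflexivity].
  intros s. unfold omega2. ring.
Qed.

Lemma z0_diff : exists l, within_diff I (z0 P) t l.
Proof.
  destruct (smooth_within_diff_R I (dy0 P) t It (sf_y0 _ _ _ _ _ Hf)) as [l Hl].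
  exists (Ci * RtoC l). apply (within_diff_scal I t Ci _ _ Hl).
Qed.

Lemma conj_z0_diff : exists l, within_diff I (fun s => Cconj (z0 P s)) t l.
Proof.
  destruct (smooth_within_diff_R I (dy0 P) t It (sf_y0 _ _ _ _ _ Hf)) as [l Hl].
  exists (- Ci * RtoC l). eapply within_diff_ext; [| |apply (within_diff_scal I t (- Ci) _ _ Hl)]; [|reflexivity].
  intros s. now rewrite conj_z0_eq.
Qed.

Lemma zpt_diff (k : nat) : In k K4 -> exists l, within_diff I (zpt P k) t l.
Proof.
  intros Hk. destruct (smooth_within_diff_R I (dx P k) t It (sf_x _ _ _ _ _ Hf k Hk)) as [l Hl].
  destruct (smooth_within_diff_R I (dm P) t It (sf_m _ _ _ _ _ Hf)) as [l' Hl'].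
  simpl in Hk. destruct Hk as [<-|[<-|[<-|[<-|[]]]]].
  - exists l. exact Hl.
  - exists l. exact Hl.
  - exists (RtoC l + Ci * RtoC l'). apply (within_diff_plus I t); auto. apply (within_diff_scal I t); auto.
  - exists (RtoC l + - Ci * RtoC l').
    apply (within_diff_ext I t (fun s => RtoC (dx P 4 s) + - Ci * RtoC (dm P s)) _ (RtoC l + - Ci * RtoC l')); [|reflexivity|].
    + intros s. unfold zpt. ring.
    + apply (within_diff_plus I t); auto. apply (within_diff_scal I t); auto.
Qed.

Lemma within_diff_hol (g : R -> C) (F : C -> C) : hol F (g t) -> (exists l, within_diff I g t l) ->
  exists l, within_diff I (fun s => F (g s)) t l.
Proof. intros [a Ha] [l Hl]. eexists. apply (within_diff_comp I t F g a l); auto. Qed.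

(** [eta_1 = 2 zeta(1/2)] and [zeta(1/2) = 2 + ell(1/2)]. The last term is a quotient of functions
    holomorphic in the period, composed with [omega2]. *)
Lemma gam_diff : exists l, within_diff I (gam beta P) t l.
Proof.
  assert (H : exists l, within_diff I (fun s => partial1 kap (1 / 2) (tau s) * / kap (1 / 2) (tau s)) t l).
  { apply (within_diff_hol tau (fun w => partial1 kap (1 / 2) w * / kap (1 / 2) w)); [|apply tau_diff].
    apply (hol_mult (fun w => partial1 kap (1 / 2) w) (fun w => / kap (1 / 2) w)).
    - destruct (hol2_partial1 kap (1 / 2) (tau t) (kap_hol2 (1 / 2) (tau t) tp)) as (r & M & Hr & H).
      refine (proj1 (proj2 (H (1 / 2) (tau t) _ _))); rewrite Cmod_self; auto.
    - apply (hol_inv (fun w => kap (1 / 2) w)).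
      + destruct (kap_hol2 (1 / 2) (tau t) tp) as (r & M & Hr & H).
        refine (proj1 (proj2 (H (1 / 2) (tau t) _ _))); rewrite Cmod_self; auto.
      + apply (kap_ne (tau t) tp). right. apply (not_lat_half_1 (tau t) tp). }
  destruct H as [l Hl].
  exists (beta / PI * 2 * (0 + l)).
  apply (within_diff_ext_on I t It (fun s => beta / PI * 2 * (/ (1 / 2) + partial1 kap (1 / 2) (tau s) * / kap (1 / 2) (tau s)))).
  - intros s Is. unfold gam, eta1, zeta_t, omega1.
    rewrite (zeta_ell (tau s) (Im_tau_pos s Is)) by apply (not_lat_half_1 (tau s) (Im_tau_pos s Is)).
    unfold ell. unfold Cdiv. ring.
  - apply (within_diff_scal I t). apply (within_diff_plus I t); auto. apply within_diff_const.
Qed.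

Lemma C1t_time_ex (g : R -> C) (z0 : C) : (exists l, within_diff I g t l) -> C1t I t (fun s _ => g s) z0.
Proof. intros [l H]. apply (C1t_time I t g z0 l H). Qed.

Lemma C1t_sub (p : R -> C) (z1 : C) : (exists l, within_diff I p t l) -> C1t I t (fun s z => z - p s) z1.
Proof.
  intros H. apply (C1t_minus I t It (fun _ z => z) (fun s _ => p s)); [apply C1t_id; auto | apply C1t_time_ex; auto].
Qed.

(** [kap], strictly differentiable in both variables, is composed with a point moving in time and
    with the moving period. *)
Lemma C1t_kap (p : R -> C) (z1 : C) : (exists l, within_diff I p t l) ->
  C1t I t (fun s z => kap (z - p s) (tau s)) z1.
Proof.
  intros H.
  apply (C1t_comp2 I t It kap (fun s z => z - p s) (fun s _ => tau s) z1 _ _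
    (hol2_strict2 kap (z1 - p t) (tau t) (kap_hol2 (z1 - p t) (tau t) tp))).
  - apply C1t_sub; auto.
  - apply C1t_time_ex, tau_diff.
Qed.

Lemma C1t_sigma (p : R -> C) (z1 : C) : (exists l, within_diff I p t l) ->
  C1t I t (fun s z => sigma_t P s (z - p s)) z1.
Proof.
  intros H. apply (C1t_ext I t It (fun s z => (z - p s) * kap (z - p s) (tau s))); [reflexivity|].
  apply (C1t_mult I t It (fun s z => z - p s) (fun s z => kap (z - p s) (tau s))); [apply C1t_sub | apply C1t_kap]; auto.
Qed.

Definition numer (s : R) (z : C) : C :=
  dc P s * (Cexp (gam beta P s * z) * Cprod (fun k => sigma_t P s (z - zpt P k s)) K4).

Lemma C1t_numer (z1 : C) : C1t I t numer z1.
Proof.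
  unfold numer. apply (C1t_mult I t It (fun s _ => dc P s)).
  { apply C1t_time_ex, smooth_within_diff; auto. apply (sf_c _ _ _ _ _ Hf). }
  apply (C1t_mult I t It (fun s z => Cexp (gam beta P s * z))).
  { apply (C1t_comp I t It Cexp (fun s z => gam beta P s * z)); [eexists; apply sdiff_Cexp|].
    apply (C1t_mult I t It (fun s _ => gam beta P s) (fun _ z => z)); [apply C1t_time_ex, gam_diff | apply C1t_id; auto]. }
  assert (Hk : forall k, In k K4 -> C1t I t (fun s z => sigma_t P s (z - zpt P k s)) z1)
    by (intros k Hk; apply C1t_sigma, zpt_diff; auto).
  generalize K4 Hk. intros l. induction l as [|k l IH]; intros Hl; simpl.
  - apply (C1t_const I t 1).
  - apply (C1t_mult I t It (fun s z => sigma_t P s (z - zpt P k s))); [apply Hl | apply IH; intros; apply Hl]; simpl; auto.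
Qed.

Lemma phi_numer (s : R) (z : C) : phi s z = numer s z *
  / (sigma_t P s (z - z0 P s) ^ 2 * sigma_t P s (z - Cconj (z0 P s)) ^ 2).
Proof. unfold phi, integrand, numer, Cdiv. ring. Qed.

Lemma nonpole_sigma (s : R) (z : C) : I s -> nonpole s z ->
  sigma_t P s (z - z0 P s) <> 0 /\ sigma_t P s (z - Cconj (z0 P s)) <> 0.
Proof.
  intros Is H. split; apply sigma_t_ne_0; auto; intros L; apply H; [left | right]; exact L.
Qed.

Definition denom (s : R) (z : C) : C :=
  (sigma_t P s (z - z0 P s) * sigma_t P s (z - z0 P s)) *
  (sigma_t P s (z - Cconj (z0 P s)) * sigma_t P s (z - Cconj (z0 P s))).

Lemma C1t_denom (z1 : C) : C1t I t denom z1.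
Proof.
  assert (H0 := C1t_sigma (z0 P) z1 z0_diff).
  assert (H1 := C1t_sigma (fun s => Cconj (z0 P s)) z1 conj_z0_diff).
  unfold denom. apply (C1t_mult I t It (fun s z => sigma_t P s (z - z0 P s) * sigma_t P s (z - z0 P s))).
  - apply (C1t_mult I t It (fun s z => sigma_t P s (z - z0 P s))); auto.
  - apply (C1t_mult I t It (fun s z => sigma_t P s (z - Cconj (z0 P s)))); auto.
Qed.

Lemma denom_ne_0 (s : R) (z : C) : I s -> nonpole s z -> denom s z <> 0.
Proof.
  intros Is H. destruct (nonpole_sigma s z Is H). unfold denom. apply Cmult_neq_0; apply Cmult_neq_0; auto.
Qed.

Lemma phi_C1t (z1 : C) : nonpole t z1 -> C1t I t phi z1.
Proof.
  intros H. apply (C1t_ext I t It (fun s z => numer s z * / denom s z)).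
  { intros s z _. rewrite phi_numer. unfold denom. f_equal. f_equal. simpl. ring. }
  apply (C1t_mult I t It numer (fun s z => / denom s z)); [apply C1t_numer|].
  apply (C1t_inv I t It denom); [apply denom_ne_0; auto | apply C1t_denom].
Qed.

End Coefficients.

(** * Poles, and paths that avoid them *)

Lemma lattice_t_coords (s : R) (z : C) : lattice_t P s z <->
  exists n k : Z, Re z = IZR n /\ Im z = (IZR k * (2 * dm P s))%R.
Proof.
  split; [apply (lat_coords (dm P s))|]. intros (n & k & E1 & E2). exists (n, k).
  rewrite (surjective_pairing z). fold (Re z) (Im z). rewrite E1, E2.
  unfold lattice_point, omega1, omega2, Ci, Cmult, Cplus, RtoC; simpl. f_equal; ring.
Qed.

Lemma is_pole_coords (s : R) (z : C) : is_pole P s z <->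
  exists n k : Z, Re z = IZR n /\ (Im z = IZR k * (2 * dm P s) + dy0 P s \/ Im z = IZR k * (2 * dm P s) - dy0 P s)%R.
Proof.
  unfold is_pole. rewrite !lattice_t_coords.
  assert (E1 : Re (z - z0 P s) = Re z) by (unfold z0, Ci, Re, Im; simpl; ring).
  assert (E2 : Im (z - z0 P s) = (Im z - dy0 P s)%R) by (unfold z0, Ci, Re, Im; simpl; ring).
  assert (E3 : Re (z - Cconj (z0 P s)) = Re z) by (unfold z0, Ci, Re, Im; simpl; ring).
  assert (E4 : Im (z - Cconj (z0 P s)) = (Im z + dy0 P s)%R) by (unfold z0, Ci, Re, Im; simpl; ring).
  rewrite E1, E2, E3, E4. split.
  - intros [(n & k & A & B)|(n & k & A & B)]; exists n, k; split; auto; [left | right]; lra.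
  - intros (n & k & A & [B|B]); [left | right]; exists n, k; split; auto; lra.
Qed.

Lemma real_axis_nonpole (s x : R) : I s -> nonpole s (RtoC x).
Proof.
  intros Is H. destruct (sm_y0 _ _ _ _ _ (sf_map _ _ _ _ _ Hf s Is)) as [Y1 Y2].
  apply is_pole_coords in H. destruct H as (n & k & _ & H). simpl in H.
  assert (k < 1)%Z by (apply lt_IZR; apply Rmult_lt_reg_r with (2 * dm P s)%R; lra).
  assert (-1 < k)%Z by (apply lt_IZR; apply Rmult_lt_reg_r with (2 * dm P s)%R; lra).
  assert (k = 0%Z) as -> by lia. lra.
Qed.

(** An induction along polygonal paths from 0. All poles have integral real part and none is real,
    so one moves along the real axis and then vertically, with a detour when [Re z] is an
    integer. *)
Lemma nonpole_ind (s : R) (Q : C -> Prop) : I s -> Q 0 ->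
  (forall a b, Q a -> (forall x, 0 <= x <= 1 -> nonpole s (a + RtoC x * (b - a))) -> Q b) ->
  forall z, nonpole s z -> Q z.
Proof.
  intros Is H0 Hstep z Hz.
  assert (HR : forall x, Q (RtoC x)).
  { intros x. apply (Hstep 0); auto. intros u _.
    replace (0 + RtoC u * (RtoC x - 0)) with (RtoC (u * x)) by (rewrite RtoC_mult; ring).
    apply real_axis_nonpole; auto. }
  destruct (classic (exists n, Re z = IZR n)) as [[n Hn]|Hn].
  (* Up the line of abscissa [1/2], then horizontally to [z]. A pole on the horizontal segment would
     have the same imaginary part as [z], and [z], having integral real part, would be a pole
     too. *)
  - apply (Hstep (RtoC (1 / 2) + Ci * RtoC (Im z))).
    + apply (Hstep (RtoC (1 / 2))); auto. intros u _ A. apply is_pole_coords in A.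
      destruct A as (n' & _ & A & _).
      replace (Re (RtoC (1 / 2) + RtoC u * (RtoC (1 / 2) + Ci * RtoC (Im z) - RtoC (1 / 2)))) with (1 / 2)%R in A
        by (unfold Ci, Re, Im; simpl; ring).
      assert (IZR (2 * n') = 1)%R by (rewrite mult_IZR; lra). apply eq_IZR in H. lia.
    + intros u _ A. apply is_pole_coords in A. destruct A as (n' & k & _ & A).
      apply Hz. apply is_pole_coords. exists n, k. split; auto.
      match type of A with (?a = _ \/ _) => replace a with (Im z) in A end; auto.
      unfold Ci, Re, Im; simpl; ring.
  - apply (Hstep (RtoC (Re z))); auto. intros u _ A. apply is_pole_coords in A.
    destruct A as (n' & _ & A & _). apply Hn. exists n'. rewrite <- A. unfold Re, Im; simpl; ring.
Qed.

Lemma denom_pole (s : R) (z : C) : I s -> is_pole P s z -> denom s z = 0.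
Proof.
  intros Is [H|H]; apply (sigma_lattice (tau s) _ (Im_tau_pos s Is)) in H;
    change (sigma_t P s (z - z0 P s) = 0) in H || change (sigma_t P s (z - Cconj (z0 P s)) = 0) in H;
    unfold denom; rewrite H; ring.
Qed.

(** Openness jointly in time and space: at a nonpole [denom] is nonzero and continuous, while it
    vanishes at all poles. *)
Lemma nonpole_near (t : R) (z1 : C) : I t -> nonpole t z1 -> exists d, 0 < d /\
  forall s z, I s -> Rabs (s - t) < d -> Cmod (z - z1) < d -> nonpole s z.
Proof.
  intros It Hz. destruct (C1t_denom t It z1) as (a & b & H).
  assert (N := denom_ne_0 t z1 It Hz). apply Cmod_gt_0 in N.
  destruct (sdt_cont I t denom z1 a b H _ N) as (d & Hd & B).
  exists d; split; auto. intros s z Is Hs Hz1 A. apply (Cmod_near_ne_0 _ _ (B s z Is Hs Hz1)).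
  apply denom_pole; auto.
Qed.

Lemma nonpole_ball (t : R) (z1 : C) : I t -> nonpole t z1 -> exists d, 0 < d /\
  forall z, Cmod (z - z1) < d -> nonpole t z.
Proof.
  intros It Hz. destruct (nonpole_near t z1 It Hz) as (d & Hd & B). exists d; split; auto.
  intros z Hz'. apply B; auto. rewrite Rminus_diag, Rabs_R0; auto.
Qed.

Lemma nonpole_segment_near (t : R) (a b : C) : I t -> 
  (forall x, 0 <= x <= 1 -> nonpole t (a + RtoC x * (b - a))) ->
  exists d, 0 < d /\ forall s, I s -> Rabs (s - t) < d ->
    forall x, 0 <= x <= 1 -> nonpole s (a + RtoC x * (b - a)).
Proof.
  intros It H.
  destruct (interval_uniform 0 1 (fun x d => forall s, I s -> Rabs (s - t) < d -> nonpole s (a + RtoC x * (b - a))))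
    as (d & Hd & B).
  - intros x d d' Q Hd' s Is Hs. apply Q; auto; lra.
  - intros x0 Hx0. destruct (nonpole_near t _ It (H x0 Hx0)) as (d & Hd & B).
    destruct (rdiff_rcont _ _ _ (rdiff_segment a b x0) d Hd) as (d' & Hd' & B').
    exists (Rmin d d'). split; [apply Rmin_glb_lt; auto|]. intros x Hx Hx' s Is Hs.
    Rmin_facts d d'.
    apply B; auto; [lra|]. apply B'. lra.
  - exists d; split; auto.
Qed.

Lemma hol_integrand (s : R) (z : C) : I s -> nonpole s z -> hol (integrand beta P s) z.
Proof.
  intros Is Hz. assert (Hc := sm_c _ _ _ _ _ (sf_map _ _ _ _ _ Hf s Is)).
  apply (hol_ext_loc (fun z => / dc P s * phi s z) _ z 1); [lra| |].
  - intros w _. unfold phi. field; auto.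
  - apply (hol_mult (fun _ => / dc P s) (phi s)); [apply hol_const|].
    apply (C1t_hol I s Is phi). apply phi_C1t; auto.
Qed.

Lemma path_exists (s : R) (z : C) : I s -> nonpole s z ->
  exists v, line_integral (integrand beta P s) (fun u => nonpole s u) 0 z v.
Proof.
  intros Is. apply (nonpole_ind s (fun z => exists v, line_integral (integrand beta P s) (fun u => nonpole s u) 0 z v)); auto.
  - exists 0. constructor.
  - intros a b [v Hv] Hab.
    destruct (CI_ex (fun x => integrand beta P s (a + RtoC x * (b - a)) * (b - a)) 0 1) as [u Hu]; [lra| |].
    + intros x Hx. apply rcont_segment. apply hol_integrand; auto.
    + exists (v + u). eapply line_integral_app; [exact Hv|]. apply line_integral_segment; auto.
Qed.

(** The integral formula holds along every admissible path, so a path to [a] can be prolonged by the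
    segment from [a] to [b]. *)
Lemma f_segment (s : R) (a b : C) : I s ->
  (forall x, 0 <= x <= 1 -> nonpole s (a + RtoC x * (b - a))) ->
  segment_primitive (fun z => f z s) (phi s) a b.
Proof.
  intros Is Hab.
  assert (Ha : nonpole s a).
  { specialize (Hab 0%R ltac:(lra)). replace (a + 0 * (b - a)) with a in Hab by ring. exact Hab. }
  destruct (path_exists s a Is Ha) as [v Hv].
  destruct (CI_ex (fun x => integrand beta P s (a + RtoC x * (b - a)) * (b - a)) 0 1) as [u Hu]; [lra| |].
  { intros x Hx. apply rcont_segment. apply hol_integrand; auto. }
  assert (Hi := sm_integral _ _ _ _ _ (sf_map _ _ _ _ _ Hf s Is)).
  unfold segment_primitive. rewrite (Hi a v Hv).
  rewrite (Hi b (v + u) (line_integral_app _ _ _ _ _ _ _ Hv (line_integral_segment _ _ _ _ _ Hab Hu))).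
  replace (dc P s * (v + u) + dc1 P s - (dc P s * v + dc1 P s)) with (dc P s * u) by ring.
  eapply CI_ext; [lra| |apply (CI_scal (dc P s) _ _ _ _ Hu)].
  intros x _. unfold phi. ring.
Qed.

(** * The time derivative of the maps and its holomorphy *)

Section Primitive.
Variable t : R.
Hypothesis It : I t.
Let t_accum := interval_accum I t (sf_interval _ _ _ _ _ Hf) It.

Definition fs (s : R) (z : C) : C := f z s.

(** At 0 the value is [c_1], which is smooth; differentiability in time is then carried along
    segments by [segment_tder]. *)
Lemma f_time_diff (z : C) : nonpole t z -> exists l, within_diff I (fun s => fs s z) t l.
Proof.
  apply (nonpole_ind t (fun z => exists l, within_diff I (fun s => fs s z) t l)); auto.
  - destruct (smooth_within_diff I (dc1 P) t It (sf_c1 _ _ _ _ _ Hf)) as [l Hl].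
    exists l. apply (within_diff_ext_on I t It (dc1 P)); auto. intros s Is. unfold fs.
    rewrite (sm_integral _ _ _ _ _ (sf_map _ _ _ _ _ Hf s Is) 0 0); [ring | constructor].
  - intros a b [l Hl] Hab.
    destruct (segment_tder I t It t_accum phi fs a b) as (v & _ & Hv).
    + intros x Hx. destruct (nonpole_ball t _ It (Hab x Hx)) as (r & Hr & B).
      exists r; split; auto. intros z' Hz'. apply phi_C1t; auto.
    + destruct (nonpole_segment_near t a b It Hab) as (d & Hd & B). exists d; split; auto.
      intros s Is Hs. apply f_segment; auto.
    + exists (l + v). eapply within_diff_ext; [| |apply (within_diff_plus I t _ _ _ _ Hl Hv)]; [|reflexivity].
      intros s. cbv beta. ring.
Qed.

Definition fdot (z : C) : C := tder I t fs z.

Lemma fs_sdt (z1 : C) : nonpole t z1 -> sdt I t fs z1 (fdot z1) (phi t z1).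
Proof.
  intros Hz. destruct (nonpole_near t z1 It Hz) as (d & Hd & B).
  apply (primitive_C1t I t It t_accum phi fs z1 d Hd).
  - intros z Hz'. apply phi_C1t; auto. apply B; auto. rewrite Rminus_diag, Rabs_R0; auto.
  - exists d. split; auto. intros s a b Is Hs Ha Hb. apply f_segment; auto.
    intros x Hx. apply B; auto. apply seg_point_near; auto.
  - apply f_time_diff; auto.
Qed.

Lemma f_sdiff (z1 : C) : nonpole t z1 -> sdiff (fun z => f z t) z1 (phi t z1).
Proof. intros Hz. exact (sdt_sdiff I t It fs z1 _ _ (fs_sdt z1 Hz)). Qed.

Lemma f_within (z1 : C) : nonpole t z1 -> within_diff I (fun s => f z1 s) t (fdot z1).
Proof. intros Hz. exact (sdt_within I t fs z1 _ _ (fs_sdt z1 Hz)). Qed.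

(** Differentiating the integral formula in time shows that [fdot] is a primitive of the continuous
    function [tder phi]. This is the exchange of the derivatives in [t] and [z]. *)
Lemma fdot_sdiff (z1 : C) : nonpole t z1 -> sdiff fdot z1 (tder I t phi z1).
Proof.
  intros Hz. destruct (nonpole_near t z1 It Hz) as (d & Hd & B).
  assert (B' : forall z, Cmod (z - z1) < d -> nonpole t z).
  { intros z Hz'. apply B; auto. rewrite Rminus_diag, Rabs_R0; auto. }
  apply (sdiff_of_primitive fdot (tder I t phi) z1 d Hd).
  - intros a b Ha Hb.
    assert (Hs : forall x, 0 <= x <= 1 -> Cmod (a + RtoC x * (b - a) - z1) < d)
      by (intros; apply seg_point_near; auto).
    destruct (segment_tder I t It t_accum phi fs a b) as (v & Hv & Hv').
    + intros x Hx. exists (d - Cmod (a + RtoC x * (b - a) - z1))%R. split; [specialize (Hs x Hx); lra|].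
      intros z Hz'. apply phi_C1t; auto. apply B'.
      pose proof (Cmod_triangle_sub z (a + RtoC x * (b - a)) z1). lra.
    + exists d. split; auto. intros s Is Hs'. apply f_segment; auto.
    + assert (E : fdot b - fdot a = v).
      { apply (within_diff_unique I t t_accum (fun s => fs s b - fs s a)); auto.
        eapply within_diff_ext; [| |apply (within_diff_plus I t (fun s => fs s b) (fun s => - (1) * fs s a))].
        3: apply (f_within b); auto.
        3: apply within_diff_scal; apply (f_within a); auto.
        - intros s. cbv beta. ring.
        - ring. }
      unfold segment_primitive. rewrite E. exact Hv.
  - intros e He. 
    destruct (tder_uniform I t It t_accum phi z1 (phi_C1t t It z1 Hz) (e / 2)%R ltac:(lra)) as (d' & Hd' & Q).
    exists (Rmin d d'). split; [apply Rmin_glb_lt; auto|]. intros z Hz'.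
    Rmin_facts d d'.
    destruct (Q z ltac:(lra)) as [Q' _]; [apply phi_C1t; auto; apply B'; lra | lra].
Qed.

End Primitive.
End Family.

(** * Quasi-elliptic functions *)

Lemma hol_punctured_unique (F G : C -> C) (a : C) (r : R) : 0 < r -> hol F a -> hol G a ->
  (forall z, Cmod (z - a) < r -> z <> a -> F z = G z) -> F a = G a.
Proof.
  intros Hr HF HG E. apply Cmod_small_eq. intros e He.
  destruct (hol_cont F a HF (e / 2)%R ltac:(lra)) as (d1 & Hd1 & B1).
  destruct (hol_cont G a HG (e / 2)%R ltac:(lra)) as (d2 & Hd2 & B2).
  set (d := Rmin r (Rmin d1 d2)). assert (Hd : 0 < d) by (repeat apply Rmin_glb_lt; auto).
  assert (d <= r) by apply Rmin_l.
  assert (d <= d1) by (eapply Rle_trans; [apply Rmin_r | apply Rmin_l]).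
  assert (d <= d2) by (eapply Rle_trans; [apply Rmin_r | apply Rmin_r]).
  set (z := a + RtoC (d / 2)).
  assert (Hz : Cmod (z - a) = (d / 2)%R).
  { replace (z - a) with (RtoC (d / 2)) by (unfold z; ring). rewrite Cmod_R, Rabs_pos_eq; lra. }
  assert (Nz : z <> a) by (intros A; rewrite A, Cmod_self in Hz; lra).
  specialize (B1 z ltac:(lra)). specialize (B2 z ltac:(lra)). rewrite (E z) in B1 by (auto; lra).
  pose proof (Cmod_triangle_sub (F a) (G z) (G a)). rewrite Cmod_minus_sym in B1. lra.
Qed.

Lemma periodic_int (F : C -> C) (w : C) : (forall z, F (z + w) = F z) ->
  forall (n : Z) z, F (z + RtoC (IZR n) * w) = F z.
Proof.
  intros H.
  assert (Hn : forall (n : nat) z, F (z + RtoC (INR n) * w) = F z).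
  { induction n as [|n IH]; intros z.
    - simpl. f_equal. ring.
    - rewrite S_INR, RtoC_plus. replace (z + (RtoC (INR n) + 1) * w) with (z + RtoC (INR n) * w + w) by ring.
      now rewrite H. }
  intros n z. destruct (Z_le_gt_dec 0 n) as [L|L].
  - rewrite <- (Z2Nat.id n L), <- INR_IZR_INZ. apply Hn.
  - rewrite <- (Hn (Z.to_nat (- n)) (z + RtoC (IZR n) * w)). f_equal.
    rewrite INR_IZR_INZ, Z2Nat.id by lia. rewrite opp_IZR, RtoC_opp. ring.
Qed.

Lemma floor_exists (x p : R) : 0 < p -> exists n : Z, 0 <= x + IZR n * p <= p.
Proof.
  intros Hp. destruct (archimed (x / p)) as [A B]. exists (1 - up (x / p))%Z.
  rewrite minus_IZR. assert (E : (x = x / p * p)%R) by (field; lra).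
  set (u := IZR (up (x / p))) in *. set (v := (x / p)%R) in *. rewrite E.
  replace (v * p + (1 - u) * p)%R with ((v + 1 - u) * p)%R by ring.
  split; [apply Rmult_le_pos; lra|]. rewrite <- (Rmult_1_l p) at 2. apply Rmult_le_compat_r; lra.
Qed.

Lemma elliptic_bounded (tau : C) (F : C -> C) : 0 < Im tau -> (forall z, hol F z) ->
  (forall z, F (z + 1) = F z) -> (forall z, F (z + tau) = F z) -> exists M, forall z, Cmod (F z) <= M.
Proof.
  intros Ht HF H1 H2.
  destruct (rectangle_bounded F 0 1 0 (Im tau)) as [M HM].
  { intros z0. apply hol_locally_bounded; auto. }
  exists M. intros z.
  destruct (floor_exists (Im z) (Im tau) Ht) as [k Hk].
  set (z1 := z + RtoC (IZR k) * tau).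
  destruct (floor_exists (Re z1) 1 ltac:(lra)) as [n Hn].
  assert (E : F z = F (z1 + RtoC (IZR n) * 1)).
  { rewrite (periodic_int F 1 H1). unfold z1. now rewrite (periodic_int F tau H2). }
  rewrite E, (surjective_pairing (z1 + RtoC (IZR n) * 1)). apply HM.
  - replace (fst (z1 + RtoC (IZR n) * 1)) with (Re z1 + IZR n * 1)%R; [exact Hn|].
    unfold Re; simpl; ring.
  - replace (snd (z1 + RtoC (IZR n) * 1)) with (Im z + IZR k * Im tau)%R; [exact Hk|].
    unfold z1, Im; simpl; ring.
Qed.

Section QuasiElliptic.
Variables (tau : C) (good : C -> Prop) (Q : C -> C) (kappa : C).
Hypothesis tau_pos : 0 < Im tau.
Hypothesis good_near : forall a, exists R, 0 < R /\ forall z, Cmod (z - a) < R -> z <> a -> good z.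
Hypothesis good_hol : forall z, good z -> hol Q z.
Hypothesis good_1 : forall z, good z -> good (z + 1).
Hypothesis good_tau : forall z, good z -> good (z + tau).
Hypothesis Q_1 : forall z, good z -> Q (z + 1) = Q z.
Hypothesis Q_tau : forall z, good z -> Q (z + tau) = Q z + kappa.
Hypothesis Q_tame : forall a e, 0 < e -> exists d, 0 < d /\ forall z, Cmod (z - a) < d -> z <> a ->
  Cmod ((z - a) * Q z) <= e.

(** [L] is the value at [a] of a local holomorphic extension of [Q]. Such values are unique, so
    choosing one at each point glues the local extensions into an entire function. *)
Definition extends_at (a L : C) : Prop := exists R G, 0 < R /\ 
  (forall z, Cmod (z - a) < R -> hol G z) /\
  (forall z, Cmod (z - a) < R -> z <> a -> good z /\ G z = Q z) /\ G a = L.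

Lemma extends_exists (a : C) : exists L, extends_at a L.
Proof.
  destruct (good_near a) as (R & HR & Hg).
  destruct (removable_singularity Q a R HR) as (G & G1 & G2); auto.
  exists (G a), R, G. repeat split; auto.
Qed.

Lemma extends_unique (a L L' : C) : extends_at a L -> extends_at a L' -> L = L'.
Proof.
  intros (R & G & HR & A1 & A2 & <-) (R' & G' & HR' & A1' & A2' & <-).
  apply (hol_punctured_unique G G' a (Rmin R R')).
  - apply Rmin_glb_lt; auto.
  - apply A1. rewrite Cmod_self; auto.
  - apply A1'. rewrite Cmod_self; auto.
  - intros z Hz N. Rmin_facts R R'.
    destruct (A2 z ltac:(lra) N) as [_ ->]. destruct (A2' z ltac:(lra) N) as [_ ->]. reflexivity.
Qed.

Definition Qext (a : C) : C := epsilon (inhabits (RtoC 0)) (extends_at a).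

Lemma Qext_spec (a : C) : extends_at a (Qext a).
Proof. exact (epsilon_spec (inhabits (RtoC 0)) (extends_at a) (extends_exists a)). Qed.

Lemma Qext_local (a : C) : exists R G, 0 < R /\ (forall z, Cmod (z - a) < R -> hol G z) /\
  (forall z, Cmod (z - a) < R -> z <> a -> good z /\ G z = Q z) /\
  (forall z, Cmod (z - a) < R -> Qext z = G z).
Proof.
  destruct (Qext_spec a) as (R & G & HR & A1 & A2 & E). exists R, G.
  split; auto. split; auto. split; auto. intros z Hz.
  destruct (Ceq_dec z a) as [->|N]; [auto|].
  apply (extends_unique z); [apply Qext_spec|].
  assert (Hp : 0 < Cmod (z - a)) by (apply Cmod_gt_0, Cminus_ne_0, N).
  (* A disc about [z] inside the given one that does not contain [a]; there [G] is itself a local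
     extension at [z]. *)
  exists (Rmin (R - Cmod (z - a)) (Cmod (z - a))), G.
  Rmin_facts (R - Cmod (z - a))%R (Cmod (z - a))%R.
  split; [apply Rmin_glb_lt; lra|]. split; [|split; auto].
  - intros w Hw. apply A1. pose proof (Cmod_triangle_sub w z a). lra.
  - intros w Hw _. apply A2; [pose proof (Cmod_triangle_sub w z a); lra|].
    intros ->. rewrite Cmod_minus_sym in Hw. lra.
Qed.

Lemma Qext_hol (a : C) : hol Qext a.
Proof.
  destruct (Qext_local a) as (R & G & HR & A1 & _ & A3).
  apply (hol_ext_loc G Qext a R HR).
  - intros z Hz. symmetry. auto.
  - apply A1. rewrite Cmod_self; auto.
Qed.

Lemma Qext_near (a : C) : exists r, 0 < r /\ forall z, Cmod (z - a) < r -> z <> a -> good z /\ Qext z = Q z.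
Proof.
  destruct (Qext_local a) as (R & G & HR & A1 & A2 & A3).
  exists R. split; auto. intros z Hz N. destruct (A2 z Hz N) as [H1 H2]. split; auto. rewrite A3; auto.
Qed.

Lemma Qext_good (a : C) : good a -> Qext a = Q a.
Proof.
  intros Ha. destruct (Qext_near a) as (r & Hr & B).
  apply (hol_punctured_unique Qext Q a r Hr); auto using Qext_hol. intros. apply B; auto.
Qed.

Lemma Qext_shift (w c : C) : (forall z, good z -> good (z + w)) -> (forall z, good z -> Q (z + w) = Q z + c) ->
  forall a, Qext (a + w) = Qext a + c.
Proof.
  intros H1 H2 a. destruct (Qext_near a) as (r & Hr & B).
  apply (hol_punctured_unique (fun z => Qext (z + w)) (fun z => Qext z + c) a r Hr).
  - apply hol_translate, Qext_hol.
  - apply hol_plus; [apply Qext_hol | apply hol_const].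
  - intros z Hz N. destruct (B z Hz N) as [G E]. rewrite E, Qext_good by auto. auto.
Qed.

Lemma C_derive_shift (F : C -> C) (w c : C) : (forall z, hol F z) -> (forall z, F (z + w) = F z + c) ->
  forall z, C_derive F (z + w) = C_derive F z.
Proof.
  intros HF H z. symmetry. apply sdiff_C_derive.
  apply (sdiff_ext (fun u => F (u + w) - c) F z (C_derive F (z + w) - 0)); [intros u; rewrite H; ring | ring|].
  apply sdiff_minus; [apply sdiff_translate, hol_sdiff, HF | apply sdiff_const].
Qed.

Lemma quasi_elliptic_constant : kappa = 0 /\ forall a, good a -> forall b, Q a = Qext b.
Proof.
  assert (S1 : forall z, Qext (z + 1) = Qext z + 0)
    by (apply Qext_shift; auto; intros z Hz; rewrite Q_1; auto; ring).
  assert (S2 : forall z, Qext (z + tau) = Qext z + kappa) by (apply Qext_shift; auto).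
  assert (HD : forall z, hol (C_derive Qext) z)
    by (intros z; apply (hol_derive Qext z 1); [lra | intros; apply Qext_hol]).
  destruct (elliptic_bounded tau (C_derive Qext) tau_pos HD) as [M HM].
  - apply (C_derive_shift Qext 1 0); auto using Qext_hol.
  - apply (C_derive_shift Qext tau kappa); auto using Qext_hol.
  - assert (HC := liouville (C_derive Qext) M HD HM).
    set (l := C_derive Qext 0).
    assert (HL : forall z, Qext z - Qext 0 = l * z).
    { intros z. apply Cmod_small_eq. intros e He.
      replace (Qext z - Qext 0 - l * z) with ((Qext z - l * z) - (Qext 0 - l * 0)) by ring.
      apply Rle_trans with (0 * Cmod (z - 0))%R; [|lra].
      apply (segment_mean_value (fun u => Qext u - l * u) (fun u => C_derive Qext u - l)).
      - intros s _. apply cdiff_minus_linear, sdiff_cdiff, hol_sdiff, Qext_hol.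
      - intros s _. unfold l. rewrite (HC _ 0), Cmod_self. lra. }
    (* An affine function of period 1 has slope 0; the quasi-period [kappa] then vanishes too. *)
    assert (El : l = 0).
    { replace l with (l * (0 + 1)) by ring. rewrite <- HL, S1. ring. }
    assert (EQ : forall z, Qext z = Qext 0).
    { intros z. replace (Qext z) with (Qext z - Qext 0 + Qext 0) by ring. rewrite HL, El. ring. }
    split.
    + replace kappa with (Qext 0 + kappa - Qext 0) by ring. rewrite <- S2, (EQ (0 + tau)). ring.
    + intros a Ha b. rewrite <- Qext_good by auto. now rewrite (EQ a), (EQ b).
Qed.

End QuasiElliptic.

(** Integrating [K / x^2] along the ray from the circle of radius [R / 2] inwards gives [K / rho]
    plus the maximum of [g] on that circle. *)
Lemma radial_growth (g dg : C -> C) (p : C) (R K : R) : 0 < R ->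
  (forall z, Cmod (z - p) < R -> z <> p -> sdiff g z (dg z) /\ 
     Cmod (dg z) <= K / (Cmod (z - p) * Cmod (z - p))) ->
  exists K', 0 <= K' /\ forall z, Cmod (z - p) < R / 2 -> z <> p -> Cmod (g z) * Cmod (z - p) <= K'.
Proof.
  intros HR H.
  assert (HK : 0 <= K).
  { set (z := p + RtoC (R / 2)).
    assert (Hz : Cmod (z - p) = (R / 2)%R).
    { replace (z - p) with (RtoC (R / 2)) by (unfold z; ring). rewrite Cmod_R, Rabs_pos_eq; lra. }
    assert (Nz : z <> p) by (intros A; rewrite A, Cmod_self in Hz; lra).
    destruct (H z ltac:(lra) Nz) as [_ Q]. rewrite Hz in Q. pose proof (Cmod_ge_0 (dg z)).
    assert (0 <= K / (R / 2 * (R / 2))) as Q' by lra.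
    replace K with (K / (R / 2 * (R / 2)) * (R / 2 * (R / 2)))%R by (field; lra).
    apply Rmult_le_pos; auto. apply Rmult_le_pos; lra. }
  (* [g] cut off outside an annulus around the circle of radius [R / 2]. Unlike [g], it is locally
     bounded on the whole plane, so [rectangle_bounded] bounds it on a square containing the
     circle. *)
  set (gc := fun z => if Rlt_dec (Cmod (z - p)) (R / 4) then RtoC 0 
     else if Rlt_dec (3 * R / 4) (Cmod (z - p)) then RtoC 0 else g z).
  assert (Hgc : forall z, Cmod (gc z) <= Cmod (g z)).
  { intros z. unfold gc. destruct (Rlt_dec _ _); [rewrite Cmod_0; apply Cmod_ge_0|].
    destruct (Rlt_dec _ _); [rewrite Cmod_0; apply Cmod_ge_0|lra]. }
  destruct (rectangle_bounded gc (Re p - R) (Re p + R) (Im p - R) (Im p + R)) as [M HM].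
  { intros z0. destruct (Rlt_or_le (Cmod (z0 - p)) R) as [L|L].
    - destruct (Ceq_dec z0 p) as [->|N].
      + exists (R / 4)%R, 0%R. split; [lra|]. intros z Hz. unfold gc. destruct (Rlt_dec _ _) as [D|D]; [rewrite Cmod_0; lra|contradiction].
      + destruct (H z0 L N) as [D _].
        destruct (hol_locally_bounded g z0 (ex_intro _ _ D)) as (r & M & Hr & B).
        exists r, M. split; auto. intros z Hz. eapply Rle_trans; [apply Hgc|auto].
    - exists (R / 4)%R, 0%R. split; [lra|]. intros z Hz. unfold gc. destruct (Rlt_dec _ _); [rewrite Cmod_0; lra|].
      destruct (Rlt_dec _ _) as [D|D]; [rewrite Cmod_0; lra|]. exfalso. apply D.
      pose proof (Cmod_triangle_sub z0 z p). rewrite (Cmod_minus_sym z0 z) in H0. lra. }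
  assert (HM' : forall z, Cmod (z - p) = (R / 2)%R -> Cmod (g z) <= M).
  { intros z Hz. assert (Eg : gc z = g z).
    { unfold gc. destruct (Rlt_dec _ _) as [D|D]; [lra|]. destruct (Rlt_dec _ _) as [D'|D']; [lra|auto]. }
    rewrite <- Eg, (surjective_pairing z). 
    assert (Q1 : Rabs (Re (z - p)) <= R) by (eapply Rle_trans; [apply re_le_Cmod | lra]).
    assert (Q2 : Rabs (Im (z - p)) <= R) by (eapply Rle_trans; [apply Im_le_Cmod | lra]).
    replace (Re (z - p)) with (fst z - Re p)%R in Q1 by reflexivity.
    replace (Im (z - p)) with (snd z - Im p)%R in Q2 by reflexivity.
    apply HM; [apply Rabs_le_between in Q1 | apply Rabs_le_between in Q2]; lra. }
  assert (HM0 : 0 <= M).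
  { set (z := p + RtoC (R / 2)).
    assert (Hz : Cmod (z - p) = (R / 2)%R).
    { replace (z - p) with (RtoC (R / 2)) by (unfold z; ring). rewrite Cmod_R, Rabs_pos_eq; lra. }
    eapply Rle_trans; [apply Cmod_ge_0 | apply (HM' z Hz)]. }
  exists (M * (R / 2) + K)%R. split; [apply Rplus_le_le_0_compat; auto; apply Rmult_le_pos; lra|].
  intros z Hz N. assert (N' := Cminus_ne_0 _ _ N). assert (Hrho := proj1 (Cmod_gt_0 _) N').
  set (rho := Cmod (z - p)) in *. set (e := (z - p) / RtoC rho).
  assert (Nr : RtoC rho <> 0) by (intros A; apply RtoC_inj in A; lra).
  assert (He : Cmod e = 1%R).
  { unfold e. rewrite Cmod_div, Cmod_R, Rabs_pos_eq by (auto; lra). fold rho. field; lra. }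
  assert (Hx : forall x, 0 <= x -> Cmod (p + e * RtoC x - p) = x).
  { intros x Hx. replace (p + e * RtoC x - p) with (e * RtoC x) by ring.
    rewrite Cmod_mult, He, Cmod_R, Rabs_pos_eq; lra. }
  (* The comparison function is [- K / x], with derivative [K / x^2]; [e] is the unit vector from
     [p] towards [z]. *)
  assert (Q : Cmod (g (p + e * RtoC (R / 2)) - g (p + e * RtoC rho)) <= - K * / (R / 2) - - K * / rho).
  { apply (mean_value_ineq (fun x => g (p + e * RtoC x)) (fun x => dg (p + e * RtoC x) * e)
      (fun x => - K * / x)%R (fun x => K * / (x * x))%R); [lra| | |].
    - intros x Hx'. apply (rdiff_comp g (fun x => p + e * RtoC x)).
      + apply H; [rewrite Hx; lra|]. intros A. assert (Q := Hx x ltac:(lra)). rewrite A, Cmod_self in Q. lra.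
      + eapply rdiff_ext; [reflexivity| |apply rdiff_plus; [apply rdiff_const | apply rdiff_scal, rdiff_id]]. ring.
    - intros x Hx'. replace (K * / (x * x))%R with (- K * (- 1 / (x ^ 2)))%R by (field; lra).
      apply is_derive_scal. apply is_derive_inv with (l := 1%R); [apply (is_derive_id (K := R_AbsRing)) | lra].
    - intros x Hx'. rewrite Cmod_mult, He, Rmult_1_r.
      destruct (H (p + e * RtoC x)) as [_ B].
      + rewrite Hx; lra.
      + intros A. assert (Q := Hx x ltac:(lra)). rewrite A, Cmod_self in Q. lra.
      + rewrite Hx in B by lra. exact B. }
  assert (Ez : p + e * RtoC rho = z) by (unfold e; field; auto).
  rewrite Ez in Q. assert (Q2 := HM' _ (Hx (R / 2)%R ltac:(lra))).
  assert (Q3 : Cmod (g z) <= M + K * / rho).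
  { pose proof (Cmod_le_add_sub (g z) (g (p + e * RtoC (R / 2)))). rewrite Cmod_minus_sym in H0.
    assert (0 <= K * / (R / 2)) by (apply Rmult_le_pos; auto; left; apply Rinv_0_lt_compat; lra). lra. }
  apply Rle_trans with ((M + K * / rho) * rho)%R; [apply Rmult_le_compat_r; lra|].
  replace ((M + K * / rho) * rho)%R with (M * rho + K)%R by (field; lra).
  assert (M * rho <= M * (R / 2)) by (apply Rmult_le_compat_l; lra). lra.
Qed.

(** * The quotient of the two derivatives *)

Section Final.
Variables (I : R -> Prop) (theta beta : R) (P : slit_data) (f : C -> R -> C).
Hypothesis Hf : slit_family I theta beta P f.
Variable t : R.
Hypothesis It : I t.

Notation tau := (omega2 P).
Notation nonpole s z := (~ is_pole P s z).
Notation phi := (phi beta P).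
Notation fdot := (fdot I f t).
Notation zk k := (zpt P k t).

Let t_accum := interval_accum I t (sf_interval _ _ _ _ _ Hf) It.
Let tp := Im_tau_pos I theta beta P f Hf t It.
Let St := sf_map _ _ _ _ _ Hf t It.

Lemma not_lattice_Im (z : C) (j : Z) :
  IZR j * (2 * dm P t) < Im z < (IZR j + 1) * (2 * dm P t) -> ~ lattice_t P t z.
Proof.
  intros H L. apply lattice_t_coords in L. destruct L as (n & k & _ & E). rewrite E in H.
  assert (Hm := sm_m _ _ _ _ _ St).
  assert (j < k)%Z by (apply lt_IZR; apply Rmult_lt_reg_r with (2 * dm P t)%R; lra).
  assert (k < j + 1)%Z by (apply lt_IZR; rewrite plus_IZR; apply Rmult_lt_reg_r with (2 * dm P t)%R; lra).
  lia.
Qed.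

Lemma not_lattice_Re (z : C) (j : Z) : IZR j < Re z < IZR j + 1 -> ~ lattice_t P t z.
Proof.
  intros H L. apply lattice_t_coords in L. destruct L as (n & k & E & _). rewrite E in H.
  assert (j < n)%Z by (apply lt_IZR; lra).
  assert (n < j + 1)%Z by (apply lt_IZR; rewrite plus_IZR; lra).
  lia.
Qed.

Ltac im_outside j :=
  apply (not_lattice_Im _ j); unfold zpt, z0, Cconj, Ci, Re, Im; simpl;
  pose proof (sm_m _ _ _ _ _ St); pose proof (sm_y0 _ _ _ _ _ St); lra.
Ltac re_outside j :=
  apply (not_lattice_Re _ j); unfold zpt, z0, Cconj, Ci, Re, Im; simpl;
  pose proof (sm_x12 _ _ _ _ _ St); pose proof (sm_x34 _ _ _ _ _ St); lra.

(** For the pairs 1, 2 and 3, 4 the imaginary parts differ by 0 and [2 m], both rows of the lattice,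
    so the real parts decide. For the other pairs the imaginary parts differ by [m], between two
    rows. *)
Lemma zk_distinct (k j : nat) : In k K4 -> In j K4 -> j <> k -> ~ lattice_t P t (zk k - zk j).
Proof.
  simpl. intros [<-|[<-|[<-|[<-|[]]]]] [<-|[<-|[<-|[<-|[]]]]] N; try congruence.
  - re_outside (-1)%Z.
  - im_outside (-1)%Z.
  - im_outside 0%Z.
  - re_outside 0%Z.
  - im_outside (-1)%Z.
  - im_outside 0%Z.
  - im_outside 0%Z.
  - im_outside 0%Z.
  - re_outside (-1)%Z.
  - im_outside (-1)%Z.
  - im_outside (-1)%Z.
  - re_outside 0%Z.
Qed.

Lemma zk_z0 (k : nat) : In k K4 -> ~ lattice_t P t (zk k - z0 P t).
Proof.
  simpl. intros [<-|[<-|[<-|[<-|[]]]]].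
  - im_outside (-1)%Z.
  - im_outside (-1)%Z.
  - im_outside 0%Z.
  - im_outside (-1)%Z.
Qed.

Lemma zk_conj_z0 (k : nat) : In k K4 -> ~ lattice_t P t (zk k - Cconj (z0 P t)).
Proof.
  simpl. intros [<-|[<-|[<-|[<-|[]]]]].
  - im_outside 0%Z.
  - im_outside 0%Z.
  - im_outside 0%Z.
  - im_outside (-1)%Z.
Qed.

Lemma z0_conj_z0 : ~ lattice_t P t (z0 P t - Cconj (z0 P t)).
Proof. im_outside 0%Z. Qed.

Lemma lattice_t_opp (z w : C) : ~ lattice_t P t (z - w) -> ~ lattice_t P t (w - z).
Proof. intros H. replace (w - z) with (- (z - w)) by ring. apply (not_lat_opp (tau t)); exact H. Qed.

Lemma zk_nonpole (k : nat) : In k K4 -> nonpole t (zk k).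
Proof. intros Hk [H|H]; [apply (zk_z0 k Hk H) | apply (zk_conj_z0 k Hk H)]. Qed.

Lemma sigma_ne (z : C) : ~ lattice_t P t z -> sigma_t P t z <> 0.
Proof. apply (sigma_t_ne_0 I theta beta P f Hf t z It). Qed.

Definition good (z : C) : Prop := nonpole t z /\ forall k, In k K4 -> ~ lattice_t P t (z - zk k).

Lemma phi_ne_0 (z : C) : good z -> phi t z <> 0.
Proof.
  intros [Hn Hk]. rewrite phi_numer.
  destruct (nonpole_sigma I theta beta P f Hf t z It Hn) as [N1 N2].
  apply Cmult_neq_0.
  - unfold numer. apply Cmult_neq_0; [apply (sm_c _ _ _ _ _ St)|].
    apply Cmult_neq_0; [apply Cexp_ne_0|]. apply Cprod_ne_0. intros k Hk'. apply sigma_ne; auto.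
  - intros E.
    assert (D : sigma_t P t (z - z0 P t) ^ 2 * sigma_t P t (z - Cconj (z0 P t)) ^ 2 <> 0).
    { simpl. rewrite !Cmult_1_r. apply Cmult_neq_0; apply Cmult_neq_0; auto. }
    assert (A := Cinv_r _ D). rewrite E, Cmult_0_r in A. apply RtoC_inj in A. lra.
Qed.

(** The derivative of [f] with the factor [sigma(z - z_k)] removed; its value at [z_k] is [D_k]. *)
Definition rest (k : nat) (z : C) : C :=
  dc P t * Cexp (gam beta P t * z) * Cprod (fun j => sigma_t P t (z - zk j)) (filter (fun j => negb (Nat.eqb j k)) K4)
  / (sigma_t P t (z - z0 P t) ^ 2 * sigma_t P t (z - Cconj (z0 P t)) ^ 2).

Lemma phi_rest (k : nat) (z : C) : In k K4 -> phi t z = sigma_t P t (z - zk k) * rest k z.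
Proof.
  intros Hk. rewrite phi_numer. unfold rest, numer, Cdiv.
  assert (E : Cprod (fun j => sigma_t P t (z - zk j)) K4 = sigma_t P t (z - zk k) *
    Cprod (fun j => sigma_t P t (z - zk j)) (filter (fun j => negb (Nat.eqb j k)) K4)).
  { simpl in Hk. destruct Hk as [<-|[<-|[<-|[<-|[]]]]]; cbn [Nat.eqb negb filter K4 Cprod fold_right]; ring. }
  rewrite E. ring.
Qed.

Lemma hol_sigma_shift (p z : C) : hol (fun z => sigma_t P t (z - p)) z.
Proof.
  apply (hol_comp (sigma_t P t) (fun z => z - p)); [apply (hol_sigma (tau t) tp)|].
  apply hol_minus; [apply hol_id | apply hol_const].
Qed.

Lemma hol_rest (k : nat) (z : C) : nonpole t z -> hol (rest k) z.
Proof.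
  intros Hn. destruct (nonpole_sigma I theta beta P f Hf t z It Hn) as [N1 N2]. unfold rest.
  apply (hol_div (fun z => dc P t * Cexp (gam beta P t * z) * Cprod (fun j => sigma_t P t (z - zk j)) (filter (fun j => negb (Nat.eqb j k)) K4))).
  - apply (hol_mult (fun z => dc P t * Cexp (gam beta P t * z))).
    + apply (hol_mult (fun _ => dc P t)); [apply hol_const|].
      apply (hol_comp Cexp (fun z => gam beta P t * z)); [eexists; apply sdiff_Cexp|].
      apply hol_mult; [apply hol_const | apply hol_id].
    + apply (hol_Cprod (fun j z => sigma_t P t (z - zk j))). intros j _. apply hol_sigma_shift.
  - assert (H0 := hol_sigma_shift (z0 P t) z). assert (H1 := hol_sigma_shift (Cconj (z0 P t)) z).
    apply (hol_mult (fun z => sigma_t P t (z - z0 P t) ^ 2)).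
    + apply (hol_mult (fun z => sigma_t P t (z - z0 P t))); auto.
      apply (hol_mult (fun z => sigma_t P t (z - z0 P t)) (fun _ => 1)); auto using hol_const.
    + apply (hol_mult (fun z => sigma_t P t (z - Cconj (z0 P t)))); auto.
      apply (hol_mult (fun z => sigma_t P t (z - Cconj (z0 P t))) (fun _ => 1)); auto using hol_const.
  - simpl. rewrite !Cmult_1_r. apply Cmult_neq_0; apply Cmult_neq_0; auto.
Qed.

Lemma rest_D (k : nat) : rest k (zk k) = D_ beta P k t.
Proof. reflexivity. Qed.

Lemma D_ne_0 (k : nat) : In k K4 -> D_ beta P k t <> 0.
Proof.
  intros Hk. destruct (nonpole_sigma I theta beta P f Hf t _ It (zk_nonpole k Hk)) as [N1 N2].
  unfold D_, Cdiv. apply Cmult_neq_0.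
  - apply Cmult_neq_0; [apply Cmult_neq_0; [apply (sm_c _ _ _ _ _ St) | apply Cexp_ne_0]|].
    apply Cprod_ne_0. intros j Hj. apply filter_In in Hj. destruct Hj as [Hj E].
    apply sigma_ne, zk_distinct; auto. intros ->. rewrite Nat.eqb_refl in E. discriminate.
  - intros E.
    assert (D : sigma_t P t (zk k - z0 P t) ^ 2 * sigma_t P t (zk k - Cconj (z0 P t)) ^ 2 <> 0).
    { simpl. rewrite !Cmult_1_r. apply Cmult_neq_0; apply Cmult_neq_0; auto. }
    assert (A := Cinv_r _ D). rewrite E, Cmult_0_r in A. apply RtoC_inj in A. lra.
Qed.

Lemma sigma_t_0 : sigma_t P t 0 = 0.
Proof. rewrite sigma_t_kap. ring. Qed.

Lemma phi_zk (k : nat) : In k K4 -> phi t (zk k) = 0.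
Proof.
  intros Hk. rewrite (phi_rest k _ Hk). replace (zk k - zk k) with (RtoC 0) by ring. rewrite sigma_t_0. ring.
Qed.

(** [sigma] has derivative 1 at its zero 0, because [kap] is 1 there; so the derivative of the
    product is the value of the other factor. *)
Lemma phi_sdiff_zk (k : nat) : In k K4 -> sdiff (phi t) (zk k) (D_ beta P k t).
Proof.
  intros Hk. destruct (hol_rest k (zk k) (zk_nonpole k Hk)) as [l Hl].
  assert (S0 : sdiff (fun z => sigma_t P t (z - zk k)) (zk k) 1).
  { assert (S1 := sdiff_sigma (tau t) tp 0).
    eapply sdiff_ext; [reflexivity| |apply (sdiff_comp (sigma_t P t) (fun z => z - zk k) (zk k)
       (kap 0 (tau t) + 0 * partial1 kap 0 (tau t)))].
    - rewrite (kap_0 (tau t) tp). instantiate (1 := 1). ring.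
    - replace (zk k - zk k) with (RtoC 0) by ring. exact S1.
    - eapply sdiff_ext; [reflexivity| |apply sdiff_minus; [apply sdiff_id | apply sdiff_const]]. ring. }
  apply (sdiff_ext (fun z => sigma_t P t (z - zk k) * rest k z) _ _
    (1 * rest k (zk k) + sigma_t P t (zk k - zk k) * l)).
  - intros z. symmetry. apply phi_rest; auto.
  - rewrite rest_D. replace (zk k - zk k) with (RtoC 0) by ring. rewrite sigma_t_0. ring.
  - apply (sdiff_mult (fun z => sigma_t P t (z - zk k)) (rest k)); auto.
Qed.

Lemma nonpole_ball_t (z : C) : nonpole t z -> exists d, 0 < d /\ forall w, Cmod (w - z) < d -> nonpole t w.
Proof. apply (nonpole_ball I theta beta P f Hf t z It). Qed.

Lemma f_deriv (z : C) : nonpole t z -> sdiff (fun u => f u t) z (phi t z).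
Proof. apply (f_sdiff I theta beta P f Hf t It z). Qed.

Lemma C_derive_f (z : C) : nonpole t z -> C_derive (fun u => f u t) z = phi t z.
Proof. intros H. apply sdiff_C_derive, f_deriv, H. Qed.

Lemma f_second_derivative (k : nat) : In k K4 ->
  sdiff (C_derive (fun u => f u t)) (zk k) (D_ beta P k t).
Proof.
  intros Hk. destruct (nonpole_ball_t _ (zk_nonpole k Hk)) as (d & Hd & B).
  apply (sdiff_ext_loc (phi t) _ _ _ d Hd); [|apply phi_sdiff_zk; auto].
  intros z Hz. symmetry. apply C_derive_f; auto.
Qed.

(** The total derivative is [fdot(z_k) + phi(z_k) z_k'], and the motion of [z_k] does not contribute
    because [phi] vanishes there. *)
Lemma A_diff (k : nat) : In k K4 -> within_diff I (A_ P f k) t (fdot (zk k)).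
Proof.
  intros Hk. destruct (zpt_diff I theta beta P f Hf t It k Hk) as [l Hl].
  assert (Q := sdt_chain I t (fs f) (zpt P k) _ _ l
    (fs_sdt I theta beta P f Hf t It _ (zk_nonpole k Hk)) Hl).
  rewrite (phi_zk k Hk) in Q. eapply within_diff_ext; [| |exact Q]; [reflexivity|ring].
Qed.

Lemma gamma_eq (k : nat) : In k K4 -> gamma_ I beta P f k t = fdot (zk k) / D_ beta P k t.
Proof.
  intros Hk. unfold gamma_. now rewrite (within_diff_dot I t It t_accum _ _ (A_diff k Hk)).
Qed.

Lemma fdot_hol (z : C) : nonpole t z -> hol fdot z.
Proof. intros H. eexists. apply (fdot_sdiff I theta beta P f Hf t It z H). Qed.

Lemma phi_hol (z : C) : nonpole t z -> hol (phi t) z.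
Proof. intros H. apply (C1t_hol I t It phi z). apply (phi_C1t I theta beta P f Hf t It z H). Qed.

Lemma pole_shift (s : R) (z w : C) : lattice_t P s w -> nonpole s z -> nonpole s (z + w).
Proof.
  intros Hw Hz [H|H]; apply Hz; [left | right].
  - replace (z - z0 P s) with (z + w - z0 P s - w) by ring. apply lat_minus; auto.
  - replace (z - Cconj (z0 P s)) with (z + w - Cconj (z0 P s) - w) by ring. apply lat_minus; auto.
Qed.

Lemma good_shift (z w : C) : lattice_t P t w -> good z -> good (z + w).
Proof.
  intros Hw [H1 H2]. split; [apply pole_shift; auto|].
  intros k Hk L. apply (H2 k Hk). replace (z - zk k) with (z + w - zk k - w) by ring. apply lat_minus; auto.
Qed.

Lemma f_shift (s : R) (z : C) : I s -> nonpole s z -> f (z + 1) s = f z s /\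
  f (z + tau s) s = Cexp (2 * Ci * beta) * f z s.
Proof.
  intros Is Hz. assert (Ss := sf_map _ _ _ _ _ Hf s Is). split.
  - apply (sm_period1 _ _ _ _ _ Ss); auto.
  - apply (sm_period2 _ _ _ _ _ Ss); auto.
Qed.

Lemma phi_shift (z : C) : nonpole t z -> phi t (z + 1) = phi t z /\
  phi t (z + tau t) = Cexp (2 * Ci * beta) * phi t z.
Proof.
  intros Hz. destruct (nonpole_ball_t z Hz) as (d & Hd & B).
  assert (S := f_deriv z Hz).
  assert (S1 := sdiff_translate _ _ _ _ (f_deriv (z + 1) (pole_shift t z 1 (lat_1 (tau t)) Hz))).
  assert (S2 := sdiff_translate _ _ _ _ (f_deriv (z + tau t) (pole_shift t z (tau t) (lat_tau (tau t)) Hz))).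
  split.
  - apply (cdiff_unique (fun u => f u t) z); apply sdiff_cdiff; auto.
    apply (sdiff_ext_loc _ _ _ _ d Hd) with (2 := S1). intros w Hw. apply f_shift; auto.
  - apply (cdiff_unique (fun u => Cexp (2 * Ci * beta) * f u t) z); apply sdiff_cdiff.
    + apply (sdiff_ext_loc _ _ _ _ d Hd) with (2 := S2). intros w Hw. apply f_shift; auto.
    + apply sdiff_scal; auto.
Qed.

Variable dtau : C.
Hypothesis Hdtau : within_diff I tau t dtau.

(** The period relations of [f] hold at all nearby times and are differentiated in time. The point
    [z + tau] moves, which brings in [phi dtau]; the multiplier does not depend on time. *)
Lemma fdot_shift (z : C) : nonpole t z -> fdot (z + 1) = fdot z /\
  fdot (z + tau t) + phi t (z + tau t) * dtau = Cexp (2 * Ci * beta) * fdot z.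
Proof.
  intros Hz. destruct (nonpole_near I theta beta P f Hf t z It Hz) as (d & Hd & B).
  assert (B' : forall s, I s -> Rabs (s - t) < d -> nonpole s z).
  { intros s Is Hs. apply B; auto. rewrite Cmod_self; auto. }
  assert (Hz1 := pole_shift t z 1 (lat_1 (tau t)) Hz).
  assert (Hz2 := pole_shift t z (tau t) (lat_tau (tau t)) Hz).
  split.
  - apply (within_diff_unique I t t_accum (fun s => f z s)).
    + apply (within_diff_ext_near I t It (fun s => f (z + 1) s) _ _ d Hd).
      * intros s Is Hs. apply f_shift; auto.
      * apply (f_within I theta beta P f Hf t It (z + 1) Hz1).
    + apply (f_within I theta beta P f Hf t It z Hz).
  - apply (within_diff_unique I t t_accum (fun s => Cexp (2 * Ci * beta) * f z s)).
    + apply (within_diff_ext_near I t It (fun s => fs f s (z + tau s)) _ _ d Hd).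
      * intros s Is Hs. unfold fs. apply f_shift; auto.
      * apply (sdt_chain I t (fs f) (fun s => z + tau s)).
        -- apply (fs_sdt I theta beta P f Hf t It (z + tau t) Hz2).
        -- eapply within_diff_ext; [| |apply (within_diff_plus I t _ _ _ _ (within_diff_const I t z) Hdtau)]; [reflexivity|ring].
    + apply within_diff_scal. apply (f_within I theta beta P f Hf t It z Hz).
Qed.

(** * The defect, its quasi-periods and its removable singularities *)

Definition quot (z : C) : C := fdot z / phi t z.

Lemma quot_shift (z : C) : good z -> quot (z + 1) = quot z /\ quot (z + tau t) = quot z - dtau.
Proof.
  intros Hz. assert (N := phi_ne_0 z Hz). destruct Hz as [Hz _].
  destruct (fdot_shift z Hz) as [E1 E2]. destruct (phi_shift z Hz) as [E3 E4].
  unfold quot. rewrite E1, E3. split; auto. rewrite E4 in *.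
  assert (Ne : Cexp (2 * Ci * beta) <> 0) by apply Cexp_ne_0.
  replace (fdot (z + tau t)) with (Cexp (2 * Ci * beta) * fdot z - Cexp (2 * Ci * beta) * phi t z * dtau)
    by (rewrite <- E2; ring).
  field; auto.
Qed.

Notation gma k := (gamma_ I beta P f k t).
Notation zt := (zeta_t P t).

Definition defect (z : C) : C := quot z - Csum (fun j => gma j * (zt (z - zk j) - eta1 P t * z)) K4.

Lemma zt_shift (z : C) : ~ lattice_t P t z -> zt (z + 1) = zt z + eta1 P t /\
  zt (z + tau t) = zt z + eta (tau t) (tau t).
Proof.
  intros H. split; [apply (zeta_add_1 (tau t) tp z H) | apply (zeta_add_tau (tau t) tp z H)].
Qed.

Definition kappa : C := 2 * PI * Ci * Csum (fun j => gma j) K4 - dtau.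

Lemma defect_shift (z : C) : good z -> defect (z + 1) = defect z /\ defect (z + tau t) = defect z + kappa.
Proof.
  intros Hz. destruct (quot_shift z Hz) as [E1 E2]. unfold defect, kappa. rewrite E1, E2.
  assert (Hl := proj2 Hz).
  split.
  - rewrite (Csum_ext _ (fun j => gma j * (zt (z - zk j) - eta1 P t * z)) K4); auto.
    intros j Hj. replace (z + 1 - zk j) with (z - zk j + 1) by ring.
    rewrite (proj1 (zt_shift _ (Hl j Hj))). ring.
  - rewrite (Csum_ext (fun j => gma j * (zt (z + tau t - zk j) - eta1 P t * (z + tau t)))
      (fun j => gma j * (zt (z - zk j) - eta1 P t * z) + - (2 * PI * Ci) * gma j) K4).
    + rewrite Csum_plus, Csum_scal. ring.
    + intros j Hj. replace (z + tau t - zk j) with (z - zk j + tau t) by ring.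
      rewrite (proj2 (zt_shift _ (Hl j Hj))).
      assert (L := legendre (dm P t) (sm_m _ _ _ _ _ St)).
      change (eta1 P t * tau t - eta (tau t) (tau t) = 2 * PI * Ci) in L. rewrite <- L. ring.
Qed.

Lemma defect_hol (z : C) : good z -> hol defect z.
Proof.
  intros Hz. assert (N := phi_ne_0 z Hz). destruct Hz as [Hz Hl]. unfold defect.
  apply (hol_minus quot).
  - apply (hol_div fdot (phi t)); auto using fdot_hol, phi_hol.
  - assert (Hj : forall j, In j K4 -> hol (fun z => gma j * (zt (z - zk j) - eta1 P t * z)) z).
    { intros j Hj. apply hol_mult; [apply hol_const|]. apply hol_minus; [|apply hol_mult; [apply hol_const | apply hol_id]].
      apply (hol_comp zt (fun z => z - zk j)); [apply (hol_zeta (tau t) tp); apply Hl; auto|].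
      apply hol_minus; [apply hol_id | apply hol_const]. }
    revert Hj. generalize K4. intros l. induction l as [|j l IH]; intros Hj; simpl; [apply hol_const|].
    apply (hol_plus (fun z => gma j * (zt (z - zk j) - eta1 P t * z))); [apply Hj; simpl; auto | apply IH; intros; apply Hj; simpl; auto].
Qed.

Lemma not_lattice_near (a p : C) : exists R, 0 < R /\ forall z, Cmod (z - a) < R -> z <> a -> ~ lattice_t P t (z - p).
Proof.
  destruct (lat_isolated (tau t) tp (a - p)) as (r & Hr & B). exists r; split; auto.
  intros z Hz N. apply B.
  - replace (z - p - (a - p)) with (z - a) by ring. auto.
  - intros E. apply N. replace z with (z - p + p) by ring. rewrite E. ring.
Qed.

Lemma good_near (a : C) : exists R, 0 < R /\ forall z, Cmod (z - a) < R -> z <> a -> good z.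
Proof.
  destruct (not_lattice_near a (z0 P t)) as (r1 & H1 & B1).
  destruct (not_lattice_near a (Cconj (z0 P t))) as (r2 & H2 & B2).
  assert (Hl : forall l : list nat, exists R, 0 < R /\ forall z, Cmod (z - a) < R -> z <> a ->
    forall k, In k l -> ~ lattice_t P t (z - zk k)).
  { induction l as [|k l (R & HR & B)].
    - exists 1%R; split; [lra|]. simpl. contradiction.
    - destruct (not_lattice_near a (zk k)) as (r & Hr & Br).
      exists (Rmin r R). split; [apply Rmin_glb_lt; auto|]. intros z Hz N j [<-|Hj].
      + apply Br; auto. pose proof (Rmin_l r R). lra.
      + apply B; auto. pose proof (Rmin_r r R). lra. }
  destruct (Hl K4) as (r3 & H3 & B3).
  exists (Rmin r1 (Rmin r2 r3)). split; [repeat apply Rmin_glb_lt; auto|]. intros z Hz N.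
  Rmin_facts r1 (Rmin r2 r3)%R.
  Rmin_facts r2 r3. split.
  - intros [A|A]; [apply (B1 z) in A | apply (B2 z) in A]; auto; lra.
  - intros k Hk. apply (B3 z); auto; lra.
Qed.

(** The hypothesis of Riemann's theorem at [a]. *)
Definition tame (a : C) : Prop := forall e, 0 < e -> exists d, 0 < d /\ forall z, Cmod (z - a) < d -> z <> a ->
  Cmod ((z - a) * defect z) <= e.

Lemma tame_of_hol (a : C) (H : C -> C) (R : R) : 0 < R -> hol H a -> H a = 0 ->
  (forall z, Cmod (z - a) < R -> z <> a -> (z - a) * defect z = H z) -> tame a.
Proof.
  intros HR Hh H0 E e He. destruct (hol_cont H a Hh e He) as (d & Hd & B).
  exists (Rmin R d). split; [apply Rmin_glb_lt; auto|]. intros z Hz N.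
  Rmin_facts R d. rewrite (E z) by (auto; lra).
  specialize (B z ltac:(lra)). rewrite H0 in B. replace (H z - 0) with (H z) in B by ring. lra.
Qed.

Lemma tame_good (a : C) : good a -> tame a.
Proof.
  intros Ha. apply (tame_of_hol a (fun z => (z - a) * defect z) 1); auto; [lra| |ring].
  apply (hol_mult (fun z => z - a)); [apply hol_minus; [apply hol_id | apply hol_const] | apply defect_hol; auto].
Qed.

Lemma hol_Csum {A : Type} (F : A -> C -> C) (l : list A) (z : C) :
  (forall a, In a l -> hol (F a) z) -> hol (fun z => Csum (fun a => F a z) l) z.
Proof.
  induction l as [|a l IH]; simpl; intros H; [apply hol_const|].
  apply (hol_plus (F a)); auto.
Qed.

Lemma tame_zk (k : nat) : In k K4 -> tame (zk k).
Proof.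
  intros Hk. set (a := zk k).
  destruct (nonpole_ball_t a (zk_nonpole k Hk)) as (d & Hd & Bd).
  destruct (divide_zero (phi t) a d Hd) as (G & G1 & G2 & G3).
  { intros z Hz. apply phi_hol; auto. }
  { apply phi_zk; auto. }
  assert (G3' : G a = D_ beta P k t) by (rewrite G3; apply sdiff_C_derive, phi_sdiff_zk; auto).
  clear G3; rename G3' into G3.
  assert (HD := D_ne_0 k Hk).
  destruct (good_near a) as (R & HR & BR).
  (* [(z - a) zeta(z - z_j)] near [a = z_k]; for [j = k] the simple pole is cancelled by hand, which
     makes every [T j] holomorphic at [a]. *)
  set (T := fun j z => if Nat.eq_dec j k then 1 + (z - a) * ell (tau t) (z - a) else (z - a) * zt (z - zk j)).
  assert (HT : forall j, In j K4 -> hol (T j) a).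
  { intros j Hj. unfold T. destruct (Nat.eq_dec j k) as [E|N].
    - apply (hol_plus (fun _ => 1)); [apply hol_const|]. apply (hol_mult (fun z => z - a)).
      + apply hol_minus; [apply hol_id | apply hol_const].
      + apply (hol_comp (ell (tau t)) (fun z => z - a)); [|apply hol_minus; [apply hol_id | apply hol_const]].
        apply (hol_ell (tau t) tp). left. ring.
    - apply (hol_mult (fun z => z - a)); [apply hol_minus; [apply hol_id | apply hol_const]|].
      apply (hol_comp zt (fun z => z - zk j)); [|apply hol_minus; [apply hol_id | apply hol_const]].
      apply (hol_zeta (tau t) tp). apply (zk_distinct k j Hk Hj N). }
  apply (tame_of_hol a (fun z => fdot z / G z - Csum (fun j => gma j * (T j z - (z - a) * (eta1 P t * z))) K4) (Rmin d R)).
  - apply Rmin_glb_lt; auto.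
  - apply (hol_minus (fun z => fdot z / G z)).
    + apply (hol_div fdot G); [apply fdot_hol, zk_nonpole; auto | apply G1; rewrite Cmod_self; auto | rewrite G3; auto].
    + apply (hol_Csum (fun j z => gma j * (T j z - (z - a) * (eta1 P t * z)))). intros j Hj.
      apply (hol_mult (fun _ => gma j)); [apply hol_const|]. apply (hol_minus (T j)); [apply HT; auto|].
      apply (hol_mult (fun z => z - a)); [apply hol_minus; [apply hol_id | apply hol_const]|].
      apply hol_mult; [apply hol_const | apply hol_id].
  - rewrite G3.
    (* At [a] the function [T k] is 1 and the others vanish, so the sum is [gamma_k], which equals
       [fdot a / D_k] by [gamma_eq]. *)
    assert (E : Csum (fun j => gma j * (T j a - (a - a) * (eta1 P t * a))) K4 = gma k).
    { rewrite (Csum_ext _ (fun j => if Nat.eq_dec j k then gma k else RtoC 0)).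
      - simpl in Hk. destruct Hk as [<-|[<-|[<-|[<-|[]]]]]; simpl; ring.
      - intros j Hj. unfold T. destruct (Nat.eq_dec j k) as [->|N]; ring. }
    rewrite E, (gamma_eq k Hk). fold a. ring.
  - intros z Hz N. Rmin_facts d R.
    assert (Gz := BR z ltac:(lra) N). assert (Np := phi_ne_0 z Gz). assert (N' := Cminus_ne_0 _ _ N).
    unfold defect, quot. rewrite G2 by auto.
    assert (E : Csum (fun j => gma j * (T j z - (z - a) * (eta1 P t * z))) K4
      = (z - a) * Csum (fun j => gma j * (zt (z - zk j) - eta1 P t * z)) K4).
    { rewrite <- Csum_scal. apply Csum_ext. intros j Hj. unfold T. destruct (Nat.eq_dec j k) as [->|Nj].
      - assert (Z := zeta_ell (tau t) tp (z - zk k) (proj2 Gz k Hk)).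
        change (zt (z - zk k) = / (z - zk k) + ell (tau t) (z - zk k)) in Z. fold a in Z |- *. rewrite Z.
        field. auto.
      - ring. }
    rewrite E. field. auto.
Qed.

(* In the frame moving with the pole [p], [fdot + dp * phi] is the time derivative, hence only
   its [z]-derivative, not the function itself, picks up the double pole. *)
Lemma pole_limit (p : R -> C) (dp : C) (N : R -> C -> C) (r : R) : 0 < r ->
  within_diff I p t dp ->
  (forall z, Cmod (z - p t) < r -> C1t I t N z) -> N t (p t) <> 0 ->
  (forall z, Cmod (z - p t) < r -> z <> p t -> nonpole t z) ->
  (forall s z, I s -> nonpole s z -> z <> p s /\ phi s z = N s z * / ((z - p s) * (z - p s))) ->
  forall e, 0 < e -> exists d, 0 < d /\ forall z, Cmod (z - p t) < d -> z <> p t -> Cmod (quot z + dp) <= e.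
Proof.
  intros Hr Hp HN HN0 Hnp Hphi.
  set (a := p t) in *. assert (Ha : Cmod (a - a) < r) by (rewrite Cmod_self; auto).
  set (N' := C_derive (N t)).
  assert (HolN : forall z, Cmod (z - a) < r -> hol (N t) z) by (intros z Hz; apply (C1t_hol I t It N z (HN z Hz))).
  assert (HolN' : hol N' a) by (apply (hol_derive (N t) a r); auto).
  destruct (tder_uniform I t It t_accum N a (HN a Ha) 1 ltac:(lra)) as (d1 & Hd1 & B1).
  destruct (hol_cont N' a HolN' 1 ltac:(lra)) as (d2 & Hd2 & B2).
  (* The numerator of the derivative of [fdot + dp phi]. The terms [2 dp N / (z - a)^3], one from
     the moving pole and one from the derivative in [z], cancel, which leaves [L / (z - a)^2] with
     [L] bounded. *)
  set (L := fun z => tder I t N z + dp * N' z).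
  set (K := (Cmod (tder I t N a) + 1 + Cmod dp * (Cmod (N' a) + 1))%R).
  set (R0 := Rmin r (Rmin d1 d2)). assert (HR0 : 0 < R0) by (repeat apply Rmin_glb_lt; auto).
  assert (R0 <= r /\ R0 <= d1 /\ R0 <= d2) as (Q1 & Q2 & Q3).
  { unfold R0. Rmin_facts r (Rmin d1 d2)%R.
    Rmin_facts d1 d2. lra. }
  assert (HL : forall z, Cmod (z - a) < R0 -> Cmod (L z) <= K).
  { intros z Hz. destruct (B1 z ltac:(lra) (HN z ltac:(lra))) as [A1 _]. specialize (B2 z ltac:(lra)).
    pose proof (Cmod_le_add_sub (tder I t N z) (tder I t N a)).
    pose proof (Cmod_le_add_sub (N' z) (N' a)).
    apply Cmod_add_le; [lra|]. apply Cmod_mult_le; lra. }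
  assert (Hg : forall z, Cmod (z - a) < R0 -> z <> a ->
    sdiff (fun z => fdot z + dp * phi t z) z (L z / ((z - a) * (z - a)))).
  { intros z Hz Nz. assert (Nz' := Cminus_ne_0 _ _ Nz).
    assert (Hz' : nonpole t z) by (apply Hnp; auto; lra).
    assert (E1 : tder I t phi z = tder I t N z * / ((z - a) * (z - a)) + N t z * (- / ((z - a) * (z - a) * ((z - a) * (z - a)))
        * ((0 + - (1) * dp) * (z - a) + (z - a) * (0 + - (1) * dp)))).
    { apply (within_diff_dot I t It t_accum).
      destruct (nonpole_near I theta beta P f Hf t z It Hz') as (d & Hd & B).
      apply (within_diff_ext_near I t It (fun s => N s z * / ((z - p s) * (z - p s))) _ _ d Hd).
      - intros s Is Hs. symmetry. apply Hphi; auto. apply B; auto. rewrite Cmod_self; auto.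
      - apply (within_diff_mult I t (fun s => N s z) (fun s => / ((z - p s) * (z - p s)))).
        + apply (sdt_within I t N z _ _ (C1t_sdt I t It t_accum N z (HN z ltac:(lra)))).
        + apply (within_diff_comp I t Cinv (fun s => (z - p s) * (z - p s))).
          * fold a. apply sdiff_inv. apply Cmult_neq_0; auto.
          * assert (D : within_diff I (fun s => z - p s) t (0 + - (1) * dp)).
            { eapply within_diff_ext; [| |apply (within_diff_plus I t _ _ _ _ (within_diff_const I t z) (within_diff_scal I t (- (1)) _ _ Hp))]; [|reflexivity].
              intros s. cbv beta. ring. }
            apply (within_diff_mult I t (fun s => z - p s) (fun s => z - p s)); exact D. }
    assert (S2 : sdiff (phi t) z (N' z * / ((z - a) * (z - a)) + N t z * (- / ((z - a) * (z - a) * ((z - a) * (z - a)))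
        * ((1 - 0) * (z - a) + (z - a) * (1 - 0))))).
    { destruct (nonpole_ball_t z Hz') as (d & Hd & B).
      apply (sdiff_ext_loc (fun z => N t z * / ((z - a) * (z - a))) _ _ _ d Hd).
      - intros w Hw. symmetry. apply Hphi; auto.
      - apply (sdiff_mult (N t) (fun z => / ((z - a) * (z - a)))).
        + apply hol_sdiff, HolN; lra.
        + apply (sdiff_comp Cinv (fun z => (z - a) * (z - a))).
          * apply sdiff_inv. apply Cmult_neq_0; auto.
          * apply (sdiff_mult (fun z => z - a) (fun z => z - a)); apply sdiff_minus; apply sdiff_id || apply sdiff_const. }
    eapply sdiff_ext; [reflexivity| |apply sdiff_plus; [apply (fdot_sdiff I theta beta P f Hf t It z Hz') | apply sdiff_scal; exact S2]].
    rewrite E1. unfold L. field. auto. }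
  destruct (radial_growth (fun z => fdot z + dp * phi t z) (fun z => L z / ((z - a) * (z - a))) a R0 K HR0) as (K' & HK' & HG).
  { intros z Hz Nz. split; [apply Hg; auto|]. assert (Nz' := Cminus_ne_0 _ _ Nz).
    rewrite Cmod_div, Cmod_mult by (apply Cmult_neq_0; auto).
    apply Rmult_le_compat_r; [|apply HL; auto]. left. apply Rinv_0_lt_compat.
    apply Rmult_lt_0_compat; now apply Cmod_gt_0. }
  intros e He. apply Cmod_gt_0 in HN0. fold a in HN0. set (n := Cmod (N t a)) in *.
  destruct (hol_cont (N t) a (HolN a Ha) (n / 2)%R ltac:(lra)) as (d3 & Hd3 & B3).
  destruct (linear_small (2 * K' / n) e) as (d4 & Hd4 & B4); [|auto|].
  { apply Rmult_le_pos; [lra|]. left. apply Rinv_0_lt_compat; auto. }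
  exists (Rmin (R0 / 2) (Rmin d3 d4)). split; [apply Rmin_glb_lt; [lra | apply Rmin_glb_lt; auto]|].
  intros z Hz Nz. Rmin_facts (R0 / 2)%R (Rmin d3 d4)%R.
  Rmin_facts d3 d4.
  assert (Nz' := Cminus_ne_0 _ _ Nz). assert (Hm := proj1 (Cmod_gt_0 _) Nz'). 
  specialize (HG z ltac:(lra) Nz). specialize (B3 z ltac:(lra)). specialize (B4 (Cmod (z - a)) ltac:(lra)).
  set (m := Cmod (z - a)) in *.
  assert (HNz : n / 2 <= Cmod (N t z)).
  { pose proof (Cmod_le_add_sub (N t a) (N t z)). rewrite Cmod_minus_sym in B3. fold n in H3. lra. }
  assert (NN : N t z <> 0) by (apply Cmod_gt_0; lra).
  destruct (Hphi t z It) as [_ E]; [apply Hnp; auto; fold a m; lra|]. fold a in E.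
  unfold quot.
  (* [fdot + dp phi] is [O(1/(z - a))] by [radial_growth], and dividing by [phi = N / (z - a)^2]
     leaves [O(z - a)]. *)
  replace (fdot z / phi t z + dp) with ((fdot z + dp * phi t z) * (z - a) * (z - a) / N t z).
  2: { rewrite E. field. repeat split; auto. }
  rewrite Cmod_div, !Cmod_mult by auto. fold m.
  apply Rle_div_l; [lra|].
  apply Rle_trans with (K' * m)%R; [apply Rmult_le_compat_r; lra|].
  apply Rle_trans with (2 * K' / n * m * (n / 2))%R; [right; field; lra|].
  apply Rmult_le_compat; try lra. apply Rmult_le_pos; [|lra]. apply Rmult_le_pos; [lra|].
  left. apply Rinv_0_lt_compat; auto.
Qed.

(** The derivative of [f] with its double pole at [p] removed, [p'] being the other pole. The factor
    [sigma(z - p)] is replaced by [kap(z - p)], so nothing vanishes at [p]. *)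
Definition Npole (p p' : R -> C) (s : R) (z : C) : C :=
  numer beta P s z * / ((kap (z - p s) (tau s) * kap (z - p s) (tau s)) *
    (sigma_t P s (z - p' s) * sigma_t P s (z - p' s))).

Lemma quot_at_pole (p p' : R -> C) (dp : C) :
  within_diff I p t dp -> (exists l, within_diff I p' t l) ->
  ((p = z0 P /\ p' = fun s => Cconj (z0 P s)) \/ (p' = z0 P /\ p = fun s => Cconj (z0 P s))) ->
  forall e, 0 < e -> exists d, 0 < d /\ forall z, Cmod (z - p t) < d -> z <> p t -> Cmod (quot z + dp) <= e.
Proof.
  intros Hp Hp' Hpp.
  assert (Hpol : forall s z, I s -> nonpole s z -> sigma_t P s (z - p s) <> 0 /\ sigma_t P s (z - p' s) <> 0).
  { intros s z Is Hz. destruct (nonpole_sigma I theta beta P f Hf s z Is Hz).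
    destruct Hpp as [[-> ->]|[-> ->]]; auto. }
  assert (Hd : ~ lattice_t P t (p t - p' t)).
  { destruct Hpp as [[-> ->]|[-> ->]]; [apply z0_conj_z0 | apply lattice_t_opp, z0_conj_z0]. }
  assert (Hdk : forall k, In k K4 -> ~ lattice_t P t (p t - zk k)).
  { intros k Hk. apply lattice_t_opp. destruct Hpp as [[-> ->]|[-> ->]]; [apply zk_z0 | apply zk_conj_z0]; auto. }
  set (a := p t).
  set (D := fun s z => (kap (z - p s) (tau s) * kap (z - p s) (tau s)) *
    (sigma_t P s (z - p' s) * sigma_t P s (z - p' s))).
  assert (HD : forall z, C1t I t D z).
  { intros z. assert (A1 := C1t_kap I theta beta P f Hf t It p z (ex_intro _ _ Hp)).
    assert (A2 := C1t_sigma I theta beta P f Hf t It p' z Hp').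
    apply (C1t_mult I t It (fun s z => kap (z - p s) (tau s) * kap (z - p s) (tau s))).
    - apply (C1t_mult I t It (fun s z => kap (z - p s) (tau s))); auto.
    - apply (C1t_mult I t It (fun s z => sigma_t P s (z - p' s))); auto. }
  assert (HDa : D t a <> 0).
  { assert (Ka : kap (a - p t) (tau t) <> 0).
    { unfold a. replace (p t - p t) with (RtoC 0) by ring. rewrite (kap_0 (tau t) tp).
      intros E; apply RtoC_inj in E; lra. }
    assert (Sa := sigma_ne _ Hd). fold a in Sa.
    unfold D. apply Cmult_neq_0; apply Cmult_neq_0; auto. }
  destruct (hol_cont (D t) a (C1t_hol I t It D a (HD a)) (Cmod (D t a))) as (d1 & Hd1 & B1).
  { apply Cmod_gt_0; auto. }
  destruct (good_near a) as (d2 & Hd2 & B2).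
  assert (Ra : 0 < Rmin d1 d2) by (apply Rmin_glb_lt; auto).
  apply (pole_limit p dp (Npole p p') (Rmin d1 d2) Ra Hp).
  - intros z Hz. pose proof (Rmin_l d1 d2).
    apply (C1t_mult I t It (numer beta P) (fun s z => / D s z)).
    + apply (C1t_numer I theta beta P f Hf t It z).
    + apply (C1t_inv I t It D); [|apply HD]. apply (Cmod_near_ne_0 (D t a)). apply B1. fold a in Hz. lra.
  - unfold Npole. apply Cmult_neq_0.
    + unfold numer. apply Cmult_neq_0; [apply (sm_c _ _ _ _ _ St)|].
      apply Cmult_neq_0; [apply Cexp_ne_0|]. apply Cprod_ne_0. intros k Hk. apply sigma_ne; auto.
    + intros E. fold a in E. change (/ D t a = 0) in E. assert (A := Cinv_r _ HDa). rewrite E, Cmult_0_r in A.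
      apply RtoC_inj in A. lra.
  - intros z Hz Nz. pose proof (Rmin_r d1 d2). apply (B2 z); auto. fold a in Hz. lra.
  - intros s z Is Hz. destruct (Hpol s z Is Hz) as [S1 S2].
    assert (N1 : z - p s <> 0) by (intros E; apply S1; rewrite E, sigma_t_kap; ring).
    split; [intros E; apply N1; rewrite E; ring|].
    assert (N2 : kap (z - p s) (tau s) <> 0) by (intros E; apply S1; rewrite sigma_t_kap, E; ring).
    rewrite phi_numer.
    replace (sigma_t P s (z - z0 P s) ^ 2 * sigma_t P s (z - Cconj (z0 P s)) ^ 2)
      with (sigma_t P s (z - p s) * sigma_t P s (z - p s) * (sigma_t P s (z - p' s) * sigma_t P s (z - p' s)))
      by (destruct Hpp as [[-> ->]|[-> ->]]; simpl; ring).
    rewrite (sigma_t_kap P s (z - p s)). unfold Npole. field. auto.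
Qed.

Definition zsum (z : C) : C := Csum (fun j => gma j * (zt (z - zk j) - eta1 P t * z)) K4.

Lemma zsum_hol (z : C) : (forall k, In k K4 -> ~ lattice_t P t (z - zk k)) -> hol zsum z.
Proof.
  intros H. apply (hol_Csum (fun j z => gma j * (zt (z - zk j) - eta1 P t * z))). intros j Hj.
  apply (hol_mult (fun _ => gma j)); [apply hol_const|].
  apply (hol_minus (fun z => zt (z - zk j))); [|apply hol_mult; [apply hol_const | apply hol_id]].
  apply (hol_comp zt (fun z => z - zk j)); [apply (hol_zeta (tau t) tp); apply H; auto|].
  apply hol_minus; [apply hol_id | apply hol_const].
Qed.

(** Near such a point [quot] and [zsum] are both bounded, so the factor [z - a] makes the product
    small. *)
Lemma tame_pole (a dp : C) : (forall k, In k K4 -> ~ lattice_t P t (a - zk k)) ->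
  (forall e, 0 < e -> exists d, 0 < d /\ forall z, Cmod (z - a) < d -> z <> a -> Cmod (quot z + dp) <= e) ->
  tame a.
Proof.
  intros Ha Hq e He. destruct (Hq 1%R ltac:(lra)) as (d1 & Hd1 & B1).
  destruct (hol_locally_bounded zsum a (zsum_hol a Ha)) as (d2 & M & Hd2 & B2).
  set (K := (1 + Cmod dp + Rmax 0 M)%R).
  assert (HK : 0 <= K) by (unfold K; pose proof (Cmod_ge_0 dp); pose proof (Rmax_l 0 M); lra).
  destruct (linear_small K e HK He) as (d3 & Hd3 & B3).
  exists (Rmin d1 (Rmin d2 d3)). split; [repeat apply Rmin_glb_lt; auto|]. intros z Hz N.
  Rmin_facts d1 (Rmin d2 d3)%R.
  Rmin_facts d2 d3.
  specialize (B1 z ltac:(lra) N). specialize (B2 z ltac:(lra)).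
  specialize (B3 (Cmod (z - a)) ltac:(split; [apply Cmod_ge_0|lra])).
  rewrite Cmod_mult. apply Rle_trans with (Cmod (z - a) * K)%R; [|lra].
  apply Rmult_le_compat_l; [apply Cmod_ge_0|].
  replace (defect z) with ((quot z + dp - dp) - zsum z) by (unfold defect, zsum; ring).
  eapply Rle_trans; [apply Cmod_minus_le|].
  pose proof (Cmod_minus_le (quot z + dp) dp). pose proof (Rmax_r 0 M). unfold K. lra.
Qed.

(** Tameness is checked at one representative of each class modulo the lattice; an additive
    constant, whatever its value, is harmless for moving to the others. *)
Lemma defect_lattice_shift (w : C) : lattice_t P t w -> exists c, forall z, good z -> defect (z + w) = defect z + c.
Proof.
  assert (Hmul : forall v, lattice_t P t v -> (exists c, forall z, good z -> defect (z + v) = defect z + c) ->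
    forall n : Z, exists c, forall z, good z -> defect (z + RtoC (IZR n) * v) = defect z + c).
  { intros v Lv [c Hc].
    assert (Ln : forall n : nat, lattice_t P t (RtoC (INR n) * v)).
    { induction n as [|n IH].
      - simpl. rewrite Cmult_0_l. apply lat_0.
      - rewrite S_INR, RtoC_plus. replace ((RtoC (INR n) + 1) * v) with (RtoC (INR n) * v + v) by ring.
        apply lat_plus; auto. }
    assert (Hn : forall (n : nat) z, good z -> defect (z + RtoC (INR n) * v) = defect z + RtoC (INR n) * c).
    { induction n as [|n IH]; intros z Hz.
      - simpl. replace (z + 0 * v) with z by ring. ring.
      - rewrite S_INR, RtoC_plus. replace (z + (RtoC (INR n) + 1) * v) with (z + RtoC (INR n) * v + v) by ring.
        rewrite Hc by (apply good_shift; auto). rewrite IH by auto. ring. }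
    intros n. destruct (Z_le_gt_dec 0 n) as [L|L].
    - exists (RtoC (IZR n) * c). intros z Hz. rewrite <- (Z2Nat.id n L), <- INR_IZR_INZ. auto.
    - exists (- (RtoC (INR (Z.to_nat (- n))) * c)). intros z Hz.
      assert (E : RtoC (IZR n) * v = - (RtoC (INR (Z.to_nat (- n))) * v)).
      { rewrite INR_IZR_INZ, Z2Nat.id by lia. rewrite opp_IZR, RtoC_opp. ring. }
      rewrite E. set (u := RtoC (INR (Z.to_nat (- n))) * v).
      assert (Hu : good (z + - u)) by (apply good_shift; auto; apply lat_opp, Ln).
      assert (E2 := Hn (Z.to_nat (- n)) (z + - u) Hu).
      replace (z + - u + RtoC (INR (Z.to_nat (- n))) * v) with z in E2 by (unfold u; ring).
      rewrite E2. ring. }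
  intros [[n k] ->]. unfold lattice_point; simpl.
  destruct (Hmul (omega1 t) (lat_1 (tau t))) with (n := n) as [c1 H1].
  { exists 0. intros z Hz. unfold omega1. rewrite (proj1 (defect_shift z Hz)). ring. }
  destruct (Hmul (tau t) (lat_tau (tau t))) with (n := k) as [c2 H2].
  { exists kappa. intros z Hz. exact (proj2 (defect_shift z Hz)). }
  exists (c1 + c2). intros z Hz.
  replace (z + (RtoC (IZR n) * omega1 t + RtoC (IZR k) * tau t)) with (z + RtoC (IZR n) * omega1 t + RtoC (IZR k) * tau t) by ring.
  rewrite H2, H1; [ring|exact Hz|].
  apply good_shift; auto. exists (n, 0%Z). unfold lattice_point; simpl. ring.
Qed.

Lemma tame_shift (a w : C) : lattice_t P t w -> tame a -> tame (a + w).
Proof.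
  intros Lw Ha e He. destruct (defect_lattice_shift w Lw) as [c Hc].
  destruct (Ha (e / 2)%R ltac:(lra)) as (d1 & Hd1 & B1). destruct (good_near a) as (d2 & Hd2 & B2).
  destruct (linear_small (Cmod c) (e / 2)) as (d3 & Hd3 & B3); [apply Cmod_ge_0 | lra|].
  exists (Rmin d1 (Rmin d2 d3)). split; [repeat apply Rmin_glb_lt; auto|]. intros z Hz N.
  Rmin_facts d1 (Rmin d2 d3)%R.
  Rmin_facts d2 d3.
  set (u := z - w). assert (Eu : z = u + w) by (unfold u; ring).
  assert (Eua : z - (a + w) = u - a) by (unfold u; ring). rewrite Eua in *.
  assert (Nu : u <> a) by (intros E; apply N; rewrite Eu, E; ring).
  rewrite Eu, Hc by (apply B2; auto; lra).
  replace ((u - a) * (defect u + c)) with ((u - a) * defect u + c * (u - a)) by ring.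
  specialize (B1 u ltac:(lra) Nu). specialize (B3 (Cmod (u - a)) ltac:(split; [apply Cmod_ge_0|lra])).
  eapply Rle_trans; [apply Cmod_triangle|]. rewrite (Cmod_mult c). lra.
Qed.

Variable dz0 : C.
Hypothesis Hdz0 : within_diff I (z0 P) t dz0.

Lemma z0_lattice (k : nat) : In k K4 -> ~ lattice_t P t (z0 P t - zk k).
Proof. intros Hk. apply lattice_t_opp, zk_z0; auto. Qed.

Lemma quot_at_z0 (e : R) : 0 < e -> exists d, 0 < d /\ forall z, Cmod (z - z0 P t) < d -> z <> z0 P t -> Cmod (quot z + dz0) <= e.
Proof.
  apply (quot_at_pole (z0 P) (fun s => Cconj (z0 P s)) dz0 Hdz0); [|left; auto].
  apply (conj_z0_diff I theta beta P f Hf t It).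
Qed.

Lemma tame_all (a : C) : tame a.
Proof.
  destruct (classic (good a)) as [G|G]; [apply tame_good; auto|].
  assert (Cs : is_pole P t a \/ exists k, In k K4 /\ lattice_t P t (a - zk k)).
  { apply NNPP. intros A. apply G. split; [intros Hp; apply A; auto|].
    intros k Hk L. apply A. right. exists k; auto. }
  destruct Cs as [[L|L]|(k & Hk & L)].
  (* Each point that is not good is a translate of [z0], of its conjugate or of some [z_k]. *)
  - replace a with (z0 P t + (a - z0 P t)) by ring. apply tame_shift; auto.
    apply (tame_pole (z0 P t) dz0); [apply z0_lattice | apply quot_at_z0].
  - replace a with (Cconj (z0 P t) + (a - Cconj (z0 P t))) by ring. apply tame_shift; auto.
    destruct (conj_z0_diff I theta beta P f Hf t It) as [l Hl].
    apply (tame_pole (Cconj (z0 P t)) l).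
    + intros k Hk. apply lattice_t_opp, zk_conj_z0; auto.
    + apply (quot_at_pole (fun s => Cconj (z0 P s)) (z0 P) l Hl); [|right; auto].
      exists dz0; auto.
  - replace a with (zk k + (a - zk k)) by ring. apply tame_shift; auto. apply tame_zk; auto.
Qed.

Lemma defect_constant : kappa = 0 /\ forall z, good z -> defect z = - dz0 - zsum (z0 P t).
Proof.
  destruct (quasi_elliptic_constant (tau t) good defect kappa tp good_near defect_hol) as [K0 HQ].
  - intros z Hz. apply good_shift; auto. apply lat_1.
  - intros z Hz. apply good_shift; auto. apply lat_tau.
  - intros z Hz. exact (proj1 (defect_shift z Hz)).
  - intros z Hz. exact (proj2 (defect_shift z Hz)).
  - intros a e He. apply tame_all; auto.
  - split; auto. intros z Hz. apply Cmod_small_eq. intros e He.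
    destruct (quot_at_z0 (e / 2)%R ltac:(lra)) as (d1 & Hd1 & B1).
    destruct (hol_cont zsum (z0 P t) (zsum_hol _ z0_lattice) (e / 2)%R ltac:(lra)) as (d2 & Hd2 & B2).
    destruct (good_near (z0 P t)) as (d3 & Hd3 & B3).
    set (d := Rmin d1 (Rmin d2 d3)). assert (Hd : 0 < d) by (repeat apply Rmin_glb_lt; auto).
    assert (d <= d1 /\ d <= d2 /\ d <= d3) as (D1 & D2 & D3).
    { unfold d. Rmin_facts d1 (Rmin d2 d3)%R.
      Rmin_facts d2 d3. lra. }
    (* A good point near [z0]. The defect takes the same value there as at [z], with [quot] close to
       [- dz0] and [zsum] close to its value at [z0]. *)
    set (u := z0 P t + RtoC (d / 2)).
    assert (Hu : Cmod (u - z0 P t) = (d / 2)%R).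
    { replace (u - z0 P t) with (RtoC (d / 2)) by (unfold u; ring). rewrite Cmod_R, Rabs_pos_eq; lra. }
    assert (Nu : u <> z0 P t) by (intros A; rewrite A, Cmod_self in Hu; lra).
    rewrite (HQ z Hz 0), <- (HQ u (B3 u ltac:(lra) Nu) 0).
    replace (defect u - (- dz0 - zsum (z0 P t))) with ((quot u + dz0) - (zsum u - zsum (z0 P t))) by (unfold defect; fold (zsum u); ring).
    specialize (B1 u ltac:(lra) Nu). specialize (B2 u ltac:(lra)).
    eapply Rle_trans; [apply Cmod_minus_le|]. lra.
Qed.

(** The subtracted terms at [z0] in [h] are the additive constant found in [defect_constant],
    distributed over the four summands. *)
Lemma quot_h (z : C) : good z -> quot z = h I beta P f z t.
Proof.
  intros Hz. assert (E := proj2 defect_constant z Hz). unfold h.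
  rewrite (within_diff_dot I t It t_accum _ _ Hdz0).
  replace (quot z) with (defect z + zsum z) by (unfold defect, zsum; ring). rewrite E. unfold zsum.
  rewrite (Csum_ext (fun j => gma j * (zt (z - zk j) - zt (z0 P t - zk j) - eta1 P t * (z - z0 P t)))
    (fun j => gma j * (zt (z - zk j) - eta1 P t * z) - gma j * (zt (z0 P t - zk j) - eta1 P t * z0 P t))).
  - rewrite Csum_minus. ring.
  - intros j _. ring.
Qed.

End Final.

Theorem theorem3 (I : R -> Prop) (theta beta : R) (P : slit_data)
    (f : C -> R -> C) (Hf : slit_family I theta beta P f) (t : R) (Ht : I t) :
  (forall k : nat, In k K4 ->
     ex_derive_within (V := C_R_NormedModule) I (A_ P f k) t /\
     is_derive (K := C_AbsRing) (V := C_NormedModule)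
       (C_derive (fun u => f u t)) (zpt P k t) (D_ beta P k t) /\
     D_ beta P k t <> 0) /\
  (forall z : C,
     ~ is_pole P t z ->
     (forall k : nat, In k K4 -> ~ lattice_t P t (z - zpt P k t)) ->
     holomorphic_at (fun u => f u t) z /\
     C_derive (fun u => f u t) z <> 0 /\
     ex_derive_within (V := C_R_NormedModule) I (fun s => f z s) t /\
     dot I (fun s => f z s) t / C_derive (fun u => f u t) z
     = h I beta P f z t) /\
  omega1 t = 1 /\
  is_derive_within (V := C_R_NormedModule) I (omega2 P) t
    (2 * PI * Ci * Csum (fun j => gamma_ I beta P f j t) K4).
Proof.
  destruct (tau_diff I theta beta P f Hf t Ht) as [dtau Hdtau].
  destruct (z0_diff I theta beta P f Hf t Ht) as [dz0 Hdz0].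
  split; [|split; [|split]].
  - intros k Hk. split; [|split].
    + exists (fdot I f t (zpt P k t)).
      apply (within_diff_is_derive I t Ht). apply (A_diff I theta beta P f Hf t Ht k Hk).
    + apply cdiff_is_derive, sdiff_cdiff. apply (f_second_derivative I theta beta P f Hf t Ht k Hk).
    + apply (D_ne_0 I theta beta P f Hf t Ht k Hk).
  - intros z Hz Hk. assert (G : good P t z) by (split; auto).
    rewrite (C_derive_f I theta beta P f Hf t Ht z Hz).
    split; [|split; [|split]].
    + exists (phi beta P t z). apply cdiff_is_derive, sdiff_cdiff.
      apply (f_deriv I theta beta P f Hf t Ht z Hz).
    + apply (phi_ne_0 I theta beta P f Hf t Ht z G).
    + exists (fdot I f t z). apply (within_diff_is_derive I t Ht).
      apply (f_within I theta beta P f Hf t Ht z Hz).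
    + apply (quot_h I theta beta P f Hf t Ht dtau Hdtau dz0 Hdz0 z G).
  - reflexivity.
  - apply (within_diff_is_derive I t Ht).
    destruct (defect_constant I theta beta P f Hf t Ht dtau Hdtau dz0 Hdz0) as [E _].
    unfold kappa in E.
    assert (E' : 2 * PI * Ci * Csum (fun j => gamma_ I beta P f j t) K4 = dtau).
    { match type of E with (?a - _ = _) => replace a with (a - dtau + dtau) by ring end. rewrite E. ring. }
    rewrite E'. exact Hdtau.
Qed.
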